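(* Let $N\geq 2$ be an integer, and let $E_N$ be the coarse moduli space of minimal elliptic surfaces over $\mathbb{P}^1$ with section and with fundamental invariant $N$. The maximal dimension of a complete subvariety of $E_N$ is $16$.
   Context: Work over an algebraically closed field $k$ of characteristic not $2$ or $3$. A minimal elliptic surface over $\mathbb{P}^1$ with section is a smooth projective surface $Y$ with a proper morphism $\pi:Y\to\mathbb{P}^1$ whose general fiber is a smooth connected curve of genus $1$ and no fiber of which contains a $(-1)$-curve, together with a section $s$ of $\pi$. Contracting the rational components of fibers not meeting the section gives its Weierstrass fibration $p:X\to\mathbb{P}^1$; the fundamental invariant is $N=\deg (R^1p_*\mathcal{O}_X)^\vee$. Such $X$ is given by $y^2z=x^3+Axz^2+Bz^3$ in $\mathbb{P}(\mathcal{O}\oplus\mathcal{O}(2N)\oplus\mathcal{O}(3N))$ with $A\in V_{4N}:=H^0(\mathbb{P}^1,\mathcal{O}(4N))$, $B\in V_{6N}:=H^0(\mathbb{P}^1,\mathcal{O}(6N))$. Let $T_N\subset V_{4N}\oplus V_{6N}$ be the open subset of pairs $(A,B)$ such that (1) $4A^3+27B^2$ is not identically zero, and (2) for every $q\in\mathbb{P}^1$, $v_q(A)\le 3$ or $v_q(B)\le 5$, where $v_q$ is the order of vanishing at $q$. The group $\mathrm{SL}_2\times\mathbb{G}_m$ acts on $V_{4N}\oplus V_{6N}$, with $\mathrm{SL}_2$ acting through $\mathbb{P}^1$ and $\lambda\in\mathbb{G}_m$ acting by $(A,B)\mapsto(\lambda^4A,\lambda^6B)$. For $N\ge 2$ all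 points of $T_N$ are GIT stable, and $E_N:=T_N/\!/(\mathrm{SL}_2\times\mathbb{G}_m)$ (GIT quotient) is the coarse moduli space. *)

(* Defs.v *)
From HB Require Import structures.
From mathcomp Require Import all_boot all_algebra.
From mathcomp Require Import all_classical topology_structure initial_topology.
From mathcomp Require Import subtype_topology.
From mathcomp Require Import mpoly.

Set Implicit Arguments.
Unset Strict Implicit.
Unset Printing Implicit Defensive.

Import GRing.Theory.

Local Open Scope classical_set_scope.
Local Open Scope ring_scope.

(* Classical algebraic geometry over a field k: a variety is a topological    *)
(* space together with a sheaf of k-valued functions that is locally          *)
(* isomorphic to a Zariski closed subset of affine space.  The sheaf is given *)
(* by its germs: a function is regular on an open set U when it is regular at *)
(* every point of U, so that the sheaf condition is automatic.                *)
HB.mixin Record hasRegularFunctions (k : fieldType) X & Topological X := {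
  regular_at : X -> (X -> k) -> Prop;
  regular_at_near : forall x f,
    regular_at x f -> \forall y \near x, regular_at y f;
  regular_at_ext : forall x (f g : X -> k),
    (\forall y \near x, f y = g y) -> regular_at x f -> regular_at x g;
  regular_at_cst : forall x (c : k), regular_at x (fun=> c);
  regular_at_add : forall x f g, regular_at x f -> regular_at x g ->
    regular_at x (fun y => f y + g y);
  regular_at_mul : forall x f g, regular_at x f -> regular_at x g ->
    regular_at x (fun y => f y * g y);
  regular_at_inv : forall x f, regular_at x f -> f x != 0 ->
    (\forall y \near x, f y != 0) /\ regular_at x (fun y => (f y)^-1)
}.

#[short(type="funSpaceType")]
HB.structure Definition FunSpace (k : fieldType) :=
  {X of Topological X & hasRegularFunctions k X}.

(* The structure induced on a subset: on an open subset this is the           *)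
(* restriction of the sheaf, on a closed subset it is the reduced structure.  *)
Section InducedStructure.
Context (k : fieldType) (X : funSpaceType k) (A : set X).

Definition sub_regular_at (x : set_type A) (f : set_type A -> k) : Prop :=
  exists2 g : X -> k, regular_at (set_val x) g &
    \forall y \near x, f y = g (set_val y).

Lemma set_val_near (x : set_type A) (P : X -> Prop) :
  (\forall y \near set_val x, P y) -> \forall y \near x, P (set_val y).
Proof. by move=> Px; apply: (@initial_continuous (set_type A) X set_val x). Qed.

Fact sub_near x f :
  sub_regular_at x f -> \forall y \near x, sub_regular_at y f.
Proof.
case=> g /regular_at_near /set_val_near gx.
move=> /near_join fg; apply: filterS2 gx fg => y gy fy.
by exists g.
Qed.

Fact sub_ext x (f g : set_type A -> k) :
  (\forall y \near x, f y = g y) -> sub_regular_at x f -> sub_regular_at x g.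
Proof.
move=> fg [h hx fh]; exists h => //.
by apply: filterS2 fg fh => y <-.
Qed.

Fact sub_cst x (c : k) : sub_regular_at x (fun=> c).
Proof.
by exists (fun=> c); [exact: regular_at_cst | exact: filterE].
Qed.

Fact sub_add x f g : sub_regular_at x f -> sub_regular_at x g ->
  sub_regular_at x (fun y => f y + g y).
Proof.
move=> [f' f'x ff'] [g' g'x gg']; exists (fun y => f' y + g' y).
  exact: regular_at_add.
by apply: filterS2 ff' gg' => y -> ->.
Qed.

Fact sub_mul x f g : sub_regular_at x f -> sub_regular_at x g ->
  sub_regular_at x (fun y => f y * g y).
Proof.
move=> [f' f'x ff'] [g' g'x gg']; exists (fun y => f' y * g' y).
  exact: regular_at_mul.
by apply: filterS2 ff' gg' => y -> ->.
Qed.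

Fact sub_inv x f : sub_regular_at x f -> f x != 0 ->
  (\forall y \near x, f y != 0) /\ sub_regular_at x (fun y => (f y)^-1).
Proof.
move=> [g gx fg] fx0.
have gx0 : g (set_val x) != 0 by rewrite -(nbhs_singleton fg).
have [/set_val_near g0 gV] := regular_at_inv _ _ gx gx0; split.
  by apply: filterS2 g0 fg => y + ->.
by exists (fun y => (g y)^-1) => //; apply: filterS fg => y ->.
Qed.

HB.instance Definition _ := @hasRegularFunctions.Build k (set_type A)
  sub_regular_at sub_near sub_ext sub_cst sub_add sub_mul sub_inv.

End InducedStructure.

Definition morphism (k : fieldType) (X Y : funSpaceType k) (phi : X -> Y) :=
  continuous phi /\
  forall x f, regular_at (phi x) f -> regular_at x (f \o phi).

Definition isomorphic (k : fieldType) (X Y : funSpaceType k) :=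
  exists (phi : X -> Y) (psi : Y -> X),
    [/\ morphism phi, morphism psi, cancel phi psi & cancel psi phi].

(* Whether f is polynomial does not depend on the choice of the basis.        *)
Definition polynomial_fun (k : fieldType) (V : vectType k) (f : V -> k) :=
  exists p : {mpoly k[\dim {:V}]},
    forall v, f v = p.@[fun i => coord (vbasis {:V}) i v].

Section PolynomialFun.
Context (k : fieldType) (V : vectType k).
Implicit Types f g : V -> k.

Lemma polynomial_cst (c : k) : @polynomial_fun k V (fun=> c).
Proof. by exists c%:MP => v; rewrite mevalC. Qed.

Lemma polynomial_add f g : polynomial_fun f -> polynomial_fun g ->
  polynomial_fun (fun v => f v + g v).
Proof. by move=> [p fp] [q gq]; exists (p + q) => v; rewrite mevalD fp gq. Qed.

Lemma polynomial_mul f g : polynomial_fun f -> polynomial_fun g ->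
  polynomial_fun (fun v => f v * g v).
Proof. by move=> [p fp] [q gq]; exists (p * q) => v; rewrite mevalM fp gq. Qed.

End PolynomialFun.

(* A finite-dimensional vector space with its Zariski topology.               *)
Definition affine_space (k : fieldType) (V : vectType k) : Type := V.

Section AffineSpace.
Context (k : fieldType) (V : vectType k).
Local Notation AV := (affine_space V).

HB.instance Definition _ := Choice.on AV.

Definition zariski_open (U : set AV) : Prop :=
  forall x, U x -> exists f : V -> k,
    [/\ polynomial_fun f, f x != 0 & forall y, f y != 0 -> U y].

Fact zariski_openT : zariski_open setT.
Proof.
move=> x _; exists (fun=> 1).
by split=> //; [exact: polynomial_cst | exact: oner_neq0].
Qed.

Fact zariski_openI : setI_closed zariski_open.
Proof.
move=> A B oA oB x [/oA [f [pf fx fA]] /oB [g [pg gx gB]]].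
exists (fun y => f y * g y); split; first exact: polynomial_mul.
  by rewrite mulf_neq0.
by move=> y; rewrite mulf_eq0 negb_or => /andP[/fA ? /gB].
Qed.

Fact zariski_open_bigU (I : Type) (F : I -> set AV) :
  (forall i, zariski_open (F i)) -> zariski_open (\bigcup_i F i).
Proof.
move=> oF x [i _ /oF [f [pf fx fF]]]; exists f; split=> // y /fF Fy.
by exists i.
Qed.

HB.instance Definition _ := isOpenTopological.Build AV
  zariski_openT zariski_openI zariski_open_bigU.

Lemma polynomial_near (f : V -> k) (x : AV) :
  polynomial_fun f -> f x != 0 -> \forall y \near x, f y != 0.
Proof.
move=> pf fx; apply: (@open_nbhs_nbhs AV x [set y | f y != 0]).
split; last exact: fx.
by move=> y fy; exists f.
Qed.

Definition affine_regular_at (x : AV) (h : AV -> k) : Prop :=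
  exists f g : V -> k, [/\ polynomial_fun f, polynomial_fun g, g x != 0 &
    \forall y \near x, h y = f y / g y].

Fact affine_near x f :
  affine_regular_at x f -> \forall y \near x, affine_regular_at y f.
Proof.
move=> [p [q [pp pq qx fpq]]].
apply: filterS2 (polynomial_near pq qx) (near_join fpq) => y qy fy.
by exists p, q.
Qed.

Fact affine_ext x (f g : AV -> k) : (\forall y \near x, f y = g y) ->
  affine_regular_at x f -> affine_regular_at x g.
Proof.
move=> fg [p [q [pp pq qx fpq]]]; exists p, q; split=> //.
by apply: filterS2 fg fpq => y <-.
Qed.

Fact affine_cst x (c : k) : affine_regular_at x (fun=> c).
Proof.
exists (fun=> c), (fun=> 1); split; try exact: polynomial_cst.
  exact: oner_neq0.
by apply: filterE => y; rewrite divr1.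
Qed.

Fact affine_add x f g : affine_regular_at x f -> affine_regular_at x g ->
  affine_regular_at x (fun y => f y + g y).
Proof.
move=> [p [q [pp pq qx fpq]]] [p' [q' [pp' pq' qx' fpq']]].
exists (fun y => p y * q' y + p' y * q y), (fun y => q y * q' y).
split; [|exact: polynomial_mul|exact: mulf_neq0|].
  by apply: polynomial_add; exact: polynomial_mul.
apply: filterS2 (polynomial_near (polynomial_mul pq pq') (mulf_neq0 qx qx'))
  (filterI fpq fpq') => y.
by rewrite mulf_eq0 negb_or => /andP[qy qy'] [-> ->]; rewrite addf_div.
Qed.

Fact affine_mul x f g : affine_regular_at x f -> affine_regular_at x g ->
  affine_regular_at x (fun y => f y * g y).
Proof.
move=> [p [q [pp pq qx fpq]]] [p' [q' [pp' pq' qx' fpq']]].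
exists (fun y => p y * p' y), (fun y => q y * q' y).
split; [exact: polynomial_mul|exact: polynomial_mul|exact: mulf_neq0|].
by apply: filterS2 fpq fpq' => y -> ->; rewrite mulf_div.
Qed.

Fact affine_inv x f : affine_regular_at x f -> f x != 0 ->
  (\forall y \near x, f y != 0) /\ affine_regular_at x (fun y => (f y)^-1).
Proof.
move=> [p [q [pp pq qx fpq]]] fx.
have px : p x != 0.
  by move: fx; rewrite (nbhs_singleton fpq) mulf_eq0 negb_or => /andP[].
split; last first.
  by exists q, p; split=> //; apply: filterS fpq => y ->; rewrite invf_div.
apply: filterS2 (filterI (polynomial_near pp px) (polynomial_near pq qx)) fpq.
by move=> y [py qy] ->; rewrite mulf_neq0 ?invr_neq0.
Qed.

HB.instance Definition _ := @hasRegularFunctions.Build k AV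
  affine_regular_at affine_near affine_ext affine_cst affine_add affine_mul
  affine_inv.

End AffineSpace.

(* The topology of the product in the category of varieties (finer than the   *)
(* product topology): locally k[U x V] = k[U] (x) k[V], so that the basic     *)
(* open sets are the nonvanishing loci of sum_i f_i(x) g_i(y) in U x V.       *)
Definition variety_prod (k : fieldType) (X Y : funSpaceType k) : Type :=
  (X * Y)%type.

Section VarietyProd.
Context (k : fieldType) (X Y : funSpaceType k).
Local Notation XY := (variety_prod X Y).

HB.instance Definition _ := Choice.on XY.

Definition prod_open (W : set XY) : Prop := forall p, W p ->
  exists (I : finType) (f : I -> X -> k) (g : I -> Y -> k),
  [/\ forall i, regular_at p.1 (f i) /\ regular_at p.2 (g i),
      \sum_i f i p.1 * g i p.2 != 0 &
      \forall x \near p.1 & y \near p.2,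
        \sum_i f i x * g i y != 0 -> W (x, y)].

Fact prod_openT : prod_open setT.
Proof.
move=> p _; exists unit, (fun _ _ => 1), (fun _ _ => 1); split.
- by move=> _; split; exact: regular_at_cst.
- by rewrite big_const card_unit /= addr0 mulr1 oner_neq0.
- exact: filterE.
Qed.

Fact prod_openI : setI_closed prod_open.
Proof.
move=> A B oA oB p [/oA [I [f [g [fg fgp fgA]]]]].
move=> /oB [J [f' [g' [fg' fgp' fgB]]]].
have E x y : \sum_(ij : I * J) (f ij.1 x * f' ij.2 x) * (g ij.1 y * g' ij.2 y)
    = (\sum_i f i x * g i y) * (\sum_j f' j x * g' j y).
  rewrite big_distrlr pair_big /=; apply: eq_bigr => ij _.
  by rewrite mulrACA.
exists (I * J)%type, (fun ij x => f ij.1 x * f' ij.2 x),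
  (fun ij y => g ij.1 y * g' ij.2 y); split.
- move=> [i j]; have [? ?] := fg i; have [? ?] := fg' j.
  by split; exact: regular_at_mul.
- by rewrite E mulf_neq0.
- apply: filterS2 fgA fgB => -[x y] /= xyA xyB.
  by rewrite E mulf_eq0 negb_or => /andP[/xyA ? /xyB].
Qed.

Fact prod_open_bigU (I : Type) (F : I -> set XY) :
  (forall i, prod_open (F i)) -> prod_open (\bigcup_i F i).
Proof.
move=> oF p [i _ /oF [J [f [g [fg fgp fgF]]]]]; exists J, f, g; split=> //.
by apply: filterS fgF => xy + fgxy => /(_ fgxy) Fi; exists i.
Qed.

HB.instance Definition _ := isOpenTopological.Build XY
  prod_openT prod_openI prod_open_bigU.

End VarietyProd.

Section Varieties.
Context (k : fieldType).
Implicit Types X Y : funSpaceType k.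

Definition irreducible (T : topologicalType) (A : set T) :=
  A !=set0 /\ forall F G : set T, closed F -> closed G ->
    A `<=` F `|` G -> A `<=` F \/ A `<=` G.

Definition affine_algebraic X := exists n (Z : set (affine_space 'rV[k]_n)),
  closed Z /\ isomorphic X (set_type Z).

Definition separated X :=
  closed [set p : variety_prod X X | p.1 = p.2].

Definition variety X :=
  [/\ irreducible [set: X],
      exists m (U : 'I_m -> set X),
        (forall i, open (U i) /\ affine_algebraic (set_type (U i))) /\
        \bigcup_i U i = setT
    & separated X].

Definition complete_variety X := variety X /\
  forall Y, variety Y -> forall C : set (variety_prod X Y),
    closed C -> closed [set p.2 | p in C].

(* A locally closed subset whose induced structure is a complete variety.     *)
Definition complete_subvariety X (Z : set X) :=
  (exists U F : set X, [/\ open U, closed F & Z = U `&` F]) /\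
  complete_variety (set_type Z).

(* Krull dimension, by chains Z_0 < ... < Z_n of irreducible closed subsets.  *)
Definition has_chain (T : topologicalType) (n : nat) :=
  exists Z : nat -> set T,
    (forall i, (i <= n)%N -> irreducible (Z i) /\ closed (Z i)) /\
    (forall i, (i < n)%N -> Z i `<` Z i.+1).

Definition has_dimension (T : topologicalType) (d : nat) :=
  has_chain T d /\ forall n, has_chain T n -> (n <= d)%N.

End Varieties.

(* The GIT quotient V //_chi G = Proj (+)_n k[V]_{chi^n} of the affine space  *)
(* V by an action of a (reductive) group G, linearized by the character chi.  *)
Section GITQuotient.
Context (k : fieldType) (V : vectType k) (G : Type).
Context (act : G -> V -> V) (chi : G -> k).

Definition semi_invariant (n : nat) (f : V -> k) :=
  polynomial_fun f /\ forall g v, f (act g v) = chi g ^+ n * f v.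

Definition semistable (v : V) :=
  exists n f, [/\ (0 < n)%N, semi_invariant n f & f v != 0].

(* v and w define the same homogeneous prime ideal of semi-invariants, that   *)
(* is, the same point of Proj.                                                *)
Definition git_equiv (v w : V) :=
  forall n f, semi_invariant n f -> (f v == 0) = (f w == 0).

(* The points of the quotient, as fibres of the quotient map V^ss -> V // G.  *)
Definition git_quotient : Type :=
  {c : set V | exists2 v, semistable v &
     c = [set w | semistable w /\ git_equiv v w]}.

Local Notation Q := git_quotient.

HB.instance Definition _ := gen_eqMixin Q.
HB.instance Definition _ := gen_choiceMixin Q.

Definition nonvanishing (f : V -> k) : set Q :=
  [set p | forall v, sval p v -> f v != 0].

Definition git_open (U : set Q) : Prop := forall p, U p -> exists n f,
  [/\ (0 < n)%N, semi_invariant n f, nonvanishing f p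
    & nonvanishing f `<=` U].

Lemma git_repr (p : Q) : exists2 v, semistable v & sval p v.
Proof. by case: p => c /= [v sv cE]; exists v; rewrite // cE. Qed.

Lemma nonvanishingP n f (p : Q) v : semi_invariant n f -> sval p v ->
  f v != 0 -> nonvanishing f p.
Proof.
case: p => c /= [u su cE] sf; rewrite /nonvanishing /= cE.
by move=> [_ uv] fv w [_ uw]; rewrite -(uw _ _ sf) (uv _ _ sf).
Qed.

Lemma semi_invariant_mul m n f g : semi_invariant m f -> semi_invariant n g ->
  semi_invariant (m + n) (fun v => f v * g v).
Proof.
move=> [pf sf] [pg sg]; split; first exact: polynomial_mul.
by move=> x v; rewrite sf sg exprD mulrACA.
Qed.

Lemma semi_invariant_add n f g : semi_invariant n f -> semi_invariant n g ->
  semi_invariant n (fun v => f v + g v).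
Proof.
move=> [pf sf] [pg sg]; split; first exact: polynomial_add.
by move=> x v; rewrite sf sg mulrDr.
Qed.

Lemma semi_invariant_cst (c : k) : semi_invariant 0 (fun=> c).
Proof. by split=> [|g v]; [exact: polynomial_cst | rewrite mul1r]. Qed.

Lemma nonvanishing_mul f g :
  nonvanishing (fun v => f v * g v) = nonvanishing f `&` nonvanishing g.
Proof.
apply/seteqP; split=> [p fg | p [fp gp] v pv].
  by split=> v /fg; rewrite mulf_eq0 negb_or => /andP[].
by rewrite mulf_neq0 ?fp ?gp.
Qed.

Fact git_openT : git_open setT.
Proof.
move=> p _; have [v [n [f [n0 sf fv]]] pv] := git_repr p.
by exists n, f; split=> //; exact: nonvanishingP sf pv fv.
Qed.

Fact git_openI : setI_closed git_open.
Proof.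
move=> A B oA oB p [/oA [n [f [n0 sf fp fA]]] /oB [m [g [m0 sg gp gB]]]].
exists (n + m)%N, (fun v => f v * g v); rewrite nonvanishing_mul; split=> //.
- by rewrite addn_gt0 n0.
- exact: semi_invariant_mul.
- by move=> q [/fA ? /gB].
Qed.

Fact git_open_bigU (I : Type) (F : I -> set Q) :
  (forall i, git_open (F i)) -> git_open (\bigcup_i F i).
Proof.
move=> oF p [i _ /oF [n [f [n0 sf fp fF]]]]; exists n, f; split=> //.
by move=> q /fF Fq; exists i.
Qed.

HB.instance Definition _ := isOpenTopological.Build Q
  git_openT git_openI git_open_bigU.

Lemma nonvanishing_near n f (p : Q) : semi_invariant n f -> nonvanishing f p ->
  \forall q \near p, nonvanishing f q.
Proof.
move=> sf fp; apply: open_nbhs_nbhs; split; last exact: fp.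
move=> q fq.
have [m [g [m0 sg gq _]]] := git_openT (I : setT q).
exists (m + n)%N, (fun v => g v * f v); rewrite nonvanishing_mul; split.
- by rewrite addn_gt0 m0.
- exact: semi_invariant_mul.
- by split.
- by move=> r [].
Qed.

Definition git_regular_at (p : Q) (h : Q -> k) : Prop :=
  exists n f g, [/\ semi_invariant n f, semi_invariant n g, nonvanishing g p &
    \forall q \near p, forall v, sval q v -> h q = f v / g v].

Fact git_near p h :
  git_regular_at p h -> \forall q \near p, git_regular_at q h.
Proof.
move=> [n [f [g [sf sg gp hfg]]]].
apply: filterS2 (nonvanishing_near sg gp) (near_join hfg) => q gq hq.
by exists n, f, g.
Qed.

Fact git_ext p (h h' : Q -> k) : (\forall q \near p, h q = h' q) ->
  git_regular_at p h -> git_regular_at p h'.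
Proof.
move=> hh' [n [f [g [sf sg gp hfg]]]]; exists n, f, g; split=> //.
by apply: filterS2 hh' hfg => q <-.
Qed.

Fact git_cst p (c : k) : git_regular_at p (fun=> c).
Proof.
exists 0%N, (fun=> c), (fun=> 1); split; try exact: semi_invariant_cst.
  by move=> v _; exact: oner_neq0.
by apply: filterE => q v _; rewrite divr1.
Qed.

Fact git_add p h h' : git_regular_at p h -> git_regular_at p h' ->
  git_regular_at p (fun q => h q + h' q).
Proof.
move=> [n [f [g [sf sg gp hfg]]]] [n' [f' [g' [sf' sg' gp' hfg']]]].
have sgg' := semi_invariant_mul sg sg'.
have gg'p : nonvanishing (fun v => g v * g' v) p by rewrite nonvanishing_mul.
exists (n + n')%N, (fun v => f v * g' v + f' v * g v), (fun v => g v * g' v).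
split=> //.
  apply: semi_invariant_add; first exact: semi_invariant_mul.
  by rewrite addnC; exact: semi_invariant_mul.
apply: filterS2 (nonvanishing_near sgg' gg'p) (filterI hfg hfg').
move=> q gg'q [hq h'q] v qv; rewrite (hq v) // (h'q v) //.
by have := gg'q v qv; rewrite mulf_eq0 negb_or => /andP[? ?]; rewrite addf_div.
Qed.

Fact git_mul p h h' : git_regular_at p h -> git_regular_at p h' ->
  git_regular_at p (fun q => h q * h' q).
Proof.
move=> [n [f [g [sf sg gp hfg]]]] [n' [f' [g' [sf' sg' gp' hfg']]]].
exists (n + n')%N, (fun v => f v * f' v), (fun v => g v * g' v).
split; [exact: semi_invariant_mul | exact: semi_invariant_mul
  | by rewrite nonvanishing_mul | ].
apply: filterS2 hfg hfg' => q hq h'q v qv.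
by rewrite (hq v) // (h'q v) // mulf_div.
Qed.

Fact git_inv p h : git_regular_at p h -> h p != 0 ->
  (\forall q \near p, h q != 0) /\ git_regular_at p (fun q => (h q)^-1).
Proof.
move=> [n [f [g [sf sg gp hfg]]]] hp.
have fp : nonvanishing f p.
  move=> v pv; move: hp; rewrite (nbhs_singleton hfg v pv) mulf_eq0 negb_or.
  by case/andP.
split; last first.
  exists n, g, f; split=> //; apply: filterS hfg => q hq v qv.
  by rewrite (hq v) // invf_div.
apply: filterS2
  (filterI (nonvanishing_near sf fp) (nonvanishing_near sg gp)) hfg.
move=> q [fq gq] hq; have [v _ qv] := git_repr q.
by rewrite (hq v) // mulf_neq0 ?invr_neq0 ?fq ?gq.
Qed.

HB.instance Definition _ := @hasRegularFunctions.Build k Q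
  git_regular_at git_near git_ext git_cst git_add git_mul git_inv.

End GITQuotient.

Section Moduli.
Context (k : fieldType).

(* H^0(P^1, O(d)): binary forms of degree d. *)
Definition binary_form (d : nat) : vectType k := dhomog 2 k d.

(* F(X) |-> F(X g) for row vectors X = (X_0, X_1), a left action of SL_2.     *)
Definition sl2_subst (g : 'M[k]_2) (F : {mpoly k[2]}) : {mpoly k[2]} :=
  F \mPo [tuple \sum_(j < 2) g j i *: 'X_j | i < 2].

Lemma sl2_subst_homog g d (F : {mpoly k[2]}) :
  F \is d.-homog -> sl2_subst g F \is d.-homog.
Proof.
move=> /dhomogP hF; rewrite /sl2_subst comp_mpolyEX big_seq.
apply: rpred_sum => m /hF dm; apply: rpredZ; rewrite comp_mpolyX.
have -> : d = (m ord0 + m ord_max)%N.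
  by rewrite -dm /= mdegE !big_ord_recl big_ord0 addn0; congr (_ + m _)%N;
     apply: val_inj.
have linh i : \sum_(j < 2) g j i *: ('X_j : {mpoly k[2]}) \is 1.-homog.
  by apply: rpred_sum => j _; apply: rpredZ; rewrite dhomogX /= mdeg1.
rewrite !big_ord_recl big_ord0 mulr1 !tnth_mktuple.
have -> : lift ord0 ord0 = ord_max :> 'I_2 by apply: val_inj.
by apply: dhomogM; rewrite -[X in X.-homog]mul1n; apply: dhomogMn; apply: linh.
Qed.

Definition sl2_act d (g : 'M[k]_2) (F : binary_form d) : binary_form d :=
  DHomog (sl2_subst_homog g (dhomog_is_dhomog F)).

Definition weierstrass_data (N : nat) : vectType k :=
  (binary_form (4 * N) * binary_form (6 * N))%type.

Definition SL2 : Type := {g : 'M[k]_2 | \det g == 1}.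
Definition Gm : Type := {l : k | l != 0}.

Definition weierstrass_act N (gl : SL2 * Gm) (AB : weierstrass_data N) :
    weierstrass_data N :=
  (val gl.2 ^+ 4 *: sl2_act (val gl.1) AB.1,
   val gl.2 ^+ 6 *: sl2_act (val gl.1) AB.2).

Definition weierstrass_char (gl : SL2 * Gm) : k := val gl.2.

(* F vanishes to order at least m at the point [q_0 : q_1] of P^1; the form   *)
(* q_1 X_0 - q_0 X_1 is a local equation of the point. The zero form vanishes *)
(* to every order.                                                            *)
Definition vanishes_to_order (q : 'rV[k]_2) (m : nat) (F : {mpoly k[2]}) :=
  exists H : {mpoly k[2]},
    F = (q 0 ord_max *: 'X_ord0 - q 0 ord0 *: 'X_ord_max) ^+ m * H.

Definition T_ (N : nat) : set (weierstrass_data N) :=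
  [set AB | let A : {mpoly k[2]} := mpoly_of_dhomog AB.1 in
            let B : {mpoly k[2]} := mpoly_of_dhomog AB.2 in
            4%:R * A ^+ 3 + 27%:R * B ^+ 2 != 0 /\
            forall q : 'rV[k]_2, q != 0 ->
              ~ vanishes_to_order q 4 A \/ ~ vanishes_to_order q 6 B].

(* T_N // (SL_2 x G_m), as the image of T_N in the projective GIT quotient of *)
(* V_{4N} (+) V_{6N}. For N >= 2 every point of T_N is stable, so this is an  *)
(* open subset whose points are the orbits of T_N.                            *)
Definition E_ (N : nat) : funSpaceType k :=
  set_type [set p : git_quotient (@weierstrass_act N) weierstrass_char |
            exists2 AB, T_ AB & sval p AB].

End Moduli.

(* Main.v *)
(* Limits are taken along places: valuations with values in k on the functions
   on a set, modulo an ultrafilter.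
   Upper bound: by semistable reduction of the roots of the pencils A^3 + s B^2,
   a family in T_N whose invariants have a limit in T_N becomes finite after
   moving it by the group. Finiteness of the 20 coefficients of (A, B) of index
   < 4 or > 4N - 4 in A, < 6 or > 6N - 6 in B, then forces finiteness of all the
   others; a normal form fixes three of the 20. On a complete subvariety every
   function is thus algebraic over 17 functions, one of which is a scale.
   Existence: covariants of the labelled roots of A and of B cut out a subset of
   T_N in which every family has a limit, and in which these 20 coefficients are
   generically arbitrary; modulo SL_2 and G_m at least 16 parameters remain. Its
   quotient is covered by affine charts, whose coordinate rings are finitely
   generated by the Artin-Tate lemma. *)
From HB Require Import structures.
From mathcomp Require Import all_boot all_order all_algebra all_fingroup.
From mathcomp Require Import all_classical topology_structure initial_topology subtype_topology.
From mathcomp Require Import mpoly ring zify.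
Require Import Defs.
Set Implicit Arguments.
Unset Strict Implicit.
Unset Printing Implicit Defensive.
Import GRing.Theory Order.TTheory.
Local Open Scope classical_set_scope.
Local Open Scope ring_scope.

(** * Places *)

(** Where the numbers come from: minimality at a point of P^1 means a nonzero coefficient of index <
    4 in A or < 6 in B, so the two fixed points of a torus account for 2 * (4 + 6) = 20
    coefficients; SL_2 takes away 3 and the scale 1. For existence, a covariant of order n - 2r
    imposes n - 2r + 1 conditions on the n + 1 coefficients of a form of degree n and leaves 2r
    free: r = 4 for A and r = 6 for B give 20 again. The characteristic may be positive, so
    invariants cannot be obtained by averaging over permutations of the roots; they are elementary
    symmetric functions of all permuted bracket products, one of which is nonzero as soon as one
    product is. The pencil A^3 + s B^2 is used because the roots of A and of B taken separately do
    not control minimality: at a minimal point at most one member vanishes to order 12, and with 12N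
    + 2 members a failure of minimality in a limit shows in the size of a cluster of roots.
    Ultrafilters serve as generic points and places with residue field k as one-parameter limits, so
    that neither function fields nor discrete valuation rings have to be constructed. *)

Section PartialPlace.
Context (k : closedFieldType) (I : Type) (U : set_system I) (UU : UltraFilter U).
Implicit Types (f g h : I -> k) (a b c : k) (S : set ((I -> k) * k)).

(** The graph of a homomorphism to [k] from a [k]-algebra of functions taken modulo [U]. Chevalley's
    extension theorem is proved for such graphs directly, without forming a quotient ring. *)
Definition partial_place S :=
  [/\ forall c, S (fun=> c, c),
      forall f g a b, S (f, a) -> S (g, b) -> S (fun i => f i + g i, a + b),
      forall f g a b, S (f, a) -> S (g, b) -> S (fun i => f i * g i, a * b)
    & forall f a, S (f, a) -> U [set i | f i = 0] -> a = 0].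

Definition maximal_partial_place S :=
  partial_place S /\ forall S', partial_place S' -> S `<=` S' -> S' `<=` S.

Lemma exists_maximal_partial_place S0 : partial_place S0 ->
  exists2 S, maximal_partial_place S & S0 `<=` S.
Proof.
move=> pS0; pose P S := S = set0 \/ (partial_place S /\ S0 `<=` S).
have [|S [PS Smax]] := @Zorn_bigcup _ P.
  move=> F FP Ftot; have [F0|/existsNP[X /not_implyP[FX X0]]] :=
    pselect (forall X, F X -> X = set0).
    by left; rewrite predeqE => x; split=> // -[X FX]; rewrite (F0 X).
  right; have [//|[pX SX]] := FP X FX.
  have up Y Z x y : F Y -> F Z -> Y x -> Z y -> exists W, [/\ F W, W x & W y].
    move=> FY FZ Yx Zy; have [YZ|ZY] := Ftot _ _ FY FZ.
      by exists Z; split=> //; apply: YZ.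
    by exists Y; split=> //; apply: ZY.
  have pp W x : F W -> W x -> partial_place W.
    by move=> FW Wx; have [W0|[]] := FP W FW; rewrite ?W0 in Wx.
  split; last by move=> x /SX Xx; exists X.
  split.
  - by move=> c; exists X => //; case: pX.
  - move=> f g a b [Y FY Yf] [Z FZ Zg]; have [W [FW Wf Wg]] := up _ _ _ _ FY FZ Yf Zg.
    by exists W => //; have [_ D _ _] := pp _ _ FW Wf; apply: D.
  - move=> f g a b [Y FY Yf] [Z FZ Zg]; have [W [FW Wf Wg]] := up _ _ _ _ FY FZ Yf Zg.
    by exists W => //; have [_ _ M _] := pp _ _ FW Wf; apply: M.
  - by move=> f a [W FW Wf]; have [_ _ _ Z] := pp _ _ FW Wf; apply: Z.
case: PS => [S_0|[pS S0S]].
  have : S `<` S0.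
    by rewrite S_0; split=> // /(_ (fun=> 0, 0)); apply; case: pS0.
  by move=> /Smax; case; right; split.
exists S => //; split=> // S' pS' SS'; apply: contrapT => S'S.
by apply: (Smax S'); [split|right; split=> // x /S0S /SS'].
Qed.

Section Maximal.
Context (S : set ((I -> k) * k)) (mS : maximal_partial_place S).

Let pS : partial_place S. Proof. by case: mS. Qed.
Let S_cst c : S (fun=> c, c). Proof. by case: pS. Qed.
Let S_add f g a b : S (f, a) -> S (g, b) -> S (fun i => f i + g i, a + b).
Proof. by case: pS => _ + _ _; apply. Qed.
Let S_mul f g a b : S (f, a) -> S (g, b) -> S (fun i => f i * g i, a * b).
Proof. by case: pS => _ _ + _; apply. Qed.
Let S_eq0 f a : S (f, a) -> U [set i | f i = 0] -> a = 0.
Proof. by case: pS => _ _ _; apply. Qed.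

(** Maximality is always used by exhibiting a larger partial place; here it is the closure of [S]
    under equality almost everywhere. *)
Lemma maximal_ae f g a : U [set i | f i = g i] -> S (f, a) -> S (g, a).
Proof.
move=> fg Sf; apply: (mS.2 [set x | exists2 h, S (h, x.2) & U [set i | h i = x.1 i]]).
- split.
  + by move=> c; exists (fun=> c) => //; apply: filterE.
  + move=> f1 f2 a1 a2 /= [h1 S1 e1] [h2 S2 e2].
    exists (fun i => h1 i + h2 i); first exact: S_add.
    by apply: filterS2 e1 e2 => i /= -> ->.
  + move=> f1 f2 a1 a2 /= [h1 S1 e1] [h2 S2 e2].
    exists (fun i => h1 i * h2 i); first exact: S_mul.
    by apply: filterS2 e1 e2 => i /= -> ->.
  + move=> f1 a1 /= [h1 S1 e1] z; apply: S_eq0 S1 _.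
    by apply: filterS2 e1 z => i /= -> ->.
- by move=> [h b] Sh; exists h => //=; apply: filterE.
- by exists f.
Qed.

(** The localization at the powers of [f] is again a partial place, because the residue [c] is
    invertible. *)
Lemma maximal_inv f c : S (f, c) -> c != 0 -> S (fun i => (f i)^-1, c^-1).
Proof.
move=> Sf c0.
have Sfn n : S (fun i => f i ^+ n, c ^+ n).
  elim: n => [|n IH]; first exact: S_cst.
  have := S_mul Sf IH; rewrite -exprS.
  by congr (S (_, _)); apply/funext => i; rewrite exprS.
have fU : U [set i | f i != 0].
  have [z|z] := in_ultra_setVsetC [set i | f i = 0] UU.
    by rewrite (S_eq0 Sf z) eqxx in c0.
  by apply: filterS z => i /= /eqP.
apply: (mS.2 [set x | exists n g a, [/\ S (g, a), x.2 = a / c ^+ n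
    & U [set i | x.1 i * f i ^+ n = g i]]]).
- split.
  + move=> b; exists 0%N, (fun=> b), b; split=> //=; first by rewrite divr1.
    by apply: filterE => i /=; rewrite expr0 mulr1.
  + move=> f1 f2 a1 a2 [n1 [g1 [b1 [S1 /= -> e1]]]] [n2 [g2 [b2 [S2 /= -> e2]]]].
    exists (n1 + n2)%N, (fun i => g1 i * f i ^+ n2 + g2 i * f i ^+ n1),
      (b1 * c ^+ n2 + b2 * c ^+ n1); split=> /=.
    * by apply: S_add; apply: S_mul.
    * by rewrite addf_div ?expf_neq0// exprD.
    * apply: filterS2 e1 e2 => i /= <- <-; rewrite exprD mulrDl; congr (_ + _).
        by rewrite mulrA.
      by rewrite -mulrA (mulrC (f i ^+ n2)).
  + move=> f1 f2 a1 a2 [n1 [g1 [b1 [S1 /= -> e1]]]] [n2 [g2 [b2 [S2 /= -> e2]]]].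
    exists (n1 + n2)%N, (fun i => g1 i * g2 i), (b1 * b2); split=> /=.
    * exact: S_mul.
    * by rewrite mulf_div exprD.
    * by apply: filterS2 e1 e2 => i /= <- <-; rewrite exprD mulrACA.
  + move=> f1 a1 [n1 [g1 [b1 [S1 /= -> e1]]]] z.
    rewrite (S_eq0 S1) ?mul0r//.
    by apply: filterS2 e1 z => i /= <- ->; rewrite mul0r.
- move=> [g a] Sg; exists 0%N, g, a; split=> //=; first by rewrite divr1.
  by apply: filterE => i /=; rewrite expr0 mulr1.
- exists 1%N, (fun=> 1), 1; split=> //=; first by rewrite mul1r.
  by apply: filterS fU => i /= fi; rewrite expr1 mulVf.
Qed.

Let S_sum n (F : nat -> I -> k) (A : nat -> k) :
  (forall j, S (F j, A j)) -> S (fun i => \sum_(j < n) F j i, \sum_(j < n) A j).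
Proof.
move=> SF; elim: n => [|n IH].
  by rewrite big_ord0; under eq_fun do rewrite big_ord0; apply: S_cst.
rewrite big_ord_recr /=; under eq_fun do rewrite big_ord_recr /=.
exact: S_add.
Qed.

(* [lift_poly g P]: the polynomial [P] over the residue field lifts to the   *)
(* family [g] of polynomials with coefficients in the domain of [S].         *)
Definition lift_poly (g : I -> {poly k}) (P : {poly k}) :=
  (exists n, forall i, (size (g i) <= n)%N) /\
  forall l, S (fun i => (g i)`_l, P`_l).

Lemma lift_polyC h a : S (h, a) -> lift_poly (fun i => (h i)%:P) a%:P.
Proof.
move=> Sh; split; first by exists 1%N => i; rewrite size_polyC leq_b1.
move=> l; under eq_fun do rewrite coefC; rewrite coefC.
by case: (l == 0)%N.
Qed.

Lemma lift_polyX : lift_poly (fun=> 'X) 'X.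
Proof.
by split=> [|l]; [exists 2%N => i; rewrite size_polyX | exact: S_cst].
Qed.

Lemma lift_polyD (g g' : I -> {poly k}) P P' : lift_poly g P -> lift_poly g' P' ->
  lift_poly (fun i => g i + g' i) (P + P').
Proof.
move=> [[n gn] gP] [[m gm] gP']; split.
  exists (maxn n m) => i; apply: leq_trans (size_polyD _ _) _.
  by rewrite geq_max !leq_max gn gm orbT.
by move=> l; rewrite coefD; under eq_fun do rewrite coefD; exact: S_add.
Qed.

Lemma lift_polyM (g g' : I -> {poly k}) P P' : lift_poly g P -> lift_poly g' P' ->
  lift_poly (fun i => g i * g' i) (P * P').
Proof.
move=> [[n gn] gP] [[m gm] gP']; split.
  exists (n + m)%N => i; apply: leq_trans (size_polyMleq _ _) _.
  by apply: leq_trans (leq_pred _) _; apply: leq_add.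
move=> l; rewrite coefM; under eq_fun do rewrite coefM.
have := @S_sum l.+1 (fun j i => (g i)`_j * (g' i)`_(l - j)) (fun j => P`_j * P'`_(l - j)).
by apply=> j; apply: S_mul.
Qed.

(* Lifts of [1] having [f] as a root, with degree at most n.                 *)
Definition unit_relation f n := exists g : I -> {poly k}, [/\ lift_poly g 1,
  forall i, (size (g i) <= n.+1)%N & U [set i | (g i).[f i] = 0]].

(** The residue polynomials that have a lift vanishing at [f] form an ideal of [k[X]]. If it is
    proper, it has a common root [c] since [k] is algebraically closed, and giving [f] the value [c]
    extends the place; otherwise it contains 1. *)
Lemma extend_or_unit_relation f :
  (exists c, S (f, c)) \/ exists n, unit_relation f n.
Proof.
pose J P := exists2 g : I -> {poly k}, lift_poly g P & U [set i | (g i).[f i] = 0].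
have JD P Q : J P -> J Q -> J (P + Q).
  move=> [g gP g0] [h hQ h0]; exists (fun i => g i + h i); first exact: lift_polyD.
  by apply: filterS2 g0 h0 => i /= g0 h0; rewrite hornerD g0 h0 addr0.
have JM P Q : J P -> J (P * Q).
  move=> [g gP g0]; exists (fun i => g i * Q).
    apply: lift_polyM => //; split; first by exists (size Q).
    by move=> l; apply: S_cst.
  by apply: filterS g0 => i /= g0; rewrite hornerM g0 mul0r.
have [[P JP P1]|nJ] := pselect (exists2 P, J P & size P = 1%N).
  right; have [a a0 Pa] : exists2 a, a != 0 & P = a%:P.
    by apply/size_poly1P; apply/eqP.
  have [g [[n gn] gS] g0] : J 1.
    have -> : 1 = P * (a^-1)%:P by rewrite Pa -polyCM mulfV.
    exact: JM.
  by exists n, g; split=> // [|i]; [split=> //; exists n|apply: leq_trans (gn i) _].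
left; have [c cJ] : exists c, forall P, J P -> root P c.
  have [J0|/existsNP[P /not_implyP[JP /eqP P0]]] := pselect (forall P, J P -> P = 0).
    by exists 0 => P /J0 ->; apply: root0.
  pose Q n := `[< exists P, [/\ J P, P != 0 & size P = n] >].
  have exQ : exists n, Q n by exists (size P); apply/asboolP; exists P.
  case: (ex_minnP exQ) => n /asboolP[R [JR R0 Rn]] nmin.
  have [c Rc] : exists c, root R c.
    by apply/closed_rootP; apply/eqP => R1; apply: nJ; exists R.
  exists c => T JT; have : J (T %% R).
    have -> : T %% R = T + R * - (T %/ R) by rewrite {2}(divp_eq T R) mulrN (mulrC R) addrC addKr.
    by apply: JD => //; apply: JM.
  move=> JTR; have TR0 : T %% R = 0.
    apply/eqP; apply: contraT => TR.
    have : Q (size (T %% R)) by apply/asboolP; exists (T %% R).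
    by move=> /nmin; rewrite leqNgt -Rn ltn_modp R0.
  by rewrite (divp_eq T R) TR0 addr0 rootM Rc orbT.
exists c; apply: (mS.2 [set x | exists (g : I -> {poly k}) P,
   [/\ lift_poly g P, x.1 = (fun i => (g i).[f i]) & x.2 = P.[c]]]).
- split.
  + move=> b; exists (fun=> b%:P), b%:P; split=> /=; [exact: lift_polyC| |by rewrite hornerC].
    by apply/funext => i; rewrite hornerC.
  + move=> _ _ _ _ [g [P [gP /= -> ->]]] [h [Q [hQ /= -> ->]]].
    exists (fun i => g i + h i), (P + Q); split; [exact: lift_polyD| |by rewrite /= hornerD].
    by apply/funext => i /=; rewrite hornerD.
  + move=> _ _ _ _ [g [P [gP /= -> ->]]] [h [Q [hQ /= -> ->]]].
    exists (fun i => g i * h i), (P * Q); split; [exact: lift_polyM| |by rewrite /= hornerM].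
    by apply/funext => i /=; rewrite hornerM.
  + move=> _ _ [g [P [gP /= -> ->]]] z; apply/eqP; apply: cJ.
    by exists g.
- move=> [g a] Sg; exists (fun i => (g i)%:P), a%:P; split=> /=.
  + exact: lift_polyC.
  + by apply/funext => i; rewrite hornerC.
  + by rewrite hornerC.
- exists (fun=> 'X), 'X; split=> /=; [exact: lift_polyX| |by rewrite hornerX].
  by apply/funext => i /=; rewrite hornerX.
Qed.

Lemma unit_relation_gt0 f n : unit_relation f n -> (0 < n)%N.
Proof.
case: n => // -[g [[_ gS] g1 g0]]; have := gS 0%N; rewrite coef1 /= => g01.
suff : 1 = 0 :> k by move/eqP; rewrite oner_eq0.
apply: S_eq0 g01 _; apply: filterS g0 => i /=.
by rewrite [g i]size1_polyC // hornerC coefC.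
Qed.

(** Multiplied by a power of [f], the relation for [f^-1] becomes one for [f] whose leading
    coefficient has residue 1. Subtracting a multiple of it with residue 0 cancels the top
    coefficient of [g] and leaves the residue equal to 1. *)
Lemma unit_relation_reduce f n m : U [set i | f i != 0] ->
  unit_relation f n.+1 -> unit_relation (fun i => (f i)^-1) m ->
  (m <= n.+1)%N -> unit_relation f n.
Proof.
move=> fU [g [gS gn g0]] [h [hS hm h0]] mn.
pose rv i : {poly k} := \poly_(j < m.+1) (h i)`_(m - j).
pose rvP : {poly k} := \poly_(j < m.+1) (1 : {poly k})`_(m - j).
have rvS : lift_poly rv rvP.
  split; first by exists m.+1 => i; apply: size_poly.
  move=> l; rewrite coef_poly; under eq_fun do rewrite coef_poly.
  by case: ifP => _; [apply: hS.2|apply: S_cst].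
pose g' i := (h i)`_0 *: g i - (g i)`_n.+1 *: ('X^(n.+1 - m) * rv i).
have cS F A : S (F, A) -> S (fun i => - F i, - A).
  move=> SFA; have := S_mul (S_cst (-1)) SFA; rewrite mulN1r.
  by congr (S (_, _)); apply/funext => i; rewrite mulN1r.
exists g'; split.
- split.
    exists (n.+2 + (n.+1 + m.+1))%N => i; apply: leq_trans (size_polyD _ _) _.
    rewrite geq_max size_polyN; apply/andP; split.
      by apply: leq_trans (size_scale_leq _ _) _; apply: leq_trans (gn i) (leq_addr _ _).
    apply: leq_trans (size_scale_leq _ _) _; apply: leq_trans (size_polyMleq _ _) _.
    rewrite size_polyXn addSn /=; apply: leq_trans (leq_add (leq_subr _ _) (size_poly _ _)) _.
    exact: leq_addl.
  move=> l.
  have -> : (1 : {poly k})`_l = (1 : {poly k})`_0 * (1 : {poly k})`_l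
      - (1 : {poly k})`_n.+1 * ('X^(n.+1 - m) * rvP)`_l.
    by rewrite !coef1 /= mul1r mul0r subr0.
  have -> : (fun i => (g' i)`_l) = (fun i => (h i)`_0 * (g i)`_l
      + - ((g i)`_n.+1 * ('X^(n.+1 - m) * rv i)`_l)).
    by apply/funext => i; rewrite /g' coefB !coefZ.
  apply: S_add; first by apply: S_mul; [apply: hS.2|apply: gS.2].
  apply: cS; apply: S_mul; first exact: gS.2.
  rewrite coefXnM; under eq_fun do rewrite coefXnM.
  by case: ifP => _; [apply: S_cst|apply: rvS.2].
- move=> i; apply/leq_sizeP => j nj; rewrite /g' coefB !coefZ coefXnM coef_poly.
  have ltF : (j < n.+1 - m)%N = false.
    by apply/negbTE; rewrite -leqNgt; apply: leq_trans (leq_subr _ _) nj.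
  rewrite ltF; case: (ltngtP j n.+1) nj => // [nj|->] _.
    rewrite (leq_sizeP _ _ (gn i) j nj) mulr0 ifF ?mulr0 ?subr0//.
    apply/negbTE; rewrite -leqNgt; apply: leq_trans (_ : m.+1 <= (n.+2 - (n.+1 - m)))%N _.
      by rewrite subSn ?leq_subr// subKn.
    exact: leq_sub2r.
  by rewrite subKn // ltnSn subnn mulrC subrr.
- apply: filterS3 fU g0 h0 => i /= fi g0 h0.
  rewrite /g' hornerD hornerN !hornerZ g0 mulr0 hornerM hornerXn.
  suff -> : (rv i).[f i] = 0 by rewrite !mulr0 subr0.
  have : f i ^+ m * (h i).[(f i)^-1] = 0 by rewrite h0 mulr0.
  rewrite (horner_coef_wide _ (hm i)) horner_poly mulr_sumr => E; rewrite -[RHS]E.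
  rewrite (reindex_inj rev_ord_inj) /=; apply: eq_bigr => j _.
  rewrite subSS subKn ?(leq_ord j)// mulrCA; congr (_ * _).
  by rewrite exprVn -expfB_cond // (negbTE fi) add0n leq_ord.
Qed.

(** If neither [f] nor its inverse has a value, both satisfy a unit relation. The longer of the two
    can always be shortened, and this descent must stop, since no unit relation has degree 0. *)
Lemma maximal_total f : (exists c, S (f, c)) \/ S (fun i => (f i)^-1, 0).
Proof.
have [fU|fU] := in_ultra_setVsetC [set i | f i = 0] UU.
  left; exists 0; apply: maximal_ae (S_cst 0).
  by apply: filterS fU => i /= ->.
have {}fU : U [set i | f i != 0] by apply: filterS fU => i /= /eqP.
have [|[n fn]] := extend_or_unit_relation f; first by left.
have [[c Sc]|[m fm]] := extend_or_unit_relation (fun i => (f i)^-1).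
  have [c0|c0] := eqVneq c 0; first by right; rewrite -c0.
  left; exists c^-1; have := maximal_inv Sc c0.
  by congr (S (_, _)); apply/funext => i; rewrite invrK.
have fVU : U [set i | (f i)^-1 != 0] by apply: filterS fU => i /=; rewrite invr_eq0.
elim: {n m}(n + m)%N {-2}n {-2}m (leqnn (n + m)%N) fn fm => [|l IH] n m nml fn fm.
  by move: nml (unit_relation_gt0 fn); rewrite leqn0 addn_eq0 => /andP[/eqP -> _].
case: n m nml fn fm (unit_relation_gt0 fn) (unit_relation_gt0 fm) => [|n] [|m] // nml fn fm _ _.
have [mn|/ltnW nm] := leqP m.+1 n.+1.
  by apply: (IH n m.+1) => //; apply: unit_relation_reduce fm mn.
apply: (IH n.+1 m) => //; first by rewrite addnS in nml *.
apply: unit_relation_reduce fVU fm _ nm.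
by under eq_fun do rewrite invrK.
Qed.

End Maximal.

End PartialPlace.

(** A valuation ring with residue field [k] in the field of functions modulo [ae]: [tends f a] says
    that [f] lies in the ring and has residue [a], and [tends_total] is the valuation property. *)
Record place (k : closedFieldType) (I : Type) := Place {
  ae : set_system I;
  ae_ultra : UltraFilter ae;
  tends : (I -> k) -> k -> Prop;
  tends_cst : forall c, tends (fun=> c) c;
  tendsD : forall f g a b, tends f a -> tends g b -> tends (fun i => f i + g i) (a + b);
  tendsM : forall f g a b, tends f a -> tends g b -> tends (fun i => f i * g i) (a * b);
  tends_ae : forall f g a, ae [set i | f i = g i] -> tends f a -> tends g a;
  tends_ae0 : forall f a, tends f a -> ae [set i | f i = 0] -> a = 0;
  tends_total : forall f, (exists a, tends f a) \/ tends (fun i => (f i)^-1) 0 }.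

#[global] Existing Instance ae_ultra.

Lemma exists_place (k : closedFieldType) (I : Type) (U : set_system I)
    (UU : UltraFilter U) (S0 : set ((I -> k) * k)) : partial_place U S0 ->
  exists P : place k I, ae P = U /\ forall f a, S0 (f, a) -> tends P f a.
Proof.
move=> /exists_maximal_partial_place[S mS S0S].
have [[p1 p2 p3 p4] _] := mS.
by exists (@Place k I U UU (fun f a => S (f, a)) p1 p2 p3
  (@maximal_ae _ _ _ UU _ mS) p4 (maximal_total UU mS)); split=> //= f a /S0S.
Qed.

(** * Calculus of limits along a place *)

Section PlaceTheory.
Context (k : closedFieldType) (I : Type) (P : place k I).
Implicit Types (f g h : I -> k) (a b c : k).
Local Notation U := (ae P).
Local Notation tends := (tends P).

Definition finite_at f := exists a, tends f a.

Lemma aeW (Q R : I -> Prop) : (forall i, Q i -> R i) -> U [set i | Q i] -> U [set i | R i].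
Proof. by move=> QR; apply: filterS. Qed.

Lemma aeT (Q : I -> Prop) : (forall i, Q i) -> U [set i | Q i].
Proof. by move=> ?; apply: filterE. Qed.

Lemma aeI (Q R : I -> Prop) : U [set i | Q i] -> U [set i | R i] -> U [set i | Q i /\ R i].
Proof. exact: filterI. Qed.

Lemma aeF : ~ U [set i | False].
Proof. by move=> F; apply: (@filter_not_empty _ U _); rewrite -[X in U X]/[set i | False] . Qed.

Lemma ae_exists (Q : I -> Prop) : U [set i | Q i] -> exists i, Q i.
Proof.
by move=> uQ; apply: contrapT => nQ; apply: aeF; apply: aeW uQ => i Qi; apply: nQ; exists i.
Qed.

Lemma aeN (Q : I -> Prop) : U [set i | Q i] \/ U [set i | ~ Q i].
Proof. exact: in_ultra_setVsetC. Qed.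

Lemma ae_or (Q R : I -> Prop) : U [set i | Q i \/ R i] -> U [set i | Q i] \/ U [set i | R i].
Proof.
move=> QR; have [|nQ] := aeN Q; [by left|right].
by apply: aeW (aeI QR nQ) => i [[]].
Qed.

Lemma ae_finP (J : finType) (Q : J -> I -> Prop) :
  U [set i | exists j, Q j i] -> exists j, U [set i | Q j i].
Proof.
move=> QU; apply: contrapT => nQ.
have {}nQ j : U [set i | ~ Q j i] by have [Qj|//] := aeN (Q j); case: nQ; exists j.
have : U [set i | forall j, j \in enum J -> ~ Q j i].
  elim: (enum J) => [|j s IH]; first exact: aeT.
  by apply: aeW (aeI (nQ j) IH) => i [Qj Qs] j'; rewrite inE => /predU1P[->|/Qs].
move=> A; apply: aeF; apply: aeW (aeI QU A) => i [[j Qj]] /(_ j).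
by rewrite mem_enum => /(_ isT).
Qed.

Lemma ae_fin_forall (J : finType) (Q : J -> I -> Prop) :
  (forall j, U [set i | Q j i]) -> U [set i | forall j, Q j i].
Proof.
move=> QU; have [//|nQ] := aeN (fun i => forall j, Q j i).
have : U [set i | exists j, ~ Q j i] by apply: aeW nQ => i /existsNP.
move=> /(@ae_finP J (fun j i => ~ Q j i))[j nQj].
by case: (@aeF); apply: aeW (aeI nQj (QU j)) => i [].
Qed.

Lemma ae_eq0 f : U [set i | f i = 0] \/ U [set i | f i != 0].
Proof. by have [|nf] := aeN (fun i => f i = 0); [left|right; apply: aeW nf => i /eqP]. Qed.

Lemma tends_ext f g a : f =1 g -> tends f a -> tends g a.
Proof. by move=> /funext ->. Qed.

Lemma tends_uniq f a b : tends f a -> tends f b -> a = b.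
Proof.
move=> fa fb; have := tendsD fa (tendsM (tends_cst P (-1)) fb).
move/tends_ae0 => /(_ _)/eqP; rewrite mulN1r subr_eq0 => E; apply/eqP/E.
by apply: aeT => i; rewrite mulN1r subrr.
Qed.

Lemma tends0 f : U [set i | f i = 0] -> tends f 0.
Proof. by move=> f0; apply: tends_ae (tends_cst P 0); apply: aeW f0 => i ->. Qed.

Lemma tendsZ c f a : tends f a -> tends (fun i => c * f i) (c * a).
Proof. exact/tendsM/tends_cst. Qed.

Lemma tendsN f a : tends f a -> tends (fun i => - f i) (- a).
Proof. by move=> /(tendsZ (-1)); rewrite mulN1r; apply: tends_ext => i; rewrite mulN1r. Qed.

Lemma tendsB f g a b : tends f a -> tends g b -> tends (fun i => f i - g i) (a - b).
Proof. by move=> fa /tendsN; apply: tendsD. Qed.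

Lemma tendsX f a n : tends f a -> tends (fun i => f i ^+ n) (a ^+ n).
Proof.
move=> fa; elim: n => [|n IH]; first exact: tends_cst.
by rewrite exprS; apply: tends_ext (tendsM fa IH) => i; rewrite exprS.
Qed.

Lemma tends_sum (J : Type) (r : seq J) (Q : pred J) (F : J -> I -> k) (A : J -> k) :
  (forall j, Q j -> tends (F j) (A j)) ->
  tends (fun i => \sum_(j <- r | Q j) F j i) (\sum_(j <- r | Q j) A j).
Proof.
move=> FA; elim: r => [|j r IH].
  by rewrite big_nil; apply: tends_ext (tends_cst P 0) => i; rewrite big_nil.
rewrite big_cons; case: ifP => Qj.
  by apply: tends_ext (tendsD (FA j Qj) IH) => i; rewrite big_cons Qj.
by apply: tends_ext IH => i; rewrite big_cons Qj.
Qed.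

Lemma tends_prod (J : Type) (r : seq J) (Q : pred J) (F : J -> I -> k) (A : J -> k) :
  (forall j, Q j -> tends (F j) (A j)) ->
  tends (fun i => \prod_(j <- r | Q j) F j i) (\prod_(j <- r | Q j) A j).
Proof.
move=> FA; elim: r => [|j r IH].
  by rewrite big_nil; apply: tends_ext (tends_cst P 1) => i; rewrite big_nil.
rewrite big_cons; case: ifP => Qj.
  by apply: tends_ext (tendsM (FA j Qj) IH) => i; rewrite big_cons Qj.
by apply: tends_ext IH => i; rewrite big_cons Qj.
Qed.

Lemma tends_ne0 f a : tends f a -> a != 0 -> U [set i | f i != 0].
Proof.
move=> fa a0; have [f0|//] := ae_eq0 f.
by rewrite (tends_ae0 fa f0) eqxx in a0.
Qed.

Lemma tendsV f a : tends f a -> a != 0 -> tends (fun i => (f i)^-1) a^-1.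
Proof.
move=> fa a0; have fU := tends_ne0 fa a0.
have nV : ~ tends (fun i => (f i)^-1) 0.
  move=> fV; have /eqP := tends_uniq (tendsM fa fV)
    (tends_ae (aeW (fun i fi => esym (mulfV fi)) fU) (tends_cst P 1)).
  by rewrite mulr0 eq_sym oner_eq0.
have [[b fb]|] := tends_total P (fun i => (f i)^-1).
  suff -> : a^-1 = b by [].
  have := tends_uniq (tendsM fa fb)
    (tends_ae (aeW (fun i fi => esym (mulfV fi)) fU) (tends_cst P 1)).
  by move=> ab; apply: (mulfI a0); rewrite ab mulfV.
move=> /(tends_ext (fun i => invrK _)) f0.
by rewrite (tends_uniq fa f0) eqxx in a0.
Qed.

Lemma tends_div f g a b : tends f a -> tends g b -> b != 0 ->
  tends (fun i => f i / g i) (a / b).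
Proof. by move=> fa gb b0; apply: tendsM fa (tendsV gb b0). Qed.

Lemma finite_at_ext f g : f =1 g -> finite_at f -> finite_at g.
Proof. by move=> /funext ->. Qed.

Lemma finite_at_ae f g : U [set i | f i = g i] -> finite_at f -> finite_at g.
Proof. by move=> fg [a fa]; exists a; apply: tends_ae fg fa. Qed.

Lemma finite_at_cst c : finite_at (fun=> c).
Proof. by exists c; apply: tends_cst. Qed.

Lemma finite_atD f g : finite_at f -> finite_at g -> finite_at (fun i => f i + g i).
Proof. by move=> [a fa] [b gb]; exists (a + b); apply: tendsD. Qed.

Lemma finite_atM f g : finite_at f -> finite_at g -> finite_at (fun i => f i * g i).
Proof. by move=> [a fa] [b gb]; exists (a * b); apply: tendsM. Qed.

Lemma finite_atX f n : finite_at f -> finite_at (fun i => f i ^+ n).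
Proof. by move=> [a fa]; exists (a ^+ n); apply: tendsX. Qed.

Lemma finite_at_sum (J : Type) (r : seq J) (Q : pred J) (F : J -> I -> k) :
  (forall j, Q j -> finite_at (F j)) -> finite_at (fun i => \sum_(j <- r | Q j) F j i).
Proof.
move=> FA; elim: r => [|j r IH].
  by apply: finite_at_ext (finite_at_cst 0) => i; rewrite big_nil.
have [Qj|Qj] := boolP (Q j).
  by apply: finite_at_ext (finite_atD (FA j Qj) IH) => i; rewrite big_cons Qj.
by apply: finite_at_ext IH => i; rewrite big_cons (negbTE Qj).
Qed.

Lemma infinite_at f : ~ finite_at f -> tends (fun i => (f i)^-1) 0.
Proof. by have [|] := tends_total P f. Qed.

Lemma infinite_ne0 f : ~ finite_at f -> U [set i | f i != 0].
Proof. by move=> nf; have [f0|//] := ae_eq0 f; case: nf; exists 0; apply: tends0. Qed.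

(** Valuation rings are integrally closed: if [f] were infinite, division of the equation by
    [f ^+ n] would give 1 = 0 in the residue field. *)
Lemma finite_at_integral f n (F : nat -> I -> k) : (forall j, (j < n)%N -> finite_at (F j)) ->
  U [set i | f i ^+ n = \sum_(j < n) F j i * f i ^+ j] -> finite_at f.
Proof.
move=> Ffin eqn; apply: contrapT => nf.
have fV := infinite_at nf; have f0 := infinite_ne0 nf.
have T0 : tends (fun i => \sum_(j < n) F j i * (f i)^-1 ^+ (n - j)) (\sum_(j < n) 0).
  apply: tends_sum => j _; have [a Fa] := Ffin j (ltn_ord j).
  have := tendsM Fa (tendsX (n - j) fV).
  by rewrite expr0n subn_eq0 leqNgt ltn_ord mulr0.
have T1 : tends (fun i => \sum_(j < n) F j i * (f i)^-1 ^+ (n - j)) 1.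
  apply: tends_ae (tends_cst P 1); apply: aeW (aeI eqn f0) => i [fn fi].
  have := congr1 (fun x => x / f i ^+ n) fn; rewrite divff ?expf_neq0// => ->.
  rewrite mulr_suml; apply: eq_bigr => j _.
  rewrite -mulrA; congr (_ * _); rewrite exprVn expfB ?ltn_ord//.
  by rewrite invfM invrK mulrC.
by have /eqP := tends_uniq T0 T1; rewrite big1// eq_sym oner_eq0.
Qed.

Lemma finite_at_root f n : (0 < n)%N -> finite_at (fun i => f i ^+ n) -> finite_at f.
Proof.
move=> n0 fn; apply: (@finite_at_integral _ n (fun j i => if j == 0%N then f i ^+ n else 0)).
  by move=> j _; case: (j == 0)%N => //; apply: finite_at_cst.
apply: aeT => i; case: n n0 {fn} => // n _.
by rewrite big_ord_recl /= expr0 mulr1 big1 ?addr0// => j _; rewrite mul0r.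
Qed.

Lemma finite_at_div f g : finite_at (fun i => f i / g i) \/
  tends (fun i => g i / f i) 0.
Proof.
have [|E] := tends_total P (fun i => f i / g i); first by left.
by right; apply: tends_ext E => i; rewrite invf_div.
Qed.

(** Valuations are totally ordered, so one of finitely many functions dominates the others. Dividing
    by it is how points of projective space acquire limits. *)
Lemma ae_dominant (J : finType) (F : J -> I -> k) :
  U [set i | exists j, F j i != 0] ->
  exists j0, U [set i | F j0 i != 0] /\ forall j, finite_at (fun i => F j i / F j0 i).
Proof.
move=> /(@ae_finP _ (fun j i => F j i != 0))[j1 F1].
suff [j0 [F0 D]] : exists j0, U [set i | F j0 i != 0] /\
    forall j, j \in enum J -> finite_at (fun i => F j i / F j0 i).
  by exists j0; split=> // j; apply: D; rewrite mem_enum.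
elim: (enum J) => [|j s [j0 [F0 D]]]; first by exists j1.
have [fj|T] := finite_at_div (F j) (F j0).
  by exists j0; split=> // j'; rewrite inE => /predU1P[->|/D].
have [Fj|Fj] := ae_eq0 (F j).
  exists j0; split=> // j'; rewrite inE => /predU1P[->|/D//].
  by exists 0; apply: tends0; apply: aeW Fj => i ->; rewrite mul0r.
exists j; split=> // j'; rewrite inE => /predU1P[->|/D [b Db]].
  by exists 1; apply: tends_ae (tends_cst P 1); apply: aeW Fj => i /divff.
exists (b * 0); apply: tends_ae (tendsM Db T).
by apply: aeW F0 => i F0i; rewrite mulrA divfK.
Qed.

Lemma tends_meval n (p : {mpoly k[n]}) (x : 'I_n -> I -> k) (c : 'I_n -> k) :
  (forall j, tends (x j) (c j)) -> tends (fun i => p.@[fun j => x j i]) p.@[c].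
Proof.
move=> xc; rewrite mevalE; under eq_fun do rewrite mevalE.
apply: tends_sum => m _; apply: tendsZ.
by apply: tends_prod => j _; apply: tendsX.
Qed.

End PlaceTheory.

(** The hypothesis says that [c] is a specialization of the point [x] modulo [U]; then the
    polynomials in [x], with their values at [c], form a partial place. *)
Lemma exists_place_vals (k : closedFieldType) (I : Type) (U : set_system I)
    (UU : UltraFilter U) n (x : 'I_n -> I -> k) (c : 'I_n -> k) :
  (forall p : {mpoly k[n]}, U [set i | p.@[fun j => x j i] = 0] -> p.@[c] = 0) ->
  exists P : place k I, ae P = U /\ forall j, tends P (x j) (c j).
Proof.
move=> xc.
have [|P [aP tP]] := exists_place UU (S0 := [set y | exists p : {mpoly k[n]},
    y.1 = (fun i => p.@[fun j => x j i]) /\ y.2 = p.@[c]]).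
  split=> /=.
  - by move=> a; exists a%:MP; split; rewrite ?mevalC//; apply/funext => i; rewrite mevalC.
  - move=> _ _ _ _ [p [-> ->]] [q [-> ->]]; exists (p + q).
    by split; rewrite ?mevalD//; apply/funext => i; rewrite mevalD.
  - move=> _ _ _ _ [p [-> ->]] [q [-> ->]]; exists (p * q).
    by split; rewrite ?mevalM//; apply/funext => i; rewrite mevalM.
  - by move=> _ _ [p [-> ->]]; apply: xc.
exists P; split=> // j; apply: tP; exists 'X_j.
by split; rewrite ?mevalXU//; apply/funext => i; rewrite mevalXU.
Qed.

Lemma ultra_of_fip (I : Type) (B : set (set I)) :
  (forall A A', B A -> B A' -> exists2 A'', B A'' & A'' `<=` A `&` A') ->
  (exists A, B A) -> (forall A, B A -> exists i, A i) ->
  exists U : set_system I, UltraFilter U /\ B `<=` U.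
Proof.
move=> BI [A0 BA0] Bne; pose F := [set A | exists2 A', B A' & A' `<=` A].
have FF : ProperFilter F.
  split; first by move=> [A BA A0']; have [i /A0'] := Bne A BA.
  split; first by exists A0.
  - move=> A A' [D BD DA] [D' BD' DA']; have [E BE ED] := BI _ _ BD BD'.
    by exists E => // i /ED[/DA ? /DA'].
  - by move=> A A' AA' [D BD DA]; exists D => // i /DA /AA'.
have [U [UU FU]] := ultraFilterLemma FF.
by exists U; split=> // A BA; apply: FU; exists A.
Qed.

(** A function without poles is locally constant, in valuative form. If infinitely many values
    occurred, an ultrafilter avoiding every finite set of values would make the inverse of [x]
    transcendental over [k], and some place would send that inverse to 0. *)
Lemma finite_range (k : closedFieldType) (I : Type) (x : I -> k) :
  (forall P : place k I, finite_at P x) -> exists s : seq k, forall i, x i \in s.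
Proof.
move=> fx; apply: contrapT => nx.
have [||| U [UU BU]] := @ultra_of_fip I [set A | exists s : seq k, A = [set i | x i \notin s]].
- move=> _ _ [s ->] [t ->]; exists [set i | x i \notin s ++ t]; first by exists (s ++ t).
  by move=> i /=; rewrite mem_cat negb_or => /andP[].
- by exists [set i | x i \notin [::]]; exists [::].
- move=> _ [s ->]; apply: contrapT => ns; apply: nx; exists s => i.
  by apply: contrapT => /negP xi; apply: ns; exists i.
have [p pU|P [aP tP]] := @exists_place_vals k I U UU 1 (fun _ i => (x i)^-1) (fun=> 0).
  pose q : {poly k} := \sum_(m <- msupp p) p@_m *: 'X^(m ord0).
  have qE y : p.@[fun=> y] = q.[y].
    rewrite mevalE horner_sum; apply: eq_bigr => m _.
    by rewrite hornerZ hornerXn big_ord_recl big_ord0 mulr1.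
  have [q0|q0] := eqVneq q 0; first by rewrite qE q0 horner0.
  have [r qr] := closed_field_poly_normal q.
  have /BU nU : [set A | exists s : seq k, A = [set i | x i \notin s]]
    [set i | x i \notin [seq y^-1 | y <- r]] by exists [seq y^-1 | y <- r].
  have [|i [/= pi /negP ri]] := @filter_ex _ U _ (fun i => p.@[fun=> (x i)^-1] = 0 /\
     x i \notin [seq y^-1 | y <- r]); first exact: filterI pU nU.
  case: ri; rewrite -[x i]invrK map_f //.
  move: pi; rewrite qE qr => /eqP.
  by rewrite -[_ == 0]/(root _ _) rootZ ?lead_coef_eq0// root_prod_XsubC.
have [a xa] := fx P; have := tP ord0.
have xU : ae P [set i | x i != 0].
  rewrite aP; have : [set A | exists s : seq k, A = [set i | x i \notin s]]
    [set i | x i \notin [:: 0]] by exists [:: 0].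
  by move=> /BU; apply: filterS => i /=; rewrite inE.
move=> /(tendsM xa); rewrite mulr0 => T0.
have T1 := tends_ae (aeW (fun i fi => esym (mulfV fi)) xU) (tends_cst P 1).
by have /eqP := tends_uniq T0 T1; rewrite eq_sym oner_eq0.
Qed.

Lemma nat_nondecreasing_subsequence (w : nat -> nat) :
  exists2 f : nat -> nat, {homo f : i j / (i < j)%N} & {homo w \o f : i j / (i <= j)%N}.
Proof.
have minx i : exists j, (i <= j)%N /\ forall l, (i <= l)%N -> (w j <= w l)%N.
  have ex : exists x, `[< exists j, (i <= j)%N /\ w j = x >].
    by exists (w i); apply/asboolP; exists i.
  case: (ex_minnP ex) => x /asboolP[j [ij <-]] jmin; exists j; split=> // l il.
  by apply: jmin; apply/asboolP; exists l.
have [nxt nxtP] := choice minx.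
pose f := fix f s := if s is s'.+1 then nxt (f s').+1 else nxt 0%N.
have fS s : (f s < f s.+1)%N by have [] := nxtP (f s).+1.
exists f; first by apply: homo_ltn => //; exact: ltn_trans.
apply: homo_leq => //=; first by move=> ? ? ?; exact: leq_trans.
case=> [|s] /=; first by have [_] := nxtP 0%N; apply.
have [lt1 min1] := nxtP (f s).+1; apply: min1.
by have [lt2 _] := nxtP (nxt (f s).+1).+1; apply: leq_trans lt1 (ltnW lt2).
Qed.

Lemma dickson n (u : nat -> 'X_{1..n}) : exists i j, (i < j)%N /\ (u i <= u j)%MM.
Proof.
suff H m : (m <= n)%N -> exists2 f : nat -> nat, {homo f : i j / (i < j)%N} &
    forall (l : 'I_n), (l < m)%N -> {homo (fun s => u (f s) l) : i j / (i <= j)%N}.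
  have [f fi fu] := H n (leqnn n); exists (f 0%N), (f 1%N); split; first exact: fi.
  by apply/mnm_lepP => l; apply: fu.
elim: m => [_|m IH mn]; first by exists id.
have [f fi fu] := IH (ltnW mn).
have [g gi gu] := nat_nondecreasing_subsequence (fun s => u (f s) (Ordinal mn)).
exists (f \o g); first by move=> i j /gi /fi.
move=> l; rewrite ltnS leq_eqVlt => /predU1P[lm|lm] i j ij.
  have -> : l = Ordinal mn by apply: val_inj.
  exact: gu.
apply: fu => //; move: ij; rewrite leq_eqVlt => /predU1P[->//|/gi].
exact: ltnW.
Qed.

(** * Hilbert basis theorem *)

Section HilbertBasis.
Context (k : fieldType) (n : nat).
Local Notation R := {mpoly k[n]}.

Definition ideal_span (J : R -> Prop) (p : R) :=
  exists2 l : seq (R * R), (forall x, x \in l -> J x.2) & p = \sum_(x <- l) x.1 * x.2.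

Lemma ideal_span_sub (J J' : R -> Prop) p :
  (forall q, J q -> ideal_span J' q) -> ideal_span J p -> ideal_span J' p.
Proof.
move=> JJ' [l lJ ->]; elim: l lJ => [|x l IH] lJ; first by exists [::].
have [l1 l1J e1] := IH (fun y yl => lJ y (mem_behead (s := x :: l) yl)).
have [l2 l2J e2] := JJ' _ (lJ x (mem_head _ _)).
exists ([seq (x.1 * y.1, y.2) | y <- l2] ++ l1).
  by move=> y; rewrite mem_cat => /orP[/mapP[z /l2J ? ->]|/l1J].
rewrite big_cons big_cat e1 big_map e2 mulr_sumr /=.
by congr (_ + _); apply: eq_bigr => z _; rewrite mulrA.
Qed.

Lemma ideal_spanD (J : R -> Prop) p q : ideal_span J p -> ideal_span J q -> ideal_span J (p + q).
Proof.
move=> [l lJ ->] [l' lJ' ->]; exists (l ++ l'); last by rewrite big_cat.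
by move=> x; rewrite mem_cat => /orP[/lJ|/lJ'].
Qed.

Lemma ideal_spanM (J : R -> Prop) p q : J q -> ideal_span J (p * q).
Proof. move=> Jq; exists [:: (p, q)] => [x|]; last by rewrite big_cons big_nil addr0.
by rewrite mem_seq1 => /eqP ->. Qed.

Lemma ideal_spanMr (J : R -> Prop) p q : ideal_span J q -> ideal_span J (p * q).
Proof.
move=> [l lJ ->]; exists [seq (p * x.1, x.2) | x <- l].
  by move=> x /mapP[y /lJ ? ->].
by rewrite big_map mulr_sumr; apply: eq_bigr => x _; rewrite mulrA.
Qed.

(** A Groebner basis argument: otherwise elements of the ideal whose leading monomials are not
    divisible by any earlier one could be chosen forever, against Dickson's lemma. As [J] is an
    arbitrary predicate and not an ideal, the basis is finally traded for the elements of [J] that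
    occur in its members. *)
Lemma hilbert_basis (J : R -> Prop) : exists2 s : seq R, (forall q, q \in s -> J q) &
  forall p, J p -> ideal_span (fun q => q \in s) p.
Proof.
have [t tJ tP] : exists2 t : seq R, (forall q, q \in t -> ideal_span J q /\ q != 0) &
    forall p, ideal_span J p -> p != 0 -> exists2 q, q \in t & (mlead q <= mlead p)%MM.
  apply: contrapT => nt.
  pose good (t : seq R) := forall q, q \in t -> ideal_span J q /\ q != 0.
  have nxtP t : exists p, good t -> [/\ ideal_span J p, p != 0 &
      forall q, q \in t -> ~ (mlead q <= mlead p)%MM].
    have [gt|ngt] := pselect (good t); last by exists 0 => /ngt.
    apply: contrapT => np; apply: nt; exists t => // p Jp p0.
    apply: contrapT => nq; apply: np; exists p => _; split=> // q qt qp.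
    by apply: nq; exists q.
  have [nxt {}nxtP] := choice nxtP.
  pose L := fix L s := if s is s'.+1 then nxt (L s') :: L s' else [::].
  have Lgood s : good (L s).
    elim: s => // s IH q /=; rewrite inE => /predU1P[->|/IH//].
    by have [] := nxtP _ IH.
  have Lin i j : (i < j)%N -> nxt (L i) \in L j.
    elim: j => // j IH; rewrite ltnS leq_eqVlt /= inE => /predU1P[->|/IH ->].
      by rewrite eqxx.
    by rewrite orbT.
  have [i [j [ij uij]]] := dickson (fun s => mlead (nxt (L s))).
  have [_ _ /(_ _ (Lin _ _ ij))] := nxtP _ (Lgood j); exact.
have divt p : ideal_span J p -> ideal_span (fun q => q \in t) p.
  elim/mleadrect: p => p IH Jp.
  have [->|p0] := eqVneq p 0; first by exists [::]; rewrite ?big_nil.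
  have [q qt qp] := tP p Jp p0; have [Jq q0] := tJ q qt.
  pose c := mleadc p / mleadc q; pose q' := c *: 'X_[mlead p - mlead q] * q.
  have lq0 : mleadc q != 0 by rewrite mleadc_eq0.
  have c0 : c != 0 by rewrite mulf_neq0 ?invr_eq0 ?mleadc_eq0.
  have lq' : mlead q' = mlead p.
    rewrite mleadM //; last by rewrite scaler_eq0 (negbTE c0) -mleadc_eq0 mleadXm mcoeffX eqxx oner_eq0.
    by rewrite mleadZ // mleadXm submK.
  have cq' : mleadc q' = mleadc p.
    have := mleadcM (c *: 'X_[mlead p - mlead q]) q; rewrite mleadcZE.
    have -> : (mlead (c *: 'X_[k, mlead p - mlead q]) + mlead q)%MM = mlead q'.
      by rewrite mleadM // scaler_eq0 (negbTE c0) -mleadc_eq0 mleadXm mcoeffX eqxx oner_eq0.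
    by move=> ->; rewrite mleadXm mcoeffX eqxx mulr1 divfK.
  have Jq' : ideal_span J q' by apply: ideal_spanMr.
  rewrite -(subrK q' p); apply: ideal_spanD; last exact: ideal_spanM.
  have [->|r0] := eqVneq (p - q') 0; first by exists [::]; rewrite ?big_nil.
  apply: IH; last first.
    by apply: ideal_spanD => //; rewrite -mulN1r; apply: ideal_spanMr.
  rewrite lt_neqAle; apply/andP; split; last first.
    by apply: le_trans (mleadB_le _ _) _; rewrite lq' joinxx.
  apply: contraNneq r0 => E; rewrite -mleadc_eq0 E mcoeffB.
  by rewrite -{2}lq' cq' subrr.
have [s sJ sP] : exists2 s : seq R, (forall q, q \in s -> J q) &
    forall q, q \in t -> ideal_span (fun q => q \in s) q.
  elim: t {tP divt} tJ => [|q t IH] tJ; first by exists [::].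
  have [s sJ sP] := IH (fun x xt => tJ x (mem_behead (s := q :: t) xt)).
  have [[l lJ ql] _] := tJ q (mem_head _ _).
  exists ([seq x.2 | x <- l] ++ s).
    by move=> x; rewrite mem_cat => /orP[/mapP[y /lJ ? ->]|/sJ].
  move=> x; rewrite inE => /predU1P[->|/sP].
    by exists l => // y yl; rewrite mem_cat map_f.
  by move=> [l' ls' ->]; exists l' => // y /ls' ys; rewrite mem_cat ys orbT.
exists s => // p Jp; apply: (ideal_span_sub sP); apply: divt.
by rewrite -[p]mul1r; apply: ideal_spanM.
Qed.

Lemma ideal_span_root (J : R -> Prop) p v : ideal_span J p ->
  (forall q, J q -> q.@[v] = 0) -> p.@[v] = 0.
Proof.
move=> [l lJ ->] Jv; rewrite rmorph_sum big_seq big1 // => x xl.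
by rewrite /= mevalM (Jv _ (lJ x xl)) mulr0.
Qed.

End HilbertBasis.

Lemma leq_expl m a b : (a <= b)%N -> (a ^ m <= b ^ m)%N.
Proof. by move=> ab; elim: m => // m IH; rewrite !expnS leq_mul. Qed.

(** * Algebraic dependence *)

Section AlgebraicDependence.
Context (k : fieldType) (I : Type) (U : set_system I) (UU : UltraFilter U).
Implicit Types (f g y : I -> k).

Definition monom (J : finType) (L : J -> I -> k) (a : J -> nat) : I -> k :=
  fun i => \prod_j L j i ^+ a j.

(** Polynomials in [L] with all exponents at most [D], up to equality almost everywhere. The
    inductive form avoids naming the polynomial, so that linear statements are checked on monomials
    only. *)
Inductive pol (J : finType) (L : J -> I -> k) (D : nat) : (I -> k) -> Prop :=
| pol_monom a f : (forall j, (a j <= D)%N) -> U [set i | f i = monom L a i] -> pol L D f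
| pol_add f g h : pol L D f -> pol L D g -> U [set i | h i = f i + g i] -> pol L D h
| pol_scale c f h : pol L D f -> U [set i | h i = c * f i] -> pol L D h.

Section Pol.
Context (J : finType) (L : J -> I -> k).

Lemma monomD a b i : monom L (fun j => a j + b j)%N i = monom L a i * monom L b i.
Proof. by rewrite -big_split; apply: eq_bigr => j _; rewrite exprD. Qed.

Lemma pol_ae D f g : pol L D f -> U [set i | g i = f i] -> pol L D g.
Proof.
by move=> pf gf; apply: (pol_scale (c := 1) pf); apply: filterS gf => i /= ->; rewrite mul1r.
Qed.

Lemma pol_le D D' f : (D <= D')%N -> pol L D f -> pol L D' f.
Proof.
move=> DD'; elim=> {f} [a f aD fa|f g h _ pf _ pg hfg|c f h _ pf hf].
- by apply: pol_monom fa => j; apply: leq_trans (aD j) DD'.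
- exact: pol_add pf pg hfg.
- exact: pol_scale pf hf.
Qed.

Lemma pol1 D : pol L D (fun=> 1).
Proof.
apply: (@pol_monom _ _ _ (fun=> 0%N)) => //; apply: filterE => i /=.
by rewrite /monom big1.
Qed.

Lemma pol_cst D c : pol L D (fun=> c).
Proof. by apply: (pol_scale (c := c) (pol1 D)); apply: filterE => i /=; rewrite mulr1. Qed.

Lemma pol_var D j : (0 < D)%N -> pol L D (L j).
Proof.
move=> D0; apply: (@pol_monom _ _ _ (fun j' => j' == j)) => [j'|].
  exact: leq_trans (leq_b1 _) D0.
apply: filterE => i /=; rewrite /monom (bigD1 j) //= eqxx expr1 big1 ?mulr1// => j' /negbTE ->.
by rewrite expr0.
Qed.

Lemma polD D f g : pol L D f -> pol L D g -> pol L D (fun i => f i + g i).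
Proof. by move=> pf pg; apply: pol_add pf pg _; apply: filterE. Qed.

Lemma polZ D c f : pol L D f -> pol L D (fun i => c * f i).
Proof. by move=> pf; apply: pol_scale pf _; apply: filterE. Qed.

Lemma polM D D' f g : pol L D f -> pol L D' g -> pol L (D + D') (fun i => f i * g i).
Proof.
elim=> {f} [a f aD fa|f1 f2 h _ IH1 _ IH2 hf|c f h _ IH hf] pg.
- elim: pg => {g} [b g bD gb|g1 g2 h _ IH1 _ IH2 hg|c g h _ IH hg].
  + apply: (@pol_monom _ _ _ (fun j => a j + b j)%N) => [j|]; first exact: leq_add.
    by apply: filterS2 fa gb => i /= -> ->; rewrite monomD.
  + by apply: pol_add IH1 IH2 _; apply: filterS hg => i /= ->; rewrite mulrDr.
  + by apply: (pol_scale (c := c) IH); apply: filterS hg => i /= ->; rewrite mulrCA.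
- by apply: pol_add (IH1 pg) (IH2 pg) _; apply: filterS hf => i /= ->; rewrite mulrDl.
- by apply: (pol_scale (c := c) (IH pg)); apply: filterS hf => i /= ->; rewrite mulrA.
Qed.

Lemma polX D f n : pol L D f -> pol L (D * n) (fun i => f i ^+ n).
Proof.
move=> pf; elim: n => [|n IH]; first by rewrite muln0; apply: (pol_ae (pol1 _)); apply: filterE.
by rewrite mulnS; apply: (pol_ae (polM pf IH)); apply: filterE => i /=; rewrite exprS.
Qed.

End Pol.

Definition in_span (T : finType) (W : T -> I -> k) f :=
  exists c : T -> k, U [set i | f i = \sum_j c j * W j i].

Lemma in_spanD (T : finType) (W : T -> I -> k) f g h : in_span W f -> in_span W g ->
  U [set i | h i = f i + g i] -> in_span W h.
Proof.
move=> [c fc] [d gd] hfg; exists (fun j => c j + d j).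
apply: filterS3 fc gd hfg => i /= -> -> ->; rewrite -big_split.
by apply: eq_bigr => j _; rewrite mulrDl.
Qed.

Lemma in_spanZ (T : finType) (W : T -> I -> k) c f h : in_span W f ->
  U [set i | h i = c * f i] -> in_span W h.
Proof.
move=> [d fd] hf; exists (fun j => c * d j).
by apply: filterS2 fd hf => i /= -> ->; rewrite mulr_sumr; apply: eq_bigr => j _; rewrite mulrA.
Qed.

(* The algebra generated by [L] has growth of degree at most [m]; the        *)
(* multiplier [w] accounts for denominators.                                 *)
Definition grow m (J : finType) (L : J -> I -> k) := exists c, forall D,
  exists (T : finType) (W : T -> I -> k) (w : I -> k), [/\ (#|T| <= c * D.+1 ^ m)%N, U [set i | w i != 0] &
    forall f, pol L D f -> in_span W (fun i => w i * f i)].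

Lemma pol_in_span (T : finType) (W : T -> I -> k) w (J : finType) (L : J -> I -> k) D :
  (forall a, (forall j, (a j <= D)%N) -> in_span W (fun i => w i * monom L a i)) ->
  forall f, pol L D f -> in_span W (fun i => w i * f i).
Proof.
move=> H f; elim=> {f} [a f aD fa|f g h _ pf _ pg hfg|c f h _ pf hf].
- by apply: (in_spanZ (c := 1) (H a aD)); apply: filterS fa => i /= ->; rewrite mul1r.
- by apply: in_spanD pf pg _; apply: filterS hfg => i /= ->; rewrite mulrDr.
- by apply: (in_spanZ (c := c) pf); apply: filterS hf => i /= ->; rewrite mulrCA.
Qed.

Lemma grow_card (J : finType) (L : J -> I -> k) : grow #|J| L.
Proof.
exists 1%N => D; pose T := {ffun J -> 'I_D.+1}.
exists T, (fun t : T => monom L (fun j => t j)), (fun=> 1); split.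
- by rewrite card_ffun card_ord mul1n.
- by apply: filterE => i; apply: oner_neq0.
- apply: pol_in_span => a aD; pose t : T := [ffun j => inord (a j)].
  exists (fun s => (s == t)%:R); apply: filterE => i /=.
  rewrite mul1r (bigD1 t) //= eqxx mul1r big1 ?addr0 => [|s /negbTE ->]; last by rewrite mul0r.
  by apply: eq_bigr => j _; rewrite ffunE inordK // ltnS.
Qed.

Lemma grow_sub m (J J' : finType) (L : J -> I -> k) (io : J' -> J) : grow m L -> grow m (L \o io).
Proof.
move=> [c cP]; exists (c * #|J'|.+1 ^ m)%N => D.
have [M [W [w [Mc w0 wP]]]] := cP (#|J'| * D)%N; exists M, W, w; split=> //.
  apply: leq_trans Mc _; rewrite -mulnA leq_mul2l -expnMn leq_expl ?orbT//.
  by rewrite mulSn -addn1 addnC leq_add // mulnS leq_addl.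
apply: pol_in_span => a aD; apply: wP.
apply: (@pol_monom _ _ _ (fun j => \sum_(j' | io j' == j) a j')%N) => [j|].
  apply: leq_trans (_ : (\sum_(j' : J') D)%N <= _)%N; last by rewrite sum_nat_const.
  by rewrite big_mkcond; apply: leq_sum => j' _; case: ifP.
apply: filterE => i /=; rewrite /monom (partition_big io xpredT) //=.
apply: eq_bigr => j _; elim/big_rec2: _ => [|j' x y /eqP <- ->]; first by rewrite expr0.
by rewrite exprD.
Qed.

Definition algebraic_over (J : finType) (L : J -> I -> k) y := exists e b (Q : nat -> I -> k),
  [/\ forall j, pol L b (Q j), U [set i | Q e i != 0]
    & U [set i | \sum_(j < e.+1) Q j i * y i ^+ j = 0]].

Definition adjoin (J : finType) (L : J -> I -> k) y : option J -> I -> k :=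
  fun o => if o is Some j then L j else y.

(** Powers of [y] are reduced by its equation to bounded exponents. Each reduction costs one factor
    [Q e], which the multiplier absorbs, and the exponents in [L] grow only linearly with [D], so
    the degree of growth is unchanged. *)
Lemma grow_adjoin m (J : finType) (L : J -> I -> k) y : grow m L -> algebraic_over L y ->
  grow m (adjoin L y).
Proof.
move=> [c cP] [e [b [Q [pQ Qe Qy]]]].
case: e Qe Qy => [|e] Qe Qy.
  suff : U [set i | False] by move=> F; case: (@filter_not_empty _ U _); apply: filterS F.
  by apply: filterS2 Qe Qy => i /= /eqP Q0; rewrite big_ord_recl big_ord0 expr0 mulr1 addr0.
have red s : exists R : nat -> I -> k, (forall j, pol L (b * s) (R j)) /\
    U [set i | Q e.+1 i ^+ s * y i ^+ s = \sum_(j < e.+1) R j i * y i ^+ j].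
  elim: s => [|s [R [pR RE]]].
    exists (fun j i => (j == 0)%:R); split=> [j|]; first exact: pol_cst.
    apply: filterE => i /=; rewrite !expr0 mulr1 big_ord_recl /= expr0 mulr1.
    by rewrite big1 ?addr0 // => j _; rewrite mul0r.
  exists (fun j i => (if j is j'.+1 then Q e.+1 i * R j' i else 0) - R e i * Q j i); split.
    move=> j; rewrite mulnS; apply: polD.
      by case: j => [|j]; [exact: pol_cst|exact: polM].
    apply: (@pol_ae _ _ _ (fun i => -1 * (R e i * Q j i))); last first.
      by apply: filterE => i /=; rewrite mulN1r.
    by apply: polZ; rewrite addnC; apply: polM.
  apply: filterS2 RE Qy => i /= RE; rewrite big_ord_recr /= => /eqP.
  rewrite addrC addr_eq0 => /eqP Qy.
  rewrite !exprS mulrACA RE.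
  under [RHS]eq_bigr do rewrite mulrBl.
  rewrite sumrB [X in _ = X - _]big_ord_recl mul0r add0r.
  rewrite big_ord_recr /= mulrDr; congr (_ + _).
    by rewrite mulr_sumr; apply: eq_bigr => j _; rewrite exprS mulrACA.
  have -> : Q e.+1 i * y i * (R e i * y i ^+ e) = R e i * (Q e.+1 i * y i ^+ e.+1).
    by rewrite exprS; ring.
  rewrite Qy mulrN mulr_sumr; congr (- _); apply: eq_bigr => j _.
  by rewrite mulrA.
exists (e.+1 * (c * b.+1 ^ m))%N => D.
have [M [W [w [Mc w0 wP]]]] := cP (b.+1 * D)%N.
pose W' (t : 'I_e.+1 * M) i := W t.2 i * y i ^+ t.1.
exists ('I_e.+1 * M)%type, W', (fun i => w i * Q e.+1 i ^+ D); split.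
- rewrite card_prod card_ord -mulnA leq_mul2l /= -mulnA; apply: leq_trans Mc _.
  rewrite leq_mul2l -expnMn leq_expl ?orbT//.
  by rewrite mulnS addnC -addn1 leq_add // addnC -mulSn mulnC.
- by apply: filterS2 w0 Qe => i /= wi Qi; rewrite mulf_neq0 // expf_neq0.
apply: pol_in_span => a aD.
have [R [pR RE]] := red (a None).
pose G j i := monom L (fun j => a (Some j)) i * (Q e.+1 i ^+ (D - a None) * R j i).
have GP j : in_span W (fun i => w i * G j i).
  apply: wP; apply: (@pol_le _ _ (D + (b * (D - a None) + b * a None))).
    by rewrite -mulnDr subnK ?aD// mulSn.
  apply: polM; first by apply: (@pol_monom _ _ _ (fun j => a (Some j))) => //; apply: filterE.
  by apply: polM => //; apply: polX.
have [C CE] := choice GP; exists (fun t : 'I_e.+1 * M => C t.1 t.2).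
have CU : U [set i | forall j : 'I_e.+1, w i * G j i = \sum_t C j t * W t i].
  elim: e.+1 => [|n IH]; first by apply: filterE => i [].
  apply: filterS2 IH (CE n) => i /= H1 H2 j.
  have [jn|] := ltnP j n; first exact: (H1 (Ordinal jn)).
  by move=> nj; have -> : j = n :> nat by apply/eqP; rewrite eqn_leq nj -ltnS ltn_ord.
apply: filterS2 RE CU => i /= RE CU.
rewrite -(pair_bigA _ (fun (j : 'I_e.+1) t => C j t * (W t i * y i ^+ j))) /=.
have -> : monom (adjoin L y) a i = y i ^+ a None * monom L (fun j => a (Some j)) i.
  rewrite /monom (bigD1 None) //=; congr (_ * _).
  rewrite (reindex_omap Some id) /=; last by case.
  by apply: eq_bigl => j; rewrite eqxx.
transitivity (\sum_(j < e.+1) (w i * G j i) * y i ^+ j); last first.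
  by apply: eq_bigr => j _; rewrite CU mulr_suml; apply: eq_bigr => t _; rewrite mulrA.
rewrite /G.
transitivity (w i * (monom L (fun j => a (Some j)) i * (Q e.+1 i ^+ (D - a None) *
  (Q e.+1 i ^+ a None * y i ^+ a None)))).
  by rewrite -[in LHS](subnK (aD None)) exprD; ring.
rewrite RE !mulr_sumr; apply: eq_bigr => j _.
by rewrite !mulrA.
Qed.

Definition alg_independent r (Y : 'I_r -> I -> k) :=
  forall p : {mpoly k[r]}, U [set i | p.@[fun j => Y j i] = 0] -> p = 0.

(** With exponents at most [c] there are [c.+1 ^ r] monomials in a space of dimension at most
    [c * c.+1 ^ m]. For m < r these are too many, and a linear relation among monomials is a
    polynomial relation. *)
Lemma grow_dependent m r (Y : 'I_r -> I -> k) : grow m Y -> (m < r)%N -> ~ alg_independent Y.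
Proof.
move=> [c cP] mr Yi; have [T [W [w [Tc w0 wP]]]] := cP c.
pose A : finType := {ffun 'I_r -> 'I_c.+1}.
have AT : (#|T| < #|A|)%N.
  rewrite card_ffun !card_ord; apply: leq_trans (leq_pexp2l _ mr) => //.
  by rewrite expnS; apply: leq_ltn_trans Tc _; rewrite ltn_mul2r ltnSn expn_gt0.
have pA (a : A) : in_span W (fun i => w i * monom Y (fun j => a j) i).
  apply: wP; apply: (@pol_monom _ _ _ (fun j => a j)) => [j|]; last exact: filterE.
  by rewrite -ltnS.
have [C CE] := choice pA.
pose B : 'M[k]_(#|A|, #|T|) := \matrix_(a, t) C (enum_val a : A) (enum_val t).
have kB : kermx B != 0.
  rewrite kermx_eq0 /row_free; apply: contraTN AT => /eqP <-.
  by rewrite -leqNgt rank_leq_col.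
have [v vB v0] : exists2 v : 'rV_(#|A|), v *m B = 0 & v != 0.
  by have /rowV0Pn[v /sub_kermxP vB v0] := kB; exists v.
pose p : {mpoly k[r]} := \sum_(a : 'I_#|A|) v 0 a *: 'X_[[multinom ((enum_val a : A) j : nat) | j < r]].
have pE a : p@_[multinom ((enum_val a : A) j : nat) | j < r] = v 0 a.
  rewrite raddf_sum (bigD1 a) //= mcoeffZ mcoeffX eqxx mulr1 big1 ?addr0// => b ba.
  rewrite mcoeffZ mcoeffX; case: eqP => [/mnmP E|]; last by rewrite mulr0.
  case/eqP: ba; apply: enum_val_inj; apply/ffunP => j; apply: val_inj.
  by have := E j; rewrite !mnmE.
have p0 : p = 0.
  apply: Yi; have : U [set i | forall a : A, w i * monom Y (fun j => a j) i = \sum_t C a t * W t i].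
    have : U [set i | forall a, a \in enum A -> w i * monom Y (fun j => a j) i = \sum_t C a t * W t i].
      elim: (enum A) => [|a s IH]; first by apply: filterE.
      apply: filterS2 (CE a) IH => i /= Ca Cs b; rewrite inE => /predU1P[->//|]; exact: Cs.
    by apply: filterS => i /= H a; apply: H; rewrite mem_enum.
  move=> CU; apply: filterS2 w0 CU => i /= wi H.
  apply: (mulfI wi); rewrite mulr0 rmorph_sum mulr_sumr /=.
  transitivity (\sum_(t : T) (\sum_(a < #|A|) v 0 a * C (enum_val a : A) t) * W t i).
    under [RHS]eq_bigr do rewrite mulr_suml.
    rewrite exchange_big; apply: eq_bigr => a _ /=.
    rewrite mevalZ mevalX mulrCA; have := H (enum_val a); rewrite /monom => E.
    have -> : \prod_(i0 < r) Y i0 i ^+ [multinom ((enum_val a : A) j : nat) | j < r] i0 =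
        \prod_(j < r) Y j i ^+ (enum_val a : A) j by apply: eq_bigr => j _; rewrite mnmE.
    by rewrite E mulr_sumr; apply: eq_bigr => t _; rewrite mulrA.
  rewrite big1 // => t _; have /rowP/(_ (enum_rank t)) := vB.
  rewrite !mxE => E; rewrite -[RHS](mul0r (W t i)) -[X in _ = X * _]E; congr (_ * _).
  by apply: eq_bigr => a _; rewrite !mxE enum_rankK.
by case/rV0Pn: v0 => a /eqP; apply; rewrite -pE p0 mcoeff0.
Qed.

(** Algebraic closure inside the functions modulo [U]. Transitivity is built into the definition,
    and the bound on the transcendence degree comes from growth instead of an exchange argument. *)
Inductive acl r (L0 : 'I_r -> I -> k) : (I -> k) -> Prop :=
| acl_base j : acl L0 (L0 j)
| acl_alg (J : finType) (M : J -> I -> k) y :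
    (forall j, acl L0 (M j)) -> algebraic_over M y -> acl L0 y.

Lemma pol_reindex (J J' : finType) (L : J -> I -> k) (io : J' -> J) b f :
  pol (L \o io) b f -> pol L (#|J'| * b) f.
Proof.
elim=> {f} [a f aD fa|f g h _ pf _ pg hfg|c f h _ pf hf].
- apply: (@pol_monom _ _ _ (fun j => \sum_(j' | io j' == j) a j')%N) => [j|].
    apply: leq_trans (_ : (\sum_(j' : J') b)%N <= _)%N; last by rewrite sum_nat_const.
    by rewrite big_mkcond; apply: leq_sum => j' _; case: ifP.
  apply: filterS fa => i /= ->; rewrite /monom (partition_big io xpredT) //=.
  apply: eq_bigr => j _; elim/big_rec2: _ => [|j' x y /eqP <- ->]; first by rewrite expr0.
  by rewrite exprD.
- exact: pol_add pf pg hfg.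
- exact: pol_scale pf hf.
Qed.

Section Acl.
Context (r : nat) (L0 : 'I_r -> I -> k).

Lemma acl_grow y : acl L0 y -> forall m (J : finType) (L : J -> I -> k) (io : 'I_r -> J),
  grow m L -> L \o io = L0 -> exists (J' : finType) (L' : J' -> I -> k) (e : J -> J') j,
    [/\ grow m L', L' \o e = L & L' j = y].
Proof.
elim=> {y} [j|J0 M y _ IH alg] m J L io gL Lio.
  by exists J, L, id, (io j); split=> //; rewrite -Lio.
have [J' [L' [e [f [gL' L'e L'f]]]]] : exists (J' : finType) (L' : J' -> I -> k) (e : J -> J')
    (f : J0 -> J'), [/\ grow m L', L' \o e = L & L' \o f = M].
  suff [J' [L' [e [gL' L'e H]]]] : exists (J' : finType) (L' : J' -> I -> k) (e : J -> J'),
      [/\ grow m L', L' \o e = L & forall j, j \in enum J0 -> exists j', L' j' = M j].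
    have [f fP] := choice (fun j => H j (mem_enum J0 j)).
    by exists J', L', e, f; split=> //; apply/funext.
  elim: (enum J0) => [|j s [J1 [L1 [e1 [g1 E1 H1]]]]]; first by exists J, L, id.
  have [|J2 [L2 [e2 [j2 [g2 E2 H2]]]]] := IH j m J1 L1 (e1 \o io) g1.
    by rewrite -Lio -E1.
  exists J2, L2, (e2 \o e1); split=> //; first by rewrite -E1 -E2.
  move=> j'; rewrite inE => /predU1P[->|/H1[j1 <-]]; first by exists j2.
  by exists (e2 j1); rewrite -E2.
exists (option J'), (adjoin L' y), (Some \o e), None; split=> //.
apply: grow_adjoin => //; have [e0 [b [Q [pQ Qe Qy]]]] := alg.
exists e0, (#|J0| * b)%N, Q; split=> // j; apply: (@pol_reindex _ _ _ f).
by rewrite L'f.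
Qed.

Lemma acl_dependent s (Y : 'I_s -> I -> k) : (r < s)%N -> (forall j, acl L0 (Y j)) ->
  ~ alg_independent Y.
Proof.
move=> rs aY.
suff [J' [L' [f [gL' L'f]]]] : exists (J' : finType) (L' : J' -> I -> k) (f : 'I_s -> J'),
    grow r L' /\ L' \o f = Y.
  apply: grow_dependent rs; rewrite -L'f; exact: grow_sub.
suff [J' [L' [io [gL' L'e H]]]] : exists (J' : finType) (L' : J' -> I -> k) (io : 'I_r -> J'),
    [/\ grow r L', L' \o io = L0 & forall j, j \in enum 'I_s -> exists j', L' j' = Y j].
  have [f fP] := choice (fun j => H j (mem_enum 'I_s j)).
  by exists J', L', f; split=> //; apply/funext.
elim: (enum 'I_s) => [|j t [J1 [L1 [io [g1 E1 H1]]]]].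
  by exists 'I_r, L0, id; split=> //; rewrite -[r in grow r](card_ord r); apply: grow_card.
have [J2 [L2 [e2 [j2 [g2 E2 H2]]]]] := acl_grow (aY j) g1 E1.
exists J2, L2, (e2 \o io); split=> //; first by rewrite -E1 -E2.
move=> j'; rewrite inE => /predU1P[->|/H1[j1 <-]]; first by exists j2.
by exists (e2 j1); rewrite -E2.
Qed.

Lemma acl_pol (J : finType) (M : J -> I -> k) b f : (forall j, acl L0 (M j)) -> pol M b f -> acl L0 f.
Proof.
move=> aM pf; apply: (acl_alg aM).
exists 1%N, b, (fun j => if j == 0%N then (fun i => -1 * f i) else fun=> 1); split.
- by case=> [|j] /=; [exact: polZ|exact: pol1].
- by apply: filterE => i /=; apply: oner_neq0.
- by apply: filterE => i /=; rewrite !big_ord_recl big_ord0 /=; ring.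
Qed.

Lemma acl_ae f g : U [set i | g i = f i] -> acl L0 f -> acl L0 g.
Proof.
move=> gf af; apply: (@acl_pol unit (fun=> f) 1) => //.
by apply: (@pol_ae _ _ _ f) => //; apply: (@pol_var _ (fun=> f) 1 tt).
Qed.

Lemma acl_cst c : acl L0 (fun=> c).
Proof. by apply: (@acl_pol void (fun=> fun=> 0) 0) => [[]|]; apply: pol_cst. Qed.

Lemma aclD f g : acl L0 f -> acl L0 g -> acl L0 (fun i => f i + g i).
Proof.
move=> af ag; apply: (@acl_pol bool (fun b => if b then f else g) 1) => [[]//|].
by apply: polD; [apply: (@pol_var _ _ 1 true)|apply: (@pol_var _ _ 1 false)].
Qed.

Lemma aclM f g : acl L0 f -> acl L0 g -> acl L0 (fun i => f i * g i).
Proof.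
move=> af ag; apply: (@acl_pol bool (fun b => if b then f else g) 2) => [[]//|].
by apply: (@polM _ _ 1 1); [apply: (@pol_var _ _ 1 true)|apply: (@pol_var _ _ 1 false)].
Qed.

Lemma acl_sum (T : Type) (t : seq T) (Q : pred T) F : (forall j, Q j -> acl L0 (F j)) ->
  acl L0 (fun i => \sum_(j <- t | Q j) F j i).
Proof.
move=> PF; elim: t => [|j t IH].
  by apply: (acl_ae _ (acl_cst 0)); apply: filterE => i; rewrite /= big_nil.
have [Qt|Qt] := boolP (Q j).
  by apply: (acl_ae _ (aclD (PF j Qt) IH)); apply: filterE => i; rewrite /= big_cons Qt.
by apply: (acl_ae _ IH); apply: filterE => i; rewrite /= big_cons (negbTE Qt).
Qed.

Lemma acl_prod (T : Type) (t : seq T) (Q : pred T) F : (forall j, Q j -> acl L0 (F j)) ->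
  acl L0 (fun i => \prod_(j <- t | Q j) F j i).
Proof.
move=> PF; elim: t => [|j t IH].
  by apply: (acl_ae _ (acl_cst 1)); apply: filterE => i; rewrite /= big_nil.
have [Qt|Qt] := boolP (Q j).
  by apply: (acl_ae _ (aclM (PF j Qt) IH)); apply: filterE => i; rewrite /= big_cons Qt.
by apply: (acl_ae _ IH); apply: filterE => i; rewrite /= big_cons (negbTE Qt).
Qed.

Lemma aclX f n : acl L0 f -> acl L0 (fun i => f i ^+ n).
Proof.
move=> af; elim: n => [|n IH]; first exact: acl_cst.
by apply: (acl_ae _ (aclM af IH)); apply: filterE => i /=; rewrite exprS.
Qed.

Lemma acl_root e (Q : nat -> I -> k) y : (forall j, acl L0 (Q j)) -> U [set i | Q e i != 0] ->
  U [set i | \sum_(j < e.+1) Q j i * y i ^+ j = 0] -> acl L0 y.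
Proof.
move=> aQ Qe Qy; apply: (@acl_alg _ _ 'I_e.+1 (fun j => Q j)) => //.
exists e, 1%N, (fun j => if (j < e.+1)%N then Q j else fun=> 0); split.
- move=> j; case: ltnP => [je|_]; last exact: pol_cst.
  exact: (@pol_var _ (fun j : 'I_e.+1 => Q j) 1 (Ordinal je)).
- by rewrite ltnSn.
- by apply: filterS Qy => i /= Qi; rewrite -[RHS]Qi; apply: eq_bigr => j _; rewrite ltn_ord.
Qed.

Lemma aclV f : acl L0 f -> acl L0 (fun i => (f i)^-1).
Proof.
move=> af; have [f0|f0] := in_ultra_setVsetC [set i | f i = 0] UU.
  by apply: (acl_ae _ (acl_cst 0)); apply: filterS f0 => i /= ->; rewrite invr0.
have {}f0 : U [set i | f i != 0] by apply: filterS f0 => i /= /eqP.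
apply: (@acl_root 1 (fun j => if j == 0%N then fun=> -1 else f)) => [[|j] /=||]//.
  exact: acl_cst.
by apply: filterS f0 => i /= fi; rewrite !big_ord_recl big_ord0 /= expr0 expr1 mulfV //; ring.
Qed.

Lemma acl_meval n (p : {mpoly k[n]}) (x : 'I_n -> I -> k) : (forall j, acl L0 (x j)) ->
  acl L0 (fun i => p.@[fun j => x j i]).
Proof.
move=> ax; under eq_fun do rewrite mevalE.
apply: acl_sum => m _; apply: aclM; first exact: acl_cst.
by apply: acl_prod => j _; apply: aclX.
Qed.

End Acl.

End AlgebraicDependence.

Lemma muni_eval (k : fieldType) n (p : {mpoly k[n.+1]}) (v : 'I_n.+1 -> k) D :
  (size (muni p) <= D)%N ->
  p.@[v] = \sum_(j < D) ((muni p)`_j).@[fun l => v (widen_ord (leqnSn n) l)] * v ord_max ^+ j.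
Proof.
move=> pD; pose e : {mpoly k[n]} -> k := meval (fun l => v (widen_ord (leqnSn n) l)).
transitivity (map_poly e (muni p)).[v ord_max]; last first.
  by rewrite (horner_coef_wide _ (leq_trans (size_poly _ _) pD)); apply: eq_bigr => j _; rewrite coef_map.
rewrite mevalE muniE rmorph_sum horner_sum /=; apply: eq_bigr => m _.
rewrite map_polyZ map_polyXn hornerZ hornerXn /= /e mevalZ mevalX big_ord_recr /= -mulrA.
by congr (_ * (_ * _)); apply: eq_bigr => l _; rewrite mnmE.
Qed.

(** By the Hilbert basis theorem some index [i0] satisfies all relations that hold for [x] almost
    everywhere. Sending [x] to its value at [i0] and [y^-1] to 0 respects every relation between
    them: all its coefficients vanish almost everywhere, since otherwise [y] would be algebraic over
    [x]. *)
Lemma transcendental_place (k : closedFieldType) (I : Type) (U : set_system I) (UU : UltraFilter U)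
    m (x : 'I_m -> I -> k) (y : I -> k) : ~ acl U x y ->
  exists P : place k I, [/\ ae P = U, forall j, finite_at P (x j) & ~ finite_at P y].
Proof.
move=> nalg; have [s sJ sP] := hilbert_basis (fun p : {mpoly k[m]} => U [set i | p.@[fun j => x j i] = 0]).
have [i0 i0P] : exists i0, forall p : {mpoly k[m]}, U [set i | p.@[fun j => x j i] = 0] ->
    p.@[fun j => x j i0] = 0.
  have : U [set i | forall q, q \in s -> q.@[fun j => x j i] = 0].
    elim: s sJ {sP} => [|q s IH] sJ; first by apply: filterE.
    apply: filterS2 (sJ q (mem_head _ _)) (IH (fun q' q's => sJ q' (mem_behead (s := q :: s) q's))).
    by move=> i /= qi si q'; rewrite inE => /predU1P[->//|/si].
  move=> /filter_ex[i0 i0s]; exists i0 => p /sP pJ.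
  exact: ideal_span_root pJ i0s.
have y0 : U [set i | y i != 0].
  have [z|z] := in_ultra_setVsetC [set i | y i = 0] UU.
    by case: nalg; apply: (acl_ae UU _ (acl_cst UU x 0)); apply: filterS z => i /= ->.
  by apply: filterS z => i /= /eqP.
pose x' (j : 'I_m.+1) i := if unlift ord_max j is Some l then x l i else (y i)^-1.
pose c' (j : 'I_m.+1) := if unlift ord_max j is Some l then x l i0 else 0.
have x'E l : x' (widen_ord (leqnSn m) l) = x l.
  have -> : widen_ord (leqnSn m) l = lift ord_max l by apply: val_inj; rewrite /= /bump leqNgt ltn_ord.
  by rewrite /x' liftK.
have c'E l : c' (widen_ord (leqnSn m) l) = x l i0.
  have -> : widen_ord (leqnSn m) l = lift ord_max l by apply: val_inj; rewrite /= /bump leqNgt ltn_ord.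
  by rewrite /c' liftK.
have [p pU|P [aP tP]] := @exists_place_vals k I U UU m.+1 x' c'.
  rewrite (muni_eval c' (leqnn _)).
  have -> : \sum_(j < size (muni p)) ((muni p)`_j).@[fun l => c' (widen_ord (leqnSn m) l)] *
      c' ord_max ^+ j = ((muni p)`_0).@[fun l => x l i0].
    case E : (size (muni p)) => [|D].
      by rewrite big_ord0 nth_default ?meval0// E.
    rewrite big_ord_recl expr0 mulr1 big1 => [|j _].
      by rewrite addr0; apply: meval_eq => l; rewrite c'E.
    by rewrite /c' unlift_none exprS mul0r mulr0.
  apply: i0P; pose Q j i := ((muni p)`_j).@[fun l => x l i].
  suff : forall j, U [set i | Q j i = 0] by move/(_ 0%N).
  apply: contrapT => /existsNP nQ.
  have exQ : exists j, `[< U [set i | Q j i != 0] >] && (j < size (muni p))%N.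
    have [j nQj] := nQ; exists j; apply/andP; split.
      apply/asboolP; have [//|z] := in_ultra_setVsetC [set i | Q j i = 0] UU.
      by apply: filterS z => i /= /eqP.
    rewrite ltnNge; apply/negP => sj; apply: nQj; apply: filterE => i.
    by rewrite /= /Q nth_default ?meval0.
  have exQU j : `[< U [set i | Q j i != 0] >] && (j < size (muni p))%N -> (j <= size (muni p))%N.
    by move=> /andP[_ /ltnW].
  case: (ex_minnP exQ) => e /andP[/asboolP Qe es] emin.
  have Qlt j : (j < e)%N -> U [set i | Q j i = 0].
    move=> je; have [//|z] := in_ultra_setVsetC [set i | Q j i = 0] UU.
    have : (e <= j)%N; last by rewrite leqNgt je.
    apply: emin; rewrite (ltn_trans je es) andbT; apply/asboolP.
    by apply: filterS z => i /= /eqP.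
  have QltU : U [set i | forall j, (j < e)%N -> Q j i = 0].
    elim: e Qlt {Qe es emin} => [|e IH] Qlt; first by apply: filterE.
    apply: filterS2 (Qlt e (ltnSn e)) (IH (fun j je => Qlt j (ltnW je))) => i /= Qe Qi j.
    by rewrite ltnS leq_eqVlt => /predU1P[->//|/Qi].
  pose D := (size (muni p)).-1.
  have De : (e <= D)%N by rewrite /D -ltnS prednK // (leq_ltn_trans _ es).
  (* Multiplied by [y ^+ D], the relation in [y^-1] becomes one in [y] of degree [D - e], with
     leading coefficient [Q e]. *)
  apply: nalg; apply: (@acl_root _ _ _ _ _ x (D - e) (fun j => Q (D - j)%N)).
  - by move=> j; apply: acl_meval => l; apply: acl_base.
  - by rewrite subKn.
  - apply: filterS3 pU y0 QltU => i /= pi yi Qi.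
    have E0 : p.@[fun j => x' j i] = \sum_(j < D.+1) Q j i * (y i)^-1 ^+ j.
      rewrite (muni_eval _ (leqSpred _)); apply: eq_bigr => j _; congr (_ * _).
        by apply: meval_eq => l; rewrite x'E.
      by rewrite /x' unlift_none.
    move: pi; rewrite E0 => /(congr1 (fun z => z * y i ^+ D)); rewrite mul0r mulr_suml => E.
    rewrite -[RHS]E [RHS](reindex_inj rev_ord_inj) /=.
    rewrite (big_ord_widen D.+1 (fun j => Q (D - j)%N i * y i ^+ j)) ?ltnS ?leq_subr//.
    rewrite big_mkcond; apply: eq_bigr => j _; have jD : (j <= D)%N by rewrite -ltnS.
    rewrite subSS ltnS; case: leqP => [je|je]; last first.
      by rewrite Qi ?mul0r// ltn_subCl // ltnW.
    rewrite -mulrA; congr (_ * _); rewrite exprVn mulrC -expfB_cond.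
      by rewrite subKn.
    by rewrite (negbTE yi) add0n leq_subr.
exists P; split=> // [j|[b yb]]; first by exists (c' (widen_ord (leqnSn m) j)); rewrite -x'E.
have := tP ord_max; rewrite /c' unlift_none => T0.
have T : tends P (fun i => (y i)^-1) 0.
  by apply: tends_ext T0 => i; rewrite /x' unlift_none.
have := tendsM yb T; rewrite mulr0 => T00.
have T1 : tends P (fun i => y i * (y i)^-1) 1.
  by apply: tends_ae (tends_cst P 1); rewrite aP; apply: filterS y0 => i /= yi; rewrite mulfV.
by have /eqP := tends_uniq T00 T1; rewrite eq_sym oner_eq0.
Qed.

(** * Binary forms *)

Section Forms.
Context (k : closedFieldType).
Local Notation pt := (k * k)%type.
Implicit Types (p q : {poly k}) (r s x : pt) (c : k).

(** A pair is a vector of [k^2], and a point of P^1 when it is nonzero. [br] is the determinant,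
    [lin r] the linear form with zero [r], [frm] the substitution of a frame [(r, s)] for the
    coordinates, and [lab r s x] the coordinates of [x] in a frame of determinant 1. *)
Definition br r s : k := r.1 * s.2 - r.2 * s.1.
Definition lin r : {poly k} := r.1 *: 'X - r.2%:P.
(* A binary form of degree [d] is represented by its dehomogenization at     *)
(* [x.1 = 1], a polynomial of size at most [d.+1].                           *)
Definition hev d p x : k := \sum_(i < d.+1) p`_i * x.1 ^+ (d - i) * x.2 ^+ i.
Definition frm d p r s : {poly k} :=
  \sum_(i < d.+1) p`_i *: ((r.1%:P + s.1 *: 'X) ^+ (d - i) * (r.2%:P + s.2 *: 'X) ^+ i).
Definition comb x r s : pt := (x.1 * r.1 + x.2 * s.1, x.1 * r.2 + x.2 * s.2).
Definition scp c r : pt := (c * r.1, c * r.2).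
Definition lab r s x : pt := (br x s, br r x).

Lemma poly_eq0_forall p : (forall y, p.[y] = 0) -> p = 0.
Proof.
move=> p0; apply/eqP; apply: contraT => /closed_nonrootP[y].
by rewrite rootE p0 eqxx.
Qed.

Lemma hev1 d p y : (size p <= d.+1)%N -> hev d p (1, y) = p.[y].
Proof.
move=> sp; rewrite (horner_coef_wide _ sp); apply: eq_bigr => i _ /=.
by rewrite expr1n mulr1.
Qed.

Lemma hev_neq0 d p x : x.1 != 0 -> (size p <= d.+1)%N -> hev d p x = x.1 ^+ d * p.[x.2 / x.1].
Proof.
move=> x0 sp; rewrite (horner_coef_wide _ sp) mulr_sumr; apply: eq_bigr => i _.
have id : (i <= d)%N by rewrite -ltnS.
have -> : x.1 ^+ d = x.1 ^+ (d - i) * x.1 ^+ i by rewrite -exprD subnK.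
rewrite expr_div_n; have xi : x.1 ^+ i != 0 by rewrite expf_neq0.
by field.
Qed.

Lemma hev0 d p y : hev d p (0, y) = p`_d * y ^+ d.
Proof.
rewrite /hev big_ord_recr /= subnn expr0 mulr1 big1 ?add0r// => i _.
by rewrite expr0n subn_eq0 leqNgt ltn_ord /= mulr0 mul0r.
Qed.

Lemma hev_eq d p q : (size p <= d.+1)%N -> (size q <= d.+1)%N -> hev d p =1 hev d q -> p = q.
Proof.
move=> sp sq pq; apply/eqP; rewrite -subr_eq0; apply/eqP/poly_eq0_forall => y.
by rewrite hornerD hornerN -(hev1 _ sp) -(hev1 _ sq) pq subrr.
Qed.

Lemma hevD d p q x : hev d (p + q) x = hev d p x + hev d q x.
Proof. by rewrite -big_split; apply: eq_bigr => i _; rewrite coefD !mulrDl. Qed.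

Lemma hevZ d c p x : hev d (c *: p) x = c * hev d p x.
Proof. by rewrite mulr_sumr; apply: eq_bigr => i _; rewrite coefZ !mulrA. Qed.

Lemma hev_sum (T : Type) (t : seq T) (Q : pred T) d F x :
  hev d (\sum_(j <- t | Q j) F j) x = \sum_(j <- t | Q j) hev d (F j) x.
Proof.
elim/big_rec2: _ => [|j y1 y2 _ <-]; last by rewrite hevD.
by rewrite /hev big1 // => i _; rewrite coef0 !mul0r.
Qed.

Lemma coefM_top d e p q : (size p <= d.+1)%N -> (size q <= e.+1)%N ->
  (p * q)`_(d + e) = p`_d * q`_e.
Proof.
move=> sp sq; rewrite coefM.
have dde : (d < (d + e).+1)%N by rewrite ltnS leq_addr.
rewrite (bigD1 (Ordinal dde)) //= addKn big1 ?addr0// => i id.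
have [lt|gt|E] := ltngtP i d; last by case/eqP: id; apply: val_inj.
  rewrite [q`_ _]nth_default ?mulr0//; apply: leq_trans sq _.
  by rewrite ltn_subRL ltn_add2r.
by rewrite nth_default ?mul0r// (leq_trans sp).
Qed.

Lemma size_mul_form d e p q : (size p <= d.+1)%N -> (size q <= e.+1)%N ->
  (size (p * q)%R <= (d + e).+1)%N.
Proof.
move=> sp sq; apply: leq_trans (size_polyMleq _ _) _.
by lia.
Qed.

Lemma hevM d e p q x : (size p <= d.+1)%N -> (size q <= e.+1)%N ->
  hev (d + e) (p * q) x = hev d p x * hev e q x.
Proof.
move=> sp sq; have [x0|x0] := eqVneq x.1 0.
  by case: x x0 => x1 x2 /= ->; rewrite !hev0 coefM_top // exprD mulrACA.
by rewrite !hev_neq0 ?size_mul_form// hornerM exprD mulrACA.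
Qed.

Lemma size_linear a c : (size (a%:P + c *: 'X)%R <= 2)%N.
Proof.
apply: leq_trans (size_polyD _ _) _; rewrite geq_max (leq_trans (size_polyC_leq1 _))//.
by apply: leq_trans (size_scale_leq _ _) _; rewrite size_polyX.
Qed.

Lemma size_exp_form d n p : (size p <= d.+1)%N -> (size (p ^+ n)%R <= (d * n).+1)%N.
Proof.
move=> sp; elim: n => [|n IH]; first by rewrite muln0 size_poly1.
by rewrite exprS mulnS; apply: size_mul_form.
Qed.

Lemma hevX d n p x : (size p <= d.+1)%N -> hev (d * n) (p ^+ n) x = hev d p x ^+ n.
Proof.
move=> sp; elim: n => [|n IH].
  by rewrite muln0 /hev big_ord_recl big_ord0 !expr0 coef1 !mulr1 addr0.
by rewrite !exprS mulnS hevM ?IH // size_exp_form.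
Qed.

Lemma hev_linear a c x : hev 1 (a%:P + c *: 'X) x = a * x.1 + c * x.2.
Proof.
rewrite /hev !big_ord_recl big_ord0 /= !coefD !coefC !coefZ !coefX /=.
by rewrite subn0 subnn !expr0 !expr1; ring.
Qed.

Lemma size_exp_linear a c n : (size ((a%:P + c *: 'X) ^+ n)%R <= n.+1)%N.
Proof. by have := size_exp_form n (size_linear a c); rewrite mul1n. Qed.

Lemma hev_exp_linear a c n x : hev n ((a%:P + c *: 'X) ^+ n) x = (a * x.1 + c * x.2) ^+ n.
Proof. by have := hevX n x (size_linear a c); rewrite mul1n hev_linear. Qed.

Lemma frm_term_size d (i : nat) r s : (i <= d)%N ->
  (size ((r.1%:P + s.1 *: 'X) ^+ (d - i) * (r.2%:P + s.2 *: 'X) ^+ i)%R <= d.+1)%N.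
Proof.
move=> id; rewrite -{2}(subnK id).
by apply: size_mul_form; apply: size_exp_linear.
Qed.

Lemma size_frm d p r s : (size (frm d p r s) <= d.+1)%N.
Proof.
apply: (big_ind (fun p : {poly k} => (size p <= d.+1)%N)) => [|p1 p2 s1 s2|i _].
- by rewrite size_poly0.
- by apply: leq_trans (size_polyD _ _) _; rewrite geq_max s1.
- by apply: leq_trans (size_scale_leq _ _) _; apply: frm_term_size; rewrite -ltnS.
Qed.

Lemma hev_frm d p r s x : hev d (frm d p r s) x = hev d p (comb x r s).
Proof.
rewrite hev_sum; apply: eq_bigr => i _; rewrite hevZ -mulrA; congr (_ * _).
have id : (i <= d)%N by rewrite -ltnS.
rewrite -{1}(subnK id) hevM ?size_exp_linear// !hev_exp_linear /=.
by rewrite ![_ * x.1]mulrC ![_ * x.2]mulrC.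
Qed.

Lemma frmM d e p q r s : (size p <= d.+1)%N -> (size q <= e.+1)%N ->
  frm (d + e) (p * q) r s = frm d p r s * frm e q r s.
Proof.
move=> sp sq; apply: (@hev_eq (d + e)); rewrite ?size_frm ?size_mul_form ?size_frm// => x.
by rewrite hev_frm !hevM ?size_frm// !hev_frm.
Qed.

Lemma frmX d n p r s : (size p <= d.+1)%N -> frm (d * n) (p ^+ n) r s = frm d p r s ^+ n.
Proof.
move=> sp; apply: (@hev_eq (d * n)); rewrite ?size_frm ?size_exp_form ?size_frm// => x.
by rewrite hev_frm !hevX ?size_frm// hev_frm.
Qed.

Lemma frm_comp d p r s r' s' :
  frm d (frm d p r s) r' s' = frm d p (comb r' r s) (comb s' r s).
Proof.
apply: (@hev_eq d); rewrite ?size_frm// => x; rewrite !hev_frm; congr (hev d p _).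
by rewrite /comb /=; congr (_, _); ring.
Qed.

Lemma frm_id d p : (size p <= d.+1)%N -> frm d p (1, 0) (0, 1) = p.
Proof.
move=> sp; apply: (@hev_eq d); rewrite ?size_frm// => x; rewrite hev_frm; congr (hev d p _).
by case: x => a b; rewrite /comb /=; congr (_, _); ring.
Qed.

Lemma frmD d p q r s : frm d (p + q) r s = frm d p r s + frm d q r s.
Proof. by rewrite -big_split; apply: eq_bigr => i _; rewrite coefD scalerDl. Qed.

Lemma frmZ d c p r s : frm d (c *: p) r s = c *: frm d p r s.
Proof. by rewrite scaler_sumr; apply: eq_bigr => i _; rewrite coefZ scalerA. Qed.

Lemma frm_scale d c p r s : frm d p (scp c r) (scp c s) = c ^+ d *: frm d p r s.
Proof.
apply: (@hev_eq d); rewrite ?size_frm ?(leq_trans (size_scale_leq _ _)) ?size_frm// => x.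
rewrite hevZ !hev_frm /hev mulr_sumr; apply: eq_bigr => i _.
have -> : comb x (scp c r) (scp c s) = scp c (comb x r s) by rewrite /comb /scp /=; congr (_, _); ring.
have id : (i <= d)%N by rewrite -ltnS.
have -> : c ^+ d = c ^+ (d - i) * c ^+ i by rewrite -exprD subnK.
by rewrite /scp /= !exprMn; ring.
Qed.

(* The inverse frame: [frm] in the frame (r, s) followed by [frm] in the      *)
(* frame of coordinates of the standard basis.                               *)
Lemma frm_inv d p r s : (size p <= d.+1)%N -> br r s = 1 ->
  frm d (frm d p r s) (s.2, - r.2) (- s.1, r.1) = p.
Proof.
move=> sp rs; rewrite frm_comp -[RHS](frm_id sp); congr (frm d p _ _); rewrite /comb /=.
  by congr (_, _); [rewrite -rs /br; ring|ring].
by congr (_, _); [ring|rewrite -rs /br; ring].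
Qed.

Lemma size_lin r : (size (lin r) <= 2)%N.
Proof. by rewrite /lin addrC -polyCN size_linear. Qed.

Lemma hev_lin r x : hev 1 (lin r) x = br r x.
Proof. by rewrite /lin addrC -polyCN hev_linear /br; ring. Qed.

Lemma br_comb a r s x : br x (comb a r s) = a.1 * br x r + a.2 * br x s.
Proof. by rewrite /br /comb /=; ring. Qed.

Lemma br_lab r s x y : br (lab r s x) (lab r s y) = br r s * br x y.
Proof. by rewrite /lab /br /=; ring. Qed.

Lemma br_scp c c' r s : br (scp c r) (scp c' s) = c * c' * br r s.
Proof. by rewrite /br /scp /=; ring. Qed.

Lemma brC r s : br r s = - br s r.
Proof. by rewrite /br; ring. Qed.

Lemma brr r : br r r = 0.
Proof. by rewrite /br; ring. Qed.

Lemma coef_lin r i : (lin r)`_i = if i == 0%N then - r.2 else if i == 1%N then r.1 else 0.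
Proof.
rewrite /lin coefB coefZ coefX coefC; case: i => [|[|i]] /=.
- by rewrite mulr0 sub0r.
- by rewrite mulr1 subr0.
- by rewrite mulr0 subr0.
Qed.

Lemma lin_eq0 r : (lin r == 0) = (r == 0).
Proof.
apply/eqP/eqP => [E|->]; last by rewrite /lin scale0r polyC0 subrr.
have := coef_lin r 0; have := coef_lin r 1; rewrite E !coef0 /= => r1 /esym/eqP.
by rewrite oppr_eq0 => /eqP r2; case: r r1 r2 {E} => a b /= <- ->.
Qed.

Lemma lin_scp c r : lin (scp c r) = c *: lin r.
Proof. by rewrite /lin /= scalerBr scalerA -!mul_polyC -polyCM. Qed.

Lemma lab_scp r s c x : lab r s (scp c x) = scp c (lab r s x).
Proof. by rewrite /lab /scp /br /=; congr (_, _); ring. Qed.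

Lemma lab_eq0 r s x : br r s != 0 -> (lab r s x == 0) = (x == 0).
Proof.
move=> rs; apply/eqP/eqP => [[E1 E2]|->]; last by rewrite /lab /br /= !(mul0r, mulr0, subr0).
have x1 : br r s * x.1 = 0.
  by transitivity (br x s * r.1 + br r x * s.1); [rewrite /br; ring|rewrite E1 E2 !mul0r addr0].
have x2 : br r s * x.2 = 0.
  by transitivity (br x s * r.2 + br r x * s.2); [rewrite /br; ring|rewrite E1 E2 !mul0r addr0].
move/eqP: x1; move/eqP: x2; rewrite !mulf_eq0 (negbTE rs) /= => /eqP x2 /eqP x1.
by case: x x1 x2 {E1 E2} => a b /= -> ->.
Qed.

Lemma br_trans r s x : s != 0 -> br r s = 0 -> br s x = 0 -> br r x = 0.
Proof.
move=> s0 rs sx; have [s1|s1] := eqVneq s.1 0.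
  have s2 : s.2 != 0 by apply: contraNneq s0 => s2; case: s s1 s2 {rs sx} => a b /= -> ->.
  by apply: (mulfI s2); transitivity (br r s * x.2 + br s x * r.2);
    [rewrite /br; ring|rewrite rs sx !mul0r mulr0 addr0].
by apply: (mulfI s1); transitivity (br r s * x.1 + br s x * r.1);
  [rewrite /br; ring|rewrite rs sx !mul0r mulr0 addr0].
Qed.

Lemma br0_scp r s : s != 0 -> br r s = 0 -> exists c, r = scp c s.
Proof.
move=> s0 rs; have [s1|s1] := eqVneq s.1 0.
  have s2 : s.2 != 0 by apply: contraNneq s0 => s2; case: s s1 s2 {rs} => a b /= -> ->.
  exists (r.2 / s.2); rewrite /scp s1 mulr0 divfK //.
  move: rs; rewrite /br s1 mulr0 subr0 => /eqP; rewrite mulf_eq0 (negbTE s2) orbF => /eqP <-.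
  by case: (r).
exists (r.1 / s.1); rewrite /scp divfK // mulrAC.
move/eqP: rs; rewrite /br subr_eq0 => /eqP ->; rewrite mulfK //; by case: r.
Qed.

Lemma exists_frame r : r != 0 -> exists s, br r s = 1.
Proof.
move=> r0; have [r1|r1] := eqVneq r.1 0.
  have r2 : r.2 != 0 by apply: contraNneq r0 => r2; case: r r1 r2 => a b /= -> ->.
  by exists (- r.2^-1, 0); rewrite /br /= r1 mulrN mulfV //; ring.
by exists (0, r.1^-1); rewrite /br /= mulfV //; ring.
Qed.

Section ProdLin.
Context (L : finType).
Implicit Types (rho : L -> pt).

Definition prodlin rho : {poly k} := \prod_l lin (rho l).

Lemma size_prodlin_seq (t : seq L) rho : (size (\prod_(l <- t) lin (rho l))%R <= (size t).+1)%N.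
Proof.
elim: t => [|l t IH]; first by rewrite big_nil size_poly1.
by rewrite big_cons; apply: (@size_mul_form 1) IH; apply: size_lin.
Qed.

Lemma size_prodlin rho : (size (prodlin rho) <= #|L|.+1)%N.
Proof. by rewrite /prodlin -big_enum cardE size_prodlin_seq. Qed.

Lemma hev_prodlin rho x : hev #|L| (prodlin rho) x = \prod_l br (rho l) x.
Proof.
rewrite /prodlin -!big_enum cardE /=; elim: (enum L) => [|l t IH].
  by rewrite !big_nil /hev big_ord_recl big_ord0 !expr0 coef1 !mulr1 addr0.
by rewrite !big_cons (@hevM 1) ?size_lin ?size_prodlin_seq// hev_lin IH.
Qed.

Lemma frm_prodlin rho r s : frm #|L| (prodlin rho) r s = prodlin (fun l => lab r s (rho l)).
Proof.
apply: (@hev_eq #|L|); rewrite ?size_frm ?size_prodlin// => x.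
rewrite hev_frm !hev_prodlin; apply: eq_bigr => l _.
by rewrite br_comb /lab /br /=; ring.
Qed.

Lemma prodlin_scp (c : L -> k) rho : prodlin (fun l => scp (c l) (rho l)) = (\prod_l c l) *: prodlin rho.
Proof.
rewrite /prodlin; under eq_bigr do rewrite lin_scp.
by rewrite scaler_prod.
Qed.

Lemma prodlin_eq0 rho : (prodlin rho == 0) = [exists l, rho l == 0].
Proof.
apply/idP/existsP => [/prodf_eq0[l _]|[l rl]]; first by rewrite lin_eq0; exists l.
by apply/prodf_eq0; exists l; rewrite // lin_eq0.
Qed.

(** Both sides say that the form vanishes to order [m] at (1, 0), where a factor vanishes exactly
    when its label is proportional to (1, 0). *)
Lemma prodlin_coef_low rho m : (forall l, rho l != 0) ->
  (forall i, (i < m)%N -> (prodlin rho)`_i = 0) <-> (m <= #|[pred l | (rho l).2 == 0%R]|)%N.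
Proof.
move=> r0; set c := #|_|.
pose R := \prod_(l | (rho l).2 != 0) lin (rho l).
have E : prodlin rho = (\prod_(l | (rho l).2 == 0) (rho l).1) *: ('X^c * R).
  rewrite /prodlin (bigID (fun l => (rho l).2 == 0)) /= scalerAl; congr (_ * _).
  rewrite (eq_bigr (fun l => (rho l).1 *: 'X)) => [|l /eqP l0]; last by rewrite /lin l0 polyC0 subr0.
  by rewrite scaler_prod prodr_const.
have a0 : \prod_(l | (rho l).2 == 0) (rho l).1 != 0.
  apply/prodf_neq0 => l /eqP l2; apply: contraNneq (r0 l) => l1.
  by case: (rho l) l1 l2 => a b /= -> ->.
have R0 : R`_0 != 0.
  rewrite -horner_coef0 horner_prod; apply/prodf_neq0 => l l2.
  by rewrite horner_coef0 coef_lin /= oppr_eq0.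
split=> [H|mc i im].
  rewrite leqNgt; apply/negP => cm; have := H c cm; rewrite E coefZ coefXnM ltnn subnn.
  by move/eqP; rewrite mulf_eq0 (negbTE a0) (negbTE R0).
by rewrite E coefZ coefXnM (leq_trans im mc) mulr0.
Qed.

Lemma prodlin_scp_lift c rho : (0 < #|L|)%N -> exists2 rho', prodlin rho' = c *: prodlin rho &
  exists f : L -> k, (c != 0 -> forall l, f l != 0) /\ rho' = fun l => scp (f l) (rho l).
Proof.
move=> /card_gt0P[l0 _]; pose f l := if l == l0 then c else 1.
exists (fun l => scp (f l) (rho l)).
  rewrite prodlin_scp (bigD1 l0) //= /f eqxx big1 ?mulr1// => l /negbTE ->//.
by exists f; split=> // c0 l; rewrite /f; case: ifP => _ //; rewrite oner_eq0.
Qed.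

Lemma exists_prodlin p : (0 < #|L|)%N -> (size p <= #|L|.+1)%N -> exists rho, prodlin rho = p.
Proof.
move=> L0 sp; have [->|p0] := eqVneq p 0.
  exists (fun=> 0); apply/eqP; rewrite prodlin_eq0; apply/existsP.
  by have /card_gt0P[l _] := L0; exists l.
have [t pE] := closed_field_poly_normal p.
have st : (size t <= #|L|)%N.
  rewrite -ltnS; apply: leq_trans sp; rewrite pE size_scale ?lead_coef_eq0//.
  by rewrite size_prod_XsubC.
(* The label (0, -1) has linear form 1; it pads the list of roots when the degree of [p] is smaller
   than [#|L|], that is, it stands for the roots at infinity. *)
pose t' : seq pt := [seq (1, z) | z <- t].
have [rho' e _] := @prodlin_scp_lift (lead_coef p)
  (fun l => nth ((0, -1) : pt) t' (index l (enum L))) L0.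
exists rho'; rewrite e [RHS]pE; congr (_ *: _).
rewrite /prodlin -big_enum /=.
rewrite -(big_map (fun l => nth ((0, -1) : pt) t' (index l (enum L))) xpredT lin).
have -> : [seq nth ((0, -1) : pt) t' (index l (enum L)) | l <- enum L] = t' ++ nseq (#|L| - size t) ((0, -1) : pt).
  apply: (@eq_from_nth _ ((0, -1) : pt)) => [|i]; rewrite size_map -?cardE.
    by rewrite size_cat size_map size_nseq subnKC.
  move=> iL; have /card_gt0P[l0 _] := L0.
  rewrite (nth_map l0) -?cardE// index_uniq ?enum_uniq -?cardE// nth_cat size_map.
  case: ltnP => // ti; rewrite nth_nseq; case: ifP => _; first by rewrite nth_default ?size_map.
  by rewrite nth_default ?size_map.
rewrite big_cat big_map /= [X in _ * X]big1_seq ?mulr1.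
  by apply: eq_bigr => z _; rewrite /lin scale1r.
move=> z /andP[_ /nseqP[-> _]].
by rewrite /lin scale0r sub0r -polyCN opprK.
Qed.

End ProdLin.
End Forms.

(** * Limits of binary forms along a place *)

Section FormLimits.
Context (k : closedFieldType) (I : Type) (P : place k I).
Local Notation pt := (k * k)%type.
Local Notation U := (ae P).

Definition tendsp (p : I -> {poly k}) (p0 : {poly k}) := forall i, tends P (fun c => (p c)`_i) p0`_i.
Definition tendst (r : I -> pt) (r0 : pt) := tends P (fun c => (r c).1) r0.1 /\ tends P (fun c => (r c).2) r0.2.
Definition finitep (p : I -> {poly k}) := forall i, finite_at P (fun c => (p c)`_i).

Lemma tendsp_ext p q p0 : p =1 q -> tendsp p p0 -> tendsp q p0.
Proof. by move=> /funext ->. Qed.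

Lemma tendsp_ae (p q : I -> {poly k}) p0 : U [set c | p c = q c] -> tendsp p p0 -> tendsp q p0.
Proof. by move=> pq pp i; apply: tends_ae (pp i); apply: aeW pq => c ->. Qed.

Lemma tendsp_cst p0 : tendsp (fun=> p0) p0.
Proof. by move=> i; apply: tends_cst. Qed.

Lemma tendspD p q p0 q0 : tendsp p p0 -> tendsp q q0 -> tendsp (fun c => p c + q c) (p0 + q0).
Proof.
move=> pp qq i; rewrite coefD; apply: tends_ext (tendsD (pp i) (qq i)) => c.
by rewrite coefD.
Qed.

Lemma tendspZ (f : I -> k) p a p0 : tends P f a -> tendsp p p0 -> tendsp (fun c => f c *: p c) (a *: p0).
Proof.
move=> ff pp i; rewrite coefZ; apply: tends_ext (tendsM ff (pp i)) => c.
by rewrite coefZ.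
Qed.

Lemma tendspC (f : I -> k) a : tends P f a -> tendsp (fun c => (f c)%:P) a%:P.
Proof.
move=> ff i; rewrite coefC; under eq_fun do rewrite coefC.
by case: (i == 0)%N => //; apply: tends_cst.
Qed.

Lemma tendspM p q p0 q0 : tendsp p p0 -> tendsp q q0 -> tendsp (fun c => p c * q c) (p0 * q0).
Proof.
move=> pp qq i; rewrite coefM; under eq_fun do rewrite coefM.
by apply: tends_sum => j _; apply: tendsM.
Qed.

Lemma tendspX p p0 n : tendsp p p0 -> tendsp (fun c => p c ^+ n) (p0 ^+ n).
Proof.
move=> pp; elim: n => [|n IH]; first exact: tendsp_cst.
by rewrite exprS; apply: tendsp_ext (tendspM pp IH) => c; rewrite exprS.
Qed.

Lemma tendsp_sum (T : Type) (t : seq T) (F : T -> I -> {poly k}) F0 :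
  (forall j, tendsp (F j) (F0 j)) ->
  tendsp (fun c => \sum_(j <- t) F j c) (\sum_(j <- t) F0 j).
Proof.
move=> FF i; rewrite coef_sum; under eq_fun do rewrite coef_sum.
by apply: tends_sum => j _; apply: FF.
Qed.

Lemma tendsp_prod (T : Type) (t : seq T) (Q : pred T) (F : T -> I -> {poly k}) F0 :
  (forall j, tendsp (F j) (F0 j)) ->
  tendsp (fun c => \prod_(j <- t | Q j) F j c) (\prod_(j <- t | Q j) F0 j).
Proof.
move=> FF; elim: t => [|j t IH].
  by rewrite big_nil; apply: tendsp_ext (tendsp_cst 1) => c; rewrite big_nil.
rewrite big_cons; case: ifP => Qj; last by apply: tendsp_ext IH => c; rewrite big_cons Qj.
by apply: tendsp_ext (tendspM (FF j) IH) => c; rewrite big_cons Qj.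
Qed.

Lemma tendsp_size (p : I -> {poly k}) p0 n : (forall c, (size (p c) <= n)%N) -> tendsp p p0 -> (size p0 <= n)%N.
Proof.
move=> pn pp; apply/leq_sizeP => j nj; apply: (tends_uniq (pp j)).
by apply: tends0; apply: aeT => c; rewrite nth_default // (leq_trans (pn c)).
Qed.

Lemma tendsp_uniq p p0 p1 : tendsp p p0 -> tendsp p p1 -> p0 = p1.
Proof. by move=> h0 h1; apply/polyP => i; apply: tends_uniq (h0 i) (h1 i). Qed.

Lemma finitep_tendsp (p : I -> {poly k}) n : (forall c, (size (p c) <= n)%N) -> finitep p -> exists p0, tendsp p p0.
Proof.
move=> pn fp; have [F FP] := choice fp.
exists (\poly_(i < n) F i) => i; rewrite coef_poly; case: ltnP => // ni.
by apply: tends0; apply: aeT => c; rewrite nth_default // (leq_trans (pn c)).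
Qed.

Lemma tendsp_lin r r0 : tendst r r0 -> tendsp (fun c => lin (r c)) (lin r0).
Proof.
move=> [r1 r2] i; rewrite coef_lin; under eq_fun do rewrite coef_lin.
by case: (i == 0)%N; [exact: tendsN|case: (i == 1)%N => //; exact: tends_cst].
Qed.

Lemma tends_br r s r0 s0 : tendst r r0 -> tendst s s0 -> tends P (fun c => br (r c) (s c)) (br r0 s0).
Proof. by move=> [r1 r2] [s1 s2]; apply: tendsB; apply: tendsM. Qed.

Lemma tendst_cst r0 : tendst (fun=> r0) r0.
Proof. by split; apply: tends_cst. Qed.

Lemma tendst_lab r s x r0 s0 x0 : tendst r r0 -> tendst s s0 -> tendst x x0 ->
  tendst (fun c => lab (r c) (s c) (x c)) (lab r0 s0 x0).
Proof. by move=> rr ss xx; split; apply: tends_br. Qed.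

Lemma tendst_ae r s r0 : U [set c | r c = s c] -> tendst r r0 -> tendst s r0.
Proof.
by move=> rs [r1 r2]; split; [apply: tends_ae r1|apply: tends_ae r2]; apply: aeW rs => c ->.
Qed.

Lemma tendsp_frm d (p : I -> {poly k}) r s p0 r0 s0 : tendsp p p0 -> tendst r r0 -> tendst s s0 ->
  tendsp (fun c => frm d (p c) (r c) (s c)) (frm d p0 r0 s0).
Proof.
move=> pp [r1 r2] [s1 s2]; apply: tendsp_sum => i; apply: tendspZ; first exact: pp.
have L f g a b : tends P f a -> tends P g b ->
    tendsp (fun c => (f c)%:P + g c *: 'X) (a%:P + b *: 'X).
  by move=> ff gg; apply: tendspD; [exact: tendspC|apply: tendspZ => //; exact: tendsp_cst].
by apply: tendspM; apply: tendspX; apply: L.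
Qed.

(** Division by the dominant coordinate gives a representative of the same point of P^1 with a
    nonzero limit. *)
Lemma exists_primitive (r : I -> pt) : U [set c | r c != 0] ->
  exists (f : I -> k) (q : I -> pt) q0, [/\ forall c, f c != 0, forall c, r c = scp (f c) (q c) \/ r c = 0,
    tendst q q0 & q0 != 0].
Proof.
move=> r0; have [|b [b0 bfin]] := @ae_dominant _ _ P bool (fun b c => if b then (r c).1 else (r c).2).
  apply: aeW r0 => c rc; have [r1|r1] := eqVneq (r c).1 0; last by exists true.
  by exists false; apply: contraNneq rc => r2; case: (r c) r1 r2 => x y /= -> ->.
pose f c := if b then (r c).1 else (r c).2.
(* The default 1 makes the scalar nonzero everywhere and not only almost everywhere. *)
pose f' c := if f c == 0 then 1 else f c.
have f'f : U [set c | f' c = f c] by apply: aeW b0 => c; rewrite /f' /f => /negbTE ->.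
have [a fa] := bfin true; have [a' fa'] := bfin false; rewrite -/f in fa fa'.
pose q c := ((r c).1 / f' c, (r c).2 / f' c).
have f'0 c : f' c != 0 by rewrite /f'; case: ifP => [_|/negbT//]; rewrite oner_eq0.
exists f', q, (a, a'); split=> //.
- by move=> c; left; rewrite /q /scp /= !mulrA ![f' c * _]mulrC !mulfK //; case: (r c).
- split=> /=; [apply: tends_ae fa|apply: tends_ae fa']; apply: aeW f'f => c ->//.
- case: (b) fa fa' b0 f f' f'f q f'0 {bfin} => /= fa fa' b0 f f' f'f q f'0.
    apply: contraNneq (oner_neq0 k) => -[a0 _]; rewrite a0 in fa.
    apply/eqP/esym; apply: tends_uniq fa (tends_ae _ (tends_cst P 1)).
    by apply: aeW b0 => c /= rc; rewrite mulfV.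
  apply: contraNneq (oner_neq0 k) => -[_ a0]; rewrite a0 in fa'.
  apply/eqP/esym; apply: tends_uniq fa' (tends_ae _ (tends_cst P 1)).
  by apply: aeW b0 => c /= rc; rewrite mulfV.
Qed.

End FormLimits.

(** * Finiteness from the extreme coefficients *)

Section Frame.
Context (k : closedFieldType).
Local Notation pt := (k * k)%type.

Lemma coef_frm_scp d (p : {poly k}) a b (r s : pt) i : (i <= d)%N ->
  (frm d p (scp a r) (scp b s))`_i = a ^+ (d - i) * b ^+ i * (frm d p r s)`_i.
Proof.
move=> id; suff -> : frm d p (scp a r) (scp b s) =
    \poly_(i < d.+1) (a ^+ (d - i) * b ^+ i * (frm d p r s)`_i) by rewrite coef_poly ltnS id.
apply: (@hev_eq _ d); rewrite ?size_frm ?size_poly// => x.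
rewrite hev_frm; have -> : comb x (scp a r) (scp b s) = comb (a * x.1, b * x.2) r s.
  by rewrite /comb /scp /=; congr (_, _); ring.
rewrite -hev_frm; apply: eq_bigr => j _ /=.
by rewrite coef_poly ltn_ord !exprMn; ring.
Qed.

Lemma coef_frm_swap d (p : {poly k}) (r s : pt) i : (i <= d)%N ->
  (frm d p s r)`_i = (frm d p r s)`_(d - i).
Proof.
move=> id; suff -> : frm d p s r = \poly_(i < d.+1) ((frm d p r s)`_(d - i)).
  by rewrite coef_poly ltnS id.
apply: (@hev_eq _ d); rewrite ?size_frm ?size_poly// => x.
rewrite hev_frm; have -> : comb x s r = comb (x.2, x.1) r s by rewrite /comb /=; congr (_, _); ring.
rewrite -hev_frm [LHS](reindex_inj rev_ord_inj); apply: eq_bigr => j _ /=.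
have jd : (j <= d)%N by rewrite -ltnS.
by rewrite coef_poly ltn_ord !subSS subKn //; ring.
Qed.

(** The frame (1, 0), (c, e) acts triangularly: coefficient [i] depends on the coefficients up to
    [i] only, and on the [i]-th one through the factor [e ^+ i]. *)
Lemma coef_frm_shear d (p : {poly k}) c e i : (frm d p (1, 0) (c, e))`_i =
  \sum_(j < d.+1) if (j <= i)%N then p`_j * e ^+ j * ((1 + c *: 'X) ^+ (d - j))`_(i - j) else 0.
Proof.
rewrite coef_sum; apply: eq_bigr => j _ /=.
rewrite coefZ polyC0 add0r exprZn -scalerAr coefZ coefMXn ltnNge.
by case: leqP => // _; rewrite ?mulr0 // mulrA.
Qed.

(** Condition (2) of [T_], read in a frame that starts at the point: coefficient [i] of the moved
    form is its term of order [i] at [r]. *)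
Definition minimal N (A B : {poly k}) := forall r s, br r s = 1 ->
  (exists2 i, (i < 4)%N & (frm (4 * N) A r s)`_i != 0) \/
  (exists2 i, (i < 6)%N & (frm (6 * N) B r s)`_i != 0).

Context (I : Type) (P : place k I).
Local Notation tends := (tends P).
Local Notation finite := (finite_at P).

(** The triangular system is solved from the lowest index on, so that only the coefficients below
    [m] enter. *)
Lemma shear_finite_low d m (F : I -> {poly k}) (c e kap rho : I -> k) :
  finitep P F -> finite c -> finite rho ->
  (forall i, (i < m)%N -> finite (fun t => kap t * rho t ^+ i * (frm d (F t) (1, 0) (c t, e t))`_i)) ->
  (m <= d.+1)%N ->
  forall i, (i < m)%N -> finite (fun t => kap t * (rho t * e t) ^+ i * (F t)`_i).
Proof.
move=> fF fc frho H md; elim/ltn_ind => i IH im.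
have fE j l : finite (fun t => ((1 + c t *: 'X) ^+ j)`_l).
  have [b cb] := fc; exists ((1 + b *: 'X) ^+ j)`_l.
  apply: (tendspX (p0 := 1 + b *: 'X)).
  by apply: tendspD; [exact: tendsp_cst|apply: tendspZ => //; exact: tendsp_cst].
have id : (i < d.+1)%N by apply: leq_trans im md.
apply: (@finite_at_ext _ _ _ (fun t => kap t * rho t ^+ i * (frm d (F t) (1, 0) (c t, e t))`_i
  + - 1 * \sum_(j < d.+1 | (j < i)%N) (kap t * (rho t * e t) ^+ j * (F t)`_j) *
    (rho t ^+ (i - j) * ((1 + c t *: 'X) ^+ (d - j))`_(i - j)))).
  move=> t; rewrite coef_frm_shear (bigD1 (Ordinal id)) //= leqnn subnn.
  have -> : ((1 + c t *: 'X) ^+ (d - i))`_0 = 1.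
    by rewrite -horner_coef0 horner_exp hornerD hornerZ hornerX hornerC mulr0 addr0 expr1n.
  set S := \sum_(j < d.+1 | j != _) _; set S' := \sum_(j < d.+1 | (j < i)%N) _.
  have -> : S' = kap t * rho t ^+ i * S.
    rewrite /S /S' mulr_sumr big_mkcond [RHS]big_mkcond; apply: eq_bigr => j _.
    rewrite -val_eqE /=; case: ltngtP => //= ji; last by rewrite mulr0.
    rewrite -[in RHS](subnKC (ltnW ji)) exprD exprMn subnKC ?(ltnW ji)//; ring.
  by rewrite exprMn; ring.
apply: finite_atD; first exact: H.
apply: finite_atM; first exact: finite_at_cst.
apply: finite_at_sum => j ji; apply: finite_atM; first by apply: IH => //; apply: ltn_trans im.
by apply: finite_atM; [exact: finite_atX|exact: fE].
Qed.

Lemma shear_finite d (F : I -> {poly k}) (c e kap rho : I -> k) :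
  finite c -> finite rho -> (forall i, finite (fun t => kap t * (rho t * e t) ^+ i * (F t)`_i)) ->
  forall i, finite (fun t => kap t * rho t ^+ i * (frm d (F t) (1, 0) (c t, e t))`_i).
Proof.
move=> fc frho H i.
have fE j l : finite (fun t => ((1 + c t *: 'X) ^+ j)`_l).
  have [b cb] := fc; exists ((1 + b *: 'X) ^+ j)`_l.
  apply: (tendspX (p0 := 1 + b *: 'X)).
  by apply: tendspD; [exact: tendsp_cst|apply: tendspZ => //; exact: tendsp_cst].
apply: (@finite_at_ext _ _ _ (fun t => \sum_(j < d.+1 | (j <= i)%N)
    (kap t * (rho t * e t) ^+ j * (F t)`_j) * (rho t ^+ (i - j) * ((1 + c t *: 'X) ^+ (d - j))`_(i - j)))).
  move=> t; rewrite coef_frm_shear mulr_sumr big_mkcond; apply: eq_bigr => j _.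
  case: leqP => [ji|]; last by rewrite mulr0.
  by rewrite -[in RHS](subnKC ji) exprD exprMn subnKC //; ring.
apply: finite_at_sum => j ji; apply: finite_atM => //.
by apply: finite_atM; [exact: finite_atX|exact: fE].
Qed.

Section Projection.
Context (N : nat) (N0 : (0 < N)%N) (A B : I -> {poly k}) (A0 B0 : {poly k}).
Hypotheses (tA : tendsp P A A0) (tB : tendsp P B B0) (mAB : minimal N A0 B0).

(** In a frame [(q, y)] that stays a frame in the limit, [p] is [c q + e y], and the growth is
    governed by [w = rho * e]. Minimality of the limit provides a low coefficient with nonzero
    limit, so [kA * w ^+ j] is finite for some j < 4 or [kB * w ^+ j] for some j < 6; since [w] is
    finite, higher powers follow. As 4 * 3 = 6 * 2, the relation [kA ^+ 3 = kB ^+ 2] carries the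
    bound from one form to the other. *)
Lemma projection_half (q p : I -> pt) (q0 p0 : pt) (kA kB rho : I -> k) :
  tendst P q q0 -> q0 != 0 -> tendst P p p0 -> finite rho ->
  ae P [set t | kA t ^+ 3 = kB t ^+ 2] ->
  (forall i, (i < 4)%N -> finite (fun t => kA t * rho t ^+ i * (frm (4 * N) (A t) (q t) (p t))`_i)) ->
  (forall i, (i < 6)%N -> finite (fun t => kB t * rho t ^+ i * (frm (6 * N) (B t) (q t) (p t))`_i)) ->
  (forall i, finite (fun t => kA t * rho t ^+ i * (frm (4 * N) (A t) (q t) (p t))`_i)) /\
  (forall i, finite (fun t => kB t * rho t ^+ i * (frm (6 * N) (B t) (q t) (p t))`_i)).
Proof.
move=> tq q00 tp frho kAB HA HB; have [y qy] := exists_frame q00.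
pose D t := br (q t) y; have tD : tends D 1.
  by rewrite -qy; apply: tends_br => //; apply: tendst_cst.
pose c t := br (p t) y / D t; pose e t := br (q t) (p t) / D t.
have tc : tends c (br p0 y / 1).
  by apply: tends_div tD _; [apply: tends_br => //; exact: tendst_cst|exact: oner_neq0].
have te : tends e (br q0 p0 / 1).
  by apply: tends_div tD _; [exact: tends_br|exact: oner_neq0].
have fc : finite c by eexists; apply: tc.
have fe : finite e by eexists; apply: te.
have D0 : ae P [set t | D t != 0] by apply: tends_ne0 tD _; apply: oner_neq0.
have pE : ae P [set t | p t = comb (c t, e t) (q t) y].
  apply: aeW D0 => t; rewrite /comb /c /e /D /br /=.
  by case: (p t) (q t) => p1 p2 [q1 q2] /= D1; congr (_, _); field.
pose FA t := frm (4 * N) (A t) (q t) y; pose FB t := frm (6 * N) (B t) (q t) y.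
have tFA : tendsp P FA (frm (4 * N) A0 q0 y) by apply: tendsp_frm => //; exact: tendst_cst.
have tFB : tendsp P FB (frm (6 * N) B0 q0 y) by apply: tendsp_frm => //; exact: tendst_cst.
have frmE d (G : I -> {poly k}) : ae P [set t | frm d (G t) (q t) (p t) =
    frm d (frm d (G t) (q t) y) (1, 0) (c t, e t)].
  apply: aeW pE => t ->; rewrite frm_comp; congr (frm d _ _ _).
  by rewrite /comb /=; case: (q t) => a b /=; congr (_, _); ring.
have eqv d (G : I -> {poly k}) (K : I -> k) i :
    finite (fun t => K t * rho t ^+ i * (frm d (G t) (q t) (p t))`_i) <->
    finite (fun t => K t * rho t ^+ i * (frm d (frm d (G t) (q t) y) (1, 0) (c t, e t))`_i).
  by split; apply: finite_at_ae; apply: aeW (frmE d G) => t ->.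
pose w t := rho t * e t; have fw : finite w by apply: finite_atM.
have fin_tendsp p1 p2 : tendsp P p1 p2 -> finitep P p1 by move=> h i; exists p2`_i.
have lowA := shear_finite_low (fin_tendsp _ _ tFA) fc frho (fun i i4 => (eqv _ _ _ i).1 (HA i i4)).
have lowB := shear_finite_low (fin_tendsp _ _ tFB) fc frho (fun i i4 => (eqv _ _ _ i).1 (HB i i4)).
have {}lowA := lowA (leq_trans (leq_pmulr _ N0) (leqnSn _)).
have {}lowB := lowB (leq_trans (leq_pmulr _ N0) (leqnSn _)).
have div_lim F F0 (K : I -> k) j : tendsp P F F0 -> F0`_j != 0 ->
    finite (fun t => K t * w t ^+ j * (F t)`_j) -> finite (fun t => K t * w t ^+ j).
  move=> tF F0j [b Kb]; exists (b / F0`_j).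
  apply: tends_ae (tends_div Kb (tF j) F0j).
  by apply: aeW (tends_ne0 (tF j) F0j) => t Fj; rewrite mulfK.
have fin_ge (K : I -> k) j l : finite (fun t => K t * w t ^+ j) -> (j <= l)%N ->
    finite (fun t => K t * w t ^+ l).
  move=> fK jl; apply: finite_at_ext (finite_atM fK (finite_atX (l - j) fw)) => t.
  by rewrite -mulrA -exprD subnKC.
have [hA hB] : (forall j, (4 <= j)%N -> finite (fun t => kA t * w t ^+ j)) /\
    (forall j, (6 <= j)%N -> finite (fun t => kB t * w t ^+ j)).
  have [[j j4 Fj]|[j j6 Fj]] := mAB qy.
    have h := div_lim _ _ _ _ tFA Fj (lowA j j4).
    split=> l lj; first by apply: fin_ge h _; apply: leq_trans (ltnW j4) lj.
    suff h6 : finite (fun t => kB t * w t ^+ 6) by apply: fin_ge h6 lj.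
    apply: (@finite_at_root _ _ _ _ 2) => //.
    apply: finite_at_ae (finite_atM (finite_atX 3 h) (finite_atX (12 - j * 3) fw)).
    apply: aeW kAB => t E; rewrite exprMn -exprM -mulrA -exprD E subnKC; last by lia.
    by ring.
  have h := div_lim _ _ _ _ tFB Fj (lowB j j6).
  split=> l lj; last by apply: fin_ge h _; apply: leq_trans (ltnW j6) lj.
  suff h4 : finite (fun t => kA t * w t ^+ 4) by apply: fin_ge h4 lj.
  apply: (@finite_at_root _ _ _ _ 3) => //.
  apply: finite_at_ae (finite_atM (finite_atX 2 h) (finite_atX (12 - j * 2) fw)).
  apply: aeW kAB => t E; rewrite exprMn -exprM -mulrA -exprD -E subnKC; last by lia.
  by ring.
split=> i; apply/eqv; apply: shear_finite => // j.
  have [/lowA//|/hA h] := ltnP j 4.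
  by apply: finite_atM h _; exact: (fin_tendsp _ _ tFA j).
have [/lowB//|/hB h] := ltnP j 6.
by apply: finite_atM h _; exact: (fin_tendsp _ _ tFB j).
Qed.

(** The vectors of the inverse frame are written as [a q] and [b p] with primitive [q] and [p].
    Either [b / a] or [a / b] is finite, so one end of a torus controls the family: the low
    coefficients suffice in the first case, the top ones in the second. *)
Lemma projection_finite (A1 B1 : I -> {poly k}) (r s : I -> pt) (lam : I -> k) :
  (forall t, (size (A1 t) <= (4 * N).+1)%N) -> (forall t, (size (B1 t) <= (6 * N).+1)%N) ->
  (forall t, br (r t) (s t) = 1) -> (forall t, lam t != 0) ->
  (forall t, A t = lam t ^+ 4 *: frm (4 * N) (A1 t) (r t) (s t)) ->
  (forall t, B t = lam t ^+ 6 *: frm (6 * N) (B1 t) (r t) (s t)) ->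
  (forall i, (i < 4)%N \/ (4 * N - 4 < i <= 4 * N)%N -> finite (fun t => (A1 t)`_i)) ->
  (forall i, (i < 6)%N \/ (6 * N - 6 < i <= 6 * N)%N -> finite (fun t => (B1 t)`_i)) ->
  finitep P A1 /\ finitep P B1.
Proof.
move=> sA sB rs1 lam0 eA eB hA hB.
pose q' t : pt := ((s t).2, - (r t).2); pose p' t : pt := (- (s t).1, (r t).1).
have q'p' t : br (q' t) (p' t) = 1 by rewrite -(rs1 t) /br /=; ring.
have q'0 t : q' t != 0.
  by apply: contraTneq isT => E; move: (q'p' t); rewrite E /br !mul0r subr0 => /esym/eqP; rewrite oner_eq0.
have p'0 t : p' t != 0.
  by apply: contraTneq isT => E; move: (q'p' t); rewrite E /br !mulr0 subr0 => /esym/eqP; rewrite oner_eq0.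
have [a [q [q0 [a0 aq tq q00]]]] := @exists_primitive _ _ P q' (aeT P q'0).
have [b [p [p0 [b0 bp tp p00]]]] := @exists_primitive _ _ P p' (aeT P p'0).
have {}aq t : q' t = scp (a t) (q t) by case: (aq t) => // /eqP; rewrite (negPf (q'0 t)).
have {}bp t : p' t = scp (b t) (p t) by case: (bp t) => // /eqP; rewrite (negPf (p'0 t)).
pose kap d f t := (lam t)^-1 ^+ d * f t ^+ (d * N).
have kapE f t : kap 4%N f t ^+ 3 = kap 6%N f t ^+ 2.
  by rewrite /kap [LHS]exprMn [RHS]exprMn -!exprM; have -> : (4 * N * 3 = 6 * N * 2)%N by rewrite mulnAC [RHS]mulnAC.
have invE d (G G1 : I -> {poly k}) t : (size (G1 t) <= (d * N).+1)%N -> G t = lam t ^+ d *: frm (d * N) (G1 t) (r t) (s t) ->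
    G1 t = (lam t)^-1 ^+ d *: frm (d * N) (G t) (q' t) (p' t).
  move=> s1 ->; rewrite frmZ scalerA -exprMn mulVf ?lam0// expr1n scale1r.
  by rewrite frm_inv.
have E1 d (G G1 : I -> {poly k}) t i : (i <= d * N)%N -> (size (G1 t) <= (d * N).+1)%N ->
    G t = lam t ^+ d *: frm (d * N) (G1 t) (r t) (s t) ->
    (G1 t)`_i = kap d a t * (b t / a t) ^+ i * (frm (d * N) (G t) (q t) (p t))`_i.
  move=> id s1 eG; rewrite (invE _ _ _ _ s1 eG) coefZ aq bp coef_frm_scp// !mulrA; congr (_ * _).
  have E : a t ^+ (d * N) = a t ^+ (d * N - i) * a t ^+ i by rewrite -exprD subnK.
  by rewrite /kap E expr_div_n; field; rewrite expf_neq0.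
have E2 d (G G1 : I -> {poly k}) t i : (i <= d * N)%N -> (size (G1 t) <= (d * N).+1)%N ->
    G t = lam t ^+ d *: frm (d * N) (G1 t) (r t) (s t) ->
    (G1 t)`_(d * N - i) = kap d b t * (a t / b t) ^+ i * (frm (d * N) (G t) (p t) (q t))`_i.
  move=> id s1 eG; rewrite (invE _ _ _ _ s1 eG) coefZ aq bp coef_frm_scp ?leq_subr// !mulrA.
  have E : b t ^+ (d * N) = b t ^+ (d * N - i) * b t ^+ i by rewrite -exprD subnK.
  by rewrite (coef_frm_swap (G t) (q t) (p t) id) subKn// /kap E expr_div_n; field; rewrite expf_neq0.
have big d (G1 : I -> {poly k}) i : (forall t, (size (G1 t) <= (d * N).+1)%N) -> (d * N < i)%N -> finite (fun t => (G1 t)`_i).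
  move=> s1 di; apply: finite_at_ext (finite_at_cst P 0) => t.
  by rewrite nth_default// (leq_trans (s1 t)).
have big' d (G : I -> {poly k}) (K : I -> k) r1 r2 i : (d * N < i)%N -> finite (fun t => K t * (frm (d * N) (G t) (r1 t) (r2 t))`_i).
  move=> di; apply: finite_at_ext (finite_at_cst P 0) => t.
  by rewrite nth_default ?mulr0// (leq_trans (size_frm _ _ _ _)).
have [fba|tab] := finite_at_div P b a.
  have [|||FA FB] := @projection_half q p q0 p0 (kap 4%N a) (kap 6%N a) _ tq q00 tp fba; first exact: aeT.
  - move=> i i4; have [di|id] := ltnP (4 * N) i; first exact: big'.
    by apply: finite_at_ext (hA i (or_introl i4)) => t; apply: E1.
  - move=> i i6; have [di|id] := ltnP (6 * N) i; first exact: big'.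
    by apply: finite_at_ext (hB i (or_introl i6)) => t; apply: E1.
  split=> i.
    have [di|id] := ltnP (4 * N) i; first exact: big.
    by apply: finite_at_ext (FA i) => t; apply/esym/E1.
  have [di|id] := ltnP (6 * N) i; first exact: big.
  by apply: finite_at_ext (FB i) => t; apply/esym/E1.
(* The mirror case: exchanging the frame vectors reverses the order of the coefficients. *)
have [|||FA FB] := @projection_half p q p0 q0 (kap 4%N b) (kap 6%N b) _ tp p00 tq (ex_intro _ _ tab); first exact: aeT.
- move=> i i4; have [di|id] := ltnP (4 * N) i; first exact: big'.
  apply: finite_at_ext (hA (4 * N - i)%N _) => [t|]; first exact: E2.
  by right; lia.
- move=> i i6; have [di|id] := ltnP (6 * N) i; first exact: big'.
  apply: finite_at_ext (hB (6 * N - i)%N _) => [t|]; first exact: E2.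
  by right; lia.
split=> i.
  have [di|id] := ltnP (4 * N) i; first exact: big.
  apply: finite_at_ext (FA (4 * N - i)%N) => t.
  by rewrite -(E2 4%N A A1 t _ (leq_subr _ _) (sA t) (eA t)) subKn.
have [di|id] := ltnP (6 * N) i; first exact: big.
apply: finite_at_ext (FB (6 * N - i)%N) => t.
by rewrite -(E2 6%N B B1 t _ (leq_subr _ _) (sB t) (eB t)) subKn.
Qed.

End Projection.

End Frame.

(** * Weierstrass data *)

Section Dehomogenization.
Context (k : closedFieldType).
Local Notation pt := (k * k)%type.
Implicit Types (F G : {mpoly k[2]}).

Definition dehom F : {poly k} := mmap (@polyC k) (fun i : 'I_2 => if i == ord0 then 1 else 'X) F.

Lemma dehomE F : dehom F = \sum_(m <- msupp F) F@_m *: 'X^(m ord_max).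
Proof.
apply: eq_bigr => m _; rewrite mul_polyC; congr (_ *: _).
by rewrite /mmap1 !big_ord_recl big_ord0 /= expr1n mul1r mulr1; congr ('X^(m _)); apply: val_inj.
Qed.

Lemma mdeg2 (m : 'X_{1..2}) : mdeg m = (m ord0 + m ord_max)%N.
Proof. by rewrite mdegE !big_ord_recl big_ord0 addn0; congr (_ + m _)%N; apply: val_inj. Qed.

Lemma homog_supp d F m : F \is d.-homog -> m \in msupp F -> m ord0 = (d - m ord_max)%N /\ (m ord_max <= d)%N.
Proof. by move=> /dhomogP h /h /= <-; rewrite mdeg2 addnK leq_addl. Qed.

Lemma size_dehom d F : F \is d.-homog -> (size (dehom F) <= d.+1)%N.
Proof.
move=> hF; rewrite dehomE big_seq.
apply: (big_ind (fun q : {poly k} => (size q <= d.+1)%N)) => [|q1 q2 h1 h2|m mF].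
- by rewrite size_poly0.
- by apply: leq_trans (size_polyD _ _) _; rewrite geq_max h1.
- by apply: leq_trans (size_scale_leq _ _) _; rewrite size_polyXn ltnS; case: (homog_supp hF mF).
Qed.

Lemma hev_dehom d F (x : 'I_2 -> k) : F \is d.-homog -> hev d (dehom F) (x ord0, x ord_max) = F.@[x].
Proof.
move=> hF; rewrite dehomE mevalE hev_sum !big_seq; apply: eq_bigr => m mF; rewrite hevZ; congr (_ * _).
have [m0 m1] := homog_supp hF mF.
rewrite !big_ord_recl big_ord0 mulr1 m0 (_ : lift ord0 ord0 = ord_max :> 'I_2); last exact: val_inj.
rewrite /hev (bigD1 (Ordinal (m1 : (m ord_max < d.+1)%N)))//= coefXn eqxx mul1r big1 ?addr0// => i.
by rewrite -val_eqE /= => /negPf im; rewrite coefXn im !mul0r.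
Qed.

Lemma coef_dehom d F (m : 'X_{1..2}) : F \is d.-homog -> mdeg m = d -> (dehom F)`_(m ord_max) = F@_m.
Proof.
move=> hF md; rewrite dehomE coef_sum [in RHS](mpolyE F) (raddf_sum (mcoeff m)) /= !big_seq; apply: eq_bigr => m' m'F.
rewrite coefZ coefXn mcoeffZ mcoeffX; congr (_ * _%:R).
have [m0 m1] := homog_supp hF m'F; rewrite eq_sym; apply/esym; congr (nat_of_bool _).
apply/eqP/eqP => [->//|E]; apply/mnmP => i.
have [->|->] : i = ord0 \/ i = ord_max; last by [].
  by case: i => [[|[|//]] ilt]; [left|right]; apply: val_inj.
by rewrite m0 E -md mdeg2 addnK.
Qed.

Lemma dehom_inj d F G : F \is d.-homog -> G \is d.-homog -> dehom F = dehom G -> F = G.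
Proof.
move=> hF hG FG; apply/mpolyP => m; have [md|md] := eqVneq (mdeg m) d.
  by rewrite -(coef_dehom hF md) FG (coef_dehom hG md).
by rewrite !(dhomog_nemf_coeff _ md).
Qed.

Lemma homog_eq d F G : F \is d.-homog -> G \is d.-homog -> (forall x, F.@[x] = G.@[x]) -> F = G.
Proof.
move=> hF hG FG; apply: (dehom_inj hF hG); apply: (hev_eq (size_dehom hF) (size_dehom hG)) => x.
pose y (i : 'I_2) := if i == ord0 then x.1 else x.2.
by case: x @y => a b y; rewrite -[(a, b)]/(y ord0, y ord_max) (hev_dehom _ hF) (hev_dehom _ hG).
Qed.

Lemma homog_mul d1 d2 d F G : F \is d1.-homog -> G \is d2.-homog -> d = (d1 + d2)%N -> F * G \is d.-homog.
Proof. by move=> hF hG ->; apply: dhomogM. Qed.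

Lemma homog_exp n F : F \is 1.-homog -> F ^+ n \is n.-homog.
Proof. by move=> /(dhomogMn n); rewrite mul1n. Qed.

Lemma homog_var (i : 'I_2) : ('X_i : {mpoly k[2]}) \is 1.-homog.
Proof. by rewrite dhomogX /= mdeg1. Qed.

Definition rehom d (p : {poly k}) : {mpoly k[2]} := \sum_(i < d.+1) p`_i *: ('X_ord0 ^+ (d - i) * 'X_ord_max ^+ i).

Lemma rehom_homog d p : rehom d p \is d.-homog.
Proof.
apply: rpred_sum => i _; apply: rpredZ.
by apply: (homog_mul (homog_exp _ (homog_var _)) (homog_exp _ (homog_var _))); rewrite subnK// -ltnS.
Qed.

Lemma meval_rehom d p x : (rehom d p).@[x] = hev d p (x ord0, x ord_max).
Proof.
rewrite /rehom raddf_sum; apply: eq_bigr => i _ /=.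
by rewrite mevalZ mevalM !rmorphXn /= !mevalXU mulrA.
Qed.

Lemma rehomK d (p : {poly k}) : (size p <= d.+1)%N -> dehom (rehom d p) = p.
Proof.
move=> sp; apply: (hev_eq (size_dehom (rehom_homog d p)) sp) => x.
pose y (i : 'I_2) := if i == ord0 then x.1 else x.2.
case: x @y => a b y; rewrite -[(a, b)]/(y ord0, y ord_max) (hev_dehom _ (rehom_homog d p)).
exact: meval_rehom.
Qed.

Definition mx_row (g : 'M[k]_2) (i : 'I_2) : pt := (g i ord0, g i ord_max).

Lemma br_mx_row (g : 'M[k]_2) : br (mx_row g ord0) (mx_row g ord_max) = \det g.
Proof.
rewrite (expand_det_row _ ord0) !big_ord_recl big_ord0 addr0 /cofactor !det_mx11 !mxE /= /br /mx_row /=.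
have -> : lift ord0 ord0 = ord_max :> 'I_2 by apply: val_inj.
have -> : lift ord_max ord0 = ord0 :> 'I_2 by apply: val_inj.
by rewrite expr0 expr1 mul1r mulN1r mulrN.
Qed.

Definition frame_mx (r s : pt) : 'M[k]_2 :=
  \matrix_(i, j) (if i == ord0 then if j == ord0 then r.1 else r.2 else if j == ord0 then s.1 else s.2).

Lemma mx_row_frame r s : mx_row (frame_mx r s) ord0 = r /\ mx_row (frame_mx r s) ord_max = s.
Proof. by rewrite /mx_row !mxE /=; case: r s => a b [c e]. Qed.

Lemma dehom_subst d g F : F \is d.-homog ->
  dehom (sl2_subst g F) = frm d (dehom F) (mx_row g ord0) (mx_row g ord_max).
Proof.
move=> hF; have hg := sl2_subst_homog g hF.
apply: (hev_eq (size_dehom hg) (size_frm _ _ _ _)) => x.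
pose y (i : 'I_2) := if i == ord0 then x.1 else x.2.
rewrite hev_frm; case: x @y => a b y; rewrite -[(a, b)]/(y ord0, y ord_max) (hev_dehom _ hg).
rewrite comp_mpoly_meval -(hev_dehom _ hF); congr (hev d _ _).
rewrite !tnth_mktuple !(raddf_sum (meval y)) /= !big_ord_recl !big_ord0 !mevalZ !mevalXU /comb /mx_row /= !addr0.
have -> : lift ord0 ord0 = ord_max :> 'I_2 by apply: val_inj.
by congr (_, _); rewrite /y /= [_ * a]mulrC [_ * b]mulrC.
Qed.

Lemma comb_lab (r s x : pt) : br r s = 1 -> comb (lab r s x) r s = x.
Proof.
move=> rs; case: x => a b; rewrite /comb /lab /br /=; congr (_, _).
  by transitivity (a * br r s); [rewrite /br; ring|rewrite rs mulr1].
by transitivity (b * br r s); [rewrite /br; ring|rewrite rs mulr1].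
Qed.

Lemma vanishes_of_coef d m F (q : 'rV[k]_2) s : F \is d.-homog -> (m <= d)%N ->
  br (q 0 ord0, q 0 ord_max) s = 1 ->
  (forall i, (i < m)%N -> (frm d (dehom F) (q 0 ord0, q 0 ord_max) s)`_i = 0) -> vanishes_to_order q m F.
Proof.
set r := (_, _) => hF md rs low; pose c := frm d (dehom F) r s.
pose Y1 : {mpoly k[2]} := s.2 *: 'X_ord0 - s.1 *: 'X_ord_max.
pose Y2 : {mpoly k[2]} := r.1 *: 'X_ord_max - r.2 *: 'X_ord0.
have lin_homog (u v : k) (i j : 'I_2) : (u *: 'X_i - v *: 'X_j : {mpoly k[2]}) \is 1.-homog.
  by apply: rpredB; apply: rpredZ; apply: homog_var.
(* The sign arises because the local equation [q_1 X_0 - q_0 X_1] is minus the second coordinate in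
   the frame. *)
exists ((-1) ^+ m *: \sum_(i < (d - m).+1) c`_(m + i) *: (Y1 ^+ (d - m - i) * Y2 ^+ i)).
apply: (homog_eq hF).
  have hs : (-1) ^+ m *: \sum_(i < (d - m).+1) c`_(m + i) *: (Y1 ^+ (d - m - i) * Y2 ^+ i) \is (d - m).-homog.
    apply: rpredZ; apply: rpred_sum => i _; apply: rpredZ.
    by apply: (homog_mul (homog_exp _ (lin_homog _ _ _ _)) (homog_exp _ (lin_homog _ _ _ _))); rewrite subnK// -ltnS.
  by apply: (homog_mul (homog_exp _ (lin_homog _ _ _ _)) hs); rewrite subnKC.
move=> x; set xx : pt := (x ord0, x ord_max).
have e1 : Y1.@[x] = (lab r s xx).1 by rewrite mevalB !mevalZ !mevalXU /lab /br /=; ring.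
have e2 : Y2.@[x] = (lab r s xx).2 by rewrite mevalB !mevalZ !mevalXU /lab /br /=; ring.
have el : (q 0 ord_max *: 'X_ord0 - q 0 ord0 *: 'X_ord_max).@[x] = - (lab r s xx).2.
  by rewrite mevalB !mevalZ !mevalXU /lab /br /=; ring.
move: e1 e2 el; set l1 := (lab r s xx).1; set l2 := (lab r s xx).2 => e1 e2 el.
rewrite -(hev_dehom x hF) -/xx -{1}(comb_lab xx rs) -hev_frm -/c.
rewrite mevalM rmorphXn /= el mevalZ raddf_sum /= [(- l2) ^+ m]exprNn.
have s1 : (-1) ^+ m * (-1) ^+ m = 1 :> k by rewrite -exprMn mulrNN mulr1 expr1n.
set S := \sum_i _; have -> : (-1) ^+ m * l2 ^+ m * ((-1) ^+ m * S) = l2 ^+ m * S.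
  by transitivity ((-1) ^+ m * (-1) ^+ m * (l2 ^+ m * S)); [ring|rewrite s1 mul1r].
rewrite {}/S.
rewrite /hev -(big_mkord predT (fun i => c`_i * _ ^+ (d - i) * _ ^+ i)).
rewrite (@big_cat_nat _ _ _ m)//=; last exact: leqW.
rewrite big1_seq ?add0r => [|i]; last by rewrite mem_index_iota => /andP[_ im]; rewrite low// !mul0r.
rewrite -{1}(add0n m) big_addn big_mkord subSn// mulr_sumr; apply: eq_bigr => i _.
rewrite mevalZ mevalM !rmorphXn /= e1 e2 [(i + m)%N]addnC subnDA exprD.
by ring.
Qed.

Lemma coef_of_vanishes d m F (q : 'rV[k]_2) s : F \is d.-homog ->
  br (q 0 ord0, q 0 ord_max) s = 1 -> vanishes_to_order q m F ->
  forall i, (i < m)%N -> (frm d (dehom F) (q 0 ord0, q 0 ord_max) s)`_i = 0.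
Proof.
set r := (_, _) => hF rs [H FH] i im.
pose hh (i : 'I_2) : {poly k} := if i == ord0 then r.1%:P + s.1 *: 'X else r.2%:P + s.2 *: 'X.
suff -> : frm d (dehom F) r s = 'X^m * ((-1) ^+ m *: mmap (@polyC k) hh H) by rewrite coefXnM im.
apply/eqP; rewrite -subr_eq0; apply/eqP; apply: poly_eq0_forall => T.
rewrite hornerD hornerN -(hev1 T (size_frm _ _ _ _)) hev_frm.
pose x (i : 'I_2) := (hh i).[T].
have -> : comb (1, T) r s = (x ord0, x ord_max).
  by rewrite /comb /x /hh /=; congr (_, _); rewrite !hornerE; ring.
rewrite (hev_dehom x hF) FH mevalM rmorphXn /= mevalB !mevalZ !mevalXU.
have -> : q 0 ord_max * x ord0 - q 0 ord0 * x ord_max = - T.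
  rewrite /x /hh /= !hornerE; transitivity (- T * br r s); last by rewrite rs mulr1.
  by rewrite /br /r /=; ring.
have hH : (mmap (@polyC k) hh H).[T] = H.@[x].
  rewrite mevalE /mmap horner_sum; apply: eq_bigr => mm _.
  rewrite hornerM hornerC; congr (_ * _); rewrite /mmap1 horner_prod; apply: eq_bigr => j _.
  by rewrite horner_exp.
by rewrite hornerM hornerXn hornerZ hH [(- T) ^+ m]exprNn; ring.
Qed.

End Dehomogenization.

Section PolynomialFunctions.
Context (k : fieldType) (V : vectType k).

Lemma polynomial_linear (f : V -> k) : (forall a u v, f (a *: u + v) = a * f u + f v) -> polynomial_fun f.
Proof.
move=> fl; have f0 : f 0 = 0 by have := fl (-1) 0 0; rewrite scaler0 addr0 mulN1r addNr.
exists (\sum_i f (tnth (vbasis {:V}) i) *: 'X_i) => v.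
rewrite {1}(coord_vbasis (memvf v)) raddf_sum /=.
elim/big_rec2: _ => [//|i y1 y2 _ <-]; rewrite fl mevalZ mevalXU mulrC; congr (_ * _ + _).
by rewrite (tnth_nth 0).
Qed.

Lemma polynomial_sum (J : Type) (s : seq J) (F : J -> V -> k) :
  (forall j, polynomial_fun (F j)) -> polynomial_fun (fun v => \sum_(j <- s) F j v).
Proof.
move=> /choice[p pE]; exists (\sum_(j <- s) p j) => v.
by rewrite raddf_sum; apply: eq_bigr => j _; apply: pE.
Qed.

End PolynomialFunctions.

Section WeierstrassData.
Context (k : closedFieldType) (N : nat).
Local Notation pt := (k * k)%type.
Local Notation W := (weierstrass_data k N).
Implicit Types (v w : W).

Definition pA v : {poly k} := dehom v.1.
Definition pB v : {poly k} := dehom v.2.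
Definition wdata (a b : {poly k}) : W := (DHomog (rehom_homog (4 * N) a), DHomog (rehom_homog (6 * N) b)).

Lemma size_pA v : (size (pA v) <= (4 * N).+1)%N.
Proof. exact/size_dehom/dhomog_is_dhomog. Qed.

Lemma size_pB v : (size (pB v) <= (6 * N).+1)%N.
Proof. exact/size_dehom/dhomog_is_dhomog. Qed.

Lemma pA_wdata (a b : {poly k}) : (size a <= (4 * N).+1)%N -> pA (wdata a b) = a.
Proof. exact: rehomK. Qed.

Lemma pB_wdata (a b : {poly k}) : (size b <= (6 * N).+1)%N -> pB (wdata a b) = b.
Proof. exact: rehomK. Qed.

Lemma wdata_eq v w : pA v = pA w -> pB v = pB w -> v = w.
Proof.
case: v w => v1 v2 [w1 w2]; rewrite /pA /pB /= => e1 e2.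
by congr (_, _); apply: val_inj; apply: (dehom_inj (dhomog_is_dhomog _) (dhomog_is_dhomog _)).
Qed.

Lemma dehomD F G : dehom (F + G) = dehom F + dehom G :> {poly k}.
Proof. by rewrite /dehom rmorphD. Qed.

Lemma dehomZ c F : dehom (c *: F) = c *: dehom F :> {poly k}.
Proof. by rewrite /dehom mmapZ mul_polyC. Qed.

Lemma pA_linear a v w : pA (a *: v + w) = a *: pA v + pA w.
Proof. by rewrite /pA /= dehomD dehomZ. Qed.

Lemma pB_linear a v w : pB (a *: v + w) = a *: pB v + pB w.
Proof. by rewrite /pB /= dehomD dehomZ. Qed.

Lemma pA_act gl v : pA (weierstrass_act gl v) =
  val gl.2 ^+ 4 *: frm (4 * N) (pA v) (mx_row (val gl.1) ord0) (mx_row (val gl.1) ord_max).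
Proof. by rewrite /pA /= dehomZ (dehom_subst _ (dhomog_is_dhomog v.1)). Qed.

Lemma pB_act gl v : pB (weierstrass_act gl v) =
  val gl.2 ^+ 6 *: frm (6 * N) (pB v) (mx_row (val gl.1) ord0) (mx_row (val gl.1) ord_max).
Proof. by rewrite /pB /= dehomZ (dehom_subst _ (dhomog_is_dhomog v.2)). Qed.

Lemma br_act (gl : SL2 k * Gm k) : br (mx_row (val gl.1) ord0) (mx_row (val gl.1) ord_max) = 1.
Proof. by rewrite br_mx_row; case: gl => -[g /= /eqP]. Qed.

Lemma exists_gl (r s : pt) (l : k) : br r s = 1 -> l != 0 -> exists gl : SL2 k * Gm k,
  [/\ mx_row (val gl.1) ord0 = r, mx_row (val gl.1) ord_max = s & val gl.2 = l].
Proof.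
move=> rs l0; have [e1 e2] := mx_row_frame r s.
have d1 : \det (frame_mx r s) == 1 by rewrite -br_mx_row e1 e2 rs.
by exists (exist _ (frame_mx r s) d1, exist _ l l0).
Qed.

Lemma polynomial_pA i : polynomial_fun (fun v : W => (pA v)`_i).
Proof. by apply: polynomial_linear => a u v; rewrite pA_linear coefD coefZ. Qed.

Lemma polynomial_pB i : polynomial_fun (fun v : W => (pB v)`_i).
Proof. by apply: polynomial_linear => a u v; rewrite pB_linear coefD coefZ. Qed.

(** [polynomial_fun] refers to an unspecified basis; expanding [v] in monomial data reduces it to
    the coefficients of A and B. The property [Q] will be to be finite, to have a prescribed limit,
    or to become polynomial after multiplication by a power of a given function. *)
Lemma polynomial_fun_coef (I : Type) (Q : (I -> k) -> Prop) (v : I -> W) (f : W -> k) :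
  (forall c, Q (fun=> c)) -> (forall g h, Q g -> Q h -> Q (fun t => g t + h t)) ->
  (forall g h, Q g -> Q h -> Q (fun t => g t * h t)) ->
  (forall i, Q (fun t => (pA (v t))`_i)) -> (forall i, Q (fun t => (pB (v t))`_i)) ->
  polynomial_fun f -> Q (fun t => f (v t)).
Proof.
move=> Qc Qa Qm QA QB [p pE].
have Qsum (J : Type) (s : seq J) (F : J -> I -> k) : (forall j, Q (F j)) -> Q (fun t => \sum_(j <- s) F j t).
  move=> QF; elim: s => [|j s IH]; first by under [fun t => _]funext do rewrite big_nil.
  under [fun t => _]funext do rewrite big_cons; exact: Qa.
have Qprod (J : Type) (s : seq J) (F : J -> I -> k) : (forall j, Q (F j)) -> Q (fun t => \prod_(j <- s) F j t).
  move=> QF; elim: s => [|j s IH]; first by under [fun t => _]funext do rewrite big_nil.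
  under [fun t => _]funext do rewrite big_cons; exact: Qm.
have Qco i : Q (fun t => coord (vbasis {:W}) i (v t)).
  pose X (d : nat) (j : nat) : {poly k} := if (j < d.+1)%N then 'X^j else 0.
  have E t : v t = \sum_(j < (4 * N).+1) (pA (v t))`_j *: wdata 'X^j 0 + \sum_(j < (6 * N).+1) (pB (v t))`_j *: wdata 0 'X^j.
    have lA (J : Type) (s : seq J) (F : J -> W) c w : pA (\sum_(j <- s) c j *: F j + w) = \sum_(j <- s) c j *: pA (F j) + pA w.
      elim: s => [|j s IH]; first by rewrite !big_nil !add0r.
      by rewrite !big_cons -!addrA pA_linear IH.
    have lB (J : Type) (s : seq J) (F : J -> W) c w : pB (\sum_(j <- s) c j *: F j + w) = \sum_(j <- s) c j *: pB (F j) + pB w.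
      elim: s => [|j s IH]; first by rewrite !big_nil !add0r.
      by rewrite !big_cons -!addrA pB_linear IH.
    have pA0 : pA 0 = 0 by have := pA_linear (-1) 0 0; rewrite scaler0 addr0 scaleN1r addNr.
    have pB0 : pB 0 = 0 by have := pB_linear (-1) 0 0; rewrite scaler0 addr0 scaleN1r addNr.
    have sX d (j : 'I_d.+1) : (size ('X^j : {poly k}) <= d.+1)%N by rewrite size_polyXn.
    apply: wdata_eq; rewrite ?lA ?lB -[X in _ = _ + _ X]addr0 ?lA ?lB ?pA0 ?pB0 addr0.
      rewrite [X in _ = _ + X]big1 => [|j _]; last by rewrite pA_wdata ?size_poly0// scaler0.
      rewrite addr0 -[LHS](polyseqK) -[LHS](coefK) polyseqK; apply/polyP => i'.
      rewrite coef_sum; under eq_bigr do rewrite coefZ pA_wdata// coefXn.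
      have [il|il] := ltnP i' (4 * N).+1.
        rewrite coef_poly (bigD1 (Ordinal il))//= eqxx mulr1 big1 ?addr0 => [|j ji].
          by case: ltnP => // h; rewrite nth_default.
        by rewrite -val_eqE eq_sym /= in ji; rewrite (negPf ji) mulr0.
      rewrite coef_poly ltnNge (leq_trans (size_pA _) il) big1// => j _.
      by rewrite gtn_eqF ?mulr0// (leq_trans (ltn_ord j)).
    rewrite big1 => [|j _]; last by rewrite pB_wdata ?size_poly0// scaler0.
    rewrite add0r -[LHS](polyseqK) -[LHS](coefK) polyseqK; apply/polyP => i'.
    rewrite coef_sum; under eq_bigr do rewrite coefZ pB_wdata// coefXn.
    have [il|il] := ltnP i' (6 * N).+1.
      rewrite coef_poly (bigD1 (Ordinal il))//= eqxx mulr1 big1 ?addr0 => [|j ji].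
        by case: ltnP => // h; rewrite nth_default.
      by rewrite -val_eqE eq_sym /= in ji; rewrite (negPf ji) mulr0.
    rewrite coef_poly ltnNge (leq_trans (size_pB _) il) big1// => j _.
    by rewrite gtn_eqF ?mulr0// (leq_trans (ltn_ord j)).
  have -> : (fun t => coord (vbasis {:W}) i (v t)) = fun t =>
     \sum_(j < (4 * N).+1) (pA (v t))`_j * coord (vbasis {:W}) i (wdata 'X^j 0) +
     \sum_(j < (6 * N).+1) (pB (v t))`_j * coord (vbasis {:W}) i (wdata 0 'X^j).
    apply/funext => t; rewrite {1}(E t) linearD !linear_sum.
    by congr (_ + _); apply: eq_bigr => j _; rewrite linearZ.
  by apply: (Qa); apply: Qsum => j; apply: Qm.
have -> : (fun t => f (v t)) = fun t => \sum_(m <- msupp p) p@_m * \prod_(i <- index_enum _) coord (vbasis {:W}) i (v t) ^+ m i.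
  by apply/funext => t; rewrite pE mevalE.
apply: (Qsum) => m; apply: (Qm) => //; apply: (Qprod) => i.
elim: (m i) => [|n IH]; first by under [fun t => _]funext do rewrite expr0.
by under [fun t => _]funext do rewrite exprS; apply: Qm.
Qed.

Lemma T_P v : (0 < N)%N ->
  T_ v <-> minimal N (pA v) (pB v) /\ 4%:R *: pA v ^+ 3 + 27%:R *: pB v ^+ 2 != 0.
Proof.
move=> N0; have h1 := dhomog_is_dhomog v.1; have h2 := dhomog_is_dhomog v.2.
have hD : 4%:R * (v.1 : {mpoly k[2]}) ^+ 3 + 27%:R * (v.2 : {mpoly k[2]}) ^+ 2 \is (12 * N).-homog.
  have H (n d e c : nat) (F : {mpoly k[2]}) : F \is d.-homog -> e = (d * n)%N -> c%:R * F ^+ n \is e.-homog.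
    by move=> hF ->; rewrite mulr_natl; apply: rpredMn; apply: dhomogMn.
  by apply: rpredD; [apply: H h1 _|apply: H h2 _]; lia.
have dE : dehom (4%:R * (v.1 : {mpoly k[2]}) ^+ 3 + 27%:R * (v.2 : {mpoly k[2]}) ^+ 2) = 4%:R *: pA v ^+ 3 + 27%:R *: pB v ^+ 2.
  by rewrite dehomD !mulr_natl -!scaler_nat !dehomZ /dehom !rmorphXn.
have disc : (4%:R * (v.1 : {mpoly k[2]}) ^+ 3 + 27%:R * (v.2 : {mpoly k[2]}) ^+ 2 != 0) = (4%:R *: pA v ^+ 3 + 27%:R *: pB v ^+ 2 != 0).
  rewrite -dE; congr (~~ _); apply/eqP/eqP => [->|E]; first by rewrite /dehom rmorph0.
  by apply: (dehom_inj hD (rpred0 _)); rewrite E /dehom rmorph0.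
pose qr (r : pt) : 'rV[k]_2 := \row_j (if j == ord0 then r.1 else r.2).
have qrE r : (qr r 0 ord0, qr r 0 ord_max) = r by rewrite !mxE; case: r.
have minP : minimal N (pA v) (pB v) <-> forall q : 'rV[k]_2, q != 0 -> ~ vanishes_to_order q 4 v.1 \/ ~ vanishes_to_order q 6 v.2.
  split=> [m q q0|h r s rs].
    have q00 : (q 0 ord0, q 0 ord_max) != 0 :> pt.
      apply: contraNneq q0 => -[e1 e2]; apply/eqP/rowP => j; rewrite mxE.
      by case: j => [[|[|//]] jl]; [rewrite -[RHS]e1|rewrite -[RHS]e2]; congr (q 0 _); apply: val_inj.
    have [s qs] := exists_frame q00.
    have [[i i4 /eqP ci]|[i i6 /eqP ci]] := m _ _ qs; [left|right] => va; apply: ci.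
      exact: (coef_of_vanishes h1 qs va).
    exact: (coef_of_vanishes h2 qs va).
  apply: contrapT => /not_orP[nA nB].
  have rs' : br (qr r 0 ord0, qr r 0 ord_max) s = 1 by rewrite qrE.
  have r0 : qr r != 0.
    apply/eqP => E; move/eqP: rs'; rewrite E !mxE /br /= !mul0r subr0 eq_sym.
    by rewrite oner_eq0.
  case: (h _ r0) => va; apply: va.
    apply: (vanishes_of_coef h1 _ rs') => [|i i4]; first by lia.
    by apply/eqP/negPn/negP => ci; apply: nA; exists i => //; rewrite -[r]qrE.
  apply: (vanishes_of_coef h2 _ rs') => [|i i6]; first by lia.
  by apply/eqP/negPn/negP => ci; apply: nB; exists i => //; rewrite -[r]qrE.
by rewrite minP -disc; split=> -[].
Qed.

End WeierstrassData.

(** * Semistable reduction *)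

Section SemistableReduction.
Context (k : closedFieldType).
Local Notation pt := (k * k)%type.

Lemma lab_comb a b (r s x : pt) : lab (comb a r s) (comb b r s) x = lab a b (lab r s x).
Proof. by rewrite /lab /comb /br /=; congr (_, _); ring. Qed.

Lemma lab_id (x : pt) : lab (1, 0) (0, 1) x = x.
Proof. by case: x => a b; rewrite /lab /br /=; congr (_, _); ring. Qed.

Lemma br_comb2 (a b r s : pt) : br (comb a r s) (comb b r s) = br a b * br r s.
Proof. by rewrite /comb /br /=; ring. Qed.

Context (I : Type) (P : place k I) (L : finType) (r : L -> I -> pt).

(** A family [(g, h)] in SL_2 moves the labels, and after rescaling by [c] they converge to the
    points [r0] of P^1. *)
Definition framed (g h : I -> pt) (c : L -> I -> k) (r0 : L -> pt) :=
  [/\ forall t, br (g t) (h t) = 1, forall x t, c x t != 0, forall x, r0 x != 0 &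
      forall x, tendst P (fun t => scp (c x t) (lab (g t) (h t) (r x t))) (r0 x)].

Lemma framed_ae (g h : I -> pt) (c : L -> I -> k) r0 :
  ae P [set t | br (g t) (h t) = 1] -> (forall x, ae P [set t | c x t != 0]) ->
  (forall x, r0 x != 0) ->
  (forall x, tendst P (fun t => scp (c x t) (lab (g t) (h t) (r x t))) (r0 x)) ->
  exists g' h' c', framed g' h' c' r0.
Proof.
move=> gh c0 r00 tr.
exists (fun t => if br (g t) (h t) == 1 then g t else (1, 0)),
  (fun t => if br (g t) (h t) == 1 then h t else (0, 1)),
  (fun x t => if c x t == 0 then 1 else c x t); split=> //.
- by move=> t; case: ifP => [/eqP//|_]; rewrite /br /=; ring.
- by move=> x t; case: ifP => [_|->]//; rewrite oner_eq0.
move=> x; apply: tendst_ae (tr x); apply: aeW (aeI gh (c0 x)) => t [-> /negPf->].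
by rewrite eqxx.
Qed.

(** Magnification at the limit of [x0]. In the affine coordinate [u] there, [y] is the label of the
    cluster whose distance to [x0] dominates. Dividing by this distance separates [y] from [x0],
    while all labels outside the cluster move to a single point away from the cluster. *)
Lemma split_cluster g h c r0 x0 : framed g h c r0 ->
  ae P [set t | forall x, br (r0 x0) (r0 x) = 0 -> br (r x0 t) (r x t) = 0] \/
  exists g' h' c' r1, framed g' h' c' r1 /\ exists2 y, br (r0 x0) (r0 y) = 0 &
    br (r1 x0) (r1 y) != 0 /\ forall x z, br (r0 x0) (r0 x) = 0 -> br (r0 x0) (r0 z) != 0 ->
    br (r1 x) (r1 z) != 0.
Proof.
move=> [gh c0 r00 tr]; have [e2 e12] := exists_frame (r00 x0); set e1 := r0 x0 in e12 *.
pose R x t := scp (c x t) (lab (g t) (h t) (r x t)).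
have tR' x : tendst P (fun t => lab e1 e2 (R x t)) (lab e1 e2 (r0 x)).
  by apply: tendst_lab (tr x); apply: tendst_cst.
pose xi x t := br (R x t) e2; pose eta x t := br e1 (R x t).
have txi x : tends P (xi x) (br (r0 x) e2) := (tR' x).1.
have teta x : tends P (eta x) (br e1 (r0 x)) := (tR' x).2.
have xi0 x : br e1 (r0 x) = 0 -> br (r0 x) e2 != 0.
  move=> ex; apply: contraTneq (oner_neq0 k) => xe2.
  by rewrite -e12 (br_trans (r00 x) ex xe2) eqxx.
pose u x t := eta x t / xi x t.
have tu x : br e1 (r0 x) = 0 -> tends P (u x) 0.
  move=> ex; rewrite -(mul0r (br (r0 x) e2)^-1).
  by apply: tends_div (xi0 x ex) => //; rewrite -ex.
have ex0 : br e1 (r0 x0) = 0 by rewrite brr.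
have rE x z t : xi x t != 0 -> xi z t != 0 -> (br (r x t) (r z t) == 0) = (u z t - u x t == 0).
  move=> X Z; have -> : u z t - u x t = br (R x t) (R z t) / (xi x t * xi z t).
    have <- : br (xi x t, eta x t) (xi z t, eta z t) = br (R x t) (R z t).
      by transitivity (br (lab e1 e2 (R x t)) (lab e1 e2 (R z t))); [|rewrite br_lab e12 mul1r].
    by rewrite /u /br /=; field; rewrite X Z.
  rewrite mulf_eq0 invr_eq0 mulf_eq0 (negPf X) (negPf Z) !orbF.
  by rewrite br_scp br_lab gh mul1r !mulf_eq0 !(negPf (c0 _ _)).
have xiU : ae P [set t | forall x, br e1 (r0 x) = 0 -> xi x t != 0].
  apply: ae_fin_forall => x; have [E|E] := eqVneq (br e1 (r0 x)) 0.
    by apply: aeW (tends_ne0 (txi x) (xi0 x E)).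
  by apply: aeT => t /eqP; rewrite (negPf E).
pose w x t := if br e1 (r0 x) == 0 then u x t - u x0 t else 0.
have [w0|wN] := aeN P (fun t => forall x, w x t = 0).
  left; apply: aeW (aeI w0 xiU) => t [W X] x ex; apply/eqP; rewrite rE ?X// -(W x) /w ex eqxx.
  by [].
right; have {}wN : ae P [set t | exists x, w x t != 0].
  apply: aeW wN => t; apply: contra_notP => /forallNP W x.
  by apply/eqP/negPn/negP; apply: W.
have [y [wy wfin]] := ae_dominant wN.
have ey : br e1 (r0 y) = 0.
  have [t] := ae_exists wy; rewrite /w; case: ifP => [/eqP//|_]; by rewrite eqxx.
have [om tom] : exists om : L -> k, forall x, tends P (fun t => w x t / w y t) (om x).
  by have [om H] := choice wfin; exists om.
pose D := w y; have tD : tends P D 0.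
  have := tendsB (tu y ey) (tu x0 ex0); rewrite subr0; apply: tends_ext => t.
  by rewrite /D /w ey eqxx.
(* A square root of the magnification factor, so that the triangular matrix with diagonal [E^-1],
   [E] has determinant 1. *)
have /choice[E EE] : forall t, exists e, e ^+ 2 = D t.
  move=> t; have [e] := solve_monicpoly (fun i => if i == 0%N then D t else 0) (isT : (0 < 2)%N).
  by rewrite !big_ord_recl big_ord0 /= mul0r !addr0 expr0 mulr1 => E; exists e.
have EU : ae P [set t | E t != 0].
  by apply: aeW wy => t; rewrite -[w y t]EE; apply: contraNneq => ->; rewrite expr0n.
pose a t : pt := ((E t)^-1, u x0 t / E t); pose b t : pt := (0, E t).
pose c' x t := if br e1 (r0 x) == 0 then c x t / (E t * xi x t) else c x t * E t.
pose r1 x : pt := if br e1 (r0 x) == 0 then (1, om x) else (0, br e1 (r0 x)).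
have labE x t : lab (comb (a t) (comb e1 (g t) (h t)) (comb e2 (g t) (h t)))
    (comb (b t) (comb e1 (g t) (h t)) (comb e2 (g t) (h t))) (r x t) =
    scp (c x t)^-1 (lab (a t) (b t) (xi x t, eta x t)).
  rewrite !lab_comb -lab_scp; congr (lab (a t) (b t) _).
  rewrite -[(_, _)]/(lab e1 e2 (R x t)) /R lab_scp /scp /= !mulrA mulVf ?c0// !mul1r.
  by [].
have lab_ab x t : lab (a t) (b t) (xi x t, eta x t) = (E t * xi x t, (eta x t - u x0 t * xi x t) / E t).
  by rewrite /lab /br /a /b /=; congr (_, _); ring.
have [||||g' [h' [c1 F]]] := @framed_ae (fun t => comb (a t) (comb e1 (g t) (h t)) (comb e2 (g t) (h t)))
   (fun t => comb (b t) (comb e1 (g t) (h t)) (comb e2 (g t) (h t))) c' r1.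
- apply: aeW EU => t Et; rewrite !br_comb2 gh e12 !mulr1 /br /=; field; exact: Et.
- move=> x; apply: aeW (aeI EU xiU) => t [Et X]; rewrite /c'; case: ifP => [/eqP ex|_]; last by rewrite mulf_neq0.
  by rewrite mulf_neq0 ?invr_neq0 ?mulf_neq0 ?X.
- move=> x; rewrite /r1; case: ifP => [_|/negbT ex].
    by apply/eqP => -[/eqP]; rewrite oner_eq0.
  by apply: contra_neq ex => -[].
- move=> x; have [/eqP ex|ex] := boolP (br e1 (r0 x) == 0).
    have : tendst P (fun t => (1, w x t / w y t)) (1, om x) by split=> //=; exact: tends_cst.
    rewrite /r1 ex eqxx; apply: tendst_ae; apply: aeW (aeI EU xiU) => t [Et X].
    have Xx := X x ex; rewrite labE lab_ab /c' ex eqxx /scp /w ex eqxx ey eqxx /=.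
    have -> : u y t - u x0 t = E t ^+ 2 by rewrite EE /D /w ey eqxx.
    by congr (_, _); rewrite /u; field; rewrite ?c0 ?Et ?Xx ?(X x0 ex0).
  have : tendst P (fun t => (D t * xi x t, eta x t - u x0 t * xi x t)) (0 * br (r0 x) e2, br e1 (r0 x) - 0 * br (r0 x) e2).
    by split=> /=; [exact: tendsM|apply: tendsB => //; apply: tendsM => //; exact: tu].
  rewrite /r1 (negPf ex) !mul0r subr0; apply: tendst_ae; apply: aeW EU => t Et.
  by rewrite labE lab_ab /c' (negPf ex) /scp /= -EE; congr (_, _); field; rewrite ?c0 ?Et.
exists g', h', c1, r1; split=> //; exists y => //.
split; last first.
  move=> x z ex ez; rewrite /r1 ex eqxx (negPf ez) /br /=; by rewrite mul1r mulr0 subr0.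
rewrite /r1 ex0 ey eqxx /br /= !mul1r !mulr1.
have -> : om y = 1.
  apply: tends_uniq (tom y) _; apply: tends_ae (tends_cst P 1).
  by apply: aeW wy => t Y; rewrite mulfV.
have -> : om x0 = 0.
  apply: tends_uniq (tom x0) _; apply: tends_ext (tends_cst P 0) => t.
  by rewrite /w ex0 eqxx subrr mul0r.
by rewrite subr0 oner_eq0.
Qed.

Definition cluster (r0 : L -> pt) x : {set L} := finset (fun z => br (r0 x) (r0 z) == 0).

Lemma in_cluster r0 x z : (z \in cluster r0 x) = (br (r0 x) (r0 z) == 0).
Proof. by rewrite finset.in_set. Qed.

(** As long as some cluster has more than half of the labels, it is split. Each new cluster lies in
    a proper part of the old one or in its complement, which has less than half of the labels; hence
    the bound on the sizes drops. *)
Theorem semistable_reduction : (forall x, ae P [set t | r x t != 0]) ->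
  (exists x0 (C : {set L}), (#|L| < 2 * #|C|)%N /\ ae P [set t | forall x, x \in C -> br (r x0 t) (r x t) = 0]) \/
  exists g h c r0, framed g h c r0 /\ forall x, (2 * #|cluster r0 x| <= #|L|)%N.
Proof.
move=> rU; suff H m : (exists g h c r0, framed g h c r0 /\ forall x, (#|cluster r0 x| <= m)%N) ->
  (exists x0 (C : {set L}), (#|L| < 2 * #|C|)%N /\ ae P [set t | forall x, x \in C -> br (r x0 t) (r x t) = 0]) \/
  exists g h c r0, framed g h c r0 /\ forall x, (2 * #|cluster r0 x| <= #|L|)%N.
  apply: (H #|L|).
  have /choice[f] := fun x => exists_primitive (rU x).
  move=> /choice[q] /choice[q0] fq.
  have [||||g' [h' [c1 F]]] := @framed_ae (fun=> (1, 0)) (fun=> (0, 1)) (fun x t => (f x t)^-1) q0.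
  - by apply: aeT => t; rewrite /br /=; ring.
  - by move=> x; apply: aeT => t; rewrite invr_neq0//; case: (fq x).
  - by move=> x; case: (fq x).
  - move=> x; case: (fq x) => f0 E t0 _; apply: tendst_ae t0; apply: aeW (rU x) => t rx.
    rewrite lab_id; case: (E t) rx => -> ; last by rewrite eqxx.
    by move=> _; rewrite /scp /= !mulrA mulVf// !mul1r; case: (q x t).
  by exists g', h', c1, q0; split=> // x; apply: max_card.
elim/ltn_ind: m => m IH [g [h [c [r0 [F cl]]]]].
have [big|/forallNP small] := pselect (exists x0, (#|L| < 2 * #|cluster r0 x0|)%N); last first.
  by right; exists g, h, c, r0; split=> // x; rewrite leqNgt; apply/negP.
have [x0 bx0] := big; set C := cluster r0 x0 in bx0.
have [par|[g' [h' [c' [r1 [F1 [y ey [yx0 cross]]]]]]]] := split_cluster x0 F.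
  left; exists x0, C; split=> //; apply: aeW par => t H x; rewrite in_cluster => /eqP; exact: H.
have r10 x : r1 x != 0 by case: F1.
have Cm : (#|C| <= m)%N by apply: cl.
have x0C : x0 \in C by rewrite in_cluster brr.
have yC : y \in C by rewrite inE ey.
apply: (IH #|C|.-1); first by move: Cm bx0; case: #|C| => [|?]; lia.
exists g', h', c', r1; split=> // x; have [xC|xC] := boolP (x \in C).
  have sub : cluster r1 x \subset C :\ (if br (r1 x) (r1 y) == 0 then x0 else y).
    apply/fintype.subsetP => z; rewrite !inE ?in_cluster => /eqP xz; apply/andP; split; last first.
      by apply: contraT => ez; have := cross x z; rewrite xz eqxx => /(_ _ ez)/implyP; move: xC; rewrite in_cluster => /eqP-> /(_ erefl).
    case: ifP => [/eqP xy|xy]; apply: contraTneq isT => ezy; rewrite ezy in xz; last by rewrite xz eqxx in xy.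
    by move: yx0; rewrite (br_trans (r10 x) _ xy) ?eqxx// brC xz oppr0.
  apply: leq_trans (subset_leq_card sub) _; set w := if _ then _ else _.
  have wC : w \in C by rewrite /w; case: ifP.
  by rewrite (cardsD1 w C) wC add1n.
have sub : cluster r1 x \subset ~: C.
  apply/fintype.subsetP => z; rewrite !inE ?in_cluster => /eqP xz; apply/negP => /eqP zC.
  have z1 : br (r1 z) (r1 x) = 0 by rewrite brC xz oppr0.
  have := cross z x zC; rewrite z1 eqxx => H.
  by move: xC; rewrite in_cluster => xC; have := H xC.
apply: leq_trans (subset_leq_card sub) _; have := cardsC C; have := max_card (pred_of_set C).
by move: bx0; lia.
Qed.

End SemistableReduction.

Lemma digits_inj B n (a b : nat -> nat) : (forall i, (i < n)%N -> (a i < B)%N) -> (forall i, (i < n)%N -> (b i < B)%N) ->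
  (\sum_(i < n) a i * B ^ i = \sum_(i < n) b i * B ^ i)%N -> forall i, (i < n)%N -> a i = b i.
Proof.
elim: n a b => [|n IH] a b aB bB; first by [].
have [B0|B0] := posnP B; first by have := aB 0%N isT; rewrite B0.
rewrite !big_ord_recl /= expn0 !muln1.
have E (c : nat -> nat) : (\sum_(i < n) c (bump 0 i) * B ^ bump 0 i = B * \sum_(i < n) c i.+1 * B ^ i)%N.
  by rewrite big_distrr; apply: eq_bigr => i _; rewrite /= /bump /= add1n expnS mulnCA.
rewrite !E => H.
have H0 : a 0%N = b 0%N.
  by have := congr1 (modn^~ B) H; rewrite /= ![(_ + B * _)%N]addnC ![(B * _)%N]mulnC !modnMDl !modn_small ?aB ?bB.
have HS : (\sum_(i < n) a i.+1 * B ^ i = \sum_(i < n) b i.+1 * B ^ i)%N.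
  move: H; rewrite H0 => /addnI/eqP; rewrite eqn_pmul2l// => /eqP.
  by [].
case=> [//|i]; rewrite ltnS => i_n.
by apply: (IH (fun i => a i.+1) (fun i => b i.+1)) => // j jn; [exact: aB|exact: bB].
Qed.

(** * Symmetric polynomials in the roots of a form *)

Section Descent.
Context (k : closedFieldType).
Local Notation pt := (k * k)%type.

Lemma exists_uniq_seq m : exists2 s : seq k, uniq s & size s = m.
Proof.
elim: m => [|m [s us sm]]; first by exists [::].
have /closed_nonrootP[y] : \prod_(x <- s) ('X - x%:P) != 0 :> {poly k}.
  by apply/monic_neq0/monic_prod_XsubC.
rewrite root_prod_XsubC => ys; exists (y :: s); last by rewrite /= sm.
by rewrite /= ys.
Qed.

Lemma coef_lagrange m (t : seq k) e : uniq t -> size t = m ->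
  exists lam : 'I_m -> k, forall p : {poly k}, (size p <= m)%N -> p`_e = \sum_j lam j * p.[t`_j].
Proof.
move=> ut tm.
pose l (j : 'I_m) : {poly k} := \prod_(i < m | i != j) ((t`_j - t`_i)^-1 *: ('X - (t`_i)%:P)).
have tinj (i j : 'I_m) : i != j -> t`_j - t`_i != 0.
  by move=> ij; rewrite subr_eq0 nth_uniq ?tm// eq_sym.
have lE (i j : 'I_m) : (l j).[t`_i] = (i == j)%:R.
  rewrite horner_prod; have [->|ij] := eqVneq i j.
    by rewrite big1// => h hj; rewrite !hornerE mulVf// tinj.
  by rewrite (bigD1 i)//= !hornerE subrr mulr0 mul0r.
have sl j : (size (l j) <= m)%N.
  have m0 : (0 < m)%N := leq_ltn_trans (leq0n j) (ltn_ord j).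
  have H (s : seq 'I_m) (Q : pred 'I_m) : (size (\prod_(i <- s | Q i) ((t`_j - t`_i)^-1 *: ('X - (t`_i)%:P)))%R <= (count Q s).+1)%N.
    elim: s => [|i s IH]; first by rewrite big_nil size_poly1.
    rewrite big_cons /=; case: (Q i) => //; apply: leq_trans (size_polyMleq _ _) _.
    have s2 : (size ((t`_j - t`_i)^-1 *: ('X - (t`_i)%:P))%R <= 2)%N.
      by apply: leq_trans (size_scale_leq _ _) _; rewrite size_XsubC.
    by rewrite -subn1 leq_subLR add1n; apply: leq_trans (leq_add s2 IH) _.
  have {}H := H (index_enum 'I_m) (fun i => i != j); apply: leq_trans H _.
  rewrite -sum1_count sum1_card (eq_card (_ : _ =i predC1 j))//.
  by rewrite cardC1 card_ord prednK.
exists (fun j => (l j)`_e) => p sp.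
suff pE : p = \sum_(j < m) p.[t`_j] *: l j.
  by rewrite {1}pE coef_sum; apply: eq_bigr => j _; rewrite coefZ mulrC.
apply/eqP; rewrite -subr_eq0; apply/eqP/(@roots_geq_poly_eq0 _ _ t) => //.
  apply/allP => x /(nthP 0)[i]; rewrite tm => im <-; rewrite rootE hornerD hornerN horner_sum.
  rewrite (bigD1 (Ordinal im))//= big1 => [|j ji].
    by rewrite hornerZ (lE (Ordinal im)) eqxx mulr1 addr0 subrr.
  by rewrite hornerZ (lE (Ordinal im)) eq_sym (negPf ji) mulr0.
rewrite tm; apply: leq_trans (size_polyD _ _) _; rewrite geq_max sp size_polyN.
apply: (big_ind (fun q : {poly k} => (size q <= m)%N)) => [|q1 q2 h1 h2|j _].
- by rewrite size_poly0.
- by apply: leq_trans (size_polyD _ _) _; rewrite geq_max h1.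
- by apply: leq_trans (size_scale_leq _ _) _.
Qed.

Section LabelSpan.
Context (T : Type) (K : (T -> k) -> Prop).
Hypothesis K_cst : forall c, K (fun=> c).
Hypothesis K_add : forall f g, K f -> K g -> K (fun v => f v + g v).
Hypothesis K_mul : forall f g, K f -> K g -> K (fun v => f v * g v).

Lemma K_sum (J : Type) (s : seq J) (Q : pred J) F : (forall j, K (F j)) -> K (fun v => \sum_(j <- s | Q j) F j v).
Proof.
move=> KF; elim: s => [|j s IH].
  by rewrite (_ : (fun v => _) = (fun=> 0)); [exact: K_cst|apply/funext => v; rewrite big_nil].
rewrite (_ : (fun v => _) = (fun v => (if Q j then F j v else 0) + \sum_(j <- s | Q j) F j v)); last first.
  by apply/funext => v; rewrite big_cons; case: (Q j); rewrite ?add0r.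
by apply: K_add => //; case: (Q j).
Qed.

Lemma K_prod (J : Type) (s : seq J) (Q : pred J) F : (forall j, K (F j)) -> K (fun v => \prod_(j <- s | Q j) F j v).
Proof.
move=> KF; elim: s => [|j s IH].
  by rewrite (_ : (fun v => _) = (fun=> 1)); [exact: K_cst|apply/funext => v; rewrite big_nil].
rewrite (_ : (fun v => _) = (fun v => (if Q j then F j v else 1) * \prod_(j <- s | Q j) F j v)); last first.
  by apply/funext => v; rewrite big_cons; case: (Q j); rewrite ?mul1r.
by apply: K_mul => //; case: (Q j).
Qed.

Context (n : nat).
Implicit Types (f g : T -> ('I_n -> pt) -> k) (dl ep : 'I_n -> nat).

Definition label_mon dl (al : 'I_n -> nat) (r : 'I_n -> pt) := \prod_x ((r x).1 ^+ (dl x - al x) * (r x).2 ^+ al x).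

(* Polynomials in the labels, multihomogeneous of multidegree [dl], with     *)
(* coefficients in [K].                                                      *)
Inductive lspan dl : (T -> ('I_n -> pt) -> k) -> Prop :=
| lspan_mon c al : K c -> (forall x, (al x <= dl x)%N) -> lspan dl (fun v r => c v * label_mon dl al r)
| lspan_add f g : lspan dl f -> lspan dl g -> lspan dl (fun v r => f v r + g v r).

Lemma lspan_ext dl ep f g : dl =1 ep -> (forall v r, f v r = g v r) -> lspan dl f -> lspan ep g.
Proof.
move=> /funext-> fg; suff -> : f = g by [].
by apply/funext => v; apply/funext => r; apply: fg.
Qed.

Lemma lspan0 dl : lspan dl (fun _ _ => 0).
Proof.
apply: (@lspan_ext dl dl (fun v r => 0 * label_mon dl (fun=> 0%N) r)) => // [v r|].
  by rewrite mul0r.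
exact: lspan_mon (K_cst 0) _.
Qed.

Lemma lspanM dl ep f g : lspan dl f -> lspan ep g -> lspan (fun x => dl x + ep x)%N (fun v r => f v r * g v r).
Proof.
elim=> [c al Kc ald|f1 f2 _ IH1 _ IH2] fg; last first.
  apply: (lspan_ext _ _ (lspan_add (IH1 fg) (IH2 fg))) => // v r.
  by rewrite mulrDl.
elim: fg => [c' be Kc' bee|g1 g2 _ IH1 _ IH2]; last first.
  apply: (lspan_ext _ _ (lspan_add IH1 IH2)) => // v r.
  by rewrite mulrDr.
have le x : (al x + be x <= dl x + ep x)%N by apply: leq_add.
apply: (lspan_ext _ _ (lspan_mon (K_mul Kc Kc') le)) => // v r.
rewrite mulrACA; congr (_ * _); rewrite /label_mon -big_split; apply: eq_bigr => x _ /=.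
have -> : (dl x + ep x - (al x + be x) = (dl x - al x) + (ep x - be x))%N.
  by have := ald x; have := bee x; lia.
by rewrite !exprD mulrACA.
Qed.

Lemma lspan_cst c : K c -> lspan (fun=> 0%N) (fun v _ => c v).
Proof.
move=> Kc; apply: (lspan_ext _ _ (@lspan_mon (fun=> 0%N) c (fun=> 0%N) Kc _)) => // v r.
by rewrite /label_mon big1 ?mulr1// => x _; rewrite !expr0 mulr1.
Qed.

Lemma lspan_sum (J : Type) (s : seq J) (Q : pred J) dl F : (forall j, Q j -> lspan dl (F j)) ->
  lspan dl (fun v r => \sum_(j <- s | Q j) F j v r).
Proof.
move=> h; elim: s => [|j s IH].
  by apply: (lspan_ext _ _ (lspan0 dl)) => // v r; rewrite big_nil.
have [Qj|Qj] := boolP (Q j).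
  by apply: (lspan_ext _ _ (lspan_add (h j Qj) IH)) => // v r; rewrite big_cons Qj.
by apply: (lspan_ext _ _ IH) => // v r; rewrite big_cons (negPf Qj).
Qed.

Lemma lspan_prod (J : Type) (s : seq J) (Q : pred J) (dl : J -> 'I_n -> nat) F : (forall j, Q j -> lspan (dl j) (F j)) ->
  lspan (fun x => \sum_(j <- s | Q j) dl j x)%N (fun v r => \prod_(j <- s | Q j) F j v r).
Proof.
move=> h; elim: s => [|j s IH].
  by apply: (lspan_ext _ _ (lspan_cst (K_cst 1))) => // [x|v r]; rewrite big_nil.
have [Qj|Qj] := boolP (Q j).
  by apply: (lspan_ext _ _ (lspanM (h j Qj) IH)) => // [x|v r]; rewrite big_cons Qj.
by apply: (lspan_ext _ _ IH) => // [x|v r]; rewrite big_cons (negPf Qj).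
Qed.

Lemma label_mon_coord x (b : bool) r : label_mon (fun z => (z == x) : nat) (fun z => ((z == x) && b) : nat) r = if b then (r x).2 else (r x).1.
Proof.
rewrite /label_mon (bigD1 x)//= big1 => [|z zx]; last by rewrite (negPf zx) !expr0 mulr1.
by rewrite eqxx; case: b => /=; rewrite ?expr0 ?expr1 ?mulr1 ?mul1r.
Qed.

Lemma lspan_coord x (b : bool) : lspan (fun z => (z == x) : nat) (fun _ r => if b then (r x).2 else (r x).1).
Proof.
have h z : (((z == x) && b) <= (z == x))%N by case: (z == x); case: b.
by apply: (lspan_ext _ _ (lspan_mon (K_cst 1) h)) => // v r; rewrite label_mon_coord mul1r.
Qed.

Lemma lspan_br x y : lspan (fun z => (z == x) + (z == y))%N (fun _ r => br (r x) (r y)).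
Proof.
have h := lspanM (lspan_coord x false) (lspan_coord y true).
have h2 := lspanM (lspan_cst (K_cst (-1))) (lspanM (lspan_coord x true) (lspan_coord y false)).
have h' := lspan_add h h2; apply: (lspan_ext _ _ h') => // v r.
by rewrite /br mulN1r.
Qed.

Context (d : nat).
Local Notation mon al r := (label_mon (fun=> d) (fun x => al x : nat) r).
Implicit Types (al be : {ffun 'I_n -> 'I_d.+1}).

Lemma lspan_normal f : lspan (fun=> d) f -> exists2 C : {ffun 'I_n -> 'I_d.+1} -> T -> k,
  (forall al, K (C al)) & forall v r, f v r = \sum_al C al v * mon al r.
Proof.
elim=> [c al Kc ald|f1 f2 _ [C1 K1 E1] _ [C2 K2 E2]]; last first.
  exists (fun al v => C1 al v + C2 al v) => [al|v r]; first exact: K_add.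
  by rewrite E1 E2 -big_split; apply: eq_bigr => al _; rewrite mulrDl.
pose al' : {ffun 'I_n -> 'I_d.+1} := [ffun x => inord (al x)].
exists (fun be v => if be == al' then c v else 0) => [be|v r]; first by case: (be == al').
rewrite (bigD1 al') //= eqxx big1 => [|be /negPf->]; last by rewrite mul0r.
rewrite addr0; by congr (_ * _); apply: eq_bigr => x _; rewrite ffunE inordK ?ltnS.
Qed.

(** Kronecker substitution: giving label [x] the value [(1, t ^+ (d.+1 ^ x))] sends different
    monomials to different powers of [t]. *)
Lemma label_mon_indep (C : {ffun 'I_n -> 'I_d.+1} -> k) : (forall r, \sum_al C al * mon al r = 0) -> forall al, C al = 0.
Proof.
move=> h be; pose e al := (\sum_(x < n) al x * d.+1 ^ x)%N.
have e_inj : injective e.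
  move=> a b E; pose a' (c : {ffun 'I_n -> 'I_d.+1}) (i : nat) : nat := if insub i is Some x then c x else 0%N.
  have a'E c (x : 'I_n) : a' c x = c x by rewrite /a' valK.
  apply/ffunP => x; apply: val_inj; rewrite /= -!a'E.
  apply: (@digits_inj d.+1 n) (ltn_ord x); rewrite /a'; try by move=> i _; case: insub => [?|//].
  by rewrite (eq_bigr (fun x : 'I_n => a x * d.+1 ^ x)%N) => [|y _]; rewrite ?valK// [LHS]E; apply: eq_bigr => y _; rewrite valK.
have : \sum_al C al *: 'X^(e al) = 0 :> {poly k}.
  apply: poly_eq0_forall => t; rewrite horner_sum -[RHS](h (fun x => (1, t ^+ (d.+1 ^ x)))).
  apply: eq_bigr => al _; rewrite hornerZ hornerXn; congr (_ * _).
  rewrite /label_mon /e -prodrXr; apply: eq_bigr => x _ /=.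
  by rewrite expr1n mul1r -exprM mulnC.
move=> /(congr1 (fun p : {poly k} => p`_(e be))); rewrite coef_sum coef0 (bigD1 be)//= big1 => [|al ab].
  by rewrite coefZ coefXn eqxx mulr1 addr0.
by rewrite coefZ coefXn eq_sym (inj_eq e_inj) (negPf ab) mulr0.
Qed.

Lemma label_mon_perm al (s : 'S_n) r : mon al (fun x => r (s x)) = mon [ffun x => al ((s^-1)%g x)] r.
Proof.
rewrite /label_mon [RHS](reindex_inj (@perm_inj _ s)); apply: eq_bigr => x _.
by rewrite ffunE permK.
Qed.

(** This number encodes the multiset of exponents: in base [n.+1] its digit at place [a] counts the
    labels with exponent [a], and no digit exceeds [n]. The products of values of [kron t] below
    therefore sort the monomials into orbits by powers of [t]. *)
Definition label_weight al := (\sum_(x < n) n.+1 ^ al x)%N.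

Lemma label_weight_perm al be : label_weight al = label_weight be -> exists s : 'S_n, forall x, be x = al (s x).
Proof.
pose cnt (c : {ffun 'I_n -> 'I_d.+1}) (a : nat) := (\sum_(x < n | c x == a :> nat) 1)%N.
have cnt_lt c a : (cnt c a < n.+1)%N.
  by rewrite ltnS /cnt sum1_card -[X in (_ <= X)%N](card_ord n) max_card.
have wE c : label_weight c = (\sum_(a < d.+1) cnt c a * n.+1 ^ a)%N.
  rewrite /label_weight (partition_big (fun x => c x) predT)//=; apply: eq_bigr => a _.
  rewrite /cnt big_distrl /=; apply: eq_big => x; first by rewrite -val_eqE.
  by move=> /eqP->; rewrite mul1n.
rewrite !wE => /(@digits_inj n.+1 d.+1 (cnt al) (cnt be) (fun a _ => cnt_lt al a) (fun a _ => cnt_lt be a)) E.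
have /tuple_permP[s sE] : perm_eq [tuple be x | x < n] [tuple al x | x < n].
  apply/allP => a _ /=; have C (c : {ffun 'I_n -> 'I_d.+1}) : count_mem a [tuple c x | x < n] = cnt c a.
    by rewrite /= count_map -sum1_count big_enum_cond; apply: eq_bigl.
  by rewrite !C E.
exists s => x; have := congr1 (fun t : seq 'I_d.+1 => nth ord0 t x) sE.
by rewrite -!tnth_nth !tnth_mktuple.
Qed.

Definition kron (t : k) : {poly k} := \poly_(a < d.+1) t ^+ (n.+1 ^ a).

Lemma prod_hev_kron t r : \prod_x hev d (kron t) (r x) = \sum_al t ^+ label_weight al * mon al r.
Proof.
under eq_bigr => x _ do rewrite /hev; rewrite bigA_distr_bigA /=; apply: eq_bigr => al _.
rewrite /label_weight /label_mon -prodrXr -big_split; apply: eq_bigr => x _ /=.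
by rewrite coef_poly ltn_ord mulrA.
Qed.

Lemma K_hev m (G : T -> {poly k}) x : (forall i, K (fun v => (G v)`_i)) -> K (fun v => hev m (G v) x).
Proof. by move=> KG; apply: (K_sum _ _ (F := fun i v => _)) => i; do 2 (apply: K_mul; last exact: K_cst). Qed.

(** The product is a resultant: up to sign it is also the product of the values of [prodlin r] at
    the roots of [q], and this expression involves the coefficients of the form only. *)
Lemma prod_hev_descent (q : {poly k}) : (0 < d)%N -> (size q <= d.+1)%N -> exists2 H : {poly k} -> k,
  (forall r : 'I_n -> pt, \prod_x hev d q (r x) = H (prodlin r)) &
  forall G : T -> {poly k}, (forall i, K (fun v => (G v)`_i)) -> K (fun v => H (G v)).
Proof.
move=> d0; rewrite -{1 2}(card_ord d) => sq; have [|s sE] := exists_prodlin _ sq; first by rewrite card_ord.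
exists (fun p => \prod_j ((-1) ^+ n * hev n p (s j))) => [r|G KG].
  rewrite -sE; under eq_bigr do rewrite hev_prodlin; rewrite exchange_big; apply: eq_bigr => j _ /=.
  have -> : hev n (prodlin r) (s j) = \prod_x br (r x) (s j) by rewrite -hev_prodlin card_ord.
  have <- : \prod_(x < n) -1 = (-1) ^+ n :> k by rewrite prodr_const card_ord.
  by rewrite -big_split; apply: eq_bigr => x _ /=; rewrite mulN1r -brC.
apply: (K_prod _ _ (F := fun j v => _)) => j; apply: K_mul; first exact: K_cst.
exact: K_hev.
Qed.

(* Every symmetric tensor over an infinite field is a linear combination of  *)
(* powers of linear forms; a power is evaluated on the labels of [G] as a    *)
(* product of values of [G].                                                 *)
Theorem symmetric_descent f (G : T -> {poly k}) : (0 < d)%N -> lspan (fun=> d) f ->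
  (forall v (s : 'S_n) r, f v (fun x => r (s x)) = f v r) ->
  (forall i, K (fun v => (G v)`_i)) ->
  exists2 F, K F & forall v r, prodlin r = G v -> f v r = F v.
Proof.
move=> d0 /lspan_normal[C KC fE] fS KG.
have CS v al (s : 'S_n) : C [ffun x => al (s x)] v = C al v.
  apply/eqP; rewrite -subr_eq0; apply/eqP.
  apply: (@label_mon_indep (fun al => C [ffun x => al (s x)] v - C al v)) => r.
  under eq_bigr do rewrite mulrBl; rewrite sumrB; apply/eqP; rewrite subr_eq0; apply/eqP.
  rewrite -[RHS]fE -(fS v s r) fE [RHS](reindex (fun al : {ffun 'I_n -> 'I_d.+1} => [ffun x => al (s x)])) /=.
    apply: eq_bigr => be _; rewrite label_mon_perm; congr (_ * label_mon _ _ r).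
    by apply/funext => x; rewrite !ffunE permKV.
  exists (fun be : {ffun 'I_n -> 'I_d.+1} => [ffun x => be ((s^-1)%g x)]) => be _; apply/ffunP => x; rewrite !ffunE.
    by rewrite permKV.
  by rewrite permK.
have CW v al be : label_weight al = label_weight be -> C al v = C be v.
  move=> /label_weight_perm[s E]; rewrite -(CS v al s); congr (C _ v).
  by apply/ffunP => x; rewrite ffunE E.
pose D := (\max_(al : {ffun 'I_n -> 'I_d.+1}) label_weight al).+1.
have wD al : (label_weight al < D)%N by rewrite ltnS; apply: leq_bigmax.
(* Interpolation at [D] values of [t] isolates each orbit sum. No division by the order of a group
   occurs, so the argument works in every characteristic. *)
have [t ut tD] := exists_uniq_seq D.
have /choice[lam lamE] e := coef_lagrange e ut tD.
have /choice[H HE] : forall j : 'I_D, exists H : {poly k} -> k,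
  (forall r : 'I_n -> pt, \prod_x hev d (kron t`_j) (r x) = H (prodlin r)) /\
  forall G : T -> {poly k}, (forall i, K (fun v => (G v)`_i)) -> K (fun v => H (G v)).
  by move=> j; have [H h1 h2] := prod_hev_descent d0 (size_poly _ _ : (size (kron t`_j) <= d.+1)%N); exists H.
pose c (e : 'I_D) v := if [pick al | label_weight al == e] is Some al then C al v else 0.
have Kc e : K (c e) by rewrite /c; case: pickP => [al _|_] //.
have cE al v : c (Ordinal (wD al)) v = C al v.
  rewrite /c; case: pickP => [be /eqP /= E|/(_ al)]; last by rewrite eqxx.
  exact: CW.
exists (fun v => \sum_e \sum_j c e v * lam e j * H j (G v)) => [|v r rG].
  apply: (K_sum _ _ (F := fun e v => _)) => e; apply: (K_sum _ _ (F := fun j v => _)) => j.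
  by apply: K_mul; [apply: K_mul => //; exact: K_cst|apply: (HE j).2].
rewrite fE (partition_big (fun al => Ordinal (wD al)) predT)//=; apply: eq_bigr => e _.
rewrite (eq_bigr (fun al : {ffun 'I_n -> 'I_d.+1} => c e v * mon al r)) => [|al /eqP<-]; last by rewrite cE.
rewrite -mulr_sumr; under [RHS]eq_bigr do rewrite -mulrA; rewrite -mulr_sumr; congr (_ * _).
pose Q : {poly k} := \sum_(al : {ffun 'I_n -> 'I_d.+1}) mon al r *: 'X^(label_weight al).
have -> : \sum_(al : {ffun 'I_n -> 'I_d.+1} | Ordinal (wD al) == e) mon al r = Q`_e.
  rewrite coef_sum big_mkcond /=; apply: eq_bigr => al _; rewrite coefZ coefXn -val_eqE /= eq_sym.
  by case: eqP; rewrite ?mulr1 ?mulr0.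
rewrite lamE; last first.
  apply: (big_ind (fun q : {poly k} => (size q <= D)%N)) => [|q1 q2 h1 h2|al _].
  - by rewrite size_poly0.
  - by apply: leq_trans (size_polyD _ _) _; rewrite geq_max h1.
  - by apply: leq_trans (size_scale_leq _ _) _; rewrite size_polyXn.
apply: eq_bigr => j _; rewrite -rG -(HE j).1 prod_hev_kron; congr (_ * _).
by rewrite horner_sum; apply: eq_bigr => al _; rewrite hornerZ hornerXn mulrC.
Qed.

End LabelSpan.
End Descent.

(** Sort by the key and pair position [i] with [i + p]: equal keys in a pair would force a run of
    [p.+1] equal keys. *)
Lemma separating_order (T : eqType) (x0 : T) (key : T -> nat) p (l : seq T) : size l = (p + p)%N ->
  (forall c, count (fun z => key z == c) l <= p)%N ->
  exists2 l', perm_eq l' l & forall i, (i < p)%N -> key (nth x0 l' i) != key (nth x0 l' (i + p)).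
Proof.
move=> sl cl; pose le x y := (key x <= key y)%N; pose l' := sort le l.
have pl : perm_eq l' l by rewrite perm_sort.
have le_tr : transitive le by move=> y x z; apply: leq_trans.
have sl' : sorted le l' by apply: sort_sorted => x y; apply: leq_total.
have szl : size l' = (p + p)%N by rewrite size_sort.
exists l' => // i ip; apply/negP => /eqP E.
have := cl (key (nth x0 l' i)); rewrite leqNgt => /negP; apply.
have -> : count (fun z => key z == key (nth x0 l' i)) l = count (fun z => key z == key (nth x0 l' i)) l'.
  by apply/esym; have /seq.permP := pl; apply.
have lenth j j' : (j <= j')%N -> (j' < p + p)%N -> (key (nth x0 l' j) <= key (nth x0 l' j'))%N.
  move=> jj' j'p; apply: (sorted_leq_nth le_tr (fun x => leqnn _) x0 sl') => //; rewrite inE szl//.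
  exact: leq_ltn_trans j'p.
set Q := fun z => key z == _; rewrite -(cat_take_drop i l') count_cat; apply: ltn_addl.
rewrite -(cat_take_drop p.+1 (drop i l')) count_cat; apply: ltn_addr.
have sz : size (take p.+1 (drop i l')) = p.+1 by rewrite size_takel// size_drop szl; lia.
suff : all Q (take p.+1 (drop i l')).
  by rewrite all_count sz => /eqP->.
apply/(all_nthP x0) => j; rewrite sz ltnS => jp; rewrite nth_take// nth_drop /Q.
rewrite eqn_leq; apply/andP; split; last by apply: lenth; lia.
by rewrite E; apply: lenth; lia.
Qed.

(** * Bracket products of perfect matchings *)

Section Matchings.
Context (k : closedFieldType) (p : nat).
Local Notation pt := (k * k)%type.
Local Notation n := (p + p)%N.
Local Notation "''Sn'" := {perm 'I_(p + p)}.
Implicit Types (r : 'I_n -> pt) (s t : 'Sn).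

(* The bracket monomial of the perfect matching [s (i) -- s (p + i)].        *)
Definition bm s r : k := \prod_(i < p) br (r (s (lshift p i))) (r (s (rshift p i))).

Lemma bm_lab s r g h : bm s (fun x => lab g h (r x)) = br g h ^+ p * bm s r.
Proof.
rewrite /bm; under eq_bigr do rewrite br_lab; rewrite big_split /= prodr_const card_ord.
by [].
Qed.

Lemma bm_scp s r c : bm s (fun x => scp (c x) (r x)) = (\prod_x c x) * bm s r.
Proof.
rewrite /bm /=; under eq_bigr do rewrite br_scp; rewrite big_split /=; congr (_ * _).
by rewrite [RHS](reindex_inj (@perm_inj _ s)) big_split_ord big_split.
Qed.

Lemma bm_neq0P s r : reflect (forall i, br (r (s (lshift p i))) (r (s (rshift p i))) != 0) (bm s r != 0).
Proof.
by apply: (iffP idP) => [/prodf_neq0 h i|h]; [apply: h|apply/prodf_neq0 => i _; apply: h].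
Qed.

Definition bms (S : {set 'Sn}) r : k := \prod_(s in S) bm s r.
(** The elementary symmetric function of degree [j] in the values of [bms S] at all permutations of
    the labels. It takes the place of the average over the symmetric group, which can vanish
    identically in positive characteristic. *)
Definition esm (S : {set 'Sn}) j r : k := \sum_(J : {set 'Sn} | #|J| == j) \prod_(t in J) bms S (fun x => r (t x)).

Lemma esm_perm S j t r : esm S j (fun x => r (t x)) = esm S j r.
Proof.
rewrite /esm [RHS](reindex (fun J : {set 'Sn} => [set (u * t)%g | u in J]%SET)) /=.
  apply: eq_big => [J|J _]; first by rewrite card_imset//; apply: mulIg.
  rewrite big_imset /=; last by move=> u v _ _; apply: mulIg.
  apply: eq_bigr => u _; congr (bms S _); apply/funext => x; by rewrite permM.
exists (fun J : {set 'Sn} => [set (u * t^-1)%g | u in J]%SET) => J _; rewrite -imset_comp -[RHS]imset_id;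
  by apply: eq_imset => u /=; rewrite ?mulgK ?mulgKV.
Qed.

Lemma bms_scp S r c : bms S (fun x => scp (c x) (r x)) = (\prod_x c x) ^+ #|S| * bms S r.
Proof. by rewrite /bms; under eq_bigr do rewrite bm_scp; rewrite big_split /= prodr_const. Qed.

Lemma esm_scp S j r c : esm S j (fun x => scp (c x) (r x)) = (\prod_x c x) ^+ (#|S| * j) * esm S j r.
Proof.
rewrite /esm mulr_sumr; apply: eq_bigr => J /eqP<-; rewrite exprM -prodr_const -big_split; apply: eq_bigr => t _ /=.
rewrite bms_scp; congr (_ ^+ _ * _); by rewrite [RHS](reindex_inj (@perm_inj _ t)).
Qed.

Lemma esm_lab S j r g h : br g h = 1 -> esm S j (fun x => lab g h (r x)) = esm S j r.
Proof.
move=> gh; apply: eq_bigr => J _; apply: eq_bigr => t _; apply: eq_bigr => s _.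
by rewrite (bm_lab s (fun x => r (t x))) gh expr1n mul1r.
Qed.

(** If all of them vanished, the product over all permutations [u] of [z * a_u + 1], where [a_u] is
    the value at [u], would be 1 for every [z]; but one factor is 0 for the inverse of [- a_t]. *)
Lemma esm_neq0 S r t : bms S (fun x => r (t x)) != 0 -> exists2 j, (0 < j <= #|{: 'Sn}|)%N & esm S j r != 0.
Proof.
move=> Sr; apply: contrapT => h.
have e0 j : (0 < j)%N -> esm S j r = 0.
  move=> j0; apply/eqP/negPn/negP => ej; apply: h; exists j => //; rewrite j0 /= leqNgt.
  apply: contra ej => jbig; rewrite /esm big1// => J /eqP Jj.
  by move: jbig; rewrite -Jj ltnNge max_card.
pose z := - (bms S (fun x => r (t x)))^-1.
have E : \prod_(u : 'Sn) (z * bms S (fun x => r (u x)) + 1) = \sum_(J : {set 'Sn}) z ^+ #|J| * \prod_(u in J) bms S (fun x => r (u x)).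
  rewrite bigA_distr; apply: eq_bigr => J _; rewrite -big_mkcond /= -prodr_const -big_split.
  by [].
move: E; rewrite (bigD1 t)//= /z mulNr mulVf// addNr mul0r => /esym.
rewrite (partition_big (fun J : {set 'Sn} => inord #|J| : 'I_(#|{: 'Sn}|.+1)) predT)//= big_ord_recl [X in _ + X]big1 => [|j _].
  rewrite addr0 (eq_bigl (pred1 finset.set0)) => [|J].
    by rewrite big_pred1_eq cards0 big_set0 mulr1 expr0 => /eqP; rewrite oner_eq0.
  by rewrite -val_eqE /= inordK ?ltnS ?max_card// cards_eq0.
rewrite (eq_bigr (fun J : {set 'Sn} => z ^+ j.+1 * \prod_(u in J) bms S (fun x => r (u x)))) => [|J].
  rewrite -mulr_sumr (_ : \sum_(J | _) _ = esm S j.+1 r) ?e0 ?mulr0//.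
  by transitivity (esm S j.+1 r); [apply: eq_bigl => J; rewrite -val_eqE /= inordK ?ltnS ?max_card|exact: e0].
by rewrite -val_eqE /= inordK ?ltnS ?max_card// => /eqP->.
Qed.

Lemma esm_neq0_inv S j r : (0 < j)%N -> esm S j r != 0 -> exists t, bms S (fun x => r (t x)) != 0.
Proof.
move=> j0; apply: contraNP => /forallNP h; rewrite /esm big1// => J /eqP Jj.
have [t tJ] : exists t, t \in J by apply/card_gt0P; rewrite Jj.
by rewrite (bigD1 t)//=; have /negP/negPn/eqP-> := h t; rewrite mul0r.
Qed.

Lemma tends_esm (I : Type) (P : place k I) S j (r : 'I_n -> I -> pt) r0 : (forall x, tendst P (r x) (r0 x)) ->
  tends P (fun c => esm S j (fun x => r x c)) (esm S j r0).
Proof.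
move=> tr; apply: tends_sum => J _; apply: tends_prod => t _; apply: tends_prod => s _; apply: tends_prod => i _.
exact: tends_br.
Qed.

Section Span.
Context (T : Type) (K : (T -> k) -> Prop).
Hypothesis K_cst : forall c, K (fun=> c).
Hypothesis K_add : forall f g, K f -> K g -> K (fun v => f v + g v).
Hypothesis K_mul : forall f g, K f -> K g -> K (fun v => f v * g v).

Lemma lspan_bm s t : lspan K (fun=> 1%N) (fun (_ : T) r => bm s (fun x => r (t x))).
Proof.
have h := @lspan_prod k T K K_cst K_mul n 'I_p (index_enum _) predT _ _
  (fun i _ => lspan_br K_cst K_mul (t (s (lshift p i))) (t (s (rshift p i)))).
apply: (lspan_ext _ _ h) => // x /=.
have [y ->] : exists y, x = t (s y) by exists ((s^-1)%g ((t^-1)%g x)); rewrite !permKV.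
under eq_bigr do rewrite !(inj_eq perm_inj).
rewrite big_split /=; transitivity (\sum_(i < n) (y == i))%N; first by rewrite big_split_ord.
by rewrite (bigD1 y)//= eqxx big1// => z; rewrite eq_sym => /negPf->.
Qed.

Lemma lspan_bms (S : {set 'Sn}) t : lspan K (fun=> #|S|) (fun (_ : T) r => bms S (fun x => r (t x))).
Proof.
have h := @lspan_prod k T K K_cst K_mul n _ (index_enum _) (fun s => s \in S) _ _ (fun s _ => lspan_bm s t).
apply: (lspan_ext _ _ h) => // x.
by rewrite sum1_card.
Qed.

Lemma lspan_esm (S : {set 'Sn}) j : lspan K (fun=> (#|S| * j)%N) (fun (_ : T) r => esm S j r).
Proof.
apply: lspan_sum => // J /eqP Jj.
have h := @lspan_prod k T K K_cst K_mul n _ (index_enum _) (fun t => t \in J) _ _ (fun t _ => lspan_bms S t).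
apply: (lspan_ext _ _ h) => // x.
by rewrite sum_nat_const Jj mulnC.
Qed.

End Span.

Section Existence.
Context (r : 'I_n -> pt) (r0 : forall x, r x != 0).

Let key x := find (fun z => br (r x) (r z) == 0) (enum 'I_n).

Lemma keyP x y : (key x == key y) = (br (r x) (r y) == 0).
Proof.
apply/eqP/eqP => [E|xy].
  have hx z : has (fun u => br (r z) (r u) == 0) (enum 'I_n) by apply/hasP; exists z; rewrite ?mem_enum// brr.
  have /eqP h1 := nth_find x (hx x); have /eqP h2 := nth_find x (hx y).
  by apply: br_trans (r0 _) h1 _; rewrite /key in E; rewrite E brC h2 oppr0.
apply: eq_find => z; apply/eqP/eqP => h; last exact: br_trans (r0 y) xy h.
by apply: br_trans (r0 x) _ h; rewrite brC xy oppr0.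
Qed.

Lemma matching_of_seq (l : seq 'I_n) x0 : perm_eq l (enum 'I_n) ->
  (forall i, (i < p)%N -> key (nth x0 l i) != key (nth x0 l (i + p))) ->
  exists2 s : 'Sn, bm s r != 0 & forall i : 'I_n, s i = nth x0 l i.
Proof.
move=> pl kl; have sl : size l = n by rewrite (perm_size pl) size_enum_ord.
have ul : uniq l by rewrite (perm_uniq pl) enum_uniq.
have inj : injective (fun i : 'I_n => nth x0 l i).
  by move=> i j /eqP; rewrite nth_uniq ?sl// => /eqP/val_inj.
exists (perm inj) => [|i]; last by rewrite permE.
apply/bm_neq0P => i; rewrite !permE /= -keyP addnC.
exact: kl.
Qed.

Lemma key_count x l : uniq l -> (count (fun z => key z == key x) l <= #|cluster r x|)%N.
Proof.
move=> ul; rewrite -size_filter cardE; apply: uniq_leq_size.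
  exact: filter_uniq.
by move=> z; rewrite mem_filter mem_enum in_cluster => /andP[]; rewrite keyP brC oppr_eq0.
Qed.

Lemma count_key m l : uniq l -> (forall x, x \in l -> (count (fun z => key z == key x) l <= m)%N) ->
  forall c, (count (fun z => key z == c) l <= m)%N.
Proof.
move=> ul h c; have [/hasP[x xl /eqP<-]|] := boolP (has (fun z => key z == c) l); first exact: h.
by rewrite has_count -leqNgt leqn0 => /eqP->.
Qed.

Lemma exists_matching : (forall x, 2 * #|cluster r x| <= n)%N -> exists s, bm s r != 0.
Proof.
move=> cl; have [p0|p0] := posnP p.
  by exists 1%g; apply/bm_neq0P => -[i ip]; exfalso; move: ip; rewrite p0.
have x0 : 'I_n by apply: (Ordinal (_ : 0 < n)%N); rewrite addn_gt0 p0.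
have [|c|l pl kl] := @separating_order _ x0 key p (enum 'I_n); first by rewrite size_enum_ord.
  apply: count_key (enum_uniq _) _ c => x _; apply: leq_trans (key_count _ (enum_uniq _)) _.
  by have := cl x; lia.
by have [s sr _] := matching_of_seq pl kl; exists s.
Qed.

(** After [x] and [y] are paired, [p.-1] pairs remain to be formed. The strict bound keeps every
    cluster at size at most [p.-1], which is what [separating_order] requires of the rest. *)
Lemma exists_matching_through x y : (forall x, 2 * #|cluster r x| < n)%N -> br (r x) (r y) != 0 ->
  exists s, bm s r != 0 /\ exists i, s (lshift p i) = x /\ s (rshift p i) = y.
Proof.
move=> cl xy; have p0 : (0 < p)%N by have := cl x; lia.
have nxy : x != y by apply: contraNneq xy => ->; rewrite brr.
pose l0 := rem y (rem x (enum 'I_n)).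
have yx : y \in rem x (enum 'I_n) by rewrite mem_rem_uniq ?enum_uniq// !inE eq_sym nxy mem_enum.
have pl0 : perm_eq (enum 'I_n) [:: x, y & l0].
  apply: perm_trans (perm_to_rem (mem_enum _ x)) _; rewrite perm_cons.
  exact: perm_to_rem yx.
have u0 : uniq [:: x, y & l0] by rewrite -(perm_uniq pl0) enum_uniq.
have [_ ul0] : uniq [:: x; y] /\ uniq l0 by move: u0; rewrite -cat1s -[y :: l0]cat1s catA cat_uniq => /and3P[].
have sl0 : size l0 = (p.-1 + p.-1)%N.
  by have := perm_size pl0; rewrite size_enum_ord /=; lia.
have [|c|l pl kl] := @separating_order _ x key p.-1 l0; first by [].
  apply: (count_key ul0 _ c) => z _; apply: leq_trans (key_count _ ul0) _.
  by have := cl z; lia.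
have sl : size l = (p.-1 + p.-1)%N by rewrite (perm_size pl).
pose l' := x :: take p.-1 l ++ y :: drop p.-1 l.
have st : size (take p.-1 l) = p.-1 by rewrite size_takel// sl leq_addr.
have pl' : perm_eq l' (enum 'I_n).
  rewrite perm_sym; apply: perm_trans pl0 _; rewrite perm_cons perm_sym -cat1s perm_catCA /= perm_cons cat_take_drop.
  exact: pl.
have ny m : m = p -> nth x l' m = y.
  move=> mp; have -> : m = p.-1.+1 by lia.
  by rewrite /l' /= nth_cat st ltnn subnn.
have [i ip|s sr sE] := @matching_of_seq l' x pl'.
  case: i ip => [|i] ip; first by rewrite (ny (0 + p)%N)//= keyP.
  rewrite addSn /= !nth_cat st; have -> : (i < p.-1)%N by lia.
  have -> : (i + p < p.-1)%N = false by lia.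
  have -> : (i + p - p.-1 = i.+1)%N by lia.
  by rewrite /= nth_take ?nth_drop ?[(p.-1 + i)%N]addnC; [apply: kl|]; lia.
exists s; split=> //; exists (Ordinal p0); rewrite !sE /=; split=> //.
by rewrite (ny (p + 0)%N)// addn0.
Qed.

End Existence.

Definition good_matchings (r : 'I_n -> pt) : {set 'Sn} := finset (fun s => bm s r != 0).

Lemma bms_good r : bms (good_matchings r) r != 0.
Proof. by apply/prodf_neq0 => s; rewrite finset.in_set. Qed.

(** Two independent labels of [r] are paired in some good matching. If the product over all good
    matchings is nonzero at a permutation of [r'], these pairs stay independent there, so each
    cluster of [r'] lies in a permuted cluster of [r]. In this way one invariant bounds cluster
    sizes. *)
Lemma cluster_le_good r r' j x' : (forall x, r x != 0) -> (forall x, 2 * #|cluster r x| < n)%N ->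
  (0 < j)%N -> esm (good_matchings r) j r' != 0 -> exists x, (#|cluster r' x'| <= #|cluster r x|)%N.
Proof.
move=> r0 cl j0 /(esm_neq0_inv j0)[t /prodf_neq0 ht].
exists ((t^-1)%g x'); have -> : #|cluster r ((t^-1)%g x')| = #|[set t z | z in cluster r ((t^-1)%g x')]%SET|.
  by rewrite card_imset//; apply: perm_inj.
apply/subset_leq_card/fintype.subsetP => z; rewrite in_cluster => /eqP xz.
apply/imsetP; exists ((t^-1)%g z); last by rewrite permKV.
rewrite in_cluster; apply/negPn/negP => /(exists_matching_through r0 cl)[s [sr [i [si1 si2]]]].
have /ht/bm_neq0P/(_ i) : s \in good_matchings r by rewrite finset.in_set.
by rewrite si1 si2 !permKV xz eqxx.
Qed.

End Matchings.

(** * Construction of invariants *)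

Section Pencil.
Context (k : closedFieldType).
Local Notation pt := (k * k)%type.

Lemma dvdXnP c (p : {poly k}) : reflect (forall i, (i < c)%N -> p`_i = 0) ('X^c %| p).
Proof.
apply: (iffP idP) => [/dvdpP[q ->] i ic|h]; first by rewrite coefMXn ic.
rewrite -(poly_take_drop c p) dvdp_addr ?dvdp_mulIr// (_ : take_poly c p = 0) ?dvdp0//.
by apply/polyP => i; rewrite coef_take_poly coef0; case: ifP => // /h.
Qed.

Lemma exists_order (p : {poly k}) : p != 0 -> exists e q, p = 'X^e * q /\ q`_0 != 0.
Proof.
move=> p0; have [e [q q0 pE]] := multiplicity_XsubC p 0; move: q0; rewrite p0 /= => q0; exists e, q.
by rewrite pE subr0 mulrC -horner_coef0 -rootE.
Qed.

Lemma dvdXn_order c e (q : {poly k}) : q`_0 != 0 -> ('X^c %| 'X^e * q) = (c <= e)%N.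
Proof.
move=> q0; apply/dvdXnP/idP => [h|ce i ic]; last by rewrite coefXnM (leq_trans ic ce).
by rewrite leqNgt; apply/negP => /h/eqP; rewrite coefXnM ltnn subnn (negPf q0).
Qed.

Lemma dvdXn_root n c e (p : {poly k}) : (0 < n)%N -> 'X^c %| p ^+ n -> (n * e < c + n)%N -> 'X^e %| p.
Proof.
move=> n0; have [->|p0] := eqVneq p 0; first by rewrite dvdp0.
have [d [q [-> q0]]] := exists_order p0.
have qn : (q ^+ n)`_0 != 0 by rewrite -(horner_coef0 (q ^+ n)) horner_exp expf_neq0// horner_coef0.
rewrite exprMn -exprM (dvdXn_order _ _ qn) (dvdXn_order _ _ q0).
by nia.
Qed.

Lemma limits_proportional (I : Type) (P : place k I) (X D : I -> {poly k}) X0 D0 (mu : I -> k) :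
  tendsp P X X0 -> tendsp P D D0 -> X0 != 0 -> D0 != 0 -> ae P [set t | X t = mu t *: D t] ->
  exists2 m, m != 0 & X0 = m *: D0.
Proof.
move=> tX tD X00 D00 XD; have [i Di] : exists i, D0`_i != 0.
  by exists (size D0).-1; rewrite -/(lead_coef D0) lead_coef_eq0.
have tm : tends P mu (X0`_i / D0`_i).
  apply: tends_ae (tends_div (tX i) (tD i) Di); apply: aeW (aeI XD (tends_ne0 (tD i) Di)) => t [-> Dt].
  by rewrite coefZ mulfK.
have E : X0 = X0`_i / D0`_i *: D0 by apply: tendsp_uniq tX (tendsp_ae _ (tendspZ tm tD)); apply: aeW XD.
exists (X0`_i / D0`_i) => //; apply: contraNneq X00 => m0.
by rewrite E m0 scale0r.
Qed.

Lemma finite_rescale (I : Type) (P : place k I) (F : I -> {poly k}) n : (forall t, (size (F t) <= n)%N) ->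
  ae P [set t | F t != 0] -> exists (ka : I -> k) F0, F0 != 0 /\ tendsp P (fun t => ka t *: F t) F0.
Proof.
move=> sF F0; have [|j [j0 jfin]] := @ae_dominant _ _ P 'I_n (fun j t => (F t)`_j).
  apply: aeW F0 => t Ft; have lt : ((size (F t)).-1 < n)%N.
    by rewrite prednK ?size_poly_gt0.
  by exists (Ordinal lt); rewrite -/(lead_coef _) lead_coef_eq0.
have [||F1 tF1] := @finitep_tendsp _ _ P (fun t => ((F t)`_j)^-1 *: F t) n.
- by move=> t; apply: leq_trans (size_scale_leq _ _) _.
- move=> i; have [il|il] := ltnP i n.
    by apply: finite_at_ext (jfin (Ordinal il)) => t; rewrite coefZ mulrC.
  by apply: finite_at_ext (finite_at_cst P 0) => t; rewrite coefZ (nth_default _ (leq_trans (sF t) il)) mulr0.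
exists (fun t => ((F t)`_j)^-1), F1; split=> //; apply/eqP => F10.
have := tF1 j; rewrite F10 coef0 => T0.
have T1 : tends P (fun t => (((F t)`_j)^-1 *: F t)`_j) 1.
  by apply: tends_ae (tends_cst P 1); apply: aeW j0 => t Ft; rewrite coefZ mulVf.
by have /eqP := tends_uniq T0 T1; rewrite eq_sym oner_eq0.
Qed.

Context (N : nat) (h : nat) (ss : 'I_h -> k).
Hypothesis ss_inj : injective ss.
Implicit Types (A B : {poly k}).

Definition pencil (A B : {poly k}) s : {poly k} := A ^+ 3 + s *: B ^+ 2.
Definition pencil_prod A B : {poly k} := \prod_i pencil A B (ss i).

Lemma pencil_dvd A B s s' (c : {poly k}) : s != s' -> c %| pencil A B s -> c %| pencil A B s' -> c %| A ^+ 3 /\ c %| B ^+ 2.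
Proof.
move=> ss' cs cs'; have cB : c %| B ^+ 2.
  have := dvdp_sub cs cs'; rewrite /pencil opprD addrACA subrr add0r -scalerBl.
  by rewrite dvdpZr// subr_eq0.
by split=> //; move: cs; rewrite /pencil dvdp_addl// -mul_polyC dvdp_mull.
Qed.

Lemma pencil_eq0 A B s s' : s != s' -> pencil A B s = 0 -> pencil A B s' = 0 -> A = 0 /\ B = 0.
Proof.
move=> ss' e1 e2; have := @pencil_dvd A B s s' 0 ss'; rewrite e1 e2 dvdp0 => /(_ isT isT)[].
by rewrite !dvd0p !expf_eq0 /= => /eqP-> /eqP->.
Qed.

Lemma size_pencil A B s : (size A <= (4 * N).+1)%N -> (size B <= (6 * N).+1)%N -> (size (pencil A B s) <= (12 * N).+1)%N.
Proof.
move=> sA sB; apply: leq_trans (size_polyD _ _) _; rewrite geq_max; apply/andP; split.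
  by apply: leq_trans (size_exp_form 3 sA) _; lia.
by apply: leq_trans (size_scale_leq _ _) _; apply: leq_trans (size_exp_form 2 sB) _; lia.
Qed.

Lemma frm_pencil A B s p q : (size A <= (4 * N).+1)%N -> (size B <= (6 * N).+1)%N ->
  frm (12 * N) (pencil A B s) p q = pencil (frm (4 * N) A p q) (frm (6 * N) B p q) s.
Proof.
move=> sA sB; rewrite /pencil frmD frmZ.
have -> : (12 * N = 4 * N * 3)%N by lia.
rewrite frmX//; have -> : (4 * N * 3 = 6 * N * 2)%N by lia.
by rewrite frmX.
Qed.

Lemma size_prod_form (J : Type) (l : seq J) (F : J -> {poly k}) d : (forall j, (size (F j) <= d.+1)%N) ->
  (size (\prod_(j <- l) F j)%R <= (d * size l).+1)%N.
Proof.
move=> sF; elim: l => [|j l IH]; first by rewrite big_nil size_poly1.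
by rewrite big_cons mulnS; apply: size_mul_form.
Qed.

Lemma frm_prod (J : Type) (l : seq J) (F : J -> {poly k}) d p q : (forall j, (size (F j) <= d.+1)%N) ->
  frm (d * size l) (\prod_(j <- l) F j) p q = \prod_(j <- l) frm d (F j) p q.
Proof.
move=> sF; elim: l => [|j l IH].
  rewrite muln0 !big_nil; apply: (@hev_eq _ 0); rewrite ?size_frm ?size_poly1// => x.
  by rewrite hev_frm /hev !big_ord_recl !big_ord0 coef1 /= !expr0.
by rewrite !big_cons mulnS frmM ?IH// size_prod_form.
Qed.

Lemma size_index_ord m : size (index_enum 'I_m) = m.
Proof. by rewrite -[RHS]card_ord cardT enumT; congr size; rewrite /index_enum; case: index_enum_key. Qed.

Lemma size_pencil_prod A B : (size A <= (4 * N).+1)%N -> (size B <= (6 * N).+1)%N -> (size (pencil_prod A B) <= (12 * N * h).+1)%N.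
Proof.
move=> sA sB; rewrite -[h in X in (_ <= X)%N]size_index_ord; apply: size_prod_form => i.
exact: size_pencil.
Qed.

Lemma frm_pencil_prod A B p q : (size A <= (4 * N).+1)%N -> (size B <= (6 * N).+1)%N ->
  frm (12 * N * h) (pencil_prod A B) p q = pencil_prod (frm (4 * N) A p q) (frm (6 * N) B p q).
Proof.
move=> sA sB; rewrite -[h in frm (12 * N * h)]size_index_ord frm_prod => [|i]; last exact: size_pencil.
by apply: eq_bigr => i _; apply: frm_pencil.
Qed.

Lemma pencil_prodZ A B l : pencil_prod (l ^+ 4 *: A) (l ^+ 6 *: B) = l ^+ (12 * h) *: pencil_prod A B.
Proof.
transitivity (\prod_(i < h) (l ^+ 12 *: pencil A B (ss i))); last by rewrite scaler_prod prodr_const card_ord -exprM.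
apply: eq_bigr => i _; rewrite /pencil !exprZn -!exprM scalerDr !scalerA [ss i * _]mulrC.
by [].
Qed.

(* A factor of the product divisible by [X ^ 12] is unique when the pencil   *)
(* is minimal at the point, and every factor has order at most [12 * N].     *)
Lemma cluster_pencil (L : finType) (r : L -> pt) A B x : (0 < h)%N -> #|L| = (12 * N * h)%N ->
  (size A <= (4 * N).+1)%N -> (size B <= (6 * N).+1)%N -> minimal N A B -> (forall x, r x != 0) ->
  prodlin r = pencil_prod A B -> (#|cluster r x| <= 11 * h.-1 + 12 * N)%N.
Proof.
move=> h0 cL sA sB mAB r0 rE; have [s xs] := exists_frame (r0 x).
pose a := frm (4 * N) A (r x) s; pose b := frm (6 * N) B (r x) s.
have GE : prodlin (fun z => lab (r x) s (r z)) = pencil_prod a b.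
  by rewrite -frm_prodlin cL rE frm_pencil_prod.
have G0 : pencil_prod a b != 0.
  rewrite -GE prodlin_eq0; apply/existsPn => z; rewrite lab_eq0 ?xs ?oner_eq0//.
have F0 i : pencil a b (ss i) != 0 by move: G0 => /prodf_neq0 /(_ i isT).
have /choice[e /choice[q qE]] := fun i => exists_order (F0 i).
have Eprod : pencil_prod a b = 'X^(\sum_i e i) * \prod_i q i.
  by rewrite -prodrXr -big_split; apply: eq_bigr => i _; case: (qE i).
have Q0 : (\prod_i q i)`_0 != 0.
  by rewrite -horner_coef0 horner_prod; apply/prodf_neq0 => i _; rewrite horner_coef0; case: (qE i).
have le_e : (#|cluster r x| <= \sum_i e i)%N.
  rewrite -(dvdXn_order _ _ Q0) -Eprod -GE; apply/dvdXnP; apply/prodlin_coef_low.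
    by move=> z; rewrite lab_eq0 ?xs ?oner_eq0.
  by apply: subset_leq_card; apply/fintype.subsetP => z; rewrite in_cluster inE.
apply: leq_trans le_e _.
have e12 i : (e i <= 12 * N)%N.
  have [Ei qi] := qE i; have s1 : (size (pencil a b (ss i)) <= (12 * N).+1)%N by apply: size_pencil; apply: size_frm.
  have qi0 : q i != 0 by apply: contraNneq qi => ->; rewrite coef0.
  move: s1; rewrite Ei size_monicM ?monicXn// size_polyXn; have : (0 < size (q i))%N by rewrite size_poly_gt0.
  by lia.
have [i0 Hi0] : exists i0, forall i, i != i0 -> (e i <= 11)%N.
  have [[i0 ei0]|/forallNP small] := pselect (exists i0, (11 < e i0)%N); last first.
    by exists (Ordinal h0) => i _; rewrite leqNgt; apply/negP; apply: small.
  exists i0 => i ii0; rewrite leqNgt; apply/negP => ei.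
  have dv j : (11 < e j)%N -> 'X^12 %| pencil a b (ss j).
    by move=> ej; case: (qE j) => -> qj; rewrite dvdXn_order.
  have [|dA dB] := pencil_dvd _ (dv i ei) (dv i0 ei0); first by rewrite (inj_eq ss_inj).
  have /dvdXnP la : 'X^4 %| a by apply: (dvdXn_root (n := 3)) dA _.
  have /dvdXnP lb : 'X^6 %| b by apply: (dvdXn_root (n := 2)) dB _.
  by have [[j /la-> /eqP]|[j /lb-> /eqP]] := mAB _ _ xs.
rewrite (bigD1 i0)//= addnC; apply: leq_add => //.
apply: leq_trans (leq_sum _ Hi0) _; rewrite sum_nat_const (eq_card (_ : _ =i predC1 i0))//.
by rewrite cardC1 card_ord mulnC.
Qed.

(** The scale [lam] gives the moved pair a nonzero limit. At most one member of the limiting pencil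
    is zero, and the corresponding member of the family is rescaled on its own. The product of the
    limits is then proportional to the product over the limit labels, so a zero of order [m] common
    to the other [h.-1] members produces a cluster of at least [h.-1 * m] labels. *)
Lemma pencil_limit (L : finType) (I : Type) (P : place k I) (A B : I -> {poly k}) (r : L -> I -> pt)
    (g g' : I -> pt) (c : L -> I -> k) (r1 : L -> pt) : (0 < N)%N -> (0 < h)%N -> #|L| = (12 * N * h)%N ->
  (forall t, (size (A t) <= (4 * N).+1)%N) -> (forall t, (size (B t) <= (6 * N).+1)%N) ->
  (forall t, prodlin (fun x => r x t) = pencil_prod (A t) (B t)) -> framed P r g g' c r1 ->
  exists lam A1 B1, [/\ forall t, lam t != 0,
    tendsp P (fun t => lam t ^+ 4 *: frm (4 * N) (A t) (g t) (g' t)) A1,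
    tendsp P (fun t => lam t ^+ 6 *: frm (6 * N) (B t) (g t) (g' t)) B1 &
    (A1 != 0 \/ B1 != 0) /\ forall a b m q s, br q s = 1 -> (m <= 3 * a)%N -> (m <= 2 * b)%N ->
      (forall i, (i < a)%N -> (frm (4 * N) A1 q s)`_i = 0) -> (forall i, (i < b)%N -> (frm (6 * N) B1 q s)`_i = 0) ->
      exists z, (h.-1 * m <= #|cluster r1 z|)%N].
Proof.
move=> N0 h0 cL sA sB rE [gg c0 r10 tr].
pose A' t := frm (4 * N) (A t) (g t) (g' t); pose B' t := frm (6 * N) (B t) (g t) (g' t).
pose R x t := scp (c x t) (lab (g t) (g' t) (r x t)).
have tD : tendsp P (fun t => prodlin (fun x => R x t)) (prodlin r1) by rewrite /prodlin; apply: tendsp_prod => x; exact: tendsp_lin (tr x).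
have D0 : prodlin r1 != 0 by rewrite prodlin_eq0; apply/existsPn.
have RE t : prodlin (fun x => R x t) = (\prod_x c x t) *: pencil_prod (A' t) (B' t).
  by rewrite prodlin_scp -frm_prodlin cL rE frm_pencil_prod.
have GU : ae P [set t | pencil_prod (A' t) (B' t) != 0].
  have [i Di] : exists i, (prodlin r1)`_i != 0.
    by exists (size (prodlin r1)).-1; rewrite -/(lead_coef _) lead_coef_eq0.
  apply: aeW (tends_ne0 (tD i) Di) => t; rewrite RE; apply: contraNneq => ->.
  by rewrite scaler0 coef0.
pose J := ('I_(4 * N).+1 + 'I_(6 * N).+1)%type.
pose f (j : J) t := match j with inl i => (A' t)`_i ^+ 3 | inr i => (B' t)`_i ^+ 2 end.
have [|j0 [j00 jfin]] := @ae_dominant _ _ P J f.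
  apply: aeW GU => t Gt; have ex d (p : {poly k}) n : (size p <= d.+1)%N -> p != 0 -> exists i : 'I_d.+1, p`_i ^+ n != 0.
    move=> sp p0; have lt : ((size p).-1 < d.+1)%N by rewrite (leq_trans _ sp)// ltn_predL size_poly_gt0.
    by exists (Ordinal lt); rewrite expf_neq0// -/(lead_coef p) lead_coef_eq0.
  have [A0|/(ex _ _ 3 (size_frm _ _ _ _))[i Ai]] := eqVneq (A' t) 0; last by exists (inl i).
  have [B0|/(ex _ _ 2 (size_frm _ _ _ _))[i Bi]] := eqVneq (B' t) 0; last by exists (inr i).
  move: Gt; rewrite A0 B0 /pencil_prod (bigD1 (Ordinal h0))//= /pencil expr0n /= expr0n /= scaler0 addr0.
  by rewrite mul0r eqxx.
pose D := f j0.
(* A twelfth root serves both weights, as 4 * 3 = 6 * 2 = 12; the value 1 is a default where [D]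
   vanishes. *)
have /choice[lam lamE] : forall t, exists l, l != 0 /\ (D t != 0 -> l ^+ 12 = (D t)^-1).
  move=> t; have [_|Dt] := eqVneq (D t) 0; first by exists 1; rewrite oner_neq0.
  have [l] := solve_monicpoly (fun i => if i == 0%N then (D t)^-1 else 0) (isT : (0 < 12)%N).
  rewrite big_ord_recl big1 => [|i _]; last by rewrite mul0r.
  rewrite /= expr0 mulr1 addr0 => lE; exists l; split=> //.
  apply: contra_eq_neq lE => ->; rewrite expr0n /= eq_sym.
  by rewrite invr_eq0.
have finA i : finite_at P (fun t => (lam t ^+ 4 *: A' t)`_i).
  have [il|il] := ltnP i (4 * N).+1; last first.
    apply: finite_at_ext (finite_at_cst P 0) => t; rewrite coefZ nth_default ?mulr0//.
    exact: leq_trans (size_frm _ _ _ _) il.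
  apply: (@finite_at_root _ _ _ _ 3) => //; apply: finite_at_ae (jfin (inl (Ordinal il))).
  apply: aeW j00 => t /= Dt; rewrite coefZ exprMn -exprM (lamE t).2// mulrC.
  by [].
have finB i : finite_at P (fun t => (lam t ^+ 6 *: B' t)`_i).
  have [il|il] := ltnP i (6 * N).+1; last first.
    apply: finite_at_ext (finite_at_cst P 0) => t; rewrite coefZ nth_default ?mulr0//.
    exact: leq_trans (size_frm _ _ _ _) il.
  apply: (@finite_at_root _ _ _ _ 2) => //; apply: finite_at_ae (jfin (inr (Ordinal il))).
  apply: aeW j00 => t /= Dt; rewrite coefZ exprMn -exprM (lamE t).2// mulrC.
  by [].
have [A1 tA] := finitep_tendsp (fun t => leq_trans (size_scale_leq _ _) (size_frm (4 * N) (A t) (g t) (g' t))) finA.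
have [B1 tB] := finitep_tendsp (fun t => leq_trans (size_scale_leq _ _) (size_frm (6 * N) (B t) (g t) (g' t))) finB.
have sA1 : (size A1 <= (4 * N).+1)%N.
  by apply: tendsp_size tA => t; apply: leq_trans (size_scale_leq _ _) (size_frm _ _ _ _).
have sB1 : (size B1 <= (6 * N).+1)%N.
  by apply: tendsp_size tB => t; apply: leq_trans (size_scale_leq _ _) (size_frm _ _ _ _).
have AB0 : A1 != 0 \/ B1 != 0.
  have no0 a : tends P (fun t => lam t ^+ 12 * D t) a -> a != 0.
    move=> ta; suff -> : a = 1 by rewrite oner_neq0.
    apply: tends_uniq ta (tends_ae _ (tends_cst P 1)); apply: aeW j00 => t /= Dt.
    by rewrite (lamE t).2// mulVf.
  case E: j0 => [i|i]; [left|right].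
    apply: contraTneq (no0 (A1`_i ^+ 3) _) => [->|]; first by rewrite coef0 expr0n eqxx.
    by apply: tends_ext (tendsX 3 (tA i)) => t; rewrite coefZ exprMn -exprM /D /f E.
  apply: contraTneq (no0 (B1`_i ^+ 2) _) => [->|]; first by rewrite coef0 expr0n eqxx.
  by apply: tends_ext (tendsX 2 (tB i)) => t; rewrite coefZ exprMn -exprM /D /f E.
exists lam, A1, B1; split=> //; first by move=> t; case: (lamE t).
split=> // a b m q s qs ma mb la lb.
pose F i t := pencil (lam t ^+ 4 *: A' t) (lam t ^+ 6 *: B' t) (ss i).
have tF i : tendsp P (F i) (pencil A1 B1 (ss i)).
  by apply: tendspD; [exact: tendspX|apply: tendspZ; [exact: tends_cst|exact: tendspX]].
have [i0 Hi0] : exists i0, forall i, i != i0 -> pencil A1 B1 (ss i) != 0.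
  have [[i0 ei0]|/forallNP small] := pselect (exists i0, pencil A1 B1 (ss i0) = 0); last first.
    by exists (Ordinal h0) => i _; apply/eqP; apply: small.
  exists i0 => i ii0; apply/eqP => ei; have [|A10 B10] := pencil_eq0 _ ei ei0; first by rewrite (inj_eq ss_inj).
  by case: AB0; rewrite ?A10 ?B10 eqxx.
have sF i t : (size (F i t) <= (12 * N).+1)%N.
  by apply: size_pencil; apply: leq_trans (size_scale_leq _ _) (size_frm _ _ _ _).
have FE t : \prod_i F i t = lam t ^+ (12 * h) *: pencil_prod (A' t) (B' t) by rewrite -pencil_prodZ.
have Fi0 : ae P [set t | F i0 t != 0].
  apply: aeW GU => t Gt; have : \prod_i F i t != 0.
    by rewrite FE scaler_eq0 negb_or Gt expf_neq0//; case: (lamE t).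
  by move=> /prodf_neq0/(_ i0 isT).
(* The member [i0] may tend to 0; rescaled by [ka] it has the nonzero limit [F0]. *)
have [ka [F0 [F00 tF0]]] := finite_rescale (sF i0) Fi0.
have tX : tendsp P (fun t => (ka t *: F i0 t) * \prod_(i | i != i0) F i t) (F0 * \prod_(i | i != i0) pencil A1 B1 (ss i)).
  by apply: tendspM => //; apply: tendsp_prod.
have X0 : F0 * \prod_(i | i != i0) pencil A1 B1 (ss i) != 0.
  by rewrite mulf_neq0//; apply/prodf_neq0.
have [|mm mm0 XE] := limits_proportional (mu := fun t => ka t * lam t ^+ (12 * h) / \prod_x c x t) tX tD X0 D0.
  apply: aeT => t; have -> : ka t *: F i0 t * \prod_(i | i != i0) F i t = ka t *: \prod_i F i t.
    by rewrite [in RHS](bigD1 i0)//= scalerAl.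
  rewrite FE RE !scalerA mulfVK//; apply/prodf_neq0 => x _; exact: c0.
have sF0 : (size F0 <= (12 * N).+1)%N.
  by apply: tendsp_size tF0 => t; apply: leq_trans (size_scale_leq _ _) (sF i0 t).
have dv : 'X^(h.-1 * m) %| frm (12 * N * h) (prodlin r1) q s.
  rewrite -(dvdpZr _ _ mm0) -frmZ -XE.
  pose H i := if i == i0 then F0 else pencil A1 B1 (ss i).
  have -> : F0 * \prod_(i | i != i0) pencil A1 B1 (ss i) = \prod_i H i.
    rewrite [RHS](bigD1 i0)//= /H eqxx; congr (_ * _); apply: eq_bigr => i /negPf->.
    by [].
  rewrite -[h in frm (12 * N * h)]size_index_ord frm_prod => [|i]; last first.
    by rewrite /H; case: eqP => // _; apply: size_pencil.
  rewrite (bigD1 i0)//=; apply: dvdp_mull.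
  have -> : h.-1 = #|predC1 i0| by rewrite cardC1 card_ord.
  rewrite mulnC exprM -prodr_const /=; apply: (big_rec2 (fun x y : {poly k} => x %| y)) => [|i x y ii0 xy].
    exact: dvdpp.
  apply: dvdp_mul => //; rewrite /H; have -> : (i == i0) = false by apply: negbTE.
  rewrite frm_pencil// /pencil; apply: dvdp_add.
    have /dvdXnP/(dvdp_exp2r 3) := la; rewrite -exprM; apply: dvdp_trans.
    by rewrite dvdp_exp2l// mulnC.
  rewrite -mul_polyC dvdp_mull//; have /dvdXnP/(dvdp_exp2r 2) := lb; rewrite -exprM; apply: dvdp_trans.
  by rewrite dvdp_exp2l// mulnC.
have L0 : (0 < #|L|)%N by rewrite cL; lia.
move: dv; rewrite -cL frm_prodlin => /dvdXnP/prodlin_coef_low H.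
have {}H : (h.-1 * m <= #|[pred z | br q (r1 z) == 0%R]|)%N.
  by apply: H => z; rewrite lab_eq0 ?qs ?oner_eq0.
have q0 : q != 0 by apply: contraTneq isT => q0; move: qs; rewrite q0 /br !mul0r subr0 => /esym/eqP; rewrite oner_eq0.
have [z zq|none] := pickP [pred z | br q (r1 z) == 0]; last first.
  have /card_gt0P[z _] := L0; exists z; rewrite (leq_trans H)// (eq_card0 none)//.
exists z; apply: leq_trans H _; apply: subset_leq_card; apply/fintype.subsetP => y; rewrite inE in_cluster => /eqP qy.
by apply/eqP; apply: br_trans q0 _ qy; rewrite brC (eqP zq) oppr0.
Qed.

End Pencil.

(** * Invariants of Weierstrass data from the roots of pencils *)

Section Invariants.
Context (k : closedFieldType) (N : nat) (N2 : (2 <= N)%N).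
Local Notation pt := (k * k)%type.
Local Notation W := (weierstrass_data k N).
Local Notation h := (12 * N + 2)%N.
Local Notation p := (6 * N * h)%N.
Local Notation n := (p + p)%N.
Local Notation "''Sn'" := {perm 'I_(p + p)}.
Context (ss : 'I_h -> k).
Hypothesis ss_inj : injective ss.

Lemma card_labels : #|'I_n| = (12 * N * h)%N.
Proof. by rewrite card_ord; lia. Qed.

Let n0 : (0 < n)%N. Proof. by rewrite addn_gt0 !muln_gt0 (ltnW N2) addn2. Qed.

Definition pencil_form (v : W) : {poly k} := pencil_prod ss (pA v) (pB v).

Lemma exists_labels v : exists r : 'I_n -> pt, prodlin r = pencil_form v.
Proof.
apply: exists_prodlin; first by rewrite card_ord.
by rewrite card_labels size_pencil_prod ?size_pA ?size_pB.
Qed.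

Lemma labels_neq0 v (r : 'I_n -> pt) : prodlin r = pencil_form v -> pencil_form v != 0 -> forall x, r x != 0.
Proof. by move=> <-; rewrite prodlin_eq0 => /existsPn. Qed.

Lemma cluster_labels v (r : 'I_n -> pt) x : minimal N (pA v) (pB v) -> prodlin r = pencil_form v -> pencil_form v != 0 ->
  (#|cluster r x| <= 11 * h.-1 + 12 * N)%N.
Proof.
move=> mv rE v0; apply: (cluster_pencil ss_inj _ _ card_labels (size_pA v) (size_pB v)) => //.
  by rewrite addn2.
exact: labels_neq0 rE v0.
Qed.

(** This is stability of the labels of a minimal pair: for N >= 2 each cluster has less than half of
    the [12 * N * h] labels. *)
Lemma cluster_bound_lt c : (c <= 11 * h.-1 + 12 * N)%N -> (2 * c < n)%N.
Proof. by move: N2; nia. Qed.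

Lemma labels_act gl v (r : 'I_n -> pt) : prodlin r = pencil_form v -> exists c : 'I_n -> k,
  \prod_x c x = val gl.2 ^+ (12 * h) /\
  prodlin (fun x => scp (c x) (lab (mx_row (val gl.1) ord0) (mx_row (val gl.1) ord_max) (r x))) = pencil_form (weierstrass_act gl v).
Proof.
move=> rE; exists (fun x => if x == Ordinal n0 then val gl.2 ^+ (12 * h) else 1).
have cE : \prod_(x < n) (if x == Ordinal n0 then val gl.2 ^+ (12 * h) else 1) = val gl.2 ^+ (12 * h).
  by rewrite (bigD1 (Ordinal n0))// eqxx big1 /= ?mulr1// => x /negPf->.
split=> //; rewrite prodlin_scp cE -frm_prodlin card_labels rE /pencil_form pA_act pB_act pencil_prodZ.
by rewrite frm_pencil_prod ?size_pA ?size_pB.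
Qed.

Lemma polynomial_pencil_form i : polynomial_fun (fun v : W => (pencil_form v)`_i).
Proof.
pose Q (F : W -> {poly k}) := forall i, polynomial_fun (fun v => (F v)`_i).
have QC c : Q (fun=> c) by move=> j; apply: polynomial_cst.
have QM F G : Q F -> Q G -> Q (fun v => F v * G v).
  move=> QF QG j; under [fun v => _]funext do rewrite coefM.
  by apply: polynomial_sum => l; apply: polynomial_mul.
have QD F G : Q F -> Q G -> Q (fun v => F v + G v).
  by move=> QF QG j; under [fun v => _]funext do rewrite coefD; apply: polynomial_add.
have QZ c F : Q F -> Q (fun v => c *: F v).
  move=> QF j; under [fun v => _]funext do rewrite coefZ.
  by apply: polynomial_mul => //; apply: polynomial_cst.
have QX F m : Q F -> Q (fun v => F v ^+ m).
  move=> QF; elim: m => [|m IH]; first by under [fun v => _]funext do rewrite expr0; exact: QC.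
  by under [fun v => _]funext do rewrite exprS; apply: QM.
suff : Q pencil_form by apply.
rewrite /pencil_form /pencil_prod; elim: (index_enum _) => [|l t IH].
  by under [fun v => _]funext do rewrite big_nil; exact: QC.
under [fun v => _]funext do rewrite big_cons.
apply: (QM) => //; apply: (QD); first by apply: QX => j; apply: polynomial_pA.
by apply: QZ; apply: QX => j; apply: polynomial_pB.
Qed.

(** [esm] is symmetric of degree [#|S| * j] in each label, so it descends to the pencil form. The
    weight follows because the group moves the labels with scalars whose product is the [12 * h]-th
    power of the scale. *)
Lemma exists_invariant (S : {set 'Sn}) j : (0 < #|S| * j)%N -> exists2 f : W -> k,
  semi_invariant (@weierstrass_act k N) (@weierstrass_char k) (12 * h * (#|S| * j)) f &
  forall v (r : 'I_n -> pt), prodlin r = pencil_form v -> f v = esm S j r.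
Proof.
move=> d0; have KC := @polynomial_cst k W; have KA := @polynomial_add k W; have KM := @polynomial_mul k W.
have [|f pf fE] := symmetric_descent KC KA KM d0 (lspan_esm KC KM S j) _ polynomial_pencil_form.
  by move=> v s r; apply: esm_perm.
exists f; last by move=> v r /fE.
split=> // gl v; have [r rE] := exists_labels v; have [c [cE lE]] := labels_act gl rE.
rewrite -(fE _ _ lE) -(fE _ _ rE) esm_scp esm_lab; last exact: br_act.
by rewrite cE -exprM.
Qed.

Local Notation card := #|{: 'Sn}|.
Local Notation M := (card`! * card`!)%N.

Definition inv_index := ({set 'Sn} * 'I_card.+1)%type.

Lemma dvd_inv_degree (l : inv_index) : (0 < #|l.1| * l.2)%N -> (#|l.1| * l.2 %| M)%N.
Proof.
rewrite muln_gt0 => /andP[S0 j0]; apply: dvdn_mul; apply: dvdn_fact.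
  by rewrite S0 max_card.
by rewrite j0 -ltnS ltn_ord.
Qed.

(** The degrees [#|S| * j] divide [M], so suitable powers bring all invariants to one weight and
    make them the coordinates of one map to a projective space. Indices of degree 0 get the zero
    function. *)
Lemma exists_invariants : exists f : inv_index -> W -> k,
  (forall l, semi_invariant (@weierstrass_act k N) (@weierstrass_char k) (12 * h * M) (f l)) /\
  forall l : inv_index, (0 < #|l.1| * l.2)%N -> exists e, [/\ (0 < e)%N, (#|l.1| * l.2 * e = M)%N &
    forall v (r : 'I_n -> pt), prodlin r = pencil_form v -> f l v = esm l.1 l.2 r ^+ e].
Proof.
have /choice[f fE] : forall l : inv_index, exists f : W -> k,
    semi_invariant (@weierstrass_act k N) (@weierstrass_char k) (12 * h * M) f /\
    ((0 < #|l.1| * l.2)%N -> exists e, [/\ (0 < e)%N, (#|l.1| * l.2 * e = M)%N &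
    forall v (r : 'I_n -> pt), prodlin r = pencil_form v -> f v = esm l.1 l.2 r ^+ e]).
  move=> l; have [l0|l0] := posnP (#|l.1| * l.2)%N.
    exists (fun=> 0); split=> //; split; first exact: polynomial_cst.
    by move=> gl v; rewrite mulr0.
  have [f [pf fs] fE] := exists_invariant l0.
  pose e := (M %/ (#|l.1| * l.2))%N.
  have eM : (#|l.1| * l.2 * e = M)%N by rewrite mulnC divnK// dvd_inv_degree.
  exists (fun v => f v ^+ e); split=> [|_].
    split.
      elim: (e) => [|m IH]; first by under [fun v => _]funext do rewrite expr0; apply: polynomial_cst.
      by under [fun v => _]funext do rewrite exprS; apply: polynomial_mul.
    by move=> gl v; rewrite fs exprMn -exprM -mulnA eM.
  exists e; split=> //.
    have : (0 < M)%N by rewrite muln_gt0 fact_gt0.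
    by rewrite -eM muln_gt0 => /andP[].
  by move=> v r rE; rewrite (fE _ _ rE).
by exists f; split=> l; case: (fE l).
Qed.

Lemma exists_invariant_neq0 (f : inv_index -> W -> k) v :
  (forall l : inv_index, (0 < #|l.1| * l.2)%N -> exists e, [/\ (0 < e)%N, (#|l.1| * l.2 * e = M)%N &
    forall v (r : 'I_n -> pt), prodlin r = pencil_form v -> f l v = esm l.1 l.2 r ^+ e]) ->
  minimal N (pA v) (pB v) -> pencil_form v != 0 -> exists l, f l v != 0.
Proof.
move=> fE mv v0; have [r rE] := exists_labels v; have r0 := labels_neq0 rE v0.
have [|s sr] := exists_matching r0.
  by move=> x; apply/ltnW/cluster_bound_lt; apply: cluster_labels mv rE v0.
have [|j /andP[j0 jc] ej] := @esm_neq0 _ _ [set s]%SET r 1%g.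
  by rewrite /bms big_set1; under [X in bm s X]funext do rewrite perm1.
have jc' : (j < card.+1)%N by rewrite ltnS.
have [|e [e0 _ fe]] := fE ([set s]%SET, Ordinal jc'); first by rewrite /= cards1 mul1n.
by exists ([set s]%SET, Ordinal jc'); rewrite (fe _ _ rE) expf_neq0.
Qed.

(** Two limits are compared: [r1] of the labels in a semistable frame, and [v0] of the invariants.
    Some invariant is nonzero at [r1], so the ratio [tau] of the two scalings has a limit. The
    invariant attached to the good matchings of [v0] is nonzero at [v0], hence also at [r1], and it
    bounds the clusters of [r1] by those of [v0]. *)
Theorem limit_normal_form (f : inv_index -> W -> k) (I : Type) (P : place k I) (v : I -> W) (v0 : W) (theta : I -> k) :
  (forall l : inv_index, (0 < #|l.1| * l.2)%N -> exists e, [/\ (0 < e)%N, (#|l.1| * l.2 * e = M)%N &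
    forall v (r : 'I_n -> pt), prodlin r = pencil_form v -> f l v = esm l.1 l.2 r ^+ e]) ->
  (forall t, minimal N (pA (v t)) (pB (v t))) -> minimal N (pA v0) (pB v0) ->
  ae P [set t | pencil_form (v t) != 0] -> pencil_form v0 != 0 ->
  (forall l, tends P (fun t => theta t * f l (v t)) (f l v0)) ->
  exists (g g' : I -> pt) (lam : I -> k) A1 B1, [/\ forall t, br (g t) (g' t) = 1, forall t, lam t != 0,
    tendsp P (fun t => lam t ^+ 4 *: frm (4 * N) (pA (v t)) (g t) (g' t)) A1,
    tendsp P (fun t => lam t ^+ 6 *: frm (6 * N) (pB (v t)) (g t) (g' t)) B1 & minimal N A1 B1].
Proof.
move=> fE mv mv0 vU v00 tf.
have /choice[r' r'E] := fun t => exists_labels (v t); pose r x t := r' t x.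
have rU x : ae P [set t | r x t != 0] by apply: aeW vU => t vt; apply: labels_neq0 (r'E t) vt x.
have [[x0 [C [C1 CU]]]|[g [g' [c [r1 [F cl1]]]]]] := semistable_reduction rU.
  have [t [vt Ct]] := ae_exists (aeI vU CU).
  have := cluster_bound_lt (cluster_labels x0 (mv t) (r'E t) vt); move: C1; rewrite card_ord ltnNge => /negP; case.
  apply: leq_trans (ltnW _); last first; first by apply: cluster_bound_lt (cluster_labels x0 (mv t) (r'E t) vt).
  rewrite leq_mul2l; apply/orP; right; apply: subset_leq_card; apply/fintype.subsetP => z zC.
  by rewrite in_cluster; apply/eqP/Ct.
have [gg c0 r10 tr] := F; rewrite card_ord in cl1.
have h0 : (0 < h)%N by rewrite addn2.
have [lam [A1 [B1 [lam0 tA tB [AB0 low]]]]] := pencil_limit ss_inj (ltnW N2) h0 card_labels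
  (fun t => size_pA (v t)) (fun t => size_pB (v t)) (fun t => r'E t) F.
exists g, g', lam, A1, B1; split=> //.
suff cl r2 : (#|cluster r1 r2| <= 11 * h.-1 + 12 * N)%N.
  move=> q s qs; apply: contrapT => /not_orP[nA nB].
  have [i i4|i i6|z] := low 4%N 6%N 12%N q s qs isT isT.
  - by apply/eqP/negPn/negP => ci; apply: nA; exists i.
  - by apply/eqP/negPn/negP => ci; apply: nB; exists i.
  (* A nonminimal point would give a cluster of [12 * h.-1] labels, more than [11 * h.-1 + 12 * N],
     because [h.-1 = 12 * N + 1]. This inequality is the origin of [h]. *)
  by rewrite leqNgt (leq_ltn_trans (cl z))//; lia.
pose R x t := scp (c x t) (lab (g t) (g' t) (r x t)); pose ka t := \prod_x c x t.
have ka0 t : ka t != 0 by apply/prodf_neq0 => x _; apply: c0.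
have esmR S j t : esm S j (fun x => R x t) = ka t ^+ (#|S| * j) * esm S j (r' t).
  by rewrite esm_scp esm_lab.
pose tau t := theta t / ka t ^+ M.
have tau_lim (l : inv_index) e : (#|l.1| * l.2 * e = M)%N -> (forall v (r : 'I_n -> pt), prodlin r = pencil_form v -> f l v = esm l.1 l.2 r ^+ e) ->
    tends P (fun t => tau t * esm l.1 l.2 (fun x => R x t) ^+ e) (f l v0) /\
    tends P (fun t => esm l.1 l.2 (fun x => R x t) ^+ e) (esm l.1 l.2 r1 ^+ e).
  move=> eM fe; split; last by apply: tendsX; apply: tends_esm.
  apply: tends_ext (tf l) => t; rewrite (fe _ _ (r'E t)) esmR exprMn -exprM eM /tau.
  by rewrite mulrA divfK ?expf_neq0.
have [r0 r0E] := exists_labels v0; have r00 := labels_neq0 r0E v00.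
have cl0 x : (2 * #|cluster r0 x| < n)%N by apply: cluster_bound_lt; apply: cluster_labels mv0 r0E v00.
have [|s0 s0r] := exists_matching r00; first by move=> x; apply/ltnW/cl0.
pose S0 := good_matchings r0.
have S00 : (0 < #|S0|)%N by apply/card_gt0P; exists s0; rewrite finset.in_set.
have [|j0 /andP[j00 j0c] ej0] := @esm_neq0 _ _ S0 r0 1%g.
  by under [X in bms S0 X]funext do rewrite perm1; apply: bms_good.
have [s1 s1r] := exists_matching r10 cl1.
have [|j1 /andP[j10 j1c] ej1] := @esm_neq0 _ _ [set s1]%SET r1 1%g.
  by rewrite /bms big_set1; under [X in bm s1 X]funext do rewrite perm1.
pose l0 : inv_index := (S0, Ordinal (j0c : (j0 < card.+1)%N)).
pose l1 : inv_index := ([set s1]%SET, Ordinal (j1c : (j1 < card.+1)%N)).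
have [|e0 [e00 e0M fe0]] := fE l0; first by rewrite muln_gt0 S00.
have [|e1 [e10 e1M fe1]] := fE l1; first by rewrite /= cards1 mul1n.
have [t0 T0] := tau_lim _ _ e0M fe0; have [t1 T1] := tau_lim _ _ e1M fe1.
have ttau : tends P tau (f l1 v0 / esm l1.1 l1.2 r1 ^+ e1).
  have N1 : esm l1.1 l1.2 r1 ^+ e1 != 0 by rewrite expf_neq0.
  apply: tends_ae (tends_div t1 T1 N1); apply: aeW (tends_ne0 T1 N1) => t Rt.
  by rewrite mulfK.
have E := tends_uniq t0 (tendsM ttau T0).
have : esm S0 j0 r1 != 0.
  apply: contraNneq (expf_neq0 e0 ej0) => Z; rewrite -(fe0 _ _ r0E) E /= Z expr0n.
  by rewrite (gtn_eqF e00) mulr0.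
move=> /(cluster_le_good r2 r00 cl0 j00)[x]; move/leq_trans; apply.
exact: cluster_labels mv0 r0E v00.
Qed.

End Invariants.

(** * The valuative criterion *)

Section Subspaces.
Context (k : fieldType).

Lemma sub_closed_sep (X : topologicalType) (A : set X) (C : set (set_type A)) x : closed C -> ~ C x ->
  exists B : set X, [/\ open B, B (set_val x) & forall y : set_type A, B (set_val y) -> ~ C y].
Proof.
move=> cC nCx; have : open (~` C) by rewrite openC.
case=> B oB BE; exists B; split=> //.
  by have : (~` C) x by []; rewrite -BE.
by move=> y By; have : (set_val @^-1` B) y by []; rewrite BE.
Qed.

Lemma sub_regular (X : funSpaceType k) (A : set X) (x : set_type A) (f : X -> k) :
  regular_at (set_val x) f -> regular_at x (f \o set_val).
Proof. by move=> fx; exists f => //; apply: filterE. Qed.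

Lemma isomorphic_setT (X : funSpaceType k) : isomorphic (set_type [set: X]) X.
Proof.
pose psi (x : X) : set_type [set: X] := exist _ x (mem_set I).
have valpsi x : set_val (psi x) = x by rewrite set_valE.
have cpsi : continuous psi.
  by apply: continuous_comp_initial => x; rewrite (_ : set_val \o psi = id)//; apply/funext => y /=.
exists set_val, psi; split=> //; first split.
- exact: initial_continuous.
- by move=> x f; apply: sub_regular.
- split=> // x f [g gx fg]; rewrite valpsi in gx.
  apply: (@regular_at_ext k X x g) gx.
  have fg' : \forall y \near x, f (psi y) = g (set_val (psi y)) := cpsi x _ fg.
  by apply: filterS fg' => y /= ->; rewrite valpsi.
- by move=> x; apply: val_inj.
Qed.

End Subspaces.

Section AffineVarieties.
Context (k : closedFieldType) (n : nat).
Local Notation V := 'rV[k]_n.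

Lemma polynomial_meval (q : {mpoly k[n]}) : polynomial_fun (fun y : V => q.@[fun j => y 0 j]).
Proof.
pose c i j := tnth (vbasis {:V}) j 0 i.
exists (q \mPo [tuple \sum_j c i j *: 'X_j | i < n]) => y.
rewrite comp_mpoly_meval; congr (_.@[_]); apply/funext => i.
rewrite tnth_mktuple raddf_sum {1}(coord_vbasis (memvf y)) summxE; apply: eq_bigr => j _ /=.
by rewrite mevalZ mevalXU mxE mulrC /c (tnth_nth 0).
Qed.

Lemma meval_polynomial (f : V -> k) : polynomial_fun f -> exists q : {mpoly k[n]}, forall y, f y = q.@[fun j => y 0 j].
Proof.
move=> [p pE]; pose c i (j : 'I_n) := coord (vbasis {:V}) i (delta_mx 0 j).
exists (p \mPo [tuple \sum_j c i j *: 'X_j | i < \dim {:V}]) => y.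
rewrite comp_mpoly_meval pE; congr (_.@[_]); apply/funext => i.
rewrite tnth_mktuple raddf_sum {1}(row_sum_delta y) linear_sum; apply: eq_bigr => j _ /=.
by rewrite linearZ mevalZ mevalXU mulrC.
Qed.

Context (Y : set (affine_space V)).

Lemma affine_closed_sep (C : set (set_type Y)) y : closed C -> ~ C y -> exists q : {mpoly k[n]},
  q.@[fun j => (set_val y : V) 0 j] != 0 /\ forall z : set_type Y, C z -> q.@[fun j => (set_val z : V) 0 j] = 0.
Proof.
move=> cC /(sub_closed_sep cC)[B [oB By BC]].
have [f [/meval_polynomial[q qE] fy fB]] := oB _ By.
exists q; split=> [|z Cz]; first by rewrite -qE.
by apply/eqP/negPn/negP; rewrite -qE => /fB/BC; apply.
Qed.

Lemma polynomial_regular (q : {mpoly k[n]}) (y : set_type Y) : regular_at y (fun z : set_type Y => q.@[fun j => (set_val z : V) 0 j]).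
Proof.
apply: (sub_regular (f := fun y : affine_space V => q.@[fun j => (y : V) 0 j])).
exists (fun y : V => q.@[fun j => y 0 j]), (fun=> 1); split.
- exact: polynomial_meval.
- exact: polynomial_cst.
- exact: oner_neq0.
- by apply: filterE => z; rewrite divr1.
Qed.

Lemma affine_variety : closed Y -> Y !=set0 ->
  (forall p q : {mpoly k[n]}, (forall y : V, Y y -> (p * q).@[fun j => y 0 j] = 0) ->
    (forall y : V, Y y -> p.@[fun j => y 0 j] = 0) \/ (forall y : V, Y y -> q.@[fun j => y 0 j] = 0)) ->
  variety (set_type Y : funSpaceType k).
Proof.
move=> cY [y0 Yy0] irr; split; last first.
- rewrite /separated -openC; change (prod_open (~` [set p : variety_prod (set_type Y) (set_type Y) | p.1 = p.2])) => -[y z] /= yz.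
  have [j jyz] : exists j, (set_val y : V) 0 j != (set_val z : V) 0 j.
    apply: contrapT => /forallNP H; apply: yz; apply: val_inj; apply/rowP => j.
    by apply/eqP/negPn/negP/H.
  exists bool, (fun b y => if b then ('X_j : {mpoly k[n]}).@[fun j => (set_val y : V) 0 j] else 1),
    (fun b z => if b then 1 else (- 'X_j : {mpoly k[n]}).@[fun j => (set_val z : V) 0 j]).
  have E (u v : set_type Y) : \sum_b (if b then ('X_j : {mpoly k[n]}).@[fun j => (set_val u : V) 0 j] else 1) *
      (if b then 1 else (- 'X_j : {mpoly k[n]}).@[fun j => (set_val v : V) 0 j]) = (set_val u : V) 0 j - (set_val v : V) 0 j.
    by rewrite big_bool /= mulr1 mul1r mevalN !mevalXU.
  split.
  + by case; split; [exact: polynomial_regular|exact: regular_at_cst|exact: regular_at_cst|exact: polynomial_regular].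
  + by rewrite E subr_eq0.
  + apply: filterE => -[u v]; rewrite E /= => uv uv'; by rewrite uv' subrr eqxx in uv.
- exists 1%N, (fun=> setT); split; last by apply/seteqP; split=> // x _; exists ord0.
  move=> _; split; first exact: openT.
  exists n, Y; split=> //; exact: isomorphic_setT.
split; first by exists (exist _ y0 (mem_set Yy0)).
move=> F G cF cG FG; apply: contrapT => /not_orP[nF nG].
have ex (C : set (set_type Y)) : ~ ([set: set_type Y] `<=` C) -> exists y, ~ C y.
  by move=> nC; apply: contrapT => /forallNP H; apply: nC => y _; apply: contrapT; apply: H.
have [y /(affine_closed_sep cF)[p [py pF]]] := ex _ nF.
have [z /(affine_closed_sep cG)[q [qz qG]]] := ex _ nG.
have YP (u : set_type Y) : Y (set_val u) by rewrite set_valE; exact: set_mem (valP u).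
have [u Yu|/(_ _ (YP y))/eqP|/(_ _ (YP z))/eqP] := irr p q; last 2 first.
- by rewrite (negPf py).
- by rewrite (negPf qz).
pose u' : set_type Y := exist _ u (mem_set Yu).
rewrite mevalM; have [/pF|/qG] := FG u' Logic.I; rewrite set_valE /= => ->; by rewrite ?mul0r ?mulr0.
Qed.

End AffineVarieties.

Section ValuativeCriterion.
Context (k : closedFieldType) (X : funSpaceType k) (J : finType) (phi : X -> J -> k).
Hypothesis cX : complete_variety X.
Hypothesis phi_neq0 : forall z, exists l, phi z l != 0.
Hypothesis phi_regular : forall z l0, phi z l0 != 0 ->
  (forall l, regular_at z (fun w => phi w l / phi w l0)) /\ \forall w \near z, phi w l0 != 0.

(** Almost every point lies on the Zariski closure of the family. An ultrafilter need not be closed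
    under infinite intersections, and the Hilbert basis theorem leaves finitely many relations. *)
Lemma ae_ultra_zero (n : nat) (I : Type) (P : place k I) (y : 'I_n -> I -> k) :
  ae P [set t | forall p : {mpoly k[n]}, ae P [set t | p.@[fun j => y j t] = 0] -> p.@[fun j => y j t] = 0].
Proof.
have [s sJ sP] := hilbert_basis (fun p : {mpoly k[n]} => ae P [set t | p.@[fun j => y j t] = 0]).
have : ae P [set t | forall q, q \in s -> q.@[fun j => y j t] = 0].
  elim: s sJ {sP} => [|q s IH] sJ; first by apply: aeT.
  have h1 := sJ q (mem_head _ _); have h2 := IH (fun q' q's => sJ q' (mem_behead (s := q :: s) q's)).
  by apply: aeW (aeI h1 h2) => t [e1 e2] q'; rewrite inE => /orP[/eqP->//|/e2].
by apply: aeW => t st p /sP sp; apply: (ideal_span_root sp).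
Qed.

(** Completeness is applied to the closure [Y] of the coordinates normalized by the dominant one and
    to the set [C] of pairs over the same projective point. The projection of [C] to [Y] is closed
    and contains almost every point of the family; a polynomial vanishing on it is thus a relation
    of the family and vanishes at the limit [eta] too. *)
Theorem valuative_criterion (I : Type) (P : place k I) (z : I -> X) :
  exists z0 (theta : I -> k), forall l, tends P (fun t => theta t * phi (z t) l) (phi z0 l).
Proof.
have [l0 [l00 lfin]] := @ae_dominant _ _ P J (fun l t => phi (z t) l) (aeT P (fun t => phi_neq0 (z t))).
pose n := #|J|; pose y (j : 'I_n) t := phi (z t) (enum_val j) / phi (z t) l0.
have /choice[eta teta] : forall j : 'I_n, exists e, tends P (y j) e by move=> j; exact: lfin.
pose rel (p : {mpoly k[n]}) := ae P [set t | p.@[fun j => y j t] = 0].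
pose Y : set (affine_space 'rV[k]_n) := [set u | forall p, rel p -> p.@[fun j => (u : 'rV[k]_n) 0 j] = 0].
pose row (u : 'I_n -> k) : affine_space 'rV[k]_n := \row_j u j : 'rV[k]_n.
have rowE u (p : {mpoly k[n]}) : p.@[fun j => (row u : 'rV[k]_n) 0 j] = p.@[u].
  by congr (_.@[_]); apply/funext => j; rewrite mxE.
have aeY : ae P [set t | Y (row (fun j => y j t))].
  by apply: aeW (ae_ultra_zero P y) => t H p rp; rewrite rowE; apply: H.
have Yeta : Y (row eta).
  move=> p rp; rewrite rowE; apply: tends_uniq (tends_meval p teta) _.
  by apply: tends0.
have cY : closed Y.
  rewrite -openC; change (zariski_open (~` Y)) => u; rewrite /Y /= => /existsNP[p /not_implyP[rp /eqP pu]].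
  exists (fun u : 'rV[k]_n => p.@[fun j => u 0 j]); split=> //; first exact: polynomial_meval.
  by move=> u' pu' /(_ p rp)/eqP; rewrite (negPf pu').
have vY : variety (set_type Y : funSpaceType k).
  apply: affine_variety => //; first by exists (row eta).
  (* The ideal of [Y] is prime because an ultrafilter decides disjunctions. *)
  move=> p q pq; have : ae P [set t | p.@[fun j => y j t] = 0 \/ q.@[fun j => y j t] = 0].
    apply: aeW aeY => t /pq; rewrite rowE mevalM => /eqP; rewrite mulf_eq0 => /orP[/eqP|/eqP]; by [left|right].
  by move=> /ae_or[rp|rq]; [left|right] => u; apply.
pose C : set (variety_prod X (set_type Y : funSpaceType k)) :=
  [set zy | forall j, phi zy.1 (enum_val j) = (set_val zy.2 : 'rV[k]_n) 0 j * phi zy.1 l0].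
have cC : closed C.
  rewrite -openC; change (prod_open (~` C)) => -[x u] /existsNP[j /eqP /= xu].
  have [l1 xl1] := phi_neq0 x; have [reg near0] := phi_regular xl1.
  exists bool, (fun b x => if b then phi x (enum_val j) / phi x l1 else phi x l0 / phi x l1),
    (fun b u => if b then 1 else (- 'X_j : {mpoly k[n]}).@[fun j => (set_val u : 'rV[k]_n) 0 j]).
  have E x' (u' : set_type Y) : \sum_b (if b then phi x' (enum_val j) / phi x' l1 else phi x' l0 / phi x' l1) *
      (if b then 1 else (- 'X_j : {mpoly k[n]}).@[fun j => (set_val u' : 'rV[k]_n) 0 j]) =
      (phi x' (enum_val j) - (set_val u' : 'rV[k]_n) 0 j * phi x' l0) / phi x' l1.
    by rewrite big_bool /= mulr1 mevalN mevalXU; ring.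
  split.
  - by case; split; [exact: reg|exact: regular_at_cst|exact: reg|exact: polynomial_regular].
  - by rewrite E mulf_neq0 ?invr_neq0 ?subr_eq0.
  - apply: filterE => -[x' u']; rewrite E /= => H H'; move: H.
    by rewrite (H' j) /= subrr mul0r eqxx.
have cD := cX.2 _ vY C cC.
pose ue : set_type Y := exist _ (row eta) (mem_set Yeta).
have [[[x u] Cxu uE]|nD] := pselect ([set p.2 | p in C] ue).
  simpl in uE; subst u; exists x, (fun t => phi x l0 / phi (z t) l0) => l.
  have := Cxu (enum_rank l); rewrite /= set_valE /= enum_rankK mxE => ->.
  rewrite mulrC; have := tendsM (tends_cst P (phi x l0)) (teta (enum_rank l)).
  by apply: tends_ext => t; rewrite /y enum_rankK mulrA mulrAC.
have [q [qe qD]] := affine_closed_sep cD nD; move/negP: qe; case; apply/eqP.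
rewrite set_valE; apply: (Yeta q); apply: aeW (aeI l00 aeY) => t [t0 Yt].
pose ut : set_type Y := exist _ (row (fun j => y j t)) (mem_set Yt).
have : [set p.2 | p in C] ut.
  by exists (z t, ut) => // j; rewrite /= set_valE /= mxE /y divfK.
by move=> /qD; rewrite set_valE /= rowE.
Qed.

End ValuativeCriterion.

(** * Points of the quotient through representatives *)

Section QuotientPoints.
Context (k : closedFieldType) (N : nat).
Local Notation W := (weierstrass_data k N).
Local Notation Q := (git_quotient (@weierstrass_act k N) (@weierstrass_char k)).
Local Notation semi_inv := (semi_invariant (@weierstrass_act k N) (@weierstrass_char k)).
Local Notation E := (E_ k N).

Lemma git_equiv_of_mem (q : Q) v w : sval q v -> sval q w -> git_equiv (@weierstrass_act k N) (@weierstrass_char k) v w.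
Proof.
by case: q => c /= [u su ->] [_ uv] [_ uw] n f sf; rewrite -(uv _ _ sf) (uw _ _ sf).
Qed.

Lemma semi_inv_cst_mul n (c : k) f : semi_inv n f -> semi_inv n (fun v => c * f v).
Proof. by move=> sf; have := semi_invariant_mul (semi_invariant_cst _ _ c) sf; rewrite add0n. Qed.

(** Equivalence only compares zeros, so it is tested on the semi-invariant [g v * f - f v * g],
    which vanishes at [v] and hence at [w]. *)
Lemma git_equiv_ratio n f g v w : git_equiv (@weierstrass_act k N) (@weierstrass_char k) v w ->
  semi_inv n f -> semi_inv n g -> g v != 0 -> g w != 0 /\ f w / g w = f v / g v.
Proof.
move=> vw sf sg gv; have gw : g w != 0 by rewrite -(vw _ _ sg).
split=> //; have sH := semi_invariant_add (semi_inv_cst_mul (g v) sf) (semi_inv_cst_mul (- f v) sg).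
have E0 : g v * f v + - f v * g v = 0 by ring.
have := vw _ _ sH; rewrite /= E0 eqxx => /esym; rewrite mulNr subr_eq0 => /eqP E.
apply: (mulfI gv); rewrite mulrA E; field.
by rewrite gv.
Qed.

Definition erep (e : E) : W := projT1 (cid2 (set_valP e)).

Lemma erep_T e : T_ (erep e).
Proof. by rewrite /erep; case: cid2. Qed.

Lemma erep_mem e : sval (set_val e) (erep e).
Proof. by rewrite /erep; case: cid2. Qed.

Definition qrep (q : Q) : W := projT1 (cid2 (git_repr q)).

Lemma qrep_mem q : sval q (qrep q).
Proof. by rewrite /qrep; case: cid2. Qed.

Lemma erep_near n f (e : E) : semi_inv n f -> f (erep e) != 0 -> \forall e' \near e, f (erep e') != 0.
Proof.
move=> sf fe; have fn := nonvanishingP sf (erep_mem e) fe.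
have := set_val_near (nonvanishing_near sf fn); apply: filterS => e' /=; apply.
exact: erep_mem.
Qed.

Lemma erep_ratio_regular n f g (e : E) : semi_inv n f -> semi_inv n g -> g (erep e) != 0 ->
  regular_at e (fun e' => f (erep e') / g (erep e')).
Proof.
move=> sf sg ge; have gn := nonvanishingP sg (erep_mem e) ge.
have near_g := nonvanishing_near sg gn.
exists (fun q => f (qrep q) / g (qrep q)).
  exists n, f, g; split=> //; apply: filterS near_g => q gq v qv.
  by case: (git_equiv_ratio (git_equiv_of_mem qv (qrep_mem q)) sf sg (gq _ qv)).
apply: filterS (set_val_near near_g) => y gy.
by case: (git_equiv_ratio (git_equiv_of_mem (qrep_mem (set_val y)) (erep_mem y)) sf sg (gy _ (qrep_mem _))).
Qed.

Section Subset.
Context (Z : set E).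
Local Notation X := (set_type Z).

Definition zrep (x : X) : W := erep (set_val x).

Lemma zrep_near n f (x : X) : semi_inv n f -> f (zrep x) != 0 -> \forall y \near x, f (zrep y) != 0.
Proof. by move=> sf fx; have := set_val_near (erep_near sf fx). Qed.

Lemma zrep_ratio_regular n f g (x : X) : semi_inv n f -> semi_inv n g -> g (zrep x) != 0 ->
  regular_at (x : (X : funSpaceType k)) (fun y : X => f (zrep y) / g (zrep y)).
Proof. by move=> sf sg gx; have := sub_regular (erep_ratio_regular sf sg gx). Qed.

Lemma zero_closed n f : semi_inv n f -> closed [set x : X | f (zrep x) = 0].
Proof.
move=> sf; rewrite -openC openE => x /eqP fx; apply: filterS (zrep_near sf fx) => y /eqP.
by [].
Qed.

Lemma zrep_closed_sep (C : set X) x : closed C -> ~ C x -> exists n f,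
  [/\ (0 < n)%N, semi_inv n f, f (zrep x) != 0 & forall c, C c -> f (zrep c) = 0].
Proof.
move=> cC /(sub_closed_sep cC)[B [oB Bx BC]].
case: oB => B' oB' BE; have B'x : B' (set_val (set_val x)) by rewrite -BE in Bx.
have [n [f [n0 sf fx fB]]] := oB' _ B'x.
exists n, f; split=> //; first by apply: fx; exact: erep_mem.
move=> c Cc; apply/eqP/negPn/negP => fc; apply: (BC c) => //; rewrite -BE.
by apply: fB; apply: nonvanishingP sf (erep_mem _) fc.
Qed.

Lemma irreducible_mul m n f g (A : set X) : irreducible A -> semi_inv m f -> semi_inv n g ->
  (exists2 x, A x & f (zrep x) != 0) -> (exists2 x, A x & g (zrep x) != 0) ->
  exists2 x, A x & f (zrep x) * g (zrep x) != 0.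
Proof.
move=> [_ irr] sf sg [x Ax fx] [y Ay gy]; apply: contrapT => H.
have [|F|F] := irr _ _ (zero_closed sf) (zero_closed sg).
- move=> z Az; have [fz|fz] := eqVneq (f (zrep z)) 0; first by left.
  right; apply/eqP/negPn/negP => gz; apply: H; exists z => //; exact: mulf_neq0.
- by move: fx; rewrite (F x Ax) eqxx.
- by move: gy; rewrite (F y Ay) eqxx.
Qed.

End Subset.

Lemma semi_inv_exp n m f : semi_inv n f -> semi_inv (n * m) (fun v => f v ^+ m).
Proof.
move=> [pf sf]; split; last by move=> g v; rewrite sf exprMn -exprM.
elim: m => [|m IH]; first by under [fun v => _]funext do rewrite expr0; exact: polynomial_cst.
by under [fun v => _]funext do rewrite exprS; apply: polynomial_mul.
Qed.

Lemma semi_inv_weight n n' f : n = n' -> semi_inv n f -> semi_inv n' f.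
Proof. by move=> ->. Qed.

Lemma semi_inv_prod (J : Type) (s : seq J) (n : J -> nat) (Qd : pred J) (F : J -> W -> k) :
  (forall j, semi_inv (n j) (F j)) -> semi_inv (\sum_(j <- s | Qd j) n j) (fun v => \prod_(j <- s | Qd j) F j v).
Proof.
move=> sF; elim: s => [|j s IH].
  rewrite big_nil (_ : (fun v => _) = (fun=> 1)); first exact: semi_invariant_cst.
  by apply/funext => v; rewrite big_nil.
rewrite big_cons (_ : (fun v => _) = (fun v => if Qd j then F j v * \prod_(j <- s | Qd j) F j v else \prod_(j <- s | Qd j) F j v)).
  by case: (Qd j) => //; apply: semi_invariant_mul.
by apply/funext => v; rewrite big_cons.
Qed.

Lemma minimal_act gl (v : W) : minimal N (pA v) (pB v) -> minimal N (pA (weierstrass_act gl v)) (pB (weierstrass_act gl v)).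
Proof.
move=> mv r s rs; set g := mx_row (val gl.1) ord0; set g' := mx_row (val gl.1) ord_max.
have gg : br g g' = 1 by apply: br_act.
have l0 : val gl.2 != 0 by case: gl.2.
have E d l p : frm d (l *: frm d p g g') r s = l *: frm d p (comb r g g') (comb s g g') by rewrite frmZ frm_comp.
have rs' : br (comb r g g') (comb s g g') = 1 by rewrite -[RHS]mulr1 -{1}rs -gg /br /comb /=; ring.
rewrite pA_act pB_act !E; have [[i i4 ci]|[i i6 ci]] := mv _ _ rs'; [left|right]; exists i => //;
  by rewrite coefZ mulf_neq0 ?expf_neq0.
Qed.

End QuotientPoints.

(** * The upper bound *)

Section ThreePencils.
Context (k : closedFieldType) (N : nat) (N2 : (2 <= N)%N).
Local Notation W := (weierstrass_data k N).
Local Notation h := (12 * N + 2)%N.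

(* For a given pair (A, B) at most one member of the pencil A^3 + s B^2      *)
(* vanishes, so that at most one of the three products vanishes.             *)
Lemma exists_pencils : exists ss : 'I_3 -> 'I_h -> k, (forall a, injective (ss a)) /\
  forall v : W, minimal N (pA v) (pB v) -> forall a b, pencil_form (ss a) v = 0 -> pencil_form (ss b) v = 0 -> a = b.
Proof.
have [t ut st] := exists_uniq_seq k (3 * h)%N.
have lt (a : 'I_3) (i : 'I_h) : (a * h + i < 3 * h)%N.
  have := ltn_ord i; have := ltn_ord a; nia.
exists (fun a i => t`_(a * h + i)); split=> [a i j /eqP|v mv a b].
  by rewrite nth_uniq ?st// eqn_add2l => /eqP/val_inj.
move=> /eqP/prodf_eq0[i _ /eqP ei] /eqP/prodf_eq0[j _ /eqP ej].
apply: contrapT => ab; have [|A0 B0] := pencil_eq0 _ ei ej.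
  rewrite nth_uniq ?st//; apply/eqP => E; apply: ab; apply: val_inj => /=.
  have := ltn_ord i; have := ltn_ord j; nia.
have rs : br (1, 0) (0, 1) = 1 :> k by rewrite /br /=; ring.
have := mv _ _ rs; rewrite A0 B0 => -[[l _]|[l _]]; rewrite /frm big1 ?coef0 ?eqxx// => m _; by rewrite coef0 scale0r.
Qed.

End ThreePencils.

(** * A normal form with three fixed coefficients *)

Section NormalForm.
Context (k : closedFieldType) (N : nat) (N2 : (2 <= N)%N).
Local Notation pt := (k * k)%type.
Implicit Types (A B F : {poly k}).

Lemma br_scpr c (r s : pt) : br r (scp c s) = c * br r s.
Proof. by rewrite /br /scp /=; ring. Qed.

Lemma coef0_frm d F (r s : pt) : (frm d F r s)`_0 = hev d F r.
Proof.
rewrite -[r in RHS](_ : comb (1, 0) r s = r); last by case: r => a b; rewrite /comb /=; congr (_, _); ring.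
by rewrite -hev_frm hev1 ?size_frm// horner_coef0.
Qed.

Lemma coefd_frm d F (r s : pt) : (frm d F r s)`_d = hev d F s.
Proof.
rewrite -[s in RHS](_ : comb (0, 1) r s = s); last by case: s => a b; rewrite /comb /=; congr (_, _); ring.
by rewrite -hev_frm hev0 expr1n mulr1.
Qed.

(** If no root of [F] is independent of [r], all labels are multiples of [r], and [F] is a scalar
    times the [d]-th power of one linear form. *)
Lemma root_or_power d F (r : pt) : (0 < d)%N -> (size F <= d.+1)%N -> r != 0 ->
  (exists2 s, br r s = 1 & hev d F s = 0) \/ (forall s i, br r s = 1 -> (i < d)%N -> (frm d F r s)`_i = 0).
Proof.
move=> d0 sF r0; have [||la laE] := @exists_prodlin k 'I_d F; rewrite ?card_ord//.
have hE s : hev d F s = \prod_i br (la i) s by rewrite -laE -hev_prodlin card_ord.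
have [[i ri]|/forallNP par] := pselect (exists i, br r (la i) != 0).
  left; exists (scp (br r (la i))^-1 (la i)).
    by rewrite br_scpr mulVf.
  by rewrite hE (bigD1 i)//= br_scpr brr mulr0 mul0r.
right=> s i rs id; have {}par j : br r (la j) = 0 by apply/eqP/negPn/negP/par.
have -> : frm d F r s = prodlin (fun j => lab r s (la j)) by rewrite -laE -frm_prodlin card_ord.
have -> : prodlin (fun j => lab r s (la j)) = \prod_j ((br (la j) s) *: 'X).
  by apply: eq_bigr => j _; rewrite /lin /lab /= par subr0.
by rewrite scaler_prod prodr_const card_ord coefZ coefXn ltn_eqF ?mulr0.
Qed.

Lemma exists_root d F : (0 < d)%N -> (size F <= d.+1)%N -> exists2 r : pt, r != 0 & hev d F r = 0.
Proof.
move=> d0 sF; have e0 : (1, 0) != 0 :> pt by apply/eqP => -[/eqP]; rewrite oner_eq0.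
have [[s rs Fs]|low] := root_or_power d0 sF e0.
  by exists s => //; apply: contraTneq isT => s0; move: rs; rewrite s0 /br /= !mulr0 subr0 => /esym/eqP; rewrite oner_eq0.
exists (1, 0) => //; have [s rs] := exists_frame e0.
by rewrite -(coef0_frm _ _ _ s) low.
Qed.

(* Roots of A are moved to 0 and infinity (or a root of A to 0 and a root of *)
(* B to infinity), and the residual torus normalizes a coefficient that is   *)
(* nonzero by minimality at infinity.                                        *)
Lemma normal_frame A B : (size A <= (4 * N).+1)%N -> (size B <= (6 * N).+1)%N -> minimal N A B ->
  exists r s : pt, let a := frm (4 * N) A r s in let b := frm (6 * N) B r s in
  [/\ br r s = 1, a`_0 = 0, a`_(4 * N) = 0 \/ b`_(6 * N) = 0 &
      (exists2 i, (i < 4)%N & a`_(4 * N - i) = 1) \/ (exists2 i, (i < 6)%N & b`_(6 * N - i) = 1)].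
Proof.
move=> sA sB mAB; have N40 : (0 < 4 * N)%N by lia.
have N60 : (0 < 6 * N)%N by lia.
have [r r0 Ar] := exists_root N40 sA.
have [s [rs As]] : exists s, br r s = 1 /\ (hev (4 * N) A s = 0 \/ hev (6 * N) B s = 0).
  have [[s rs As]|lowA] := root_or_power N40 sA r0; first by exists s; split=> //; left.
  have [[s rs Bs]|lowB] := root_or_power N60 sB r0; first by exists s; split=> //; right.
  have [s rs] := exists_frame r0.
  by have [[i i4]|[i i6]] := mAB _ _ rs; [rewrite lowA ?eqxx //; lia|rewrite lowB ?eqxx //; lia].
have scale (ta : k) : ta != 0 -> br (scp ta r) (scp ta^-1 s) = 1 by move=> t0; rewrite br_scp rs mulr1 mulfV.
have coefE d F (ta : k) i : ta != 0 -> (i <= d)%N -> (2 * i < d)%N ->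
    (frm d F (scp ta r) (scp ta^-1 s))`_(d - i) = ta ^- (d - 2 * i) * (frm d F r s)`_(d - i).
  move=> t0 id id2; rewrite coef_frm_scp ?leq_subr// subKn//; congr (_ * _).
  have -> : (d - i = i + (d - 2 * i))%N by lia.
  by rewrite exprD mulrA -exprMn mulfV// expr1n mul1r exprVn.
have root_ex d (c : k) i : (2 * i < d)%N -> c != 0 -> exists2 ta : k, ta != 0 & ta ^- (d - 2 * i) * c = 1.
  move=> id c0; have m0 : (0 < d - 2 * i)%N by rewrite subn_gt0.
  have [ta] := solve_monicpoly (fun j => if j == 0%N then c else 0) m0.
  rewrite -(prednK m0) big_ord_recl big1 => [|j _]; last by rewrite mul0r.
  rewrite expr0 mulr1 addr0 => tE; exists ta; last by rewrite tE mulVf.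
  by apply: contra_neq c0 => t0; rewrite -tE t0 expr0n.
have fin ta : ta != 0 -> (frm (4 * N) A (scp ta r) (scp ta^-1 s))`_0 = 0 /\
   ((frm (4 * N) A (scp ta r) (scp ta^-1 s))`_(4 * N) = 0 \/ (frm (6 * N) B (scp ta r) (scp ta^-1 s))`_(6 * N) = 0).
  move=> t0; rewrite !coef_frm_scp// coef0_frm Ar mulr0; split=> //.
  by rewrite !coefd_frm; case: As => ->; [left|right]; rewrite mulr0.
(* A frame that starts at [s]: minimality there concerns the top coefficients in the frame
   [(r, s)]. *)
have sr : br s (scp (-1) r) = 1.
  by rewrite br_scpr mulN1r brC opprK.
have top d F i : (i <= d)%N -> (frm d F s (scp (-1) r))`_i != 0 -> (frm d F r s)`_(d - i) != 0.
  move=> id; have -> : frm d F s (scp (-1) r) = frm d F (scp 1 s) (scp (-1) r).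
    by congr (frm d F _ _); case: (s) => a b; rewrite /scp /= !mul1r.
  by rewrite coef_frm_scp// coef_frm_swap// mulf_eq0 negb_or => /andP[].
have [[i i4 ci]|[i i6 ci]] := mAB _ _ sr.
  have {}ci := top _ _ i _ ci; have [||ta t0 E] := root_ex (4 * N)%N _ i _ (ci _); try lia.
  exists (scp ta r), (scp ta^-1 s); split; [exact: scale|by case: (fin ta t0)|by case: (fin ta t0)|left].
  by exists i => //; rewrite coefE//; lia.
have {}ci := top _ _ i _ ci; have [||ta t0 E] := root_ex (6 * N)%N _ i _ (ci _); try lia.
exists (scp ta r), (scp ta^-1 s); split; [exact: scale|by case: (fin ta t0)|by case: (fin ta t0)|right].
by exists i => //; rewrite coefE//; lia.
Qed.

End NormalForm.

(** * Algebraically independent functions from a chain *)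

Section Chains.
Context (k : closedFieldType) (N : nat).
Local Notation W := (weierstrass_data k N).
Local Notation semi_inv := (semi_invariant (@weierstrass_act k N) (@weierstrass_char k)).
Context (Z : set (E_ k N)).
Local Notation X := (set_type Z).
Context (r : nat) (Zs : nat -> set X) (ff : nat -> W -> k) (w : nat).
Hypothesis irrZ : forall i, (i <= r)%N -> irreducible (Zs i).
Hypothesis subZ : forall i, (i < r)%N -> Zs i `<=` Zs i.+1.
Hypothesis sff : forall i, semi_inv w (ff i).
Hypothesis ff0 : forall i, (i < r)%N -> forall x, Zs i x -> ff i.+1 (zrep x) = 0.
Hypothesis ffN : forall i, (i <= r)%N -> exists2 x, Zs i x & ff i (zrep x) != 0.
Local Notation mon := 'X_{1..r.+1}.

Let term j (m : mon) v := \prod_(i < r.+1 | (i <= j)%N) ff i v ^+ m i.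

Let termS j (jr : (j.+1 < r.+1)%N) m v : term j.+1 m v = ff j.+1 v ^+ m (Ordinal jr) * term j m v.
Proof.
rewrite /term (bigD1 (Ordinal jr))//=; congr (_ * _); apply: eq_bigl => i.
by rewrite andbC -val_eqE /= -ltn_neqAle ltnS.
Qed.

(** Factor out the smallest power [e] of [ff j.+1]. On [Zs j] the cofactor reduces to the monomials
    with exponent exactly [e], and it is nonzero there by induction. On [Zs j.+1] neither factor is
    identically zero, and irreducibility makes the product nonzero. *)
Lemma chain_indep_homog j : (j <= r)%N -> forall (S : seq mon) (c : mon -> k) d, S != [::] -> uniq S ->
  (forall m, m \in S -> c m != 0) ->
  (forall m m', m \in S -> m' \in S -> (forall i : 'I_r.+1, (i <= j)%N -> m i = m' i) -> m = m') ->
  (forall m, m \in S -> \sum_(i < r.+1 | (i <= j)%N) m i = d)%N ->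
  exists2 x, Zs j x & \sum_(m <- S) c m * term j m (zrep x) != 0.
Proof.
elim: j => [|j IH] jr S c d S0 uS cS injS homS.
  case: S S0 uS cS injS homS => [//|m S] _ /andP[mS uS] cS injS homS.
  have -> : S = [::].
    case: S mS uS cS injS homS => [//|m' S]; rewrite inE negb_or => /andP[/eqP mm' _] _ _ injS homS.
    case: mm'; apply: injS; rewrite ?inE ?eqxx ?orbT// => i i0.
    have -> : i = ord0 by apply: val_inj; apply/eqP; rewrite /= -leqn0.
    have E (m'' : mon) : (\sum_(i < r.+1 | (i <= 0)%N) m'' i = m'' ord0)%N.
      by rewrite (big_pred1 ord0)// => l /=; rewrite leqn0 -val_eqE.
    by rewrite -!E !homS ?inE ?eqxx ?orbT.
  have [x Zx fx] := ffN jr; exists x => //; rewrite big_seq1 mulf_neq0 ?cS ?mem_head//.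
  by rewrite /term (big_pred1 ord0) ?expf_neq0// => l /=; rewrite leqn0 -val_eqE.
pose o : 'I_r.+1 := Ordinal (jr : (j.+1 < r.+1)%N).
have exP : exists e, has (fun m : mon => m o == e) S.
  by case: S S0 {uS cS injS homS} => [//|m S] _; exists (m o); rewrite /= eqxx.
have [e /hasP[m1 m1S /eqP m1e] emin] := ex_minnP exP.
have {}emin m : m \in S -> (e <= m o)%N by move=> mS; apply: emin; apply/hasP; exists m.
pose S' := [seq m : mon <- S | m o == e].
have sumS (m : mon) : (\sum_(i < r.+1 | (i <= j.+1)%N) m i = m o + \sum_(i < r.+1 | (i <= j)%N) m i)%N.
  rewrite (bigD1 o)//=; congr (_ + _)%N; apply: eq_bigl => i.
  by rewrite andbC -val_eqE /= -ltn_neqAle ltnS.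
have [||m|m m'|m|x0 Zx0 S'x0] := IH (ltnW jr) S' c (d - e)%N.
- by apply/eqP => E; suff : m1 \in S' by [rewrite E]; rewrite mem_filter m1e eqxx.
- exact: filter_uniq.
- by rewrite mem_filter => /andP[_ /cS].
- rewrite !mem_filter => /andP[/eqP me mS] /andP[/eqP me' mS'] E; apply: injS => // i; rewrite leq_eqVlt => /orP[/eqP ij|].
    by have -> : i = o by [apply: val_inj]; rewrite me me'.
  by rewrite ltnS; apply: E.
- by rewrite mem_filter => /andP[/eqP me mS]; rewrite -(homS m mS) sumS me addKn.
pose G v := \sum_(m <- S) c m * (ff j.+1 v ^+ (m o - e) * term j m v).
have GE v : \sum_(m <- S) c m * term j.+1 m v = ff j.+1 v ^+ e * G v.
  rewrite /G mulr_sumr !big_seq; apply: eq_bigr => m mS; rewrite (termS jr).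
  by rewrite -{1}(subnKC (emin m mS)) exprD; ring.
have sG : semi_inv (w * (d - e)) (fun v => \sum_(m <- [seq m <- S | m \in S]) c m * (ff j.+1 v ^+ (m o - e) * term j m v)).
  have : all (mem S) [seq m <- S | m \in S] by apply: filter_all.
  elim: [seq m <- S | m \in S] => [|m s IHs].
    by move=> _; rewrite (_ : (fun v => _) = (fun=> 0)); [split; [exact: polynomial_cst|move=> g v; rewrite mulr0]|apply/funext => v; rewrite big_nil].
  move=> /andP[mS /IHs{}IHs].
  rewrite (_ : (fun v => _) = (fun v => c m * (ff j.+1 v ^+ (m o - e) * term j m v) + \sum_(m <- s) c m * (ff j.+1 v ^+ (m o - e) * term j m v))); last first.
    by apply/funext => v; rewrite big_cons.
  apply: semi_invariant_add IHs; apply: semi_inv_cst_mul.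
  have sm := semi_invariant_mul (semi_inv_exp (m o - e) (sff j.+1))
    (semi_inv_prod (index_enum _) (fun i : 'I_r.+1 => (i <= j)%N) (fun i : 'I_r.+1 => semi_inv_exp (m i) (sff i))).
  apply: semi_inv_weight sm; rewrite -big_distrr /= -mulnDr; congr (_ * _)%N.
  by rewrite -(homS m mS) sumS addnBAC// emin.
have fS : [seq m <- S | m \in S] = S by apply/all_filterP/allP.
rewrite fS in sG.
have Gx0 : G (zrep x0) != 0.
  suff -> : G (zrep x0) = \sum_(m <- S') c m * term j m (zrep x0) by [].
  rewrite /G /S' big_filter [RHS]big_mkcond !big_seq; apply: eq_bigr => m mS /=.
  rewrite (ff0 jr Zx0) expr0n subn_eq0; case: eqP => [->|ne]; first by rewrite leqnn mul1r.
  have -> : (m o <= e)%N = false by apply/negbTE; rewrite -ltnNge ltn_neqAle emin// andbT; apply/eqP => E; apply: ne.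
  by rewrite mul0r mulr0.
have [|y Zy] := irreducible_mul (irrZ jr) (sff j.+1) sG (ffN jr); first by exists x0 => //; exact: (subZ jr).
rewrite mulf_eq0 negb_or => /andP[fy Gy]; exists y => //.
by rewrite GE mulf_neq0// expf_neq0.
Qed.

(** Only homogeneous expressions in semi-invariants are functions on the quotient. The free scale
    [lam] separates the homogeneous parts, so a chain of length [r] yields [r.+1] independent
    functions. *)
Lemma chain_indep (p : {mpoly k[r.+1]}) : (0 < w)%N -> p != 0 -> exists x lam,
  [/\ Zs r x, lam != 0 & p.@[fun i => lam ^+ w * ff i (zrep x)] != 0].
Proof.
move=> w0 p0; have [m0 m0p] : exists m, m \in msupp p.
  move: p0; rewrite -msupp_eq0; case: (msupp p) => [//|m s] _; by exists m; rewrite mem_head.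
pose S := [seq m <- msupp p | mdeg m == mdeg m0].
have full (m : mon) v : term r m v = \prod_(i < r.+1) ff i v ^+ m i.
  by apply: eq_bigl => i; rewrite -ltnS ltn_ord.
have [||m|m m' _ _ E|m|x Zx Sx] := chain_indep_homog (leqnn r) (S := S) (c := fun m => p@_m) (d := mdeg m0).
- by apply/eqP => E; suff : m0 \in S by [rewrite E]; rewrite mem_filter eqxx.
- by rewrite filter_uniq// msupp_uniq.
- by rewrite mem_filter => /andP[_]; rewrite mcoeff_msupp.
- by apply/mnmP => i; apply: E; rewrite -ltnS.
- rewrite mem_filter => /andP[/eqP <- _]; rewrite mdegE; apply: eq_bigl => i.
  by rewrite -ltnS ltn_ord.
pose q : {poly k} := \sum_(m <- msupp p) (p@_m * term r m (zrep x)) *: 'X^(w * mdeg m).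
have q0 : 'X * q != 0.
  rewrite mulf_neq0 ?polyX_eq0//; apply: contraNneq Sx => q0.
  have := congr1 (fun q : {poly k} => q`_(w * mdeg m0)) q0; rewrite coef0 coef_sum => E; apply/eqP; rewrite -[RHS]E.
  rewrite /S big_filter big_mkcond /=; apply: eq_bigr => m _.
  by rewrite coefZ coefXn eqn_pmul2l// eq_sym; case: eqP; rewrite ?mulr1 ?mulr0.
have /closed_nonrootP[lam] := q0; rewrite rootE hornerM hornerX mulf_eq0 negb_or => /andP[lam0 qlam].
exists x, lam; split=> //; congr (_ != 0): qlam; rewrite mevalE horner_sum; apply: eq_bigr => m _.
rewrite hornerZ hornerXn -mulrA; congr (_ * _); rewrite full; under [RHS]eq_bigr do rewrite exprMn.
rewrite big_split /= mulrC; congr (_ * _); rewrite mdegE big_distrr /= -prodrXr; apply: eq_bigr => i _.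
by rewrite exprM.
Qed.

End Chains.

Section UpperBound.
Context (k : closedFieldType) (N : nat) (N2 : (2 <= N)%N).
Local Notation pt := (k * k)%type.
Local Notation W := (weierstrass_data k N).
Local Notation semi_inv := (semi_invariant (@weierstrass_act k N) (@weierstrass_char k)).
Context (Z : set (E_ k N)).
Local Notation X := (set_type Z).

(** The 20 extreme coefficients: 0-3 low in A, 4-7 top in A, 8-13 low in B, 14-19 top in B, the top
    ones counted down from the degree. For N >= 2 the low and top ranges are disjoint. *)
Definition slot (i : 'I_20) (v : W) : k :=
  if (i < 4)%N then (pA v)`_i else if (i < 8)%N then (pA v)`_(4 * N - (i - 4))
  else if (i < 14)%N then (pB v)`_(i - 8) else (pB v)`_(6 * N - (i - 14)).

Lemma slot_top_A (i : 'I_20) v j : (j < 4)%N -> nat_of_ord i = (4 + j)%N -> slot i v = (pA v)`_(4 * N - j).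
Proof.
move=> j4 ij; rewrite /slot ij; have -> : (4 + j < 4)%N = false by lia.
by have -> : (4 + j < 8)%N by [lia]; rewrite addKn.
Qed.

Lemma slot_low_B (i : 'I_20) v j : (j < 6)%N -> nat_of_ord i = (8 + j)%N -> slot i v = (pB v)`_j.
Proof.
move=> j6 ij; rewrite /slot ij; have -> : (8 + j < 4)%N = false by lia.
have -> : (8 + j < 8)%N = false by lia.
by have -> : (8 + j < 14)%N by [lia]; rewrite addKn.
Qed.

Lemma slot_top_B (i : 'I_20) v j : (j < 6)%N -> nat_of_ord i = (14 + j)%N -> slot i v = (pB v)`_(6 * N - j).
Proof.
move=> j6 ij; rewrite /slot ij; have -> : (14 + j < 4)%N = false by lia.
have -> : (14 + j < 8)%N = false by lia.
by have -> : (14 + j < 14)%N = false by [lia]; rewrite addKn.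
Qed.

Lemma zrep_minimal (x : X) : minimal N (pA (zrep x)) (pB (zrep x)).
Proof. by have /(T_P _ (ltnW N2))[] := erep_T (set_val x). Qed.

(* The theta-limits of a point of a complete subvariety along a place are    *)
(* realized by a family of representatives that has a minimal limit.         *)
Lemma complete_limit (I : Type) (P : place k I) (z : I -> X) (v : I -> W) (c : I -> k) :
  complete_variety (X : funSpaceType k) -> (forall t, c t != 0) -> (forall t, minimal N (pA (v t)) (pB (v t))) ->
  (forall n f, semi_inv n f -> forall t, f (v t) = c t ^+ n * f (zrep (z t))) ->
  exists (g g' : I -> pt) (lam : I -> k) A1 B1, [/\ forall t, br (g t) (g' t) = 1, forall t, lam t != 0,
    tendsp P (fun t => lam t ^+ 4 *: frm (4 * N) (pA (v t)) (g t) (g' t)) A1,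
    tendsp P (fun t => lam t ^+ 6 *: frm (6 * N) (pB (v t)) (g t) (g' t)) B1 & minimal N A1 B1].
Proof.
move=> cX c0 mv fv; have [ss [ss_inj ss1]] := exists_pencils k N2.
have /choice[f fP] := fun a => exists_invariants N2 (ss a).
pose phi (x : X) (al : 'I_3 * inv_index N) := f al.1 al.2 (zrep x).
have [w sf] : exists w, forall al, semi_inv w (f al.1 al.2) by eexists => al; exact: (fP al.1).1 al.2.
(* One pencil may be lost because its product vanishes along the family, another because it vanishes
   at the limit; with three pencils one remains. *)
have two (v1 v2 : W) (a1 a2 : 'I_3) : exists a, a != a1 /\ a != a2.
  have : (0 < #|(~: [set a1; a2])%SET|)%N.
    by have := cardsC [set a1; a2]%SET; rewrite cards2 card_ord; case: (_ != _) => /=; lia.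
  by move=> /card_gt0P[a]; rewrite !inE negb_or => /andP[]; exists a.
have bad (v1 : W) : minimal N (pA v1) (pB v1) -> exists a1, forall a, a != a1 -> pencil_form (ss a) v1 != 0.
  move=> m1; have [[a1 e1]|/forallNP H] := pselect (exists a, pencil_form (ss a) v1 = 0).
    by exists a1 => a /eqP aa; apply/eqP => e; apply: aa; apply: (ss1 v1).
  by exists ord0 => a _; apply/eqP/H.
have H1 x : exists al, phi x al != 0.
  have [a1 H] := bad _ (zrep_minimal x); have [a [aa _]] := two (zrep x) (zrep x) a1 a1.
  have [l fl] := exists_invariant_neq0 N2 (ss_inj a) (fP a).2 (zrep_minimal x) (H a aa).
  by exists (a, l).
have H2 x al0 : phi x al0 != 0 -> (forall al, regular_at (x : (X : funSpaceType k)) (fun y => phi y al / phi y al0)) /\ \forall y \near x, phi y al0 != 0.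
  move=> p0; split=> [al|]; first exact: zrep_ratio_regular (sf al) (sf al0) p0.
  exact: zrep_near (sf al0) p0.
have [z0 [theta tth]] := valuative_criterion cX H1 H2 P z.
have [a1 /= aeA] : exists a1, ae P [set t | forall a, a != a1 -> pencil_form (ss a) (v t) != 0].
  by apply: ae_finP; apply: aeT => t; apply: bad.
have [a2 Ha2] := bad _ (zrep_minimal z0); have [a [aa1 aa2]] := two (zrep z0) (zrep z0) a1 a2.
apply: (limit_normal_form N2 (ss_inj a) (fP a).2 mv (zrep_minimal z0) _ (Ha2 a aa2)
  (theta := fun t => theta t / c t ^+ w)).
  by apply: aeW aeA => t; apply.
move=> l; apply: tends_ext (tth (a, l)) => t; rewrite /phi /= (fv _ _ (sf (a, l)) t).
by rewrite mulrA divfK// expf_neq0.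
Qed.

(** A chain of length 17 gives 18 independent functions [Y], while only 17 slots of the normal form
    vary. Some [Y j] is then transcendental over the slots and infinite at a place where all slots
    are finite. Completeness provides a minimal limit along that place, and the projection to the
    slots forces all coefficients, hence [Y j], to be finite. *)
Theorem no_long_chain : complete_variety (X : funSpaceType k) -> ~ has_chain X 17.
Proof.
move=> cX [Zs [Zirr Zlt]].
have [n [f fP]] : exists (n : nat -> nat) (f : nat -> W -> k), forall i, (i <= 17)%N ->
    [/\ (0 < n i)%N, semi_inv (n i) (f i), exists2 x, Zs i x & f i (zrep x) != 0 &
     forall j, i = j.+1 -> forall x, Zs j x -> f i (zrep x) = 0].
  have /choice[n /choice[f H]] : forall i, exists n f, (i <= 17)%N ->
    [/\ (0 < n)%N, semi_inv n f, exists2 x, Zs i x & f (zrep x) != 0 &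
     forall j, i = j.+1 -> forall x, Zs j x -> f (zrep x) = 0].
    case=> [|i].
      have [[[x0 Zx0] _] _] := Zirr 0%N isT.
      have [|n [f [n0 sf fx _]]] := @zrep_closed_sep _ _ Z set0 x0 closed0; first by [].
      by exists n, f => _; split=> //; exists x0.
    have [il|il] := leqP i.+1 17; last by exists 0%N, (fun=> 0).
    have [sub nsub] := Zlt _ il; have [x Zx nx] : exists2 x, Zs i.+1 x & ~ Zs i x.
      by apply: contrapT => H; apply: nsub => x Zx; apply: contrapT => nx; apply: H; exists x.
    have [n [f [n0 sf fx f0]]] := zrep_closed_sep (Zirr i (ltnW il)).2 nx.
    exists n, f => _; split=> //; first by exists x.
    by move=> j [<-].
  by exists n, f.
pose w := (\prod_(i < 18) n i)%N.
have w0 : (0 < w)%N by apply: prodn_gt0 => i; case: (fP i (ltn_ord i : (i <= 17)%N)).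
(* Powers give a common weight; beyond index 17 the value 0 makes semi-invariance hold at every
   index. *)
pose ff i v := if (i <= 17)%N then f i v ^+ (w %/ n i) else 0.
have dvw i : (i <= 17)%N -> (n i * (w %/ n i) = w)%N.
  by move=> il; rewrite mulnC divnK// /w (bigD1 (Ordinal (il : (i < 18)%N)))//= dvdn_mulr.
have sff i : semi_inv w (ff i).
  rewrite /ff; case: leqP => il; last by split; [exact: polynomial_cst|move=> g v; rewrite mulr0].
  by apply: (semi_inv_weight (dvw i il)); apply: semi_inv_exp; case: (fP i il).
have pos i : (i <= 17)%N -> (0 < w %/ n i)%N.
  by move=> il; rewrite divn_gt0; [apply: dvdn_leq => //; rewrite -(dvw i il) dvdn_mulr|]; case: (fP i il).
have ff0 i : (i < 17)%N -> forall x, Zs i x -> ff i.+1 (zrep x) = 0.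
  move=> il x Zx; rewrite /ff il; case: (fP i.+1 il) => _ _ _ /(_ i erefl x Zx) ->.
  by rewrite expr0n gtn_eqF ?pos.
have ffN i : (i <= 17)%N -> exists2 x, Zs i x & ff i (zrep x) != 0.
  by move=> il; case: (fP i il) => _ _ [x Zx fx] _; exists x => //; rewrite /ff il expf_neq0.
have indep := @chain_indep k N Z 17 Zs ff w (fun i il => (Zirr i il).1) (fun i il => (Zlt i il).1) sff ff0 ffN.
pose I := (X * k)%type.
pose la (t : I) := if t.2 == 0 then 1 else t.2.
have la0 t : la t != 0 by rewrite /la; case: ifP => [_|->]//; rewrite oner_neq0.
pose D (p : {mpoly k[18]}) : set I := [set t | p.@[fun i => la t ^+ w * ff i (zrep t.1)] != 0].
have [|||U [UU UD]] := @ultra_of_fip I [set A | exists2 p, p != 0 & A = D p].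
- by move=> _ _ [p p0 ->] [p' p'0 ->]; exists (D (p * p')); [exists (p * p') => //; rewrite mulf_neq0|move=> t; rewrite /D /= mevalM mulf_eq0 negb_or => /andP[]].
- by exists (D 1), 1 => //; rewrite oner_neq0.
- move=> _ [p p0 ->]; have [x [lam [_ lam0 px]]] := indep p w0 p0.
  by exists (x, lam); rewrite /D /= /la /= (negPf lam0).
pose Y (i : 'I_18) (t : I) := la t ^+ w * ff i (zrep t.1).
have indY : alg_independent U Y.
  move=> p pY; apply: contrapT => /eqP p0; have Dp : U (D p) by apply: UD; exists p.
  have [t [/= e]] : exists t, [set t | p.@[fun j => Y j t] = 0] t /\ D p t.
    by apply: (@filter_ex _ U); apply: filterI.
  by rewrite /D /= -/(Y _ _) e eqxx.
have e01 : br (1, 0) (0, 1) = 1 :> k by rewrite /br /=; ring.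
have /choice[gl1 gl1E] := fun t => exists_gl e01 (la0 t).
pose u t := weierstrass_act (gl1 t) (zrep t.1).
have mu t : minimal N (pA (u t)) (pB (u t)) by apply: minimal_act; apply: zrep_minimal.
have /choice[rr /choice[s0 nf]] := fun t => normal_frame N2 (size_pA (u t)) (size_pB (u t)) (mu t).
have /choice[gl2 gl2E] : forall t, exists gl : SL2 k * Gm k,
    [/\ mx_row (val gl.1) ord0 = rr t, mx_row (val gl.1) ord_max = s0 t & val gl.2 = 1].
  by move=> t; apply: exists_gl; [case: (nf t)|exact: oner_neq0].
pose v t := weierstrass_act (gl2 t) (u t).
have mv t : minimal N (pA (v t)) (pB (v t)) by apply: minimal_act.
have vA t : pA (v t) = frm (4 * N) (pA (u t)) (rr t) (s0 t).
  by rewrite pA_act; case: (gl2E t) => -> -> ->; rewrite expr1n scale1r.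
have vB t : pB (v t) = frm (6 * N) (pB (u t)) (rr t) (s0 t).
  by rewrite pB_act; case: (gl2E t) => -> -> ->; rewrite expr1n scale1r.
have fv n' f' : semi_inv n' f' -> forall t, f' (v t) = la t ^+ n' * f' (zrep t.1).
  move=> [_ sf'] t; rewrite !sf' /weierstrass_char; case: (gl2E t) => _ _ ->; case: (gl1E t) => _ _ ->.
  by rewrite expr1n mul1r.
have i4 : (4 < 20)%N by []. have i14 : (14 < 20)%N by [].
(* Which slots are normalized depends on [t], and the ultrafilter selects one choice. The two
   inequalities keep the chosen slots apart from slot 0; they differ from each other since one value
   is 0 and the other 1. *)
pose cand (ii : 'I_20 * 'I_20) t := [/\ slot ord0 (v t) = 0, slot ii.1 (v t) = 0, slot ii.2 (v t) = 1,
  (3 < ii.1)%N & (3 < ii.2)%N].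
have [ii iiU] : exists ii, U [set t | cand ii t].
  have H : U [set t | exists ii, cand ii t].
    apply: filterE => t; have [_ a0 ab w1] := nf t; rewrite -vA -vB in a0 ab w1.
    have [i2 [i23 s2]] : exists i2 : 'I_20, (3 < i2)%N /\ slot i2 (v t) = 0.
      by case: ab => E; [exists (Ordinal i4)|exists (Ordinal i14)]; rewrite /slot /= subnn subn0.
    have [i3 [i33 s3]] : exists i3 : 'I_20, (3 < i3)%N /\ slot i3 (v t) = 1.
      case: w1 => -[i il E].
        have lt : (4 + i < 20)%N by lia.
        by exists (Ordinal lt); rewrite (slot_top_A _ il).
      have lt : (14 + i < 20)%N by lia.
      by exists (Ordinal lt); rewrite (slot_top_B _ il).
    by exists (i2, i3); split=> //; rewrite /slot /= a0.
  apply: contrapT => /forallNP nU; apply: (@filter_not_empty _ U _).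
  have : U [set t | forall ii, ~ cand ii t].
    have [e] : exists e : seq ('I_20 * 'I_20), forall ii, ii \in e by exists (enum {: 'I_20 * 'I_20}) => ii; rewrite mem_enum.
    move=> eall; suff : U [set t | forall ii, ii \in e -> ~ cand ii t] by apply: filterS => t Ht ii; apply: Ht.
    elim: e {eall} => [|ii e IH]; first exact: filterE.
    have [Ui|Ui] := in_ultra_setVsetC [set t | cand ii t] UU; first by case: (nU ii).
    apply: filterS2 Ui IH => t h1 h2 jj; rewrite inE => /orP[/eqP->//|/h2].
    by [].
  by move=> h; apply: filterS2 h H => t h1 [jj /h1].
pose D3 := (ord0 |: (ii.1 |: [set ii.2]))%SET.
have cD : #|(~: D3)%SET| = 17%N.
  have [t [s00 s01 s02 l1 l2]] : exists t, cand ii t by apply: (@filter_ex _ U).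
  have d3 : #|D3| = 3%N.
    rewrite /D3 !cardsU1 cards1 !inE; have -> : (ord0 == ii.1) = false by apply/eqP => E; move: l1; rewrite -E.
    have -> : (ord0 == ii.2) = false by apply/eqP => E; move: l2; rewrite -E.
    by have /negPf-> : ii.1 != ii.2 by apply: contraTneq isT => E; move: s02; rewrite -E s01 => /esym/eqP; rewrite oner_eq0.
  by have := cardsC D3; rewrite card_ord d3; lia.
pose L0 (j : 'I_17) t := slot (enum_val (cast_ord (esym cD) j)) (v t).
have [j nj] : exists j, ~ acl U L0 (Y j).
  by apply: contrapT => /forallNP H; apply: (@acl_dependent _ _ _ UU _ L0 18 Y isT _ indY) => j; apply: contrapT; apply: H.
have [P [PU Lfin Yinf]] := transcendental_place UU nj; apply: Yinf.
have slot_fin i : finite_at P (fun t => slot i (v t)).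
  have [iD|iD] := boolP (i \in D3).
    have : exists c : k, ae P [set t | slot i (v t) = c].
      move: iD; rewrite !inE => /orP[|/orP[]] /eqP->; [exists 0|exists 0|exists 1]; rewrite PU; apply: filterS iiU => t [] //.
    by move=> [c ec]; apply: finite_at_ae (finite_at_cst P c); apply: aeW ec => t ->.
  have iC : i \in (~: D3)%SET by rewrite inE.
  apply: finite_at_ext (Lfin (cast_ord cD (enum_rank_in iC i))) => t.
  by rewrite /L0 cast_ordK enum_rankK_in.
have [g [g' [lam [A1 [B1 [gg lam0 tA tB mAB]]]]]] := complete_limit P (z := fun t : I => t.1) cX la0 mv fv.
have [||fA fB] := projection_finite (ltnW N2) tA tB mAB (fun t => size_pA (v t)) (fun t => size_pB (v t)) gg lam0 (fun=> erefl) (fun=> erefl).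
- move=> i [il|/andP[i1 i2]].
    have lt : (i < 20)%N by lia.
    by apply: finite_at_ext (slot_fin (Ordinal lt)) => t; rewrite /slot /= il.
  have lt : (4 + (4 * N - i) < 20)%N by lia.
  have il : (4 * N - i < 4)%N by lia.
  by apply: finite_at_ext (slot_fin (Ordinal lt)) => t; rewrite (slot_top_A _ il)// subKn.
- move=> i [il|/andP[i1 i2]].
    have lt : (8 + i < 20)%N by lia.
    by apply: finite_at_ext (slot_fin (Ordinal lt)) => t; rewrite (slot_low_B _ il).
  have lt : (14 + (6 * N - i) < 20)%N by lia.
  have il : (6 * N - i < 6)%N by lia.
  by apply: finite_at_ext (slot_fin (Ordinal lt)) => t; rewrite (slot_top_B _ il)// subKn.
have fin := polynomial_fun_coef (@finite_at_cst _ _ P) (@finite_atD _ _ P) (@finite_atM _ _ P) fA fB (sff j).1.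
by apply: finite_at_ext fin => t; rewrite (fv _ _ (sff j)).
Qed.

Theorem complete_subvariety_dimension : complete_subvariety Z -> exists2 d, (d <= 16)%N & has_dimension X d.
Proof.
move=> [_ cX]; have down m n : (m <= n)%N -> has_chain X n -> has_chain X m.
  move=> mn [Zs [Zi Zl]]; exists Zs; split=> i im; first exact: Zi (leq_trans im mn).
  exact: Zl (leq_trans im mn).
pose ch n := `[< has_chain X n >].
have ch0 : ch 0%N.
  apply/asboolP; exists (fun=> setT); split=> [i _|i]; last by rewrite ltn0.
  by split; [case: cX.1|exact: closedT].
have chb n : ch n -> (n <= 16)%N.
  by move=> /asboolP cn; rewrite leqNgt; apply/negP => n17; apply: (no_long_chain cX); apply: down cn.
have exch : exists n, ch n by exists 0%N.
have [d /asboolP cd dmax] := ex_maxnP exch chb.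
exists d; first by apply/chb/asboolP.
by split=> // n cn; apply/dmax/asboolP.
Qed.

End UpperBound.

(** * A complete family *)

Section Avoid.
Context (k : closedFieldType).

(** The moment curve is contained in no hyperplane, so one of its points avoids any finite number of
    them. *)
Lemma avoid_functionals (L : finType) (J : eqType) (s : seq J) (l : J -> L -> k) :
  (forall j, j \in s -> exists x, l j x != 0) -> exists c : L -> k, forall j, j \in s -> \sum_x l j x * c x != 0.
Proof.
move=> ls; pose P j : {poly k} := \sum_x l j x *: 'X^(enum_rank x).
have P0 j : j \in s -> P j != 0.
  move=> /ls[x lx]; apply: contraNneq lx => /(congr1 (fun p : {poly k} => p`_(enum_rank x))).
  rewrite coef_sum coef0 (bigD1 x)//= big1 => [|y yx]; first by rewrite coefZ coefXn eqxx mulr1 addr0 => ->.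
  by rewrite coefZ coefXn (inj_eq val_inj) (inj_eq enum_rank_inj) eq_sym (negPf yx) mulr0.
have /closed_nonrootP[t] : \prod_(j <- s) P j != 0.
  by rewrite prodf_seq_neq0; apply/allP => j js; apply: P0.
move=> tP; exists (fun x => t ^+ enum_rank x) => j js.
have : root (P j) t = false by apply: contraNF tP => rj; rewrite root_prod_XsubC || (rewrite rootE horner_prod; apply/eqP; rewrite (big_rem j js) /= (eqP rj) mul0r).
rewrite rootE /P horner_sum => /negbT; apply: contraNneq => E; rewrite -[X in _ == X]E; apply/eqP.
by apply: eq_bigr => x _; rewrite hornerZ hornerXn.
Qed.

End Avoid.

(** * Covariants that restrict the sizes of clusters *)

Section Covariants.
Context (k : closedFieldType) (r e : nat).
Local Notation pt := (k * k)%type.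
Local Notation n := (r + r + e)%N.
Local Notation "''Sn'" := {perm 'I_(r + r + e)}.
Implicit Types (a : 'I_n -> pt) (t : 'Sn).

Definition cov_l i : 'I_n := lshift e (lshift r i).
Definition cov_r i : 'I_n := lshift e (rshift r i).
Definition cov_q j : 'I_n := rshift (r + r) j.

(* A covariant of order [e] of a configuration of [2 r + e] labels.          *)
Definition cov_term t a x : k :=
  (\prod_(i < r) br (a (t (cov_l i))) (a (t (cov_r i)))) * \prod_(j < e) br (a (t (cov_q j))) x.
(** The coefficients [c] stay free. The value is linear in [c], so it can be made nonzero at
    finitely many prescribed arguments as soon as at each of them one term is nonzero. *)
Definition cov (c : 'Sn -> k) a x : k := \sum_t cov_term t a x * c t.

Lemma cov_term_scp t a x (s : 'I_n -> k) u :
  cov_term t (fun y => scp (s y) (a y)) (scp u x) = (\prod_y s y) * u ^+ e * cov_term t a x.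
Proof.
rewrite /cov_term /=; under eq_bigr do rewrite br_scp; under [X in _ * X]eq_bigr do rewrite br_scp.
rewrite !big_split /= prodr_const card_ord.
have -> : \prod_y s y = (\prod_(i < r) s (t (cov_l i))) * (\prod_(i < r) s (t (cov_r i))) * \prod_(j < e) s (t (cov_q j)).
  by rewrite (reindex_inj (@perm_inj _ t)) big_split_ord big_split_ord.
by ring.
Qed.

Lemma cov_scp c a x (s : 'I_n -> k) u : cov c (fun y => scp (s y) (a y)) (scp u x) = (\prod_y s y) * u ^+ e * cov c a x.
Proof. by rewrite /cov mulr_sumr; apply: eq_bigr => t _; rewrite cov_term_scp mulrA. Qed.

Lemma cov_lab c a x g h : cov c (fun y => lab g h (a y)) (lab g h x) = br g h ^+ (r + e) * cov c a x.
Proof.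
rewrite /cov mulr_sumr; apply: eq_bigr => t _; rewrite mulrA; congr (_ * _); rewrite /cov_term.
under eq_bigr do rewrite br_lab; under [X in _ * X]eq_bigr do rewrite br_lab.
by rewrite !big_split /= !prodr_const !card_ord exprD; ring.
Qed.

Definition cov_zero c a := forall x, cov c a x = 0.

Lemma cov_zero_lab c a g h (s : 'I_n -> k) : br g h != 0 -> cov_zero c a -> cov_zero c (fun y => scp (s y) (lab g h (a y))).
Proof.
move=> gh0 az x; pose x' := comb x (scp (br g h)^-1 g) (scp (br g h)^-1 h).
have -> : x = scp 1 (lab g h x').
  move: gh0; rewrite [LHS]surjective_pairing /x' /scp /lab /comb /br /= => gh0; congr (_, _); field; exact: gh0.
by rewrite cov_scp cov_lab az !mulr0.
Qed.

Lemma tends_cov (I : Type) (P : place k I) c (a : 'I_n -> I -> pt) a0 x :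
  (forall y, tendst P (a y) (a0 y)) -> tends P (fun i => cov c (fun y => a y i) x) (cov c a0 x).
Proof.
move=> ta; apply: tends_sum => t _; apply: tendsM (tends_cst _ _).
by apply: tendsM; apply: tends_prod => i _; apply: tends_br => //; exact: tendst_cst.
Qed.

Lemma cov_zero_lim (I : Type) (P : place k I) c (a : 'I_n -> I -> pt) a0 :
  ae P [set i | cov_zero c (fun y => a y i)] -> (forall y, tendst P (a y) (a0 y)) -> cov_zero c a0.
Proof.
move=> az ta x; apply: tends_uniq (tends_cov c x ta) _; apply: tends0.
by apply: aeW az => i /(_ x).
Qed.

Definition split_config (S : {set 'I_n}) y : pt := if y \in S then (1, 0) else (0, 1).

(* In a frame starting at the cluster, shrinking the first coordinate of the *)
(* other labels degenerates the configuration to [split_config].             *)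
Lemma cov_zero_split c a x0 : (forall y, a y != 0) -> cov_zero c a ->
  cov c (split_config (cluster a x0)) (1, 1) = 0.
Proof.
move=> a0 az; have [h gh] := exists_frame (a0 x0); set g := a x0 in gh *; set S := cluster a x0.
have inS y : (y \in S) = (br g (a y) == 0) by rewrite in_cluster.
pose b y := lab g h (a y).
pose au (u : k) y : pt := if y \in S then (1, 0) else (u * (b y).1 / (b y).2, 1).
have b2 y : y \notin S -> (b y).2 != 0 by rewrite inS.
have b1 y : y \in S -> (b y).1 != 0.
  move=> yS; apply: contraTneq (a0 y) => E; apply/negPn; rewrite -(lab_eq0 (r := g) (s := h)) ?gh ?oner_eq0//.
  by move: yS; rewrite inS => /eqP E2; rewrite -[lab g h _]/(b y) (surjective_pairing (b y)) E /b /lab /= E2.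
have bz : cov_zero c b.
  move=> x; have := cov_zero_lab (g := g) (h := h) (fun=> 1) _ az x; rewrite gh oner_neq0 => /(_ isT).
  have -> : (fun y => scp 1 (lab g h (a y))) = b; last by [].
  by apply/funext => y; rewrite -[RHS]/(b y) -[LHS]/(scp 1 (b y)) /scp !mul1r; case: (b y).
have cu u : u != 0 -> cov c (au u) (1, 1) = 0.
  move=> u0; pose s y := if y \in S then (u * (b y).1)^-1 else (b y).2^-1.
  have -> : au u = fun y => scp (s y) (lab (1, 0) (0, u) (b y)).
    apply/funext => y; rewrite /au /s /lab /br /scp /=; case: ifP => yS.
      have E2 : br g (a y) = 0 by apply/eqP; rewrite -inS.
      have B0 : br (a y) h != 0 := b1 y yS.
      by rewrite E2; congr (_, _); [|ring]; field; rewrite u0 B0.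
    have B0 : br g (a y) != 0 by apply: b2; rewrite yS.
    by congr (_, _); field; exact: B0.
  rewrite -[(1, 1)]/(1 : k, 1 : k); have := cov_zero_lab (g := (1, 0)) (h := (0, u)) s _ bz (1, 1).
  by apply; rewrite /br /=; apply: contra_neq u0 => E; rewrite -E; ring.
(* The value is a polynomial in [u] that vanishes for all nonzero [u], hence also at [u = 0], where
   [au] is the split configuration. *)
pose K (f : k -> k) := exists p : {poly k}, forall u, f u = p.[u].
have Kc z : K (fun=> z) by exists z%:P => u; rewrite hornerC.
have Ka f f' : K f -> K f' -> K (fun u => f u + f' u) by move=> [p E] [p' E']; exists (p + p') => u; rewrite hornerD E E'.
have Km f f' : K f -> K f' -> K (fun u => f u * f' u) by move=> [p E] [p' E']; exists (p * p') => u; rewrite hornerM E E'.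
have Ki : K id by exists 'X => u; rewrite hornerX.
pose Kp (q : k -> pt) := K (fun u => (q u).1) /\ K (fun u => (q u).2).
have Kbr q q' : Kp q -> Kp q' -> K (fun u => br (q u) (q' u)).
  move=> [q1 q2] [q1' q2']; rewrite /br; apply: (Ka _ (fun u => - ((q u).2 * (q' u).1))); first exact: Km.
  by rewrite (_ : (fun u => _) = (fun u => -1 * ((q u).2 * (q' u).1))); [apply: (Km) => //; exact: Km|apply/funext => u; rewrite mulN1r].
have Kau y : Kp (fun u => au u y).
  rewrite /Kp /au; case: (y \in S) => /=; split => //.
  by do 2 apply: (Km) => //.
have [p pE] : K (fun u => cov c (au u) (1, 1)).
  apply: (K_sum Kc Ka) => t; apply: (Km) => //; apply: (Km); apply: (K_prod Kc Km) => i; apply: Kbr => //.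
have p0 : p = 0.
  have : 'X * p = 0.
    apply: poly_eq0_forall => u; rewrite hornerM hornerX -pE; have [->|u0] := eqVneq u 0; first by rewrite mul0r.
    by rewrite cu// mulr0.
  by move=> /eqP; rewrite mulf_eq0 polyX_eq0 => /eqP.
have := pE 0; rewrite p0 horner0 => <-; congr (cov c _ _); apply/funext => y.
by rewrite /split_config /au mul0r mul0r.
Qed.

Lemma exists_split_perm (S : {set 'I_n}) : (r <= #|S|)%N -> (#|S| <= n - r)%N ->
  exists t : 'Sn, forall i, t (cov_l i) \in S /\ t (cov_r i) \notin S.
Proof.
move=> rS Sr; pose l := enum S; pose l' := enum (~: S)%SET.
have sl : size l = #|S| by rewrite -cardE.
have sl' : size l' = (n - #|S|)%N by rewrite -cardE cardsCs finset.setCK card_ord.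
pose m := take r l ++ take r l' ++ (drop r l ++ drop r l').
have pm : perm_eq m (l ++ l').
  by rewrite /m -{3}(cat_take_drop r l) -{3}(cat_take_drop r l') -!catA perm_cat2l perm_catCA perm_cat2l perm_catC -catA || (rewrite /m -{3}(cat_take_drop r l) -{3}(cat_take_drop r l') -!catA perm_cat2l perm_catCA).
have um : uniq m.
  rewrite (perm_uniq pm) cat_uniq !enum_uniq andbT /=; apply/hasPn => y; rewrite !mem_enum finset.in_setC.
  by [].
have sm : size m = n by rewrite (perm_size pm) size_cat sl sl'; lia.
have [n0|n0] := posnP n.
  by exists 1%g => i; exfalso; have := ltn_ord i; move: n0 i => /eqP; rewrite !addn_eq0 => /andP[/andP[/eqP-> _] _].
pose x0 : 'I_n := Ordinal n0.
have inj : injective (fun i : 'I_n => nth x0 m i).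
  by move=> i j /eqP; rewrite nth_uniq ?sm// => /eqP/val_inj.
have str : size (take r l) = r by rewrite size_takel// sl.
have str' : size (take r l') = r by rewrite size_takel// sl'; lia.
exists (perm inj) => i; rewrite !permE /= /m; split.
  rewrite nth_cat str ltn_ord; have /mem_take : nth x0 (take r l) i \in take r l by rewrite mem_nth// str.
  by rewrite mem_enum.
rewrite nth_cat str ltnNge leq_addr /= addKn nth_cat str' ltn_ord.
have /mem_take : nth x0 (take r l') i \in take r l' by rewrite mem_nth// str'.
by rewrite mem_enum finset.in_setC.
Qed.

Lemma cov_split_neq0 (S : {set 'I_n}) : (r <= #|S|)%N -> (#|S| <= n - r)%N ->
  exists t, cov_term t (split_config S) (1, 1) != 0.
Proof.
move=> rS Sr; have [t tS] := exists_split_perm rS Sr; exists t; rewrite mulf_neq0//.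
  by apply/prodf_neq0 => i _; have [iS iN] := tS i; rewrite /split_config iS (negPf iN) /br /= mul1r mul0r subr0 oner_neq0.
apply/prodf_neq0 => j _; rewrite /split_config /br; case: ifP => _ /=.
  by rewrite mul1r mul0r subr0 oner_neq0.
by rewrite mul0r mul1r sub0r oppr_eq0 oner_neq0.
Qed.

(* [c] detects the clusters of intermediate size. *)
Definition cov_good (c : 'Sn -> k) := forall S : {set 'I_n}, (r <= #|S|)%N -> (#|S| <= n - r)%N ->
  cov c (split_config S) (1, 1) != 0.

Lemma cov_good_cluster c a x0 : cov_good c -> (forall y, a y != 0) -> cov_zero c a ->
  (#|cluster a x0| < r)%N \/ (n - r < #|cluster a x0|)%N.
Proof.
move=> cg a0 az; have [|rS] := ltnP #|cluster a x0| r; first by left.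
have [|Sr] := ltnP (n - r) #|cluster a x0|; first by right.
by have := cg _ rS Sr; rewrite cov_zero_split// eqxx.
Qed.

Lemma exists_cov_good (J : eqType) (s : seq J) (al : J -> 'I_n -> pt) (xs : J -> pt) :
  (forall j, j \in s -> exists t, cov_term t (al j) (xs j) != 0) ->
  exists c, cov_good c /\ forall j, j \in s -> cov c (al j) (xs j) != 0.
Proof.
move=> H; pose ok (S : {set 'I_n}) := (r <= #|S|)%N && (#|S| <= n - r)%N.
pose l (z : {set 'I_n} + J) t := match z with inl D => cov_term t (split_config D) (1, 1) | inr j => cov_term t (al j) (xs j) end.
have [|c cP] := @avoid_functionals k 'Sn _ (map inl (enum ok) ++ map inr s) l.
  move=> z; rewrite mem_cat => /orP[] /mapP[y yi ->] /=; last exact: H.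
  by move: yi; rewrite mem_enum => /andP[]; apply: cov_split_neq0.
exists c; split=> [S rS Sr|j js]; last by apply: (cP (inr j)); rewrite mem_cat map_f ?orbT.
by apply: (cP (inl S)); rewrite mem_cat map_f// mem_enum; apply/andP.
Qed.

End Covariants.

(** * Finiteness of the doubled configurations *)

Section DoubleConfigurations.
Context (k : closedFieldType) (e : nat).
Local Notation pt := (k * k)%type.
Local Notation n := (4 + 4 + e)%N.
Context (c : {perm 'I_n} -> k) (cg : cov_good c).

Definition double_config (a : 'I_n -> pt) :=
  [/\ forall y, a y != 0, cov_zero c a & forall x, #|cluster a x| = 2%N].

Definition cross_ratio (a : 'I_n -> pt) x y z w := br (a x) (a w) * br (a y) (a z) / (br (a y) (a w) * br (a x) (a z)).

(** In a semistable limit a cluster has at most half of the labels, and then fewer than 4 because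
    the covariant vanishes. Two distinct pairs cannot collide, as they would form a cluster of 4. So
    a bracket that is nonzero almost everywhere has a nonzero limit, and the cross ratio has no
    pole. *)
Lemma cross_ratio_finite (P : place k {a | double_config a}) x y z w :
  finite_at P (fun t => cross_ratio (sval t) x y z w).
Proof.
pose r u (t : {a | double_config a}) := sval t u.
have rU u : ae P [set t | r u t != 0] by apply: aeT => t; case: (svalP t) => h _ _; apply: h.
have [[x0 [C [C1 CU]]]|[g [h [d [r1 [F cl]]]]]] := semistable_reduction rU.
  have [t Ct] := ae_exists CU; exfalso.
  have : (#|C| <= #|cluster (sval t) x0|)%N.
    by apply: subset_leq_card; apply/fintype.subsetP => u uC; rewrite in_cluster; apply/eqP/Ct.
  by case: (svalP t) => _ _ ->; move: C1; rewrite card_ord; lia.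
have [gh d0 r10 tr] := F; rewrite card_ord in cl.
have r1z : cov_zero c r1.
  apply: (cov_zero_lim _ tr); apply: aeT => t; apply: cov_zero_lab; first by rewrite gh oner_neq0.
  by case: (svalP t).
have small u : (#|cluster r1 u| < 4)%N.
  by case: (cov_good_cluster u cg r10 r1z) => //; have := cl u; lia.
have par u v : ae P [set t | br (r u t) (r v t) = 0] -> br (r1 u) (r1 v) = 0.
  move=> uv; apply: tends_uniq (tends_br (tr u) (tr v)) _; apply: tends0; apply: aeW uv => t E.
  by rewrite br_scp br_lab E !mulr0.
have npar u v : ae P [set t | br (r u t) (r v t) != 0] -> br (r1 u) (r1 v) != 0.
  move=> uv; apply/negP => /eqP E.
  have mate u' : exists u'', u'' != u' /\ ae P [set t | br (r u' t) (r u'' t) = 0].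
    have : ae P [set t | exists u'', u'' != u' /\ br (r u' t) (r u'' t) = 0].
      apply: aeT => t; have [_ _ /(_ u') c2] := svalP t.
      have : (0 < #|cluster (sval t) u' :\ u'|)%N.
        by have := cardsD1 u' (cluster (sval t) u'); rewrite c2 in_cluster brr eqxx; lia.
      by move=> /card_gt0P[u'']; rewrite !inE ?in_cluster => /andP[uu /eqP E']; exists u''.
    by move=> /ae_finP[u'' H]; exists u''; split; [have [t []] := ae_exists H|apply: aeW H => t []].
  have [u' [uu' Eu']] := mate u; have [v' [vv' Ev']] := mate v.
  have [t [[nuv e1] e2]] := ae_exists (aeI (aeI uv Eu') Ev').
  have rt0 z' : r z' t != 0 by case: (svalP t) => h0 _ _; apply: h0.
  have sub : [:: u; u'; v; v'] \subset cluster r1 u.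
    apply/fintype.subsetP => q; rewrite !inE ?in_cluster => /or4P[] /eqP->; apply/eqP.
    - exact: brr.
    - exact: par.
    - exact: E.
    - exact: br_trans (r10 v) E (par _ _ Ev').
  have un : uniq [:: u; u'; v; v'].
    have uv' : u != v by apply: contraNneq nuv => ->; rewrite brr.
    have u_v' : u != v'.
      by apply: contraNneq nuv => ->; rewrite brC e2 oppr0.
    have u'v : u' != v by apply: contraNneq nuv => <-; rewrite e1.
    have u'v' : u' != v'.
      apply: contraNneq nuv => E'; apply/eqP; apply: br_trans (rt0 u') e1 _.
      by rewrite E' brC e2 oppr0.
    by rewrite /= !inE !negb_or uv' u_v' u'v u'v' ![u == u']eq_sym uu' ![v == v']eq_sym vv'.
  by have := leq_ltn_trans (subset_leq_card sub) (small u); rewrite (card_uniqP un).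
have [D0|D0] := ae_eq0 P (fun t => br (r y t) (r w t) * br (r x t) (r z t)).
  apply: finite_at_ae (finite_at_cst P 0); apply: aeW D0 => t D0.
  by rewrite /cross_ratio -/(r _ t) -/(r _ t) -/(r _ t) -/(r _ t) D0 invr0 mulr0.
have h1 : br (r1 y) (r1 w) * br (r1 x) (r1 z) != 0.
  by rewrite mulf_neq0 ?npar//; apply: aeW D0 => t; rewrite mulf_eq0 negb_or => /andP[].
pose R u t := scp (d u t) (lab (g t) (h t) (r u t)).
have tb u v : tends P (fun t => br (R u t) (R v t)) (br (r1 u) (r1 v)) := tends_br (tr u) (tr v).
eexists; apply: tends_ext (tends_div (tendsM (tb x w) (tb y z)) (tendsM (tb y w) (tb x z)) h1) => t.
rewrite /R !br_scp !br_lab !gh !mul1r /cross_ratio -!/(r _ t).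
have [Z|Z] := eqVneq (br (r y t) (r w t) * br (r x t) (r z t)) 0.
  rewrite Z invr0 mulr0 [X in _ / X](_ : _ = 0) ?invr0 ?mulr0//.
  by rewrite mulrACA Z mulr0.
move: Z; rewrite mulf_eq0 negb_or => /andP[Z1 Z2].
by field; rewrite Z1 Z2 !d0.
Qed.

(** Without poles, the cross ratios take finitely many values, and they determine a configuration
    once three independent labels are put in standard position. [om] lists the configurations with
    coordinates in this finite set; the last index stands for the point (0, 1). *)
Lemma double_config_finite : exists Om : seq ('I_n -> pt), forall a, double_config a ->
  exists i (g h : pt) (s : 'I_n -> k), [/\ (i < size Om)%N, br g h != 0, forall y, s y != 0 &
    forall y, nth (fun=> 0) Om i y = scp (s y) (lab g h (a y))].
Proof.
have /choice[s sP] : forall q : 'I_n * 'I_n * ('I_n * 'I_n), exists s : seq k, forall t : {a | double_config a}, cross_ratio (sval t) q.1.1 q.1.2 q.2.1 q.2.2 \in s.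
  by move=> q; apply: finite_range => P; apply: cross_ratio_finite.
pose S := flatten [seq s q | q <- enum {: 'I_n * 'I_n * ('I_n * 'I_n)}].
have SP a x y z w : double_config a -> cross_ratio a x y z w \in S.
  move=> da; apply/flattenP; exists (s ((x, y), (z, w))); last exact: (sP ((x, y), (z, w)) (exist _ a da)).
  by apply: map_f; rewrite mem_enum.
pose om (f : {ffun 'I_n -> 'I_(size S).+1}) y : pt := if (f y < size S)%N then (1, S`_(f y)) else (0, 1).
exists [seq om f | f <- enum {: {ffun 'I_n -> 'I_(size S).+1}}] => a da; have [a0 _ c2] := da.
have ex2 x : exists y, br (a x) (a y) != 0.
  have : (0 < #|~: cluster a x|)%SET%N by have := cardsC (cluster a x); rewrite c2 card_ord; lia.
  by move=> /card_gt0P[y]; rewrite finset.in_setC in_cluster; exists y.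
pose x : 'I_n := ord0; have [y xy] := ex2 x.
have [z [xz yz]] : exists z, br (a x) (a z) != 0 /\ br (a y) (a z) != 0.
  have : (0 < #|~: (cluster a x :|: cluster a y)|)%SET%N.
    have := cardsC (cluster a x :|: cluster a y)%SET; have := cardsUI (cluster a x) (cluster a y).
    by rewrite !c2 card_ord; lia.
  by move=> /card_gt0P[z]; rewrite finset.in_setC finset.in_setU !in_cluster negb_or => /andP[]; exists z.
pose g := scp (br (a y) (a z)) (a x); pose h := scp (- br (a x) (a z)) (a y).
have labE w : lab g h (a w) = (br (a x) (a z) * br (a y) (a w), br (a y) (a z) * br (a x) (a w)).
  by rewrite /lab /g /h /br /scp /=; congr (_, _); ring.
pose f : {ffun 'I_n -> 'I_(size S).+1} := [ffun w => if br (a y) (a w) == 0 then ord_max else inord (index (cross_ratio a x y z w) S)].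
pose sc w := if br (a y) (a w) == 0 then (br (a y) (a z) * br (a x) (a w))^-1 else (br (a x) (a z) * br (a y) (a w))^-1.
have xw w : br (a y) (a w) = 0 -> br (a x) (a w) != 0.
  move=> yw; apply: contra_neq xy => E; apply: br_trans (a0 w) E _.
  by rewrite brC yw oppr0.
exists (enum_rank f), g, h, sc; split.
- by rewrite size_map -cardE ltn_ord.
- by rewrite /g /h br_scp !mulf_neq0 ?oppr_eq0.
- by move=> w; rewrite /sc /=; case: (br (a y) (a w) =P 0) => [yw|/eqP ww]; rewrite invr_neq0 ?mulf_neq0// xw.
move=> w; rewrite (nth_map f) -?cardE ?ltn_ord// nth_enum_rank labE /om /sc ffunE.
case: eqP => [yw|/eqP yw].
  by rewrite /= ltnn /scp /= yw !mulr0 mulVf// mulf_neq0// xw.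
have cS : (index (cross_ratio a x y z w) S < size S)%N by rewrite index_mem; apply: SP.
rewrite inordK ?(leqW cS)// cS nth_index ?SP// /scp /= mulVf ?mulf_neq0//; congr (_, _).
by rewrite /cross_ratio; field; rewrite xz yw.
Qed.

End DoubleConfigurations.

Section ChooseCovariants.
Context (k : closedFieldType) (eA eB : nat).
Local Notation pt := (k * k)%type.
Local Notation nA := (4 + 4 + eA)%N.
Local Notation nB := (6 + 6 + eB)%N.

Lemma exists_nonparallel (L : finType) (a : L -> pt) : (forall y, a y != 0) -> exists x, forall y, br (a y) x != 0.
Proof.
move=> a0; have /closed_nonrootP[t] : prodlin a != 0 by rewrite prodlin_eq0; apply/existsPn.
rewrite rootE -(hev1 t (size_prodlin a)) hev_prodlin => /prodf_neq0 h.
by exists (1, t) => y; apply: h.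
Qed.

(* The second covariant is chosen after the first one, so as not to vanish   *)
(* on the finitely many tripled configurations whose doubles are killed by   *)
(* the first one; this keeps the discriminant 4 A^3 + 27 B^2 away from 0.    *)
Theorem exists_covariants : exists (c1 : {perm 'I_nA} -> k) (c2 : {perm 'I_nB} -> k),
  [/\ cov_good c1, cov_good c2 & forall (al : 'I_nA -> pt) (be : 'I_nB -> pt) (rho : 'I_nB -> 'I_nA),
    (forall x, al x != 0) -> (forall y, be y != 0) -> cov_zero c1 al -> cov_zero c2 be ->
    (forall x, #|cluster al x| = 2%N) -> (forall y, #|cluster be y| = 3%N) ->
    ~ forall y, br (be y) (al (rho y)) = 0].
Proof.
have [c1 [g1 _]] := @exists_cov_good k 4 eA unit [::] (fun _ _ => 0) (fun=> 0) (fun j H => False_ind _ (Bool.diff_false_true H)).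
have [Om OmP] := double_config_finite g1.
pose J := ('I_(size Om) * {ffun 'I_nB -> 'I_nA})%type.
pose cf (j : J) (y : 'I_nB) : pt := nth (fun=> 0) Om j.1 (j.2 y).
pose valid (j : J) := (forall y, cf j y != 0) /\ forall y, #|cluster (cf j) y| = 3%N.
have /choice[xs xsP] : forall j, exists x, valid j -> forall y, br (cf j y) x != 0.
  move=> j; have [v|nv] := pselect (valid j); last by exists 0.
  by have [x xP] := exists_nonparallel v.1; exists x.
have [|c2 [g2 c2P]] := @exists_cov_good k 6 eB _ [seq j <- enum {: J} | `[< valid j >]] cf xs.
  move=> j; rewrite mem_filter => /andP[/asboolP v _]; have [v0 v3] := v.
  pose y0 : 'I_nB := ord0.
  have [y1 y01] : exists y1, br (cf j y0) (cf j y1) != 0.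
    have : (0 < #|~: cluster (cf j) y0|)%SET%N by have := cardsC (cluster (cf j) y0); rewrite v3 card_ord; lia.
    by move=> /card_gt0P[y1]; rewrite finset.in_setC in_cluster; exists y1.
  (* Two clusters of size 3 make a set of 6 labels; the six brackets of a covariant term can be
     taken between it and its complement, and they are all nonzero. *)
  pose S := (cluster (cf j) y0 :|: cluster (cf j) y1)%SET.
  have S6 : #|S| = 6%N.
    have := cardsUI (cluster (cf j) y0) (cluster (cf j) y1); rewrite !v3 (_ : _ :&: _ = finset.set0)%SET ?cards0 ?addn0 //.
    apply/eqP; rewrite -finset.subset0; apply/fintype.subsetP => z; rewrite !inE ?in_cluster => /andP[/eqP z0 /eqP z1].
    by case/negP: y01; apply/eqP; apply: br_trans (v0 z) z0 _; rewrite brC z1 oppr0.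
  have [||t tS] := @exists_split_perm 6 eB S; [by rewrite S6|by rewrite S6; lia|].
  exists t; rewrite mulf_neq0//; last by apply/prodf_neq0 => i _; apply: xsP.
  apply/prodf_neq0 => i _; have [iS iN] := tS i; apply: contraNneq iN => E.
  move: iS; rewrite !finset.in_setU !in_cluster => /orP[] /eqP h; apply/orP; [left|right];
    by apply/eqP; apply: br_trans (v0 _) h E.
exists c1, c2; split=> // al be rho al0 be0 z1 z2 cl2 cl3 par.
have [i [g [h [s [il gh s0 sE]]]]] := OmP al (And3 al0 z1 cl2).
pose j : J := (Ordinal il, [ffun y => rho y]).
have cfE y : cf j y = scp (s (rho y)) (lab g h (al (rho y))) by rewrite /cf /= ffunE sE.
have scp0 (u : k) (q : pt) : u != 0 -> q != 0 -> scp u q != 0.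
  move=> u0; apply: contraNneq => -[/eqP]; rewrite mulf_eq0 (negPf u0) /= => /eqP q1 /eqP.
  by rewrite mulf_eq0 (negPf u0) /= => /eqP q2; apply/eqP; case: q q1 q2 => ? ? /= -> ->.
have cf0 y : cf j y != 0 by rewrite cfE scp0// lab_eq0.
have /choice[u uE] : forall y, exists u, cf j y = scp u (lab g h (be y)).
  move=> y; have bl0 : lab g h (be y) != 0 by rewrite lab_eq0.
  have [|u ->] := br0_scp (r := cf j y) bl0; last by exists u.
  have E1 : br (lab g h (al (rho y))) (lab g h (be y)) = 0 by rewrite br_lab [X in _ * X]brC par oppr0 mulr0.
  have -> : lab g h (be y) = scp 1 (lab g h (be y)) by rewrite /scp !mul1r; case: (lab g h (be y)).
  by rewrite cfE br_scp E1 mulr0.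
have u0 y : u y != 0 by apply: contraNneq (cf0 y) => E; rewrite uE E /scp !mul0r.
have vj : valid j.
  split=> // y; apply: eq_trans (cl3 y); apply: eq_card => z; rewrite !in_cluster !uE br_scp br_lab.
  by rewrite !mulf_eq0 !(negPf (u0 _)) (negPf gh).
have : cov c2 (cf j) (xs j) != 0 by apply: c2P; rewrite mem_filter mem_enum andbT; apply/asboolP.
have -> : cf j = fun y => scp (u y) (lab g h (be y)) by apply/funext.
by rewrite (cov_zero_lab _ gh z2) eqxx.
Qed.

End ChooseCovariants.

Lemma frm_prodlin_ord (k : closedFieldType) m (a : 'I_m -> k * k) g g' :
  frm m (prodlin a) g g' = prodlin (fun y => lab g g' (a y)).
Proof. by have := frm_prodlin a g g'; rewrite card_ord. Qed.

(** * Limits of forms killed by a covariant *)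

Section CovariantLimits.
Context (k : closedFieldType) (r e : nat).
Local Notation pt := (k * k)%type.
Local Notation n := (r + r + e)%N.
Context (c : {perm 'I_n} -> k).

Lemma cov_zero0 : (0 < n)%N -> cov_zero c (fun=> 0).
Proof.
move=> n0 x; have := cov_scp c (fun=> 0) x (fun=> 0) 1.
rewrite (_ : (fun y => scp 0 0) = fun=> 0); last by apply/funext => y; rewrite /scp !mul0r.
rewrite (_ : scp 1 x = x); last by rewrite /scp !mul1r; case: x.
by move=> ->; rewrite prodr_const card_ord expr0n (gtn_eqF n0) !mul0r.
Qed.

(** The labels are made primitive so that they converge, and the vanishing of the covariant passes
    to their limits. The product of the limits is proportional to [F1], and the constant is absorbed
    into one label. *)
Lemma limit_labels (I : Type) (P : place k I) (a : I -> 'I_n -> pt) (g g' : I -> pt) (l : I -> k) (F1 : {poly k}) :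
  (0 < n)%N -> (forall t, br (g t) (g' t) = 1) -> (forall t, cov_zero c (a t)) ->
  tendsp P (fun t => l t *: frm n (prodlin (a t)) (g t) (g' t)) F1 ->
  exists2 b, prodlin b = F1 & cov_zero c b.
Proof.
move=> n0 gg az tF; have [F0|F0] := eqVneq F1 0.
  exists (fun=> 0); last exact: cov_zero0.
  by rewrite F0; apply/eqP; rewrite prodlin_eq0; apply/existsP; exists (Ordinal n0).
have FE t : l t *: frm n (prodlin (a t)) (g t) (g' t) = l t *: prodlin (fun y => lab (g t) (g' t) (a t y)).
  by rewrite frm_prodlin_ord.
have [i Fi] : exists i, F1`_i != 0 by exists (size F1).-1; rewrite -/(lead_coef _) lead_coef_eq0.
have lU : ae P [set t | forall y, lab (g t) (g' t) (a t y) != 0].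
  apply: aeW (tends_ne0 (tF i) Fi) => t /=; rewrite FE => H y; apply: contraNneq H => E.
  have /eqP -> : prodlin (fun y => lab (g t) (g' t) (a t y)) == 0 by rewrite prodlin_eq0; apply/existsP; exists y; rewrite E.
  by rewrite scaler0 coef0.
have /choice[f fP] : forall y, exists f : (I -> k) * (I -> pt) * pt, [/\ forall t, f.1.1 t != 0,
    forall t, lab (g t) (g' t) (a t y) = scp (f.1.1 t) (f.1.2 t) \/ lab (g t) (g' t) (a t y) = 0,
    tendst P f.1.2 f.2 & f.2 != 0].
  move=> y; have [|f [q [q0 H]]] := @exists_primitive _ _ P (fun t => lab (g t) (g' t) (a t y)).
    by apply: aeW lU => t; apply.
  by exists (f, q, q0).
pose q y t := (f y).1.2 t; pose q0 y := (f y).2.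
have q00 y : q0 y != 0 by case: (fP y).
have tq y : tendst P (q y) (q0 y) by case: (fP y).
have f0 y t : (f y).1.1 t != 0 by case: (fP y).
have qE : ae P [set t | forall y, lab (g t) (g' t) (a t y) = scp ((f y).1.1 t) (q y t)].
  apply: aeW lU => t H y; have [_ /(_ t)[//|E] _ _] := fP y.
  by have := H y; rewrite E eqxx.
have tD : tendsp P (fun t => prodlin (fun y => q y t)) (prodlin q0) by rewrite /prodlin; apply: tendsp_prod => y; exact: tendsp_lin (tq y).
have D0 : prodlin q0 != 0 by rewrite prodlin_eq0; apply/existsPn.
have [|m m0 E] := limits_proportional (mu := fun t => l t * \prod_y (f y).1.1 t) tF tD F0 D0.
  apply: aeW qE => t H; rewrite /= FE -scalerA -prodlin_scp; congr (_ *: prodlin _).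
  by apply/funext => y; rewrite H.
have qz : cov_zero c q0.
  apply: (cov_zero_lim _ tq); apply: aeW qE => t H.
  have -> : (fun y => q y t) = fun y => scp ((f y).1.1 t)^-1 (lab (g t) (g' t) (a t y)).
    apply/funext => y; rewrite H /scp /= !mulrA mulVf// !mul1r; by case: (q y t).
  by apply: cov_zero_lab (az t); rewrite gg oner_neq0.
have [|b bE [s [_ bs]]] := prodlin_scp_lift m q0; first by rewrite card_ord.
exists b; first by rewrite bE E.
move=> x; rewrite bs; have -> : x = scp 1 x by rewrite /scp !mul1r; case: x.
by rewrite cov_scp qz mulr0.
Qed.

(** A zero of order [r] is a cluster of at least [r] labels; the sizes from [r] to [n - r] being
    excluded, it has more than [n - r]. *)
Lemma order_jump (b : 'I_n -> pt) q s : (0 < r)%N -> cov_good c -> cov_zero c b -> br q s = 1 ->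
  (forall i, (i < r)%N -> (frm n (prodlin b) q s)`_i = 0) -> forall i, (i <= n - r)%N -> (frm n (prodlin b) q s)`_i = 0.
Proof.
move=> r0 cg bz qs low; have [E|] := eqVneq (prodlin b) 0.
  by move=> i _; rewrite E -[X in frm n X](scale0r (0 : {poly k})) frmZ scale0r coef0.
rewrite prodlin_eq0 => /existsPn b0; have FE : frm n (prodlin b) q s = prodlin (fun y => lab q s (b y)).
  by rewrite frm_prodlin_ord.
have l0 y : lab q s (b y) != 0 by rewrite lab_eq0 ?qs ?oner_neq0//; apply: b0.
have q0 : q != 0.
  by apply: contraTneq isT => q0; move: qs; rewrite q0 /br !mul0r subr0 => /esym/eqP; rewrite oner_eq0.
have := low; rewrite FE => /(prodlin_coef_low _ l0) rc.
have [z zq|none] := pickP [pred z | br q (b z) == 0]; last by move: rc; rewrite (eq_card0 none) leqNgt r0.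
have cE : #|[pred y | (lab q s (b y)).2 == 0]| = #|cluster b z|.
  apply: eq_card => y; rewrite inE in_cluster /lab /=; apply/eqP/eqP => h.
    by apply: br_trans q0 _ h; rewrite brC (eqP zq) oppr0.
  by apply: br_trans (b0 z) (eqP zq) h.
rewrite cE in rc; have [|H] := cov_good_cluster z cg b0 bz; first by rewrite ltnNge rc.
have {}H : ((n - r).+1 <= #|[pred y | (lab q s (b y)).2 == 0%R]|)%N by rewrite cE.
by move=> i ile; have /(prodlin_coef_low _ l0)/(_ i) := H; apply.
Qed.

End CovariantLimits.

(** The two inequalities are what proportionality of a cube and a square gives for the orders [a]
    and [b] of their roots, with the divisions by 2 and 3 rounded up. *)
Lemma order_ratio a b : (uphalf (3 * a) <= b)%N -> ((2 * b + 2) %/ 3 <= a)%N -> (3 * a = 2 * b)%N.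
Proof. by lia. Qed.

Lemma uphalf3_lt a : (2 * uphalf (3 * a) < a * 3 + 2)%N.
Proof. by lia. Qed.

Lemma div3_lt b : (3 * ((2 * b + 2) %/ 3) < b * 2 + 3)%N.
Proof. by lia. Qed.

(** * A family in which all limits exist *)

Section CompleteFamily.
Context (k : closedFieldType) (N : nat) (N2 : (2 <= N)%N).
Hypotheses (c2_neq0 : 2%N \notin [pchar k]%R) (c3_neq0 : 3%N \notin [pchar k]%R).
Local Notation pt := (k * k)%type.
Local Notation W := (weierstrass_data k N).
Local Notation nA := (4 + 4 + (4 * N - 8))%N.
Local Notation nB := (6 + 6 + (6 * N - 12))%N.
Context (c1 : {perm 'I_nA} -> k) (c2 : {perm 'I_nB} -> k).

(** The covariants have orders 4N - 8 and 6N - 12 and impose 4N - 7 and 6N - 11 conditions, which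
    leaves 8 and 12 coefficients free. The label counts [nA] and [nB] equal 4N and 6N because N >=
    2. *)
Definition in_family (v : W) := T_ v /\ exists (al : 'I_nA -> pt) (be : 'I_nB -> pt),
  [/\ prodlin al = pA v, prodlin be = pB v, cov_zero c1 al & cov_zero c2 be].

Hypotheses (g1 : cov_good c1) (g2 : cov_good c2).
Hypothesis c12 : forall (al : 'I_nA -> pt) (be : 'I_nB -> pt) (rho : 'I_nB -> 'I_nA),
  (forall x, al x != 0) -> (forall y, be y != 0) -> cov_zero c1 al -> cov_zero c2 be ->
  (forall x, #|cluster al x| = 2%N) -> (forall y, #|cluster be y| = 3%N) ->
  ~ forall y, br (be y) (al (rho y)) = 0.

Lemma nA_eq : nA = (4 * N)%N. Proof. by lia. Qed.
Lemma nB_eq : nB = (6 * N)%N. Proof. by lia. Qed.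
Lemma frm_nA (p : {poly k}) q s : frm nA p q s = frm (4 * N) p q s. Proof. by rewrite nA_eq. Qed.
Lemma frm_nB (p : {poly k}) q s : frm nB p q s = frm (6 * N) p q s. Proof. by rewrite nB_eq. Qed.

Let mult m (a : 'I_m -> pt) q := #|[pred y | br q (a y) == 0]|.

Lemma mult_dvd m (a : 'I_m -> pt) q s j : br q s = 1 -> (forall y, a y != 0) ->
  ('X^j %| frm m (prodlin a) q s) = (j <= mult a q)%N.
Proof.
move=> qs a0; have FE : frm m (prodlin a) q s = prodlin (fun y => lab q s (a y)).
  by rewrite frm_prodlin_ord.
have l0 y : lab q s (a y) != 0 by rewrite lab_eq0 ?qs ?oner_neq0.
rewrite FE; apply/dvdXnP/idP => [/(prodlin_coef_low _ l0)//|H].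
by apply/(prodlin_coef_low _ l0).
Qed.

(** If A^3 and B^2 were proportional, the orders a, b at a point would satisfy 3a = 2b, and
    minimality leaves (0, 0) and (2, 3). So A would be a doubled and B a tripled configuration over
    the same points, which [c12] excludes. The characteristic enters through the invertibility of 4
    and 27. *)
Lemma disc_neq0 (al : 'I_nA -> pt) (be : 'I_nB -> pt) : cov_zero c1 al -> cov_zero c2 be ->
  minimal N (prodlin al) (prodlin be) -> 4%:R *: prodlin al ^+ 3 + 27%:R *: prodlin be ^+ 2 != 0.
Proof.
move=> z1 z2 mAB; apply/negP => /eqP D.
have nz (p : nat) : prime p -> p \notin [pchar k] -> (p%:R : k) != 0.
  by move=> pp; apply: contraNneq => p0; rewrite inE /= pp p0 /=.
have n2 : (2%:R : k) != 0 by apply: nz.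
have n3 : (3%:R : k) != 0 by apply: nz.
have n4 : (4%:R : k) != 0 by rewrite (natrM _ 2 2) mulf_neq0.
have n27 : (27%:R : k) != 0 by rewrite (natrM _ 3 9) (natrM _ 3 3) !mulf_neq0.
have AE : prodlin al ^+ 3 = (- (27%:R / 4%:R)) *: prodlin be ^+ 2.
  apply: (scalerI n4); rewrite scalerA mulrN mulrCA mulfV// mulr1 scaleNr; apply/eqP.
  by rewrite -addr_eq0 D.
have BE : prodlin be ^+ 2 = (- (4%:R / 27%:R)) *: prodlin al ^+ 3.
  rewrite AE scalerA mulrNN mulrA divfK// mulfV ?scale1r//.
have fr0 : br ((1, 0) : pt) (0, 1) = 1 by rewrite /br /= mulr1 mulr0 subr0.
have A0 : prodlin al != 0.
  apply: contraT => /negPn/eqP A0; have B0 : prodlin be = 0.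
    by apply/eqP; rewrite -(expf_eq0 _ 2) /= || (have /eqP := BE; rewrite A0 expr0n /= scaler0 expf_eq0 /= => /eqP->).
  have [[i _]|[i _]] := mAB _ _ fr0; rewrite ?A0 ?B0.
    by rewrite -[X in frm _ X](scale0r (0 : {poly k})) frmZ scale0r coef0 eqxx.
  by rewrite -[X in frm _ X](scale0r (0 : {poly k})) frmZ scale0r coef0 eqxx.
have B0 : prodlin be != 0.
  by apply: contraNneq A0 => B0; move/eqP: AE; rewrite B0 expr0n /= scaler0 expf_eq0.
have al0 : forall x, al x != 0 by move: A0; rewrite prodlin_eq0 => /existsPn.
have be0 : forall x, be x != 0 by move: B0; rewrite prodlin_eq0 => /existsPn.
have sA : (size (prodlin al) <= nA.+1)%N by rewrite -[X in (_ <= X.+1)%N]card_ord size_prodlin.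
have sB : (size (prodlin be) <= nB.+1)%N by rewrite -[X in (_ <= X.+1)%N]card_ord size_prodlin.
have EF q s : frm nA (prodlin al) q s ^+ 3 = (- (27%:R / 4%:R)) *: frm nB (prodlin be) q s ^+ 2.
  rewrite -!frmX// -frmZ -AE; congr frm; lia.
have EF' q s : frm nB (prodlin be) q s ^+ 2 = (- (4%:R / 27%:R)) *: frm nA (prodlin al) q s ^+ 3.
  rewrite -!frmX// -frmZ -BE; congr frm; lia.
have order q : q != 0 -> (3 * mult al q = 2 * mult be q)%N.
  move=> /exists_frame[s qs].
  have dA : 'X^(mult al q) %| frm nA (prodlin al) q s by rewrite mult_dvd.
  have dB : 'X^(mult be q) %| frm nB (prodlin be) q s by rewrite mult_dvd.
  have h1 : (uphalf (3 * mult al q) <= mult be q)%N.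
    rewrite -(mult_dvd _ qs be0); apply: (dvdXn_root (isT : (0 < 2)%N) _ (uphalf3_lt (mult al q))).
    by rewrite EF' -mul_polyC dvdp_mull// exprM dvdp_exp2r.
  have h2 : ((2 * mult be q + 2) %/ 3 <= mult al q)%N.
    rewrite -(mult_dvd _ qs al0); apply: (dvdXn_root (isT : (0 < 3)%N) _ (div3_lt (mult be q))).
    by rewrite EF -mul_polyC dvdp_mull// exprM dvdp_exp2r.
  exact: order_ratio h1 h2.
have mA (x : 'I_nA) : (0 < mult al (al x))%N by apply/card_gt0P; exists x; rewrite inE brr.
have mB (x : 'I_nB) : (0 < mult be (be x))%N by apply/card_gt0P; exists x; rewrite inE brr.
have small q : q != 0 -> (mult al q < 4)%N \/ (mult be q < 6)%N.
  move=> /exists_frame[s qs]; have [[i i4 Ai]|[i i6 Bi]] := mAB _ _ qs; [left|right].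
    rewrite ltnNge; apply: contra Ai; rewrite -(mult_dvd _ qs al0) => /dvdXnP/(_ i i4).
    by rewrite frm_nA => ->.
  rewrite ltnNge; apply: contra Bi; rewrite -(mult_dvd _ qs be0) => /dvdXnP/(_ i i6).
  by rewrite frm_nB => ->.
have exact q : q != 0 -> (0 < mult al q)%N || (0 < mult be q)%N -> mult al q = 2%N /\ mult be q = 3%N.
  by move=> q0; have := order q q0; case: (small q q0); lia.
have cA x : #|cluster al x| = 2%N.
  have [|E _] := exact _ (al0 x); first by rewrite mA.
  by apply: eq_trans E; apply: eq_card => y; rewrite in_cluster inE.
have cB y : #|cluster be y| = 3%N.
  have [|_ E] := exact _ (be0 y); first by rewrite mB orbT.
  by apply: eq_trans E; apply: eq_card => z; rewrite in_cluster inE.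
have /choice[rho rhoP] : forall y, exists x, br (be y) (al x) = 0.
  move=> y; have [|E _] := exact _ (be0 y); first by rewrite mB orbT.
  have : (0 < mult al (be y))%N by rewrite E.
  by move=> /card_gt0P[x]; rewrite inE => /eqP; exists x.
exact: c12 al0 be0 z1 z2 cA cB rhoP.
Qed.

(** Semistable reduction of the pencil labels gives a nonzero limit pair killed by both covariants.
    At a nonminimal point the orders would jump to at least 4N - 3 and 6N - 5, so that all members
    but one would vanish to order 12N - 10 and more than half of the labels would form a cluster,
    against semistability. *)
Theorem family_limit (I : Type) (P : place k I) (v : I -> W) : (forall t, in_family (v t)) ->
  exists (g g' : I -> pt) (lam : I -> k) w, [/\ forall t, br (g t) (g' t) = 1, forall t, lam t != 0,
    tendsp P (fun t => lam t ^+ 4 *: frm (4 * N) (pA (v t)) (g t) (g' t)) (pA w),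
    tendsp P (fun t => lam t ^+ 6 *: frm (6 * N) (pB (v t)) (g t) (g' t)) (pB w) & in_family w].
Proof.
move=> fv; have [ss [ss_inj ss1]] := exists_pencils k N2.
have mv t : minimal N (pA (v t)) (pB (v t)) by have [/(T_P _ (ltnW N2))[]] := fv t.
have [a0 vU] : exists a, ae P [set t | pencil_form (ss a) (v t) != 0].
  apply/ae_finP; apply: aeT => t /=.
  have [E|H] := eqVneq (pencil_form (ss ord0) (v t)) 0; last by exists ord0.
  by exists ord_max; apply/eqP => E'; have := ss1 _ (mv t) _ _ E E'.
have sa_inj := ss_inj a0.
have /choice[r' r'E] := fun t => exists_labels N2 (ss a0) (v t); pose r x t := r' t x.
have rU x : ae P [set t | r x t != 0] by apply: aeW vU => t vt; apply: labels_neq0 (r'E t) vt x.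
have [[x0 [C [C1 CU]]]|[g [g' [c [r1 [F cl1]]]]]] := semistable_reduction rU.
  have [t [vt Ct]] := ae_exists (aeI vU CU); exfalso.
  have := cluster_bound_lt N2 (cluster_labels N2 sa_inj x0 (mv t) (r'E t) vt); move: C1; rewrite card_ord.
  have : (#|C| <= #|cluster (r' t) x0|)%N.
    by apply: subset_leq_card; apply/fintype.subsetP => z zC; rewrite in_cluster; apply/eqP/Ct.
  have := cluster_labels N2 sa_inj x0 (mv t) (r'E t) vt; move/(cluster_bound_lt N2); lia.
have [gg c0 r10 tr] := F; rewrite card_ord in cl1.
have h0 : (0 < 12 * N + 2)%N by rewrite addn2.
have [lam [A1 [B1 [lam0 tA tB [AB0 low]]]]] := pencil_limit sa_inj (ltnW N2) h0 (card_labels N2)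
  (fun t => size_pA (v t)) (fun t => size_pB (v t)) (fun t => r'E t) F.
have sA1 : (size A1 <= (4 * N).+1)%N.
  by apply: tendsp_size tA => t; apply: leq_trans (size_scale_leq _ _) (size_frm _ _ _ _).
have sB1 : (size B1 <= (6 * N).+1)%N.
  by apply: tendsp_size tB => t; apply: leq_trans (size_scale_leq _ _) (size_frm _ _ _ _).
exists g, g', lam, (wdata N A1 B1); rewrite pA_wdata// pB_wdata//; split=> //.
have /choice[al alP] : forall t, exists al : 'I_nA -> pt, prodlin al = pA (v t) /\ cov_zero c1 al.
  by move=> t; have [_ [al [be []]]] := fv t; exists al.
have /choice[be beP] : forall t, exists be : 'I_nB -> pt, prodlin be = pB (v t) /\ cov_zero c2 be.
  by move=> t; have [_ [al' [be []]]] := fv t; exists be.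
have [|a aE az] := @limit_labels _ _ _ c1 I P al g g' (fun t => lam t ^+ 4) A1 isT gg (fun t => (alP t).2).
  by apply: tendsp_ext tA => t; rewrite (alP t).1 nA_eq.
have [|b bE bz] := @limit_labels _ _ _ c2 I P be g g' (fun t => lam t ^+ 6) B1 isT gg (fun t => (beP t).2).
  by apply: tendsp_ext tB => t; rewrite (beP t).1 nB_eq.
have mAB : minimal N A1 B1.
  move=> q s qs; apply: contrapT => /not_orP[nA' nB'].
  have jA := @order_jump _ _ _ c1 a q s isT g1 az qs; have jB := @order_jump _ _ _ c2 b q s isT g2 bz qs.
  rewrite aE nA_eq in jA; rewrite bE nB_eq in jB.
  have [||i iA|i iB|z cz] := low (4 * N - 3)%N (6 * N - 5)%N (12 * N - 10)%N q s qs; try by lia.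
  - apply: jA; last by lia.
    by move=> j j4; apply/eqP/negPn/negP => cj; apply: nA'; exists j.
  - apply: jB; last by lia.
    by move=> j j6; apply/eqP/negPn/negP => cj; apply: nB'; exists j.
  have := cl1 z; have : (12 * N * (12 * N + 2) < 2 * ((12 * N + 2).-1 * (12 * N - 10)))%N by nia.
  rewrite -(card_labels N2) card_ord; lia.
split; last by exists a, b; rewrite pA_wdata// pB_wdata.
apply/(T_P _ (ltnW N2)); rewrite pA_wdata// pB_wdata//; split=> //.
by rewrite -aE -bE; apply: disc_neq0; rewrite ?aE ?bE.
Qed.

Local Notation semi_inv := (semi_invariant (@weierstrass_act k N) (@weierstrass_char k)).

Theorem family_limit_invariants (I : Type) (P : place k I) (v : I -> W) : (forall t, in_family (v t)) ->
  exists (th : I -> k) w, [/\ forall t, th t != 0, in_family w &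
    forall n f, semi_inv n f -> tends P (fun t => th t ^+ n * f (v t)) (f w)].
Proof.
move=> /(family_limit P)[g [g' [lam [w [gg lam0 tA tB fw]]]]]; exists lam, w; split=> // n f [pf sf].
have /choice[gl glP] := fun t => exists_gl (gg t) (lam0 t).
(* [option I] adjoins the limit as one more index, so that a single application of
   [polynomial_fun_coef] treats the family together with its limit. *)
pose u (o : option I) : W := if o is Some t then weierstrass_act (gl t) (v t) else w.
pose Q (h : option I -> k) := tends P (fun t => h (Some t)) (h None).
suff : Q (fun o => f (u o)).
  by apply: tends_ext => t; rewrite /= sf; have [_ _ <-] := glP t.
apply: (polynomial_fun_coef (Q := Q)) pf.
- by move=> c; apply: tends_cst.
- by move=> h h' th th'; apply: tendsD.
- by move=> h h' th th'; apply: tendsM.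
- by move=> i; apply: tends_ext (tA i) => t; rewrite /= pA_act; have [-> -> ->] := glP t.
by move=> i; apply: tends_ext (tB i) => t; rewrite /= pB_act; have [-> -> ->] := glP t.
Qed.

End CompleteFamily.

(** * Points of the quotient and classes of families *)

Section GradedForms.
Context (k : closedFieldType) (T : Type) (K : (T -> k) -> Prop).
Hypothesis K_cst : forall c, K (fun=> c).
Hypothesis K_add : forall f g, K f -> K g -> K (fun v => f v + g v).
Hypothesis K_mul : forall f g, K f -> K g -> K (fun v => f v * g v).
Context (n : nat).
Local Notation pt := (k * k)%type.
Local Notation lsp := (@lspan k T K n).

Lemma lspan_perm dl f (t : {perm 'I_n}) : lsp dl f -> lsp (fun x => dl ((t^-1)%g x)) (fun v r => f v (fun x => r (t x))).
Proof.
elim=> [c al Kc ald|f1 f2 _ IH1 _ IH2]; last by apply: (lspan_add IH1 IH2).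
apply: (lspan_ext _ _ (@lspan_mon _ _ K n (fun x => dl ((t^-1)%g x)) c (fun x => al ((t^-1)%g x)) Kc _)) => //.
move=> v r; congr (_ * _); rewrite /label_mon (reindex_inj (@perm_inj _ t)); apply: eq_bigr => x _.
by rewrite permK.
Qed.

Lemma lspan_exp dl f e : lsp dl f -> lsp (fun x => e * dl x)%N (fun v r => f v r ^+ e).
Proof.
move=> lf; elim: e => [|e IH]; first by apply: (lspan_ext _ _ (lspan_cst n (K_cst 1))) => // v r; rewrite expr0.
by apply: (lspan_ext _ _ (lspanM K_mul lf IH)) => [x|v r]; rewrite ?exprS// mulSn.
Qed.

Context (x z : 'I_n).
Let deg d i u := ((d - i) * (u == x) + i * (u == z))%N.

(** Degree bookkeeping for a form expanded in the frame of the labels [x] and [z]: coefficient [i]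
    has degree [d - i] in label [x], [i] in label [z], and 0 in the others. *)
Definition graded_form d (F : T -> ('I_n -> pt) -> {poly k}) := forall i,
  ((i <= d)%N -> lsp (deg d i) (fun v r => (F v r)`_i)) /\ ((d < i)%N -> forall v r, (F v r)`_i = 0).

Lemma graded_form_ext d F G : (forall v r, F v r = G v r) -> graded_form d F -> graded_form d G.
Proof. by move=> FG; suff -> : F = G by []; apply/funext => v; apply/funext => r. Qed.

Lemma graded_formM d e F G : graded_form d F -> graded_form e G -> graded_form (d + e) (fun v r => F v r * G v r).
Proof.
move=> hF hG i; split=> [ide|ide v r]; last first.
  rewrite coefM big1// => j _; have [dj|jd] := ltnP d j; first by rewrite (hF j).2// mul0r.
  by rewrite (hG (i - j)%N).2 ?mulr0//; lia.
pose Q (j : 'I_i.+1) := (j <= d)%N && (i - j <= e)%N.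
have H : lsp (deg (d + e) i) (fun v r => \sum_(j < i.+1 | Q j) (F v r)`_j * (G v r)`_(i - j)).
  apply: lspan_sum => // j /andP[jd je]; have := ltn_ord j; rewrite ltnS => ji.
  apply: (lspan_ext _ _ (lspanM K_mul ((hF j).1 jd) ((hG (i - j)%N).1 je))) => // u.
  by rewrite /deg; nia.
apply: (lspan_ext _ _ H) => // v r; rewrite coefM [RHS](bigID Q) /= [X in _ + X]big1 ?addr0// => j.
by rewrite negb_and -!ltnNge => /orP[/(hF j).2->|/(hG (i - j)%N).2->]; rewrite ?mul0r ?mulr0.
Qed.

Lemma graded_form1 : graded_form 0 (fun _ _ => 1).
Proof.
move=> i; split=> [|i0 v r]; last by rewrite coef1 gtn_eqF.
rewrite leqn0 => /eqP->; apply: (lspan_ext _ _ (lspan_cst n (K_cst 1))) => [u|v r]; first by rewrite /deg; lia.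
by rewrite coef1.
Qed.

Lemma graded_formX d e F : graded_form d F -> graded_form (d * e) (fun v r => F v r ^+ e).
Proof.
move=> hF; elim: e => [|e IH]; first by rewrite muln0; apply: graded_form_ext graded_form1 => v r; rewrite expr0.
by rewrite mulnS; apply: graded_form_ext (graded_formM hF IH) => v r; rewrite exprS.
Qed.

Lemma graded_form_linear (b : bool) : graded_form 1
  (fun _ r => if b then (r x).2%:P + (r z).2 *: 'X else (r x).1%:P + (r z).1 *: 'X).
Proof.
case=> [|[|i]]; split=> // _.
- apply: (lspan_ext _ _ (lspan_coord K_cst x b)) => [u|v r]; first by rewrite /deg; case: (u == x); case: (u == z).
  by case: b; rewrite coefD coefZ coefX coefC /= mulr0 addr0.
- apply: (lspan_ext _ _ (lspan_coord K_cst z b)) => [u|v r]; first by rewrite /deg; case: (u == x); case: (u == z).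
  by case: b; rewrite coefD coefZ coefX coefC /= mulr1 add0r.
- by move=> v r; case: b; rewrite coefD coefZ coefX coefC /= mulr0 addr0.
Qed.

Lemma graded_form_frm d (P : T -> {poly k}) : (forall i, K (fun v => (P v)`_i)) ->
  graded_form d (fun v r => frm d (P v) (r x) (r z)).
Proof.
move=> KP i; split=> [id|di v r]; last by rewrite nth_default// (leq_trans (size_frm _ _ _ _)).
have H : lsp (deg d i) (fun v r => \sum_(j < d.+1) (P v)`_j *
    (((r x).1%:P + (r z).1 *: 'X) ^+ (d - j) * ((r x).2%:P + (r z).2 *: 'X) ^+ j)`_i).
  apply: lspan_sum => // j _; have := ltn_ord j; rewrite ltnS => jd.
  have := graded_formM (graded_formX (d - j) (graded_form_linear false)) (graded_formX j (graded_form_linear true)).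
  rewrite !mul1n subnK// => /(_ i)[/(_ id) h _].
  by apply: (lspan_ext _ _ (lspanM K_mul (lspan_cst n (KP j)) h)).
by apply: (lspan_ext _ _ H) => // v r; rewrite /frm coef_sum; apply: eq_bigr => j _; rewrite coefZ.
Qed.

End GradedForms.

(** * Coefficients in a frame spanned by three labels *)

Section LabelFunctions.
Context (k : closedFieldType) (N : nat) (N2 : (2 <= N)%N).
Local Notation pt := (k * k)%type.
Local Notation W := (weierstrass_data k N).
Local Notation h := (12 * N + 2)%N.
Local Notation p := (6 * N * h)%N.
Local Notation n := (p + p)%N.
Local Notation "''Sn'" := {perm 'I_(p + p)}.
Local Notation semi_inv := (semi_invariant (@weierstrass_act k N) (@weierstrass_char k)).
Context (ss : 'I_h -> k).
Local Notation PF := (@polynomial_fun k W).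
Local Notation lsp := (@lspan k W PF n).
Local Notation KC := (@polynomial_cst k W).
Local Notation KA := (@polynomial_add k W).
Local Notation KM := (@polynomial_mul k W).
Implicit Types (phi : W -> ('I_n -> pt) -> k).

Definition lab_act (gl : SL2 k * Gm k) (c : 'I_n -> k) (r : 'I_n -> pt) x :=
  scp (c x) (lab (mx_row (val gl.1) ord0) (mx_row (val gl.1) ord_max) (r x)).

(** Such functions live on the cover given by labelled roots; their elementary symmetric functions
    over all permutations descend to semi-invariants. *)
Definition equivariant D a phi := lsp (fun=> D) phi /\ forall gl v r c,
  phi (weierstrass_act gl v) (lab_act gl c r) = (\prod_x c x) ^+ D * val gl.2 ^+ a * phi v r.

Lemma equivariantM D a D' a' phi phi' : equivariant D a phi -> equivariant D' a' phi' ->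
  equivariant (D + D') (a + a') (fun v r => phi v r * phi' v r).
Proof.
move=> [lp ep] [lp' ep']; split; first by apply: (lspan_ext _ _ (lspanM KM lp lp')).
by move=> gl v r c; rewrite ep ep' !exprD; ring.
Qed.

Lemma equivariantX D a phi e : equivariant D a phi -> equivariant (e * D) (e * a) (fun v r => phi v r ^+ e).
Proof.
move=> [lp ep]; split; first by apply: (lspan_ext _ _ (lspan_exp KC KM e lp)).
by move=> gl v r c; rewrite ep ![in LHS]exprMn -!exprM ![(_ * e)%N]mulnC.
Qed.

Definition esum phi j v r : k := \sum_(J : {set 'Sn} | #|J| == j) \prod_(t in J) phi v (fun x => r (t x)).

Lemma esum0 phi v r : esum phi 0 v r = 1.
Proof.
rewrite /esum (eq_bigl (pred1 finset.set0)) => [|J]; last by rewrite cards_eq0.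
by rewrite big_pred1_eq big_set0.
Qed.

Lemma esum_perm phi j (t : 'Sn) v r : esum phi j v (fun x => r (t x)) = esum phi j v r.
Proof.
rewrite /esum [RHS](reindex (fun J : {set 'Sn} => [set (u * t)%g | u in J]%SET)) /=.
  apply: eq_big => [J|J _]; first by rewrite card_imset//; apply: mulIg.
  rewrite big_imset /=; last by move=> u v' _ _; apply: mulIg.
  by apply: eq_bigr => u _; congr (phi v _); apply/funext => x; rewrite permM.
exists (fun J : {set 'Sn} => [set (u * t^-1)%g | u in J]%SET) => J _; rewrite -imset_comp -[RHS]imset_id; apply: eq_imset => u /=.
  by rewrite mulgK.
by rewrite mulgKV.
Qed.

(** The function is a root of the monic polynomial whose roots are its values at all permutations of
    the labels, hence integral over the invariants. *)
Lemma esum_root phi (t : 'Sn) v r : \sum_(j < #|{: 'Sn}|.+1) (-1) ^+ j * esum phi j v r *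
  phi v (fun x => r (t x)) ^+ (#|{: 'Sn}| - j) = 0.
Proof.
pose a u := phi v (fun x => r (u x)).
have : \prod_(u : 'Sn) (- a u + a t) = 0 by rewrite (bigD1 t)//= addNr mul0r.
rewrite bigA_distr (partition_big (fun J : {set 'Sn} => inord #|J| : 'I_(#|{: 'Sn}|.+1)) predT)//= => E.
rewrite -[RHS]E; apply: eq_bigr => j _; rewrite /esum mulr_sumr mulr_suml.
apply: eq_big => [J|J /eqP Jj]; first by rewrite -val_eqE /= inordK ?ltnS ?max_card.
rewrite [RHS](bigID (mem J)) /=; congr (_ * _).
  by rewrite -Jj -prodr_const -big_split /=; apply: eq_bigr => u uJ; rewrite uJ mulN1r.
rewrite [RHS](eq_bigr (fun=> a t)) => [|u /negPf-> //].
rewrite [RHS](eq_bigl (fun u => u \in (~: J)%SET)) => [|u]; last by rewrite finset.in_setC.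
by rewrite prodr_const cardsCs finset.setCK Jj.
Qed.

Lemma exists_esum D a phi j : (0 < D)%N -> equivariant D a phi ->
  exists f, semi_inv (j * (12 * h * D + a)) f /\ forall v r, prodlin r = pencil_form ss v -> f v = esum phi j v r.
Proof.
move=> D0 [lp ep]; have [->|j0] := posnP j.
  by exists (fun=> 1); split=> [|v r _]; [exact: semi_invariant_cst|rewrite esum0].
have lsp_e : lsp (fun=> (D * j)%N) (esum phi j).
  apply: lspan_sum => [|J /eqP Jj]; first exact: KC.
  have hp := @lspan_prod k W PF KC KM n _ (index_enum _) (fun t : 'Sn => t \in J) _ _ (fun t _ => lspan_perm t lp).
  by apply: (lspan_ext _ _ hp) => // x; rewrite sum_nat_const Jj mulnC.
have d0 : (0 < D * j)%N by rewrite muln_gt0 D0.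
have [|f pf fE] := symmetric_descent KC KA KM d0 lsp_e _ (polynomial_pencil_form ss).
  by move=> v s r; apply: esum_perm.
exists f; split; last by move=> v r /fE->.
split=> // gl v; have [r rE] := exists_labels N2 ss v; have [c [cE lE]] := labels_act N2 gl rE.
rewrite -(fE _ _ lE) -(fE _ _ rE) /esum mulr_sumr; apply: eq_bigr => J /eqP<-.
rewrite [(#|J| * _)%N]mulnC exprM -prodr_const -big_split /=; apply: eq_bigr => t _.
have -> : (fun x => scp (c (t x)) (lab (mx_row (val gl.1) ord0) (mx_row (val gl.1) ord_max) (r (t x)))) =
  lab_act gl (fun x => c (t x)) (fun x => r (t x)) by [].
rewrite ep exprD [weierstrass_char gl ^+ (12 * h * D)]exprM; congr (_ ^+ _ * _ * _).
by rewrite -[RHS]cE [RHS](reindex_inj (@perm_inj _ t)).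
Qed.

Context (s1 s2 s3 : 'Sn) (i1 i2 i3 : 'I_p) (x y z : 'I_n).
Hypotheses (s1x : s1 (lshift p i1) = x) (s1y : s1 (rshift p i1) = y).
Hypotheses (s2y : s2 (lshift p i2) = y) (s2z : s2 (rshift p i2) = z).
Hypotheses (s3x : s3 (lshift p i3) = x) (s3z : s3 (rshift p i3) = z).

Definition bm_but (s : 'Sn) i (r : 'I_n -> pt) := \prod_(j < p | j != i) br (r (s (lshift p j))) (r (s (rshift p j))).
Definition rest (r : 'I_n -> pt) := bm_but s1 i1 r * bm_but s2 i2 r * bm_but s3 i3 r.
Definition tri (r : 'I_n -> pt) := br (r x) (r y) * br (r y) (r z) * br (r x) (r z).
Definition mat3 (r : 'I_n -> pt) := bm s1 r * bm s2 r * bm s3 r.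

Lemma mat3E r : mat3 r = tri r * rest r.
Proof.
have E s i : bm s r = br (r (s (lshift p i))) (r (s (rshift p i))) * bm_but s i r by rewrite /bm (bigD1 i).
by rewrite /mat3 (E s1 i1) (E s2 i2) (E s3 i3) s1x s1y s2y s2z s3x s3z /tri /rest; ring.
Qed.

Lemma equivariant_mat3 : equivariant 3 0 (fun _ r => mat3 r).
Proof.
have E s : equivariant 1 0 (fun _ r => bm s r).
  split; first by apply: (lspan_ext _ _ (lspan_bm KC KM s 1%g)) => // v r; congr bm; apply/funext => u; rewrite perm1.
  move=> gl v r c; rewrite /lab_act (bm_scp s (fun u => lab _ _ (r u)) c) bm_lab br_act.
  by rewrite !expr1n expr0 expr1; ring.
exact: equivariantM (equivariantM (E s1) (E s2)) (E s3).
Qed.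

(** By the Pluecker relation the sum of the two frame vectors is [br (r x) (r z)] times [r y], so
    the frame puts three labels in standard position. Its determinant is [tri r]. *)
Definition frame_l (r : 'I_n -> pt) := scp (br (r y) (r z)) (r x).
Definition frame_r (r : 'I_n -> pt) := scp (br (r x) (r y)) (r z).

(** The coefficient has degree [2 * e] in each of the labels x, y, z and degree 0 in the others;
    [rest] has degree 1 in these three and 3 in all others. The product has degree [3 * e] in every
    label, as [equivariant] demands. *)
Definition frame_coef e (P : W -> {poly k}) i (v : W) r := rest r ^+ e * (frm (2 * e) (P v) (frame_l r) (frame_r r))`_i.

Lemma lspan_bm_but s i : exists2 dl, lsp dl (fun _ r => bm_but s i r) &
  forall u, (dl u + ((u == s (lshift p i)) + (u == s (rshift p i))) = 1)%N.
Proof.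
have hp := @lspan_prod k W PF KC KM n 'I_p (index_enum _) (fun j => j != i) _ _
  (fun j _ => lspan_br KC KM (s (lshift p j)) (s (rshift p j))).
eexists; first exact: hp.
move=> u /=; have E : (\sum_(j < p) ((u == s (lshift p j)) + (u == s (rshift p j))) = 1)%N.
  have [v ->] : exists v, u = s v by exists ((s^-1)%g u); rewrite permKV.
  under eq_bigr do rewrite !(inj_eq perm_inj).
  rewrite big_split /=; transitivity (\sum_(i < n) (v == i))%N; first by rewrite big_split_ord.
  by rewrite (bigD1 v)//= eqxx big1// => w; rewrite eq_sym => /negPf->.
by rewrite -[RHS]E [RHS](bigD1 i)//= addnC.
Qed.

Lemma equivariant_frame_coef e a (P : W -> {poly k}) i : (forall i, PF (fun v => (P v)`_i)) ->
  (forall gl v, P (weierstrass_act gl v) = val gl.2 ^+ a *: frm (2 * e) (P v) (mx_row (val gl.1) ord0) (mx_row (val gl.1) ord_max)) ->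
  (i <= 2 * e)%N -> equivariant (3 * e) a (frame_coef e P i).
Proof.
move=> KP Pact ie; split.
  have [d1 l1 E1] := lspan_bm_but s1 i1; have [d2 l2 E2] := lspan_bm_but s2 i2; have [d3 l3 E3] := lspan_bm_but s3 i3.
  have lr := lspan_exp KC KM e (lspanM KM (lspanM KM l1 l2) l3).
  have lA := lspan_exp KC KM (2 * e - i) (lspan_br KC KM y z).
  have lB := lspan_exp KC KM i (lspan_br KC KM x y).
  have [/(_ ie) lF _] := graded_form_frm KC KM x z (2 * e) KP i.
  apply: (lspan_ext _ _ (lspanM KM lr (lspanM KM (lspanM KM lA lB) lF))) => [u|v r].
    have := E1 u; have := E2 u; have := E3 u; rewrite s1x s1y s2y s2z s3x s3z => e3 e2 e1.
    have -> : (d1 u + d2 u + d3 u = 3 - 2 * ((u == x) + (u == y) + (u == z)))%N by lia.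
    by nia.
  by rewrite /frame_coef coef_frm_scp// -!mulrA.
move=> gl v r c; pose g := mx_row (val gl.1) ord0; pose g' := mx_row (val gl.1) ord_max; have gg : br g g' = 1 by apply: br_act.
have brE u w : br (lab_act gl c r u) (lab_act gl c r w) = c u * c w * br (r u) (r w).
  by rewrite /lab_act br_scp br_lab -/g -/g' gg mul1r.
pose cc := c x * c y * c z.
have fl : frame_l (lab_act gl c r) = scp cc (lab g g' (frame_l r)).
  by rewrite /frame_l brE /lab_act -/g -/g' lab_scp /scp /= /cc; congr (_, _); ring.
have fr : frame_r (lab_act gl c r) = scp cc (lab g g' (frame_r r)).
  by rewrite /frame_r brE /lab_act -/g -/g' lab_scp /scp /= /cc; congr (_, _); ring.
have bE (s : 'Sn) j : c (s (lshift p j)) * c (s (rshift p j)) * bm_but s j (lab_act gl c r) = (\prod_u c u) * bm_but s j r.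
  have -> : bm_but s j (lab_act gl c r) = (\prod_(l < p | l != j) (c (s (lshift p l)) * c (s (rshift p l)))) * bm_but s j r.
    by rewrite /bm_but -big_split /=; apply: eq_bigr => l _; rewrite brE.
  rewrite mulrA; congr (_ * _); transitivity (\prod_(l < p) (c (s (lshift p l)) * c (s (rshift p l)))); first by rewrite [RHS](bigD1 j).
  by rewrite big_split /= [RHS](reindex_inj (@perm_inj _ s)) big_split_ord.
have rE : cc ^+ 2 * rest (lab_act gl c r) = (\prod_u c u) ^+ 3 * rest r.
  have := bE s1 i1; have := bE s2 i2; have := bE s3 i3; rewrite s1x s1y s2y s2z s3x s3z => e3 e2 e1.
  rewrite /rest; set b1 := bm_but s1 i1 _ in e1 *; set b2 := bm_but s2 i2 _ in e2 *; set b3 := bm_but s3 i3 _ in e3 *.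
  transitivity ((c x * c y * b1) * (c y * c z * b2) * (c x * c z * b3)); first by rewrite /cc; ring.
  by rewrite e1 e2 e3; ring.
rewrite /frame_coef fl fr frm_scale Pact frmZ -/g -/g' frm_comp !comb_lab// !coefZ.
rewrite [cc ^+ _]exprM [X in _ = X * _ * _]exprM.
transitivity ((cc ^+ 2 * rest (lab_act gl c r)) ^+ e * (val gl.2 ^+ a * (frm (2 * e) (P v) (frame_l r) (frame_r r))`_i)).
  by rewrite [in RHS]exprMn; ring.
by rewrite rE [in LHS]exprMn; ring.
Qed.

(** A square root of [tri r] normalizes the frame to determinant 1, and it disappears from the
    formula because the degree [2 * e] is even. *)
Lemma frame_recover r : mat3 r != 0 -> exists g g', br g g' = 1 /\
  forall e P i v, frame_coef e P i v r = mat3 r ^+ e * (frm (2 * e) (P v) g g')`_i.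
Proof.
rewrite mat3E mulf_eq0 negb_or => /andP[t0 _].
have [rho rhoE] : exists rho, rho ^+ 2 = tri r.
  have [l] := solve_monicpoly (fun i => if i == 0%N then tri r else 0) (isT : (0 < 2)%N).
  by rewrite !big_ord_recl big_ord0 /= expr0 mulr1 mul0r !addr0 => lE; exists l.
have r0 : rho != 0 by apply: contraNneq t0 => r0; rewrite -rhoE r0 expr0n.
exists (scp rho^-1 (frame_l r)), (scp rho^-1 (frame_r r)); split.
  rewrite br_scp /frame_l /frame_r br_scp; transitivity (rho^-1 * rho^-1 * tri r); first by rewrite /tri; ring.
  by rewrite -rhoE; field.
move=> e P i v; rewrite /frame_coef frm_scale coefZ [in RHS]exprMn -rhoE -exprM.
transitivity ((rho * rho^-1) ^+ (2 * e) * (rest r ^+ e * (frm (2 * e) (P v) (frame_l r) (frame_r r))`_i)).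
  by rewrite mulfV// expr1n mul1r.
by rewrite [in LHS]exprMn; ring.
Qed.

End LabelFunctions.

(** Two clusters, each smaller than half, do not cover the labels, so three pairwise independent
    labels exist; each pair occurs in a matching with nonzero bracket product. *)
Lemma exists_mat3 (k : closedFieldType) (N : nat) (N2 : (2 <= N)%N) (ss : 'I_(12 * N + 2) -> k) (v : weierstrass_data k N) (r : 'I_(6 * N * (12 * N + 2) + 6 * N * (12 * N + 2)) -> k * k) : injective ss -> minimal N (pA v) (pB v) -> pencil_form ss v != 0 ->
  prodlin r = pencil_form ss v -> exists (s1 s2 s3 : {perm 'I_(6 * N * (12 * N + 2) + 6 * N * (12 * N + 2))}) i1 i2 i3 x y z,
  [/\ [/\ s1 (lshift _ i1) = x, s1 (rshift _ i1) = y, s2 (lshift _ i2) = y & s2 (rshift _ i2) = z],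
      s3 (lshift _ i3) = x /\ s3 (rshift _ i3) = z & @mat3 k N s1 s2 s3 r != 0].
Proof.
move=> ssi mv v0 rE; have r0 := labels_neq0 rE v0.
have cl x : (2 * #|cluster r x| < 6 * N * (12 * N + 2) + 6 * N * (12 * N + 2))%N.
  have B1 := cluster_bound_lt N2 (cluster_labels N2 ssi x mv rE v0).
  exact: B1.
have n0 : (0 < 6 * N * (12 * N + 2) + 6 * N * (12 * N + 2))%N by lia.
pose x : 'I_(6 * N * (12 * N + 2) + 6 * N * (12 * N + 2)) := Ordinal n0.
have out (S : {set 'I_(6 * N * (12 * N + 2) + 6 * N * (12 * N + 2))}) : (#|S| < 6 * N * (12 * N + 2) + 6 * N * (12 * N + 2))%N -> exists y, y \notin S.
  move=> Sn; have : (0 < #|~: S|)%SET%N by rewrite -subn_gt0 in Sn; rewrite cardsCs finset.setCK card_ord.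
  by move=> /card_gt0P[y]; rewrite finset.in_setC; exists y.
have lt2 (a m : nat) : (2 * a < m -> a < m)%N by lia.
have lt3 (a b c m : nat) : (2 * a < m -> 2 * b < m -> c <= a + b -> c < m)%N by lia.
have [y] : exists y, y \notin cluster r x by apply: out; apply: lt2 (cl x).
have [z] : exists z, z \notin (cluster r x :|: cluster r y)%SET.
  by apply: out; apply: lt3 (cl x) (cl y) (leq_card_setU _ _).
rewrite finset.in_setU negb_or !in_cluster => /andP[xz yz] xy.
have [s1 [m1 [i1 [e1 e1']]]] := exists_matching_through r0 cl xy.
have [s2 [m2 [i2 [e2 e2']]]] := exists_matching_through r0 cl yz.
have [s3 [m3 [i3 [e3 e3']]]] := exists_matching_through r0 cl xz.
exists s1, s2, s3, i1, i2, i3, x, y, z; split=> //.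
by rewrite /mat3 !mulf_neq0.
Qed.

Section Points.
Context (k : closedFieldType) (N : nat) (N2 : (2 <= N)%N).
Local Notation W := (weierstrass_data k N).
Local Notation E := (E_ k N).
Local Notation gequiv := (git_equiv (@weierstrass_act k N) (@weierstrass_char k)).
Local Notation sstable := (semistable (@weierstrass_act k N) (@weierstrass_char k)).

Lemma T_semistable (v : W) : T_ v -> sstable v.
Proof.
move=> /(T_P _ (ltnW N2))[mv _]; have [ss [ss_inj ss1]] := exists_pencils k N2.
have [a va] : exists a, pencil_form (ss a) v != 0.
  have [E0|H] := eqVneq (pencil_form (ss ord0) v) 0; last by exists ord0.
  by exists ord_max; apply/eqP => E'; have := ss1 _ mv _ _ E0 E'.
have [f [sf fE]] := exists_invariants N2 (ss a).
have [l fl] := exists_invariant_neq0 N2 (ss_inj a) fE mv va.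
eexists; exists (f l); split; [|exact: sf|exact: fl].
by rewrite !muln_gt0 !fact_gt0 addn2.
Qed.

Lemma gequiv_sym (v w : W) : gequiv v w -> gequiv w v.
Proof. by move=> vw n f sf; rewrite (vw n f sf). Qed.

Lemma gequiv_trans (u v w : W) : gequiv u v -> gequiv v w -> gequiv u w.
Proof. by move=> uv vw n f sf; rewrite (uv n f sf) (vw n f sf). Qed.

Lemma exists_class (v : W) : T_ v -> exists e : E, gequiv v (erep e).
Proof.
move=> Tv; have sv := T_semistable Tv.
pose q : git_quotient (@weierstrass_act k N) (@weierstrass_char k) :=
  exist _ [set w | sstable w /\ gequiv v w] (ex_intro2 _ _ v sv erefl).
have qT : [set p : git_quotient (@weierstrass_act k N) (@weierstrass_char k) | exists2 AB, T_ AB & sval p AB] q.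
  by exists v => //; split.
by exists (exist _ q (mem_set qT)); have [] := erep_mem (exist _ q (mem_set qT) : E).
Qed.

Lemma erep_inj (e e' : E) : gequiv (erep e) (erep e') -> e = e'.
Proof.
move=> ee; apply: val_inj; have := erep_mem e; have := erep_mem e'; rewrite !set_valE /=.
case: (val e) => c [u su cE]; case: (val e') => c' [u' su' cE'] /= c'e ce.
have [_ ue] : [set w | sstable w /\ gequiv u w] (erep e) by rewrite -cE.
have [_ ue'] : [set w | sstable w /\ gequiv u' w] (erep e') by rewrite -cE'.
apply: eq_exist => /=; rewrite cE cE'; apply/seteqP; split=> w [sw uw]; split=> //.
  exact: gequiv_trans ue' (gequiv_trans (gequiv_sym ee) (gequiv_trans (gequiv_sym ue) uw)).
exact: gequiv_trans ue (gequiv_trans ee (gequiv_trans (gequiv_sym ue') uw)).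
Qed.

End Points.

(** * Irreducible subfamilies and their images in the quotient *)

Section Families.
Context (k : closedFieldType) (N : nat) (N2 : (2 <= N)%N).
Local Notation W := (weierstrass_data k N).
Local Notation E := (E_ k N).
Local Notation gequiv := (git_equiv (@weierstrass_act k N) (@weierstrass_char k)).
Local Notation semi_inv := (semi_invariant (@weierstrass_act k N) (@weierstrass_char k)).
Context (fam : W -> Prop).
Hypothesis fam_T : forall v, fam v -> T_ v.
Hypothesis fam_lim : forall (I : Type) (P : place k I) (v : I -> W), (forall t, fam (v t)) ->
  exists (th : I -> k) w, [/\ forall t, th t != 0, fam w &
    forall n f, semi_inv n f -> tends P (fun t => th t ^+ n * f (v t)) (f w)].

Lemma place_of_ultra (I : Type) (U : set_system I) (UU : UltraFilter U) : exists P : place k I, ae P = U.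
Proof.
have [|P [aP _]] := @exists_place_vals k I U UU 0 (fun _ _ => 0) (fun=> 0); last by exists P.
move=> p; rewrite (_ : [set i | _] = if p.@[fun=> 0] == 0 then setT else set0).
  by case: eqP => // _ /filter_ex[].
have E0 i : p.@[fun j : 'I_0 => (fun=> 0) i] = p.@[fun=> 0] by [].
by apply/seteqP; case: (p.@[fun=> 0] =P 0) => H; split=> i.
Qed.

(* The closed subset of the family determined by a generic point of it.      *)
Definition generic_in (A : W -> Prop) (I : Type) (P : place k I) (v : I -> W) :=
  (forall t, fam (v t)) /\ forall w, A w <-> fam w /\ forall n f, semi_inv n f -> ae P [set t | f (v t) = 0] -> f w = 0.
Definition irr_family (A : W -> Prop) := exists (I : Type) (P : place k I) (v : I -> W), generic_in A P v.

Lemma ae_generic (I : Type) (P : place k I) (v : I -> W) :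
  ae P [set t | forall n f, semi_inv n f -> ae P [set t' | f (v t') = 0] -> f (v t) = 0].
Proof.
pose y (j : 'I_(\dim {:W})) t := coord (vbasis {:W}) j (v t).
apply: aeW (ae_ultra_zero P y) => t H n f [[p pE] _] fU; rewrite pE; apply: H.
by apply: aeW fU => t'; rewrite pE.
Qed.

Lemma generic_ae (A : W -> Prop) (I : Type) (P : place k I) (v : I -> W) : generic_in A P v -> ae P [set t | A (v t)].
Proof. by move=> [fv AE]; apply: aeW (ae_generic P v) => t H; apply/AE. Qed.

Lemma generic_vanish (A : W -> Prop) (I : Type) (P : place k I) (v : I -> W) n f : generic_in A P v -> semi_inv n f ->
  (forall w, A w -> f w = 0) <-> ae P [set t | f (v t) = 0].
Proof.
move=> gA sf; split=> [H|fU w]; first by apply: aeW (generic_ae gA) => t; apply: H.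
by move=> /gA.2[_]; apply; first exact: sf.
Qed.

Lemma irr_family_fam A w : irr_family A -> A w -> fam w.
Proof. by move=> [I [P [v [_ AE]]]] /AE[]. Qed.

Lemma irr_family_ex A : irr_family A -> exists w, A w.
Proof. by move=> [I [P [v gA]]]; have [t At] := ae_exists (generic_ae gA); exists (v t). Qed.

Lemma irr_family_closed A w : irr_family A -> fam w ->
  (forall n f, semi_inv n f -> (forall u, A u -> f u = 0) -> f w = 0) -> A w.
Proof.
move=> [I [P [v gA]]] fw H; apply/gA.2; split=> // n f sf fU; apply: (H n) => //.
by apply/(generic_vanish gA sf).
Qed.

Lemma irr_family_lim A (I : Type) (P : place k I) (v : I -> W) : irr_family A -> (forall t, A (v t)) ->
  exists (th : I -> k) w, [/\ forall t, th t != 0, A w &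
    forall n f, semi_inv n f -> tends P (fun t => th t ^+ n * f (v t)) (f w)].
Proof.
move=> iA Av; have [th [w [th0 fw tw]]] := fam_lim P (fun t => irr_family_fam iA (Av t)).
exists th, w; split=> //; apply: (irr_family_closed iA fw) => n f sf fA.
apply: tends_uniq (tw n f sf) _; apply: tends0; apply: aeT => t; rewrite fA ?mulr0//; exact: Av.
Qed.

Definition classes (A : W -> Prop) : set E := [set e | forall n f, semi_inv n f -> (forall w, A w -> f w = 0) -> f (erep e) = 0].

(** Two limits of one family are compared, one rescaled by [th], the other given by fractions with
    powers of [Phi] below. Raising to the power [m] makes every weight divisible by that of [Phi],
    and semistability of [w] excludes that [Phi] vanishes at [w]. *)
Lemma gequiv_of_lim (I : Type) (P : place k I) (v : I -> W) (th : I -> k) (w u : W) m Phi :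
  (forall n f, semi_inv n f -> tends P (fun t => th t ^+ n * f (v t)) (f w)) -> T_ w ->
  semi_inv m Phi -> (0 < m)%N -> Phi u != 0 ->
  (forall l f, semi_inv (m * l) f -> tends P (fun t => f (v t) / Phi (v t) ^+ l) (f u / Phi u ^+ l)) ->
  ae P [set t | Phi (v t) != 0] -> gequiv w u.
Proof.
move=> tw Tw sPhi m0 Pu tr PU.
have key n f : semi_inv n f -> f w ^+ m = f u ^+ m / Phi u ^+ n * Phi w ^+ n.
  move=> sf; have sfm := semi_inv_exp m sf; have sPn := semi_inv_exp n sPhi.
  have t1 := tw _ _ sfm; have t2 := tw _ _ sPn.
  have sfm' : semi_inv (m * n) (fun v => f v ^+ m) by apply: semi_inv_weight sfm; rewrite mulnC.
  apply: tends_uniq t1 _; apply: tends_ae _ (tendsM (tr n _ sfm') t2); apply: aeW PU => t Pt /=.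
  by rewrite mulrCA divfK ?expf_neq0// mulnC.
have Pw : Phi w != 0.
  have [n [f [n0 sf fw]]] := T_semistable N2 Tw.
  apply: contraNneq fw => Pw; have := key n f sf; rewrite Pw expr0n (gtn_eqF n0) mulr0 => /eqP.
  by rewrite expf_eq0 m0.
move=> n f sf; have := key n f sf => E0; have := congr1 (fun c => c == 0) E0.
by rewrite !mulf_eq0 invr_eq0 !expf_eq0 m0 (negPf Pw) (negPf Pu) !andbF !orbF.
Qed.

(** The image of [A] in the quotient is closed: for [e] in its closure some place gives the
    fractions of weight 0 over [Phi] their values at [e], and the limit of the generic point along
    this place lies in [A] and is equivalent to [erep e]. *)
Lemma classesP A e : irr_family A -> classes A e <-> exists2 w, A w & gequiv w (erep e).
Proof.
move=> iA; split=> [cA|[w Aw we] n f sf fA]; last by apply/eqP; rewrite -(we n f sf) fA.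
have [I [P0 [v gA]]] := iA; have fv := gA.1.
have [m [Phi [m0 sPhi Pe]]] := T_semistable N2 (erep_T e).
have zero n f : semi_inv n f -> ae P0 [set t | f (v t) = 0] -> f (erep e) = 0.
  by move=> sf /(generic_vanish gA sf); apply: (cA n f sf).
have PU : ae P0 [set t | Phi (v t) != 0].
  by have [/(zero _ _ sPhi)/eqP|//] := ae_eq0 P0 (fun t => Phi (v t)); rewrite (negPf Pe).
pose S1 := [set y : (I -> k) * k | exists l f, [/\ semi_inv (m * l) f,
  ae P0 [set t | y.1 t = f (v t) / Phi (v t) ^+ l] & y.2 = f (erep e) / Phi (erep e) ^+ l]].
have [|P [aP tP]] := exists_place (ae_ultra P0) (S0 := S1).
  split.
  - move=> c; exists 0%N, (fun=> c); split; first by rewrite muln0; exact: semi_invariant_cst.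
      by apply: aeT => t; rewrite expr0 divr1.
    by rewrite expr0 divr1.
  - move=> f g a b [l [F [sF fF aF]]] [l' [G [sG gG bG]]].
    have sFP := semi_invariant_mul sF (semi_inv_exp l' sPhi); have sGP := semi_invariant_mul sG (semi_inv_exp l sPhi).
    exists (l + l')%N, (fun v => F v * Phi v ^+ l' + G v * Phi v ^+ l); split.
    + apply: semi_invariant_add; [apply: semi_inv_weight sFP|apply: semi_inv_weight sGP]; by rewrite mulnDr ?[(m * l + _)%N]addnC.
    + apply: aeW (aeI PU (aeI fF gG)) => t /= [Pt [-> ->]]; rewrite exprD; field.
      by rewrite !expf_neq0.
    + rewrite /= in aF bG *; rewrite aF bG exprD; field.
      by rewrite !expf_neq0.
  - move=> f g a b [l [F [sF fF aF]]] [l' [G [sG gG bG]]].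
    exists (l + l')%N, (fun v => F v * G v); split.
    + by have := semi_invariant_mul sF sG; rewrite mulnDr.
    + apply: aeW (aeI PU (aeI fF gG)) => t /= [Pt [-> ->]]; rewrite exprD; field.
      by rewrite !expf_neq0.
    + rewrite /= in aF bG *; rewrite aF bG exprD; field.
      by rewrite !expf_neq0.
  move=> f a [l [F [sF /= fF ->]]] f0; rewrite (zero _ _ sF) ?mul0r//.
  apply: aeW (aeI PU (aeI fF f0)) => t [Pt [fE f0t]]; move: f0t; rewrite fE => /eqP.
  by rewrite mulf_eq0 invr_eq0 expf_eq0 (negPf Pt) andbF orbF => /eqP.
have [th [w [th0 fw tw]]] := fam_lim P fv.
have we : gequiv w (erep e).
  apply: (gequiv_of_lim tw (fam_T fw) sPhi m0 Pe); last by rewrite aP.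
  by move=> l f sf; apply: tP; exists l, f; split=> //; apply: aeT.
exists w => //; apply: (irr_family_closed iA fw) => n f sf fA.
by apply/eqP; rewrite (we n f sf) (cA n f sf fA).
Qed.

Lemma irr_family_mul A m n f g : irr_family A -> semi_inv m f -> semi_inv n g ->
  (forall w, A w -> f w * g w = 0) -> (forall w, A w -> f w = 0) \/ (forall w, A w -> g w = 0).
Proof.
move=> [I [P [v gA]]] sf sg fg; have := generic_ae gA => AU.
have : ae P [set t | f (v t) = 0 \/ g (v t) = 0].
  by apply: aeW AU => t /fg/eqP; rewrite mulf_eq0 => /orP[]/eqP; [left|right].
by move=> /ae_or[] /(generic_vanish gA _) H; [left|right]; eapply H; eassumption.
Qed.

Section InSubset.
Context (Z : set E).
Local Notation X := (set_type Z).

Definition zclasses (A : W -> Prop) : set X := [set x | classes A (set_val x)].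

Lemma zclasses_closed A : closed (zclasses A).
Proof.
rewrite -openC openE => x /= /existsNP[n /existsNP[f /not_implyP[sf /not_implyP[fA /eqP fx]]]].
apply: filterS (zrep_near sf fx) => y fy cy; move: fy; rewrite /zrep (cy n f sf fA) eqxx.
by [].
Qed.

Lemma zclasses_irreducible A : irr_family A -> (forall e, classes A e -> Z e) -> irreducible (zclasses A).
Proof.
move=> iA AZ; split.
  have [w Aw] := irr_family_ex iA; have [e we] := exists_class N2 (fam_T (irr_family_fam iA Aw)).
  have ce : classes A e by apply/(classesP e iA); exists w.
  by exists (exist _ e (mem_set (AZ e ce)) : X); rewrite /zclasses /= set_valE.
move=> F G cF cG FG; apply: contrapT => /not_orP[/existsNP[x /not_implyP[Ax nFx]] /existsNP[y /not_implyP[Ay nGy]]].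
have [m [f [_ sf fx fF]]] := zrep_closed_sep cF nFx; have [n [g [_ sg gy gG]]] := zrep_closed_sep cG nGy.
have [w Aw|fA|gA] := irr_family_mul iA sf sg; last 2 first.
- by move: fx; rewrite /zrep (Ax m f sf fA) eqxx.
- by move: gy; rewrite /zrep (Ay n g sg gA) eqxx.
have [e we] := exists_class N2 (fam_T (irr_family_fam iA Aw)).
have ce : classes A e by apply/(classesP e iA); exists w.
pose z : X := exist _ e (mem_set (AZ e ce)); have ze : erep (set_val z) = erep e by rewrite set_valE.
have zz : zclasses A z by rewrite /zclasses /= set_valE.
have [/fF|/gG] := FG z zz; rewrite /zrep ze => /eqP.
  by rewrite -(we m f sf) => /eqP->; rewrite mul0r.
by rewrite -(we n g sg) => /eqP->; rewrite mulr0.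
Qed.

Lemma regular_ratio (x : X) (f : X -> k) : regular_at (x : (X : funSpaceType k)) f ->
  exists n F G, [/\ semi_inv n F, semi_inv n G, G (zrep x) != 0 & \forall y \near x, f y = F (zrep y) / G (zrep y)].
Proof.
case=> g1 [g2 [n [F [G [sF sG Gx g2E]]]] g1E] fE; exists n, F, G; split=> //; first exact: Gx (erep_mem _).
apply: filterS2 fE (set_val_near (filterI g1E (set_val_near g2E))) => y -> [-> H].
exact: H (erep_mem _).
Qed.

End InSubset.

Section Complete.
Context (A : W -> Prop) (iA : irr_family A).
Local Notation Z := (classes A).
Local Notation X := (set_type Z : funSpaceType k).

Lemma classes_closed : closed (classes A).
Proof.
rewrite -openC openE => e /= /existsNP[n /existsNP[f /not_implyP[sf /not_implyP[fA /eqP fe]]]].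
apply: filterS (erep_near sf fe) => e' fe' ce'; move: fe'; rewrite (ce' n f sf fA) eqxx.
by [].
Qed.

(** Over a point [y0] in the closure of the projection, take an ultrafilter on [C] that converges to
    [y0] and a place giving every function regular at [y0] its value there. The limit of the
    representatives defines [z0]. The sums of products that test openness in [variety_prod] converge
    to their values at [(z0, y0)], so this point cannot lie outside the closed set [C]. *)
Lemma classes_proper (Y : funSpaceType k) (C : set (variety_prod X Y)) : closed C -> closed [set p.2 | p in C].
Proof.
move=> cC; rewrite -openC openE => y0 /= ny0; apply: contrapT => near_y0.
have [|||U [UU UB]] := @ultra_of_fip (variety_prod X Y) [set B | exists2 O : set Y, nbhs y0 O & B = [set q | C q /\ O q.2]].
- move=> _ _ [O nO ->] [O' nO' ->]; exists [set q | C q /\ (O `&` O') q.2]; last by move=> q [Cq [Oq O'q]].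
  by exists (O `&` O') => //; apply: filterI.
- by exists [set q | C q /\ setT q.2], setT => //; apply: filterT.
- move=> _ [O nO ->]; apply: contrapT => H; apply: near_y0; apply: filterS nO => y Oy [q Cq qy].
  by apply: H; exists q; split; rewrite ?qy.
have CU : U [set q | C q] by apply: filterS (UB _ (ex_intro2 _ _ setT filterT erefl)) => q [].
have nU (O : set Y) : nbhs y0 O -> U [set q | O q.2].
  by move=> nO; apply: filterS (UB _ (ex_intro2 _ _ O nO erefl)) => q [].
have [|P [aP tP]] := exists_place UU (S0 := [set y : (variety_prod X Y -> k) * k |
    exists2 f : Y -> k, regular_at y0 f & y.1 = (fun q => f q.2) /\ y.2 = f y0]).
  split.
  - by move=> c; exists (fun=> c) => //; exact: regular_at_cst.
  - move=> f g a b [F rF [/= -> ->]] [G rG [/= -> ->]]; exists (fun y => F y + G y) => //; exact: regular_at_add.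
  - move=> f g a b [F rF [/= -> ->]] [G rG [/= -> ->]]; exists (fun y => F y * G y) => //; exact: regular_at_mul.
  move=> f a [F rF [/= -> ->]] F0; apply/eqP/negPn/negP => Fy.
  have [n0 _] := regular_at_inv _ _ rF Fy.
  by have [q []] := filter_ex (filterI F0 (nU _ n0)) => /= ->; rewrite eqxx.
have /choice[v vP] : forall q : variety_prod X Y, exists v, A v /\ gequiv v (zrep q.1).
  by move=> q; have /(classesP _ iA)[w Aw we] := set_valP q.1; exists w.
have [th [w [th0 Aw tw]]] := irr_family_lim P iA (fun q => (vP q).1).
have [e we] := exists_class N2 (fam_T (irr_family_fam iA Aw)).
have ce : classes A e by apply/(classesP e iA); exists w.
pose z0 : X := exist _ e (mem_set ce); have ze : zrep z0 = erep e by rewrite /zrep set_valE.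
have near_lim n f : semi_inv n f -> f (erep e) != 0 -> ae P [set q | f (v q) != 0].
  move=> sf fe; have fw : f w != 0 by rewrite (we n f sf).
  by apply: aeW (tends_ne0 (tw n f sf) fw) => q; apply: contraNneq => ->; rewrite mulr0.
suff : C (z0, y0) by move=> Cz; apply: ny0; exists (z0, y0).
apply: contrapT => nC; have oC : open (~` C) by rewrite openC.
have [I [f [g [fg fgp fgC]]]] := oC _ nC.
have nearX (O : set X) : nbhs z0 O -> ae P [set q | O q.1].
  move=> nO; have : nbhs z0 (O^°) by apply: nbhs_interior.
  move=> /nbhs_singleton Oz; have cO : closed (~` O^°) by apply: open_closedC; exact: open_interior.
  have [|n [h [n0 sh hz hO]]] := zrep_closed_sep cO (x := z0); first by move=> /(_ Oz).
  rewrite ze in hz; apply: aeW (near_lim n h sh hz) => q hq; apply: contrapT => nOq.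
  have : h (zrep q.1) = 0 by apply: hO => /= Oq; apply: nOq; exact: interior_subset Oq.
  by move=> /eqP; rewrite -((vP q).2 n h sh) (negPf hq).
have tf i : tends P (fun q => f i q.1) (f i z0).
  have [/= /regular_ratio[n [F [G [sF sG Gz fE]]]] _] := fg i.
  have Ge : G (erep e) != 0 by rewrite -ze.
  have Gw : G w != 0 by rewrite (we n G sG).
  have [_ ->] : G w != 0 /\ f i z0 = F w / G w.
    split=> //; rewrite (nbhs_singleton fE); have [_] := git_equiv_ratio we sF sG Gw.
    by rewrite ze.
  apply: tends_ae _ (tends_div (tw n F sF) (tw n G sG) Gw).
  apply: aeW (aeI (near_lim n G sG Ge) (nearX _ fE)) => q [Gq fq].
  have [_ E1] := git_equiv_ratio (vP q).2 sF sG Gq.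
  rewrite fq E1 invfM mulrACA mulfV ?mul1r//; exact: expf_neq0.
have tg i : tends P (fun q => g i q.2) (g i y0).
  by have [_ /= rg] := fg i; apply: tP; exists (g i).
have tS : tends P (fun q => \sum_i f i q.1 * g i q.2) (\sum_i f i z0 * g i y0).
  by apply: tends_sum => i _; exact: tendsM (tf i) (tg i).
case: fgC => -[O O'] /= [nO nO'] H; have H2 : ae P [set q | C q /\ O' q.2] by rewrite aP; apply: filterI (nU _ nO').
have [q [[S0 [Cq O'q]] Oq]] := ae_exists (aeI (aeI (tends_ne0 tS fgp) H2) (nearX _ nO)).
by apply: (H (q.1, q.2) (conj Oq O'q) S0); case: q Cq {S0 O'q Oq}.
Qed.

End Complete.

End Families.

(** Kronecker substitution turns [p] into a nonzero polynomial in one variable. *)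
Lemma mpoly_neq0_point (k : closedFieldType) n (p : {mpoly k[n]}) : p != 0 -> exists c, p.@[c] != 0.
Proof.
move=> p0; have [m0 m0p] : exists m, m \in msupp p.
  by move: p0; rewrite -msupp_eq0; case: (msupp p) => [//|m s] _; exists m; rewrite mem_head.
pose B := msize p; pose e (m : 'X_{1..n}) := (\sum_(i < n) m i * B ^ i)%N.
have mB (m : 'X_{1..n}) i : m \in msupp p -> (m i < B)%N.
  by move=> /msize_mdeg_lt; apply: leq_ltn_trans; rewrite mdegE (bigD1 i)//= leq_addr.
pose q : {poly k} := \sum_(m <- msupp p) p@_m *: 'X^(e m).
have qE t : q.[t] = p.@[fun i => t ^+ (B ^ i)].
  rewrite mevalE horner_sum; apply: eq_bigr => m _; rewrite hornerZ hornerXn /e -prodrXr; congr (_ * _).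
  by apply: eq_bigr => i _; rewrite -exprM mulnC.
have e_inj : {in msupp p &, injective e}.
  pose a' (m : 'X_{1..n}) (i : nat) : nat := if insub i is Some x then m x else 0%N.
  have a'E (m : 'X_{1..n}) (i : 'I_n) : a' m i = m i by rewrite /a' valK.
  have a'B (m : 'X_{1..n}) : m \in msupp p -> forall i, (i < n)%N -> (a' m i < B)%N.
    by move=> mp i i_n; rewrite -[i]/(val (Ordinal i_n)) a'E; apply: mB.
  move=> m m' mp m'p E; apply/mnmP => i; rewrite -!a'E.
  apply: (digits_inj (a'B _ mp) (a'B _ m'p) _ (ltn_ord i)).
  by under eq_bigr do rewrite a'E; under [RHS]eq_bigr do rewrite a'E.
have /closed_nonrootP[t] : q != 0.
  apply: contraTneq m0p => q0; rewrite mcoeff_msupp negbK; apply: contraT => pm0.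
  have m0p : m0 \in msupp p by rewrite mcoeff_msupp.
  have := congr1 (fun q : {poly k} => q`_(e m0)) q0.
  rewrite coef0 coef_sum (bigD1_seq m0) ?msupp_uniq//= big1_seq => [|m /andP[mm0 mp]].
    by rewrite addr0 coefZ coefXn eqxx mulr1 => /eqP; rewrite (negPf pm0).
  rewrite coefZ coefXn; case: eqP => [E|_]; last by rewrite mulr0.
  by move: mm0; rewrite (e_inj m0 m m0p mp E) eqxx.
by rewrite rootE qE; exists (fun i => t ^+ (B ^ i)).
Qed.

(** * Maps to projective spaces and flags of subfamilies *)

Section ProjectiveMaps.
Context (k : closedFieldType) (N : nat) (N2 : (2 <= N)%N).
Local Notation W := (weierstrass_data k N).
Local Notation E := (E_ k N).
Local Notation gequiv := (git_equiv (@weierstrass_act k N) (@weierstrass_char k)).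
Local Notation semi_inv := (semi_invariant (@weierstrass_act k N) (@weierstrass_char k)).
Context (fam : W -> Prop).
Hypothesis fam_T : forall v, fam v -> T_ v.
Hypothesis fam_lim : forall (I : Type) (P : place k I) (v : I -> W), (forall t, fam (v t)) ->
  exists (th : I -> k) w, [/\ forall t, th t != 0, fam w &
    forall n f, semi_inv n f -> tends P (fun t => th t ^+ n * f (v t)) (f w)].

Definition bpf d m (f : nat -> W -> k) :=
  (forall j, semi_inv m (f j)) /\ forall w, fam w -> exists2 j, (j <= d)%N & f j w != 0.

(* The map to P^d given by f sends A onto the linear subspace of the first   *)
(* i + 1 coordinates, or at least to a set that contains it.                 *)
Definition onto d (f : nat -> W -> k) i (A : W -> Prop) := forall c : nat -> k, (exists2 j, (j <= i)%N & c j != 0) ->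
  exists w l, [/\ A w, l != 0 & forall j, (j <= d)%N -> f j w = l * (if (j <= i)%N then c j else 0)].

(** Take [d] minimal among the systems without base points on the family. If the image missed a
    point [c], projection from [c] would give such a system with one function less. *)
Lemma exists_onto (d0 m : nat) f0 : (exists w, fam w) -> bpf d0 m f0 ->
  exists d f, bpf d m f /\ onto d f d fam.
Proof.
move=> [w0 fw0] b0; pose Q d := `[< exists f, bpf d m f >].
have exQ : exists d, Q d by exists d0; apply/asboolP; exists f0.
have [d /asboolP[f bf] dmin] := ex_minnP exQ; exists d, f; split=> // c [j0 j0d cj0].
apply: contrapT => none; case: d => [|d] in bf dmin j0d none *.
  apply: none; have [j] := bf.2 _ fw0; rewrite leqn0 => /eqP-> fw; exists w0, (f 0%N w0 / c 0%N).
  move: j0d cj0; rewrite leqn0 => /eqP-> c0.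
  split=> //; first by rewrite mulf_neq0 ?invr_neq0.
  by move=> j1; rewrite leqn0 => /eqP->; rewrite eqxx divfK.
suff : (d.+1 <= d)%N by rewrite ltnn.
apply: dmin; apply/asboolP.
(* Projection from [c] with pivot [j0]; [bump] skips the pivot in the numbering. *)
exists (fun i v => f (bump j0 i) v * c j0 + - (c (bump j0 i)) * f j0 v); split=> [i|w fw].
  apply: semi_invariant_add; last exact: semi_inv_cst_mul (bf.1 j0).
  have := semi_inv_cst_mul (c j0) (bf.1 (bump j0 i)); congr semi_invariant; apply/funext => v; exact: mulrC.
apply: contrapT => H; apply: none; have fE j : (j <= d.+1)%N -> f j w = f j0 w / c j0 * c j.
  move=> jd; have [->|jj] := eqVneq j j0; first by rewrite divfK.
  have : f j w * c j0 + - c j * f j0 w = 0.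
    apply/eqP/negPn/negP => nz; apply: H; exists (unbump j0 j); last by rewrite unbumpK// inE.
    by move/eqP: jj => jj; rewrite /unbump; case: (ltnP j0 j) => ? /=; lia.
  by rewrite mulNr => /subr0_eq E; apply: (mulIf cj0); rewrite E mulrAC divfK// mulrC.
exists w, (f j0 w / c j0); split=> //; last by move=> j jd; rewrite jd fE.
have [j jd fj] := bf.2 _ fw; apply: contraNneq fj => E; rewrite fE// E mul0r.
by [].
Qed.

Context (d m : nat) (m0 : (0 < m)%N) (f : nat -> W -> k) (bf : bpf d m f).

Lemma onto_le i i' A : (i <= i')%N -> onto d f i' A -> onto d f i A.
Proof.
move=> ii' oA c [j ji cj]; have [|w [l [Aw l0 fE]]] := oA (fun j => if (j <= i)%N then c j else 0).
  by exists j; rewrite ?ji// (leq_trans ji).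
exists w, l; split=> // j' /fE ->; congr (_ * _); case: ifP => // ji'; case: ifP => // ji2.
by rewrite (leq_trans ji2 ii') in ji'.
Qed.

(** [U] is the generic point of the cone over the linear subspace, lifted to [B] together with a
    scale. Every nonzero point [c] of the cone is a specialization of it, and the limit of the lifts
    along a place that realizes the specialization lies in [A] above [c]. *)
Lemma chain_step i (B : W -> Prop) : (i <= d)%N -> onto d f i B -> (forall w, B w -> fam w) ->
  exists A, [/\ irr_family fam A, onto d f i A, forall w, A w -> forall j, (i < j <= d)%N -> f j w = 0 &
    forall n g, semi_inv n g -> (forall w, B w -> g w = 0) -> forall w, A w -> g w = 0].
Proof.
move=> id oB Bfam.
pose ok (t : W * k) := [/\ B t.1, t.2 != 0 & forall j, (i < j <= d)%N -> f j t.1 = 0].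
pose y (j : 'I_i.+1) (t : W * k) := t.2 * f j t.1.
pose D (p : {mpoly k[i.+1]}) := [set t | ok t /\ p.@[fun j => y j t] != 0].
have [|||U [UU UD]] := @ultra_of_fip (W * k)%type [set S | exists2 p, p != 0 & S = D p].
- move=> _ _ [p p0 ->] [p' p'0 ->]; exists (D (p * p')).
    by exists (p * p') => //; rewrite mulf_neq0.
  by move=> t [okt]; rewrite mevalM mulf_eq0 negb_or => /andP[].
- by exists (D 1), 1 => //; rewrite oner_neq0.
- move=> _ [p p0 ->].
  have [|c pc] := @mpoly_neq0_point _ _ (p * 'X_ord0).
    rewrite mulf_neq0//; apply: contraTneq isT => /(congr1 (fun q : {mpoly k[i.+1]} => q.@[fun=> 1]))/eqP.
    by rewrite mevalXU meval0 oner_eq0.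
  move: pc; rewrite mevalM mevalXU mulf_eq0 negb_or => /andP[pc c0].
  have [|w [l [Bw l0 fE]]] := oB (fun j => c (inord j)).
    by exists 0%N => //; rewrite (_ : inord 0 = ord0)//; apply: val_inj; rewrite /= inordK.
  exists (w, l^-1); split.
    split=> //; first by rewrite invr_eq0.
    by move=> j /andP[ij jd]; rewrite /= fE// leqNgt ij mulr0.
  congr (_ != 0): pc; congr (_.@[_]); apply/funext => j; rewrite /y /= fE.
    by rewrite -ltnS ltn_ord mulKf// inord_val.
  by apply: leq_trans id; rewrite -ltnS ltn_ord.
have okU : U [set t | ok t].
  by apply: filterS (UD _ (ex_intro2 _ _ 1 (oner_neq0 _) erefl)) => t [].
have [b Bb] : exists b, B b by have [t [Bt _ _]] := filter_ex okU; exists t.1.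
pose v (t : W * k) := if `[< B t.1 >] then t.1 else b.
have fv t : fam (v t) by apply: Bfam; rewrite /v; case: asboolP.
have vU : U [set t | v t = t.1] by apply: filterS okU => t [Bt _ _] /=; rewrite /v asboolT.
have [P0 aP0] := place_of_ultra k UU.
pose A w := fam w /\ forall n g, semi_inv n g -> ae P0 [set t | g (v t) = 0] -> g w = 0.
have gA : generic_in fam A P0 v by split.
have fA0 w : A w -> forall j, (i < j <= d)%N -> f j w = 0.
  move=> [_ H] j ij; apply: (H m _ (bf.1 j)); rewrite aP0.
  by apply: filterS (filterI okU vU) => t [[_ _ h] vt] /=; rewrite vt; apply: h.
exists A; split=> //; first by exists (W * k)%type, P0, v.
- move=> c [j0 j0i cj0].
  have [p pU|P [aP tP]] := exists_place_vals UU (x := y) (c := fun j => c j).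
    have [->|p0] := eqVneq p 0; first by rewrite meval0.
    by have [t [[_ H] E]] := filter_ex (filterI (UD _ (ex_intro2 _ _ p p0 erefl)) pU); rewrite E eqxx in H.
  have [th [w [th0 fw tw]]] := fam_lim P fv.
  have Aw : A w.
    split=> // n g sg; rewrite aP0 => gU; apply: tends_uniq (tw n g sg) _; apply: tends0; rewrite aP.
    by apply: filterS gU => t /= ->; rewrite mulr0.
  have tf j : (j <= i)%N -> tends P (fun t => t.2 * f j (v t)) (c j).
    move=> ji; apply: tends_ae _ (tP (Ordinal (ji : (j < i.+1)%N))); rewrite aP.
    by apply: filterS vU => t /= ->.
  have cross j j' : (j <= i)%N -> (j' <= i)%N -> f j w * c j' = f j' w * c j.
    move=> ji j'i; apply: tends_uniq (tendsM (tw m _ (bf.1 j)) (tf _ j'i)) _.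
    by apply: tends_ext (tendsM (tw m _ (bf.1 j')) (tf _ ji)) => t; ring.
  have [j1 j1d f1] := bf.2 _ fw.
  have j1i : (j1 <= i)%N.
    by rewrite leqNgt; apply: contra f1 => ij1; rewrite (fA0 _ Aw)// ij1.
  have f0 : f j0 w != 0.
    apply: contraNneq f1 => E; have := cross _ _ j1i j0i; rewrite E mul0r => /eqP.
    by rewrite mulf_eq0 (negPf cj0) orbF.
  exists w, (f j0 w / c j0); split=> //; first by rewrite mulf_neq0 ?invr_neq0.
  move=> j jd; case: leqP => ji; last by rewrite (fA0 _ Aw) ?ji// mulr0.
  by rewrite mulrAC -(cross _ _ ji j0i) mulfK.
move=> n g sg gB w [_ H]; apply: (H n g sg); rewrite aP0.
by apply: filterS (filterI okU vU) => t [[Bt _ _] vt] /=; rewrite vt; apply: gB.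
Qed.

(** Irreducible subfamilies over a flag of linear subspaces, each chosen inside the next. The
    function [f j.+1] vanishes on [A j] and not on [A j.+1], which makes the inclusions strict
    without a theorem on fibre dimensions. *)
Lemma exists_flag i (B : W -> Prop) : (i <= d)%N -> onto d f i B -> (forall w, B w -> fam w) ->
  exists A : nat -> W -> Prop, [/\ forall j, (j <= i)%N -> irr_family fam (A j),
    forall j, (j < i)%N -> (forall n g, semi_inv n g -> (forall w, A j.+1 w -> g w = 0) -> forall w, A j w -> g w = 0),
    forall j, (j < i)%N -> exists2 w, A j.+1 w & f j.+1 w != 0 &
    forall j w, (j < i)%N -> A j w -> f j.+1 w = 0].
Proof.
suff H : (i <= d)%N -> onto d f i B -> (forall w, B w -> fam w) -> exists A : nat -> W -> Prop, [/\ forall j, (j <= i)%N -> [/\ irr_family fam (A j), onto d f j (A j) &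
      forall w, A j w -> forall j', (j < j' <= d)%N -> f j' w = 0],
    forall j, (j < i)%N -> (forall n g, semi_inv n g -> (forall w, A j.+1 w -> g w = 0) -> forall w, A j w -> g w = 0) &
    forall n g, semi_inv n g -> (forall w, B w -> g w = 0) -> forall w, A i w -> g w = 0].
  move=> id oB Bfam; have [A [A1 A2 _]] := H id oB Bfam; exists A; split=> //.
  - by move=> j /A1[].
  - move=> j ji; have [_ oA1 _] := A1 _ ji; have [|w [l [Aw l0 fE]]] := oA1 (fun j' => (j' == j.+1)%:R).
      by exists j.+1; rewrite // eqxx oner_neq0.
    by exists w => //; rewrite fE ?leqnn ?eqxx ?mulr1// (leq_trans ji id).
  - move=> j w ji Aw; have [_ _ /(_ w Aw j.+1)] := A1 _ (ltnW ji); apply.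
    by rewrite ltnSn (leq_trans ji id).
elim: i B => [|i IH] B id oB Bfam /=.
  have [A [iA oA fA AB]] := chain_step id oB Bfam; exists (fun=> A); split=> // j.
  by rewrite leqn0 => /eqP->.
have [A [iA oA fA AB]] := chain_step id oB Bfam.
have [As [As1 As2 As3]] := IH A (ltnW id) (onto_le (leqnSn i) oA) (fun w => irr_family_fam iA).
exists (fun j => if j == i.+1 then A else As j); split.
- move=> j; rewrite leq_eqVlt; case: eqP => [->//|_] /=; exact: As1.
- move=> j; rewrite ltnS leq_eqVlt => /orP[/eqP->|ji].
    by rewrite eqxx ltn_eqF.
  by rewrite eqSS ltn_eqF// ltn_eqF ?(ltn_trans ji)//; exact: As2.
by rewrite eqxx.
Qed.

End ProjectiveMaps.

(** * Common zeros of multilinear forms *)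

Section CommonZeros.
Context (k : closedFieldType).
Local Notation pt := (k * k)%type.
Local Notation K := (fun _ : unit -> k => True).
Local Notation lsp n := (@lspan k unit K n).

Lemma lspan_scp n dl f (s : 'I_n -> k) (a : 'I_n -> pt) v : lsp n dl f ->
  f v (fun y => scp (s y) (a y)) = \prod_y s y ^+ dl y * f v a.
Proof.
elim=> [c al _ ald|f1 f2 _ IH1 _ IH2]; last by rewrite IH1 IH2 mulrDr.
rewrite mulrCA; congr (_ * _); rewrite /label_mon -big_split; apply: eq_bigr => x _ /=.
by rewrite /scp /= ![in LHS]exprMn -{3}(subnK (ald x)) exprD; ring.
Qed.

Lemma tends_lspan n dl f (I : Type) (P : place k I) (a : 'I_n -> I -> pt) a0 v : lsp n dl f ->
  (forall y, tendst P (a y) (a0 y)) -> tends P (fun t => f v (fun y => a y t)) (f v a0).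
Proof.
move=> lf ta; elim: lf => [c al _ ald|f1 f2 _ IH1 _ IH2]; last exact: tendsD.
apply: tendsM (tends_cst _ _) _; apply: tends_prod => x _; have [t1 t2] := ta x.
by apply: tendsM; apply: tendsX.
Qed.

Definition extend n (r : 'I_n -> pt) (b : pt) (y : 'I_n.+1) : pt := if insub (val y) is Some j then r j else b.

Lemma extend_widen n (r : 'I_n -> pt) b j : extend r b (widen_ord (leqnSn n) j) = r j.
Proof. by rewrite /extend /= valK. Qed.

Lemma extend_max n (r : 'I_n -> pt) b : extend r b ord_max = b.
Proof. by rewrite /extend insubN //= ltnn. Qed.

Lemma lspan_extend n dl f b : lsp n.+1 dl f -> lsp n (fun x => dl (widen_ord (leqnSn n) x)) (fun v r => f v (extend r b)).
Proof.
elim=> [c al _ ald|f1 f2 _ IH1 _ IH2]; last exact: lspan_add IH1 IH2.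
pose c' (u : unit) := c u * (b.1 ^+ (dl ord_max - al ord_max) * b.2 ^+ al ord_max).
have h := @lspan_mon k unit K n (fun x => dl (widen_ord (leqnSn n) x)) c' (fun x => al (widen_ord (leqnSn n) x)) I.
apply: (lspan_ext _ _ (h _)) => // v r; rewrite /label_mon [in RHS]big_ord_recr /= extend_max /c' -mulrA; congr (_ * _).
by rewrite mulrC; congr (_ * _); apply: eq_bigr => x _; rewrite extend_widen.
Qed.

(** By induction the first [n] equations are solvable with the last label fixed at [(1, t)], for
    every [t]. If the last form had no zero on these solutions, every product of label coordinates
    divided by it would be finite at all places and take finitely many values; but [t] is a quotient
    of two such functions. *)
Theorem multilinear_common_zero n (L : 'I_n -> ('I_n -> pt) -> k) :
  (forall i, lsp n (fun=> 1%N) (fun _ => L i)) -> exists a, (forall x, a x != 0) /\ forall i, L i a = 0.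
Proof.
elim: n L => [|n IH] L lL; first by exists (fun=> 0); split; case.
apply: contrapT => none; pose w := widen_ord (leqnSn n).
have ex t : exists a : 'I_n.+1 -> pt, [/\ forall x, a x != 0, forall i, L (w i) a = 0 & a ord_max = (1, t)].
  have [|a [a0 La]] := IH (fun i r => L (w i) (extend r (1, t))); first by move=> i; exact: lspan_extend (lL (w i)).
  exists (extend a (1, t)); split=> //; last exact: extend_max.
  move=> x; rewrite /extend; case: insubP => [j _ _|_]; first exact: a0.
  by rewrite xpair_eqE negb_and oner_neq0.
pose V := {a : 'I_n.+1 -> pt | (forall x, a x != 0) /\ forall i, L (w i) a = 0}.
pose co (b : bool) (q : pt) := if b then q.2 else q.1.
pose sg (al : {ffun 'I_n.+1 -> bool}) (a : V) := \prod_x co (al x) (sval a x) / L ord_max (sval a).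
have scpE i s a : L i (fun y => scp (s y) (a y)) = (\prod_y s y) * L i a.
  by rewrite (lspan_scp s a tt (lL i)); under eq_bigr do rewrite expr1.
have fin al : exists s : seq k, forall a, sg al a \in s.
  apply: finite_range => P.
  have /choice[f fP] : forall y, exists f : (V -> k) * (V -> pt) * pt, [/\ forall t, f.1.1 t != 0,
      forall t, sval t y = scp (f.1.1 t) (f.1.2 t), tendst P f.1.2 f.2 & f.2 != 0].
    move=> y; have [|f [q [q0 [f0 fq tq q00]]]] := @exists_primitive _ _ P (fun t : V => sval t y).
      by apply: aeT => t; case: (svalP t) => h _; apply: h.
    exists (f, q, q0); split=> // t; case: (fq t) => // E; have [/(_ y)] := svalP t.
    by rewrite E eqxx.
  pose q y t := (f y).1.2 t; pose q0 y := (f y).2.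
  have f0 y t : (f y).1.1 t != 0 by case: (fP y).
  have q00 y : q0 y != 0 by case: (fP y).
  have tq y : tendst P (q y) (q0 y) by case: (fP y).
  have aE t : sval t = fun y => scp ((f y).1.1 t) (q y t) by apply/funext => y; case: (fP y).
  have p0 t : \prod_y (f y).1.1 t != 0 by apply/prodf_neq0.
  have tL i := tends_lspan tt (lL i) tq.
  have L0 i : L (w i) q0 = 0.
    apply: tends_uniq (tL (w i)) _; apply: tends0; apply: aeT => t; have [_ /(_ i)] := svalP t.
    by rewrite [X in L _ X]aE scpE => /eqP; rewrite mulf_eq0 (negPf (p0 t)) => /eqP.
  have Lm : L ord_max q0 != 0.
    apply/negP => /eqP Lm; apply: none; exists q0; split=> // i.
    have [im|] := ltnP i n; last first.
      by move=> ni; have -> : i = ord_max by [apply: val_inj; apply/eqP; rewrite eqn_leq ni -ltnS ltn_ord].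
    by rewrite -(L0 (Ordinal im)); congr L; apply: val_inj.
  have tc : tends P (fun t => \prod_x co (al x) (q x t)) (\prod_x co (al x) (q0 x)).
    by apply: tends_prod => x _; have [] := tq x; rewrite /co; case: (al x).
  eexists; apply: tends_ext (tends_div tc (tL ord_max) Lm) => t; rewrite /sg [in RHS]aE scpE.
  have -> : \prod_x co (al x) (scp ((f x).1.1 t) (q x t)) = (\prod_y (f y).1.1 t) * \prod_x co (al x) (q x t).
    by rewrite -big_split; apply: eq_bigr => x _; rewrite /co /scp; case: (al x).
  by rewrite invfM mulrACA mulfV// mul1r.
have /choice[s sP] := fin; pose S := flatten [seq s al | al <- enum {: {ffun 'I_n.+1 -> bool}}].
have inS al a : sg al a \in S.
  by apply/flattenP; exists (s al); [apply: map_f; rewrite mem_enum|exact: sP].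
pose R := [seq x / y | x <- S, y <- S].
have /closed_nonrootP[t tR] : \prod_(x <- R) ('X - x%:P) != 0 by apply/monic_neq0/monic_prod_XsubC.
case/negP: tR; rewrite root_prod_XsubC; have [a [a0 La am]] := ex t.
pose v : V := exist _ a (conj a0 La).
have Lm : L ord_max a != 0.
  apply/negP => /eqP Lm; apply: none; exists a; split=> // i.
  have [im|] := ltnP i n; last first.
    by move=> ni; have -> : i = ord_max by [apply: val_inj; apply/eqP; rewrite eqn_leq ni -ltnS ltn_ord].
  by rewrite -(La (Ordinal im)); congr L; apply: val_inj.
(* A nonzero coordinate is selected at every label but the last, where the two choices of [b] give
   [t] and 1. *)
pose al b : {ffun 'I_n.+1 -> bool} := [ffun x => if x == ord_max then b else (a x).1 == 0].
have sgE b : sg (al b) v = (\prod_(x | x != ord_max) co ((a x).1 == 0) (a x)) * (if b then t else 1) / L ord_max a.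
  case: b; rewrite /sg (bigD1 ord_max)//= ffunE eqxx am [X in X / _]mulrC; congr (_ * _ / _);
    by apply: eq_bigr => x /negPf xm; rewrite ffunE xm.
have c0 : \prod_(x | x != ord_max) co ((a x).1 == 0) (a x) != 0.
  apply/prodf_neq0 => x _; rewrite /co; case: ((a x).1 =P 0) => [E|/eqP//]; apply: contraNneq (a0 x) => E2.
  by rewrite [a x]surjective_pairing E E2.
have -> : t = sg (al true) v / sg (al false) v.
  by rewrite (sgE true) (sgE false) mulr1; field; rewrite c0 Lm.
by apply: allpairs_f.
Qed.

Lemma lspan_br_cst n (x : 'I_n) q : lsp n (fun z => (z == x) : nat) (fun _ r => br (r x) q).
Proof.
have KC (c : k) : K (fun=> c) by []. have KM (f g : unit -> k) : K f -> K g -> K (fun v => f v * g v) by [].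
have h1 := lspanM KM (@lspan_cst k unit K n (fun=> q.2) I) (lspan_coord KC x false).
have h2 := lspanM KM (@lspan_cst k unit K n (fun=> - q.1) I) (lspan_coord KC x true).
by apply: (lspan_ext _ _ (lspan_add h1 h2)) => // v r; rewrite /br; ring.
Qed.

Lemma lspan_prodlin_coef n i : lsp n (fun=> 1%N) (fun _ r => (prodlin r)`_i).
Proof.
have KC (c : k) : K (fun=> c) by []. have KM (f g : unit -> k) : K f -> K g -> K (fun v => f v * g v) by [].
have [t ut st] := exists_uniq_seq k n.+1; have [lam lamE] := coef_lagrange i ut st.
have h j : lsp n (fun=> 1%N) (fun _ r => lam j * \prod_y br (r y) (1, t`_j)).
  have hp := @lspan_prod k unit K KC KM n 'I_n (index_enum _) predT _ _ (fun y _ => lspan_br_cst y (1, t`_j)).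
  apply: (lspan_ext _ _ (lspanM KM (@lspan_cst k unit K n (fun=> lam j) I) hp)) => // u /=.
  by rewrite (bigD1 u)//= eqxx big1// => y; rewrite eq_sym => /negPf->.
have hs := @lspan_sum k unit K KC n _ (index_enum 'I_n.+1) predT _ _ (fun j _ => h j).
apply: (lspan_ext _ _ hs) => // v r; rewrite lamE; last by have := size_prodlin r; rewrite card_ord.
apply: eq_bigr => j _; congr (_ * _); rewrite -(hev1 (t`_j) (size_prodlin r)) hev_prodlin.
by [].
Qed.

End CommonZeros.

Section Extremes.
Context (k : closedFieldType) (r e : nat) (r0 : (0 < r)%N).
Local Notation pt := (k * k)%type.
Local Notation n := (r + r + e)%N.
Local Notation K := (fun _ : unit -> k => True).
Local Notation lsp n := (@lspan k unit K n).
Context (c : {perm 'I_n} -> k) (cg : cov_good c).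

Lemma lspan_cov x : lsp n (fun=> 1%N) (fun _ a => cov c a x).
Proof.
have KC (z : k) : K (fun=> z) by []. have KM (f g : unit -> k) : K f -> K g -> K (fun v => f v * g v) by [].
apply: lspan_sum => // t _.
have h1 := @lspan_prod k unit K KC KM n 'I_r (index_enum _) predT _ _
  (fun i _ => lspan_br KC KM (t (cov_l e i)) (t (cov_r e i))).
have h2 := @lspan_prod k unit K KC KM n 'I_e (index_enum _) predT _ _
  (fun i _ => lspan_br_cst (t (cov_q r i)) x).
apply: (lspan_ext _ _ (lspanM KM (lspanM KM h1 h2) (@lspan_cst k unit K n (fun=> c t) I))) => // u /=.
have [y ->] : exists y, u = t y by exists ((t^-1)%g u); rewrite permKV.
under eq_bigr do rewrite !(inj_eq perm_inj); under [X in (_ + X + _)%N]eq_bigr do rewrite (inj_eq perm_inj).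
rewrite addn0 big_split /=; transitivity (\sum_(i < n) (y == i))%N; first by rewrite big_split_ord big_split_ord.
by rewrite (bigD1 y)//= eqxx big1// => z; rewrite eq_sym => /negPf->.
Qed.

Lemma cov_zero_points a (t : seq k) : uniq t -> size t = e.+1 -> (forall i, (i < e.+1)%N -> cov c a (1, t`_i) = 0) -> cov_zero c a.
Proof.
move=> ut st H.
pose P := \sum_t (c t * \prod_(i < r) br (a (t (cov_l e i))) (a (t (cov_r e i)))) *: prodlin (fun j : 'I_e => a (t (cov_q r j))).
have PE x : cov c a x = hev e P x.
  rewrite /P hev_sum; apply: eq_bigr => s _; rewrite hevZ /cov_term; have := hev_prodlin (fun j : 'I_e => a (s (cov_q r j))) x.
  by rewrite card_ord => ->; ring.
have sP : (size P <= e.+1)%N.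
  apply: (big_ind (fun q : {poly k} => (size q <= e.+1)%N)) => [|q1 q2 h1 h2|j _].
  - by rewrite size_poly0.
  - by apply: leq_trans (size_polyD _ _) _; rewrite geq_max h1.
  - apply: leq_trans (size_scale_leq _ _) _; have := size_prodlin (fun i : 'I_e => a (j (cov_q r i))).
    by rewrite card_ord.
have P0 : P = 0.
  apply: (@roots_geq_poly_eq0 _ _ t) => //; last by rewrite st.
  by apply/allP => x /(nthP 0)[i]; rewrite st => ie <-; rewrite rootE -(hev1 _ sP) -PE H.
by move=> x; rewrite PE P0 -(scale0r (0 : {poly k})) hevZ mul0r.
Qed.

(** The order of the indices matches [slot]: first the low ones, then those counted down from the
    degree. *)
Definition extreme j := (if (j < r)%N then j else n - (j - r))%N.

(** The conditions are e + 1 values of the covariant and 2r - 1 proportions between the extreme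
    coefficients, together n multilinear equations in n labels. The constant coefficient of a
    solution is nonzero: otherwise all extreme coefficients would vanish, and [order_jump] would
    make the form zero. *)
Lemma exists_extremes (s : nat -> k) : s 0%N != 0 ->
  exists a, cov_zero c a /\ forall j, (j < 2 * r)%N -> (prodlin a)`_(extreme j) = s j.
Proof.
move=> s0; have [t ut st] := exists_uniq_seq k e.+1.
have KC (z : k) : K (fun=> z) by []. have KM (f g : unit -> k) : K f -> K g -> K (fun v => f v * g v) by [].
pose L (i : 'I_n) (a : 'I_n -> pt) := if (i < e.+1)%N then cov c a (1, t`_i)
  else s (i - e)%N * (prodlin a)`_0 + - s 0%N * (prodlin a)`_(extreme (i - e)).
have [|a [a0 La]] := @multilinear_common_zero k n L.
  move=> i; have [ie|/negPf ie] := boolP (i < e.+1)%N.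
    by apply: (lspan_ext _ _ (lspan_cov (1, t`_i))) => // v q; rewrite /L ie.
  have h1 := lspanM KM (@lspan_cst k unit K n (fun=> s (i - e)%N) I) (lspan_prodlin_coef k n 0).
  have h2 := lspanM KM (@lspan_cst k unit K n (fun=> - s 0%N) I) (lspan_prodlin_coef k n (extreme (i - e))).
  by apply: (lspan_ext _ _ (lspan_add h1 h2)) => // v q; rewrite /L ie.
have az : cov_zero c a.
  apply: (cov_zero_points ut st) => i ie; have lt : (i < n)%N by lia.
  by have := La (Ordinal lt); rewrite /L /= ie.
have pr j : (j < 2 * r)%N -> s j * (prodlin a)`_0 = s 0%N * (prodlin a)`_(extreme j).
  have [->|j0] := posnP j; first by rewrite /extreme r0.
  move=> jr; have lt : (j + e < n)%N by lia.
  have := La (Ordinal lt); rewrite /L /= addnK; have -> : (j + e < e.+1)%N = false by lia.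
  by rewrite mulNr => /subr0_eq.
have P0 : (prodlin a)`_0 != 0.
  apply/negP => /eqP E.
  have ext0 j : (j < 2 * r)%N -> (prodlin a)`_(extreme j) = 0.
    by move=> /pr; rewrite E mulr0 => /esym/eqP; rewrite mulf_eq0 (negPf s0) => /eqP.
  have fid : frm n (prodlin a) (1, 0) (0, 1) = prodlin a.
    by apply: frm_id; have := size_prodlin a; rewrite card_ord.
  have fr0 : br ((1, 0) : pt) (0, 1) = 1 by rewrite /br /= mulr1 mulr0 subr0.
  have low := order_jump r0 cg az fr0; rewrite fid in low.
  have {}low : forall i, (i <= n - r)%N -> (prodlin a)`_i = 0.
    by apply: low => i ir; have := ext0 i; rewrite /extreme ir; apply; lia.
  suff : prodlin a == 0 by rewrite prodlin_eq0 => /existsP[x]; rewrite (negPf (a0 x)).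
  apply/eqP/polyP => i; rewrite coef0; have [/low//|ni] := leqP i (n - r).
  have [ni2|ni2] := ltnP n i; first by rewrite nth_default// (leq_trans (size_prodlin a))// card_ord.
  have := ext0 (r + (n - i))%N; rewrite /extreme; have -> : (r + (n - i) < r)%N = false by lia.
  by have -> : (n - (r + (n - i) - r) = i)%N by [lia]; apply; lia.
have [|b bE [u [_ bs]]] := prodlin_scp_lift (s 0%N / (prodlin a)`_0) a; first by rewrite card_ord; lia.
exists b; split=> [x|j jr].
  by rewrite bs (_ : x = scp 1 x) ?cov_scp ?az ?mulr0//; rewrite /scp !mul1r; case: x.
by rewrite bE coefZ mulrAC -(pr j jr) mulfK.
Qed.

End Extremes.

Section AlgebraicPolynomials.
Context (k : closedFieldType) (I : Type) (U : set_system I) (UU : UltraFilter U) (r : nat) (L0 : 'I_r -> I -> k).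
Local Notation pt := (k * k)%type.

Definition aclp (F : I -> {poly k}) := forall i, acl U L0 (fun t => (F t)`_i).

Lemma aclpM F G : aclp F -> aclp G -> aclp (fun t => F t * G t).
Proof.
move=> aF aG i; apply: (acl_ae UU (f := fun t => \sum_(j < i.+1) (F t)`_j * (G t)`_(i - j))).
  by apply: filterE => t /=; rewrite coefM.
by apply: (acl_sum UU) => j _; apply: (aclM UU).
Qed.

Lemma aclpX F e : aclp F -> aclp (fun t => F t ^+ e).
Proof.
move=> aF; elim: e => [|e IH].
  by move=> i; apply: (acl_ae UU (f := fun=> (1 : {poly k})`_i)); [apply: filterE|apply: (acl_cst UU)].
by move=> i; apply: (acl_ae UU) (aclpM aF IH i); apply: filterE => t /=; rewrite exprS.
Qed.

Lemma aclp_frm d (P : I -> {poly k}) (g g' : I -> pt) : aclp P ->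
  acl U L0 (fun t => (g t).1) -> acl U L0 (fun t => (g t).2) -> acl U L0 (fun t => (g' t).1) -> acl U L0 (fun t => (g' t).2) ->
  aclp (fun t => frm d (P t) (g t) (g' t)).
Proof.
move=> aP a1 a2 b1 b2.
have lin (x y : I -> k) : acl U L0 x -> acl U L0 y -> aclp (fun t => (x t)%:P + y t *: 'X).
  move=> ax ay [|[|i]].
  - by apply: (acl_ae UU) ax; apply: filterE => t /=; rewrite coefD coefZ coefX coefC /= mulr0 addr0.
  - by apply: (acl_ae UU) ay; apply: filterE => t /=; rewrite coefD coefZ coefX coefC /= mulr1 add0r.
  - by apply: (acl_ae UU) (acl_cst UU L0 0); apply: filterE => t /=; rewrite coefD coefZ coefX coefC /= mulr0 addr0.
move=> i; apply: (acl_ae UU (f := fun t => \sum_(j < d.+1) (P t)`_j *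
    ((((g t).1)%:P + (g' t).1 *: 'X) ^+ (d - j) * (((g t).2)%:P + (g' t).2 *: 'X) ^+ j)`_i)).
  by apply: filterE => t /=; rewrite /frm coef_sum; apply: eq_bigr => j _; rewrite coefZ.
apply: (acl_sum UU) => j _; apply: (aclM UU); first exact: aP.
by apply: aclpM; apply: aclpX; apply: lin.
Qed.

End AlgebraicPolynomials.

(** * The dimension count for the family *)

Section Generic.
Context (k : closedFieldType) (N : nat) (N2 : (2 <= N)%N).
Hypotheses (c2_neq0 : 2%N \notin [pchar k]%R) (c3_neq0 : 3%N \notin [pchar k]%R).
Local Notation pt := (k * k)%type.
Local Notation W := (weierstrass_data k N).
Local Notation nA := (4 + 4 + (4 * N - 8))%N.
Local Notation nB := (6 + 6 + (6 * N - 12))%N.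
Local Notation semi_inv := (semi_invariant (@weierstrass_act k N) (@weierstrass_char k)).
Context (c1 : {perm 'I_nA} -> k) (c2 : {perm 'I_nB} -> k).
Hypotheses (g1 : cov_good c1) (g2 : cov_good c2).
Hypothesis c12 : forall (al : 'I_nA -> pt) (be : 'I_nB -> pt) (rho : 'I_nB -> 'I_nA),
  (forall x, al x != 0) -> (forall y, be y != 0) -> cov_zero c1 al -> cov_zero c2 be ->
  (forall x, #|cluster al x| = 2%N) -> (forall y, #|cluster be y| = 3%N) ->
  ~ forall y, br (be y) (al (rho y)) = 0.
Local Notation fam := (in_family c1 c2).

(** The point of the factorization is that such forms depend on only 2 + 4 parameters, fewer than
    the 8 free coefficients of A. *)
Lemma clustered_form (al : 'I_nA -> pt) q s : cov_zero c1 al -> br q s = 1 ->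
  (forall i, (i < 4)%N -> (frm (4 * N) (prodlin al) q s)`_i = 0) ->
  exists L C : {poly k}, prodlin al = L ^+ (4 * N - 3) * C /\ (size L <= 2)%N /\ (size C <= 4)%N.
Proof.
move=> az qs low; have E4 : nA = (4 * N)%N by lia.
have := order_jump (isT : (0 < 4)%N) g1 az qs; rewrite !frm_nA// => /(_ low) jump.
pose F := frm (4 * N) (prodlin al) q s; pose u : pt := (s.2, - q.2); pose u' : pt := (- s.1, q.1).
have sF : (size F <= (4 * N).+1)%N := size_frm _ _ _ _.
pose D := drop_poly (4 * N - 3) F.
have FE : F = 'X^(4 * N - 3) * D.
  rewrite -[LHS](poly_take_drop (4 * N - 3)) mulrC (_ : take_poly _ _ = 0) ?add0r//.
  apply/polyP => i; rewrite coef_take_poly coef0; case: ifP => // ilt; apply: jump; lia.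
have sD : (size D <= 4)%N by rewrite size_drop_poly; lia.
have sA : (size (prodlin al) <= (4 * N).+1)%N by apply: leq_trans (size_prodlin al) _; rewrite card_ord E4.
exists (frm 1 'X u u'), (frm 3 D u u'); split; last by rewrite !size_frm.
rewrite -frmX ?size_polyX// mul1n -frmM ?size_polyXn// -FE subnK; last by lia.
by rewrite /F frm_inv.
Qed.

(** [U] is the generic point of affine 20-space, and the family is built with these coordinates as
    extreme coefficients; the generic point has nonzero coordinates, as [exists_extremes] requires
    of the constant coefficients. *)
Lemma exists_generic : exists (U : set_system ('I_20 -> k)) (v : ('I_20 -> k) -> W),
  [/\ UltraFilter U, forall t, fam (v t), U [set t | forall j, slot j (v t) = t j] &
      alg_independent U (fun j t => t j)].
Proof.
pose D (p : {mpoly k[20]}) := [set t : 'I_20 -> k | p.@[t] != 0].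
have [|||U [UU UD]] := @ultra_of_fip ('I_20 -> k) [set S | exists2 p, p != 0 & S = D p].
- move=> _ _ [p p0 ->] [p' p'0 ->]; exists (D (p * p')); first by exists (p * p') => //; rewrite mulf_neq0.
  by move=> t; rewrite /D /= mevalM mulf_eq0 negb_or => /andP[].
- by exists (D 1), 1 => //; rewrite oner_neq0.
- by move=> _ [p p0 ->]; exact: mpoly_neq0_point.
have ind : alg_independent U (fun j (t : 'I_20 -> k) => t j).
  move=> p pU; apply/eqP/negPn/negP => p0.
  by have [t [H E]] := filter_ex (filterI (UD _ (ex_intro2 _ _ p p0 erefl)) pU); move: H; rewrite /D /= E eqxx.
have X0 (j : 'I_20) : U [set t | t j != 0].
  have nX : ('X_j : {mpoly k[20]}) != 0.
    by apply: contraTneq isT => /(congr1 (fun q : {mpoly k[20]} => q.@[fun=> 1]))/eqP; rewrite mevalXU meval0 oner_eq0.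
  by apply: filterS (UD _ (ex_intro2 _ _ 'X_j nX erefl)) => t; rewrite /D /= mevalXU.
have /choice[al alP] : forall t : 'I_20 -> k, exists al, t (inord 0) != 0 ->
    cov_zero c1 al /\ forall j, (j < 8)%N -> (prodlin al)`_(extreme 4 (4 * N - 8) j) = t (inord j).
  move=> t; have [t0|t0] := eqVneq (t (inord 0)) 0; first by exists (fun=> 0).
  by have [al H] := exists_extremes (isT : (0 < 4)%N) g1 (s := fun j => t (inord j)) t0; exists al.
have /choice[be beP] : forall t : 'I_20 -> k, exists be, t (inord 8) != 0 ->
    cov_zero c2 be /\ forall j, (j < 12)%N -> (prodlin be)`_(extreme 6 (6 * N - 12) j) = t (inord (8 + j)).
  move=> t; have [t0|t0] := eqVneq (t (inord 8)) 0; first by exists (fun=> 0).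
  by have [be H] := exists_extremes (isT : (0 < 6)%N) g2 (s := fun j => t (inord (8 + j))) t0; exists be.
have E4 : nA = (4 * N)%N by lia.
have E6 : nB = (6 * N)%N by lia.
have sA t : (size (prodlin (al t)) <= (4 * N).+1)%N by apply: leq_trans (size_prodlin (al t)) _; rewrite card_ord E4.
have sB t : (size (prodlin (be t)) <= (6 * N).+1)%N by apply: leq_trans (size_prodlin (be t)) _; rewrite card_ord E6.
pose v0 t := wdata N (prodlin (al t)) (prodlin (be t)).
have ok0 : U [set t | t (inord 0) != 0 /\ t (inord 8) != 0] by apply: filterI; apply: X0.
have exA i : extreme 4 (4 * N - 8) i = (if (i < 4)%N then i else 4 * N - (i - 4))%N by rewrite /extreme E4.
have exB i : extreme 6 (6 * N - 12) i = (if (i < 6)%N then i else 6 * N - (i - 6))%N by rewrite /extreme E6.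
have slotE : U [set t | forall j, slot j (v0 t) = t j].
  apply: filterS ok0 => t [t0 t8] j; have [_ aP] := alP t t0; have [_ bP] := beP t t8.
  have jE : j = inord j by rewrite inord_val.
  have [j8|j8] := ltnP j 8.
    rewrite {2}jE -aP// /slot pA_wdata// exA; case: ifP => // j4.
    by rewrite j8.
  have -> : t j = t (inord (8 + (j - 8))) by rewrite subnKC ?inord_val.
  have j20 := ltn_ord j; rewrite -bP; last by lia.
  rewrite /slot pB_wdata// exB; have -> : (j < 4)%N = false by lia.
  have -> : (j < 8)%N = false by lia.
  case: (ltnP j 14) => j14; first by have -> : (j - 8 < 6)%N by lia.
  by have -> : (j - 8 < 6)%N = false by [lia]; congr (_`_(_ - _)); lia.
have minU : U [set t | minimal N (prodlin (al t)) (prodlin (be t))].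
  (* If the generic pair were nonminimal, A would be given by the 6 coefficients of a linear and a
     cubic form; with the 12 slots of B these are 18 functions for 20 independent slots. *)
  have [//|nU] := in_ultra_setVsetC [set t | minimal N (prodlin (al t)) (prodlin (be t))] UU; exfalso.
  have /choice[LC LCP] : forall t, exists LC : {poly k} * {poly k}, t (inord 0) != 0 -> ~ minimal N (prodlin (al t)) (prodlin (be t)) ->
      prodlin (al t) = LC.1 ^+ (4 * N - 3) * LC.2 /\ (size LC.1 <= 2)%N /\ (size LC.2 <= 4)%N.
    move=> t; have [t0|t0] := eqVneq (t (inord 0)) 0; first by exists (0, 0).
    have [m|nm] := pselect (minimal N (prodlin (al t)) (prodlin (be t))); first by exists (0, 0).
    have /existsNP[q /existsNP[s /not_implyP[qs /not_orP[nA' _]]]] := nm.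
    have [|L [C H]] := clustered_form (alP t t0).1 qs; last by exists (L, C).
    by move=> i i4; apply/eqP/negPn/negP => ci; apply: nA'; exists i.
  pose L0 (j : 'I_18) (t : 'I_20 -> k) : k := if (j < 2)%N then (LC t).1`_j else if (j < 6)%N then (LC t).2`_(j - 2) else t (inord (j + 2)).
  have base (j : nat) (lt : (j < 18)%N) := acl_base U L0 (Ordinal lt).
  have okn : U [set t | prodlin (al t) = (LC t).1 ^+ (4 * N - 3) * (LC t).2 /\ (size (LC t).1 <= 2)%N /\ (size (LC t).2 <= 4)%N].
    by apply: filterS (filterI ok0 nU) => t [[t0 _] nm]; apply: LCP.
  have aL : aclp U L0 (fun t => (LC t).1).
    move=> i; have [i2|i2] := ltnP i 2.
      have lt : (i < 18)%N by lia.
      by apply: (acl_ae UU) (base i lt); apply: filterE => t /=; rewrite /L0 /= i2.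
    by apply: (acl_ae UU) (acl_cst UU L0 0); apply: filterS okn => t [_ [sL _]] /=; rewrite nth_default ?(leq_trans sL).
  have aC : aclp U L0 (fun t => (LC t).2).
    move=> i; have [i4|i4] := ltnP i 4.
      have lt : (i + 2 < 18)%N by lia.
      apply: (acl_ae UU) (base _ lt); apply: filterE => t /=; rewrite /L0 /= addnK; have -> : (i + 2 < 2)%N = false by lia.
      by have -> : (i + 2 < 6)%N by lia.
    by apply: (acl_ae UU) (acl_cst UU L0 0); apply: filterS okn => t [_ [_ sL]] /=; rewrite nth_default ?(leq_trans sL).
  have aA := aclpM UU (aclpX UU (4 * N - 3) aL) aC.
  apply: (acl_dependent UU (L0 := L0) (Y := fun (j : 'I_20) (t : 'I_20 -> k) => t j)) ind => // j.
  have [j8|j8] := ltnP j 8.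
    apply: (acl_ae UU) (aA (extreme 4 (4 * N - 8) j)); apply: filterS (filterI ok0 okn) => t /= [[t0 _] [<- _]].
    by rewrite (alP t t0).2// inord_val.
  have lt : (j - 2 < 18)%N by have := ltn_ord j; lia.
  apply: (acl_ae UU) (base _ lt); apply: filterE => t /=; rewrite /L0 /=.
  have -> : (j - 2 < 2)%N = false by lia.
  have -> : (j - 2 < 6)%N = false by lia.
  by rewrite subnK ?inord_val//; lia.
have famU : U [set t | fam (v0 t)].
  apply: filterS (filterI ok0 minU) => t [[t0 t8] mt]; split.
    apply/(T_P _ (ltnW N2)); rewrite pA_wdata// pB_wdata//; split=> //.
    have D1 := disc_neq0 N2 c2_neq0 c3_neq0 c12 (alP t t0).1 (beP t t8).1 mt.
    exact: D1.
  by exists (al t), (be t); rewrite pA_wdata// pB_wdata//; split=> //; [case: (alP t t0)|case: (beP t t8)].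
have [t1 ft1] := filter_ex famU.
exists U, (fun t => if `[< fam (v0 t) >] then v0 t else v0 t1); split=> //.
  by move=> t; case: asboolP.
by apply: filterS (filterI famU slotE) => t [ft st] j; rewrite asboolT.
Qed.

(** At a place where all [f j] are finite, one of them is nonzero at the limit in the family, which
    makes the inverse of the scaling [th] finite. Then every semi-invariant is finite at that place,
    so none is transcendental over the [f j]. *)
Lemma semi_inv_acl (I : Type) (U : set_system I) (UU : UltraFilter U) (v : I -> W) d m f (ga : 'I_3 -> I -> k) n g :
  (forall t, fam (v t)) -> (0 < m)%N -> bpf fam d m f -> semi_inv n g ->
  acl U (fun (j : 'I_(d.+1 + 3)) t => match fintype.split j with inl i => f i (v t) | inr i => ga i t end) (fun t => g (v t)).
Proof.
move=> fv m0 [sf bf] sg; apply: contrapT => /(transcendental_place UU)[P [aP fin nfin]]; apply: nfin.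
have [th [w [th0 fw tw]]] := family_limit_invariants N2 c2_neq0 c3_neq0 g1 g2 c12 P fv.
have [j jd fj] := bf w fw.
have [a ta] := fin (lshift 3 (Ordinal (jd : (j < d.+1)%N))).
have {}ta : tends P (fun t => f j (v t)) a by apply: tends_ext ta => t; rewrite (unsplitK (inl _)).
have fth : finite_at P (fun t => (th t)^-1).
  apply: (@finite_at_root _ _ _ _ m) => //; exists (a / f j w).
  apply: tends_ae _ (tends_div ta (tw m _ (sf j)) fj); apply: aeW (tends_ne0 (tw m _ (sf j)) fj) => t.
  rewrite mulf_eq0 negb_or => /andP[_ ft] /=; rewrite exprVn; field.
  by rewrite ft andbT expf_neq0.
apply: finite_at_ext (finite_atM (finite_atX n fth) (ex_intro _ _ (tw n g sg))) => t.
by rewrite exprVn mulrA mulVf ?mul1r// expf_neq0.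
Qed.

(** Semi-invariants are algebraic over the d + 1 functions [f j]; coefficients in a label frame are
    algebraic over semi-invariants; the original coefficients need in addition the frame, an element
    of SL_2, that is three more functions. Thus 20 independent slots are algebraic over d + 4
    functions. *)
Theorem bpf_dimension d m f : (0 < m)%N -> bpf fam d m f -> (16 <= d)%N.
Proof.
move=> m0 bf; rewrite leqNgt; apply/negP => d16.
have [U [v [UU fv slotU ind]]] := exists_generic.
have [ss [ss_inj ss1]] := exists_pencils k N2.
have mv t : minimal N (pA (v t)) (pB (v t)) by have [/(T_P _ (ltnW N2))[]] := fv t.
have [P0 aP0] := place_of_ultra k UU.
have [a0 vU] : exists a, ae P0 [set t | pencil_form (ss a) (v t) != 0].
  apply/ae_finP; apply: aeT => t /=.
  have [E|H] := eqVneq (pencil_form (ss ord0) (v t)) 0; last by exists ord0.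
  by exists ord_max; apply/eqP => E'; have := ss1 _ (mv t) _ _ E E'.
have /choice[r rE] := fun t => exists_labels N2 (ss a0) (v t).
pose n := (6 * N * (12 * N + 2))%N.
pose J := ({perm 'I_(n + n)} * {perm 'I_(n + n)} * {perm 'I_(n + n)} * ('I_n * 'I_n * 'I_n) * ('I_(n + n) * 'I_(n + n) * 'I_(n + n)))%type.
have [[[[[s1 s2] s3] [[i1 i2] i3]] [[x y] z]] jU] : exists j : J, ae P0 [set t |
   [/\ [/\ j.1.1.1.1 (lshift _ j.1.2.1.1) = j.2.1.1, j.1.1.1.1 (rshift _ j.1.2.1.1) = j.2.1.2,
    j.1.1.1.2 (lshift _ j.1.2.1.2) = j.2.1.2 & j.1.1.1.2 (rshift _ j.1.2.1.2) = j.2.2],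
      j.1.1.2 (lshift _ j.1.2.2) = j.2.1.1 /\ j.1.1.2 (rshift _ j.1.2.2) = j.2.2 & @mat3 k N j.1.1.1.1 j.1.1.1.2 j.1.1.2 (r t) != 0]].
  apply/ae_finP; apply: aeW vU => t vt /=.
  have [s1 [s2 [s3 [i1 [i2 [i3 [x [y [z H]]]]]]]]] := exists_mat3 N2 (ss_inj a0) (mv t) vt (rE t).
  by exists ((s1, s2, s3), (i1, i2, i3), (x, y, z)).
have [t0 [[e1 e1' e2 e2'] [e3 e3'] _]] := ae_exists jU; rewrite /= in e1 e1' e2 e2' e3 e3'.
have mU : U [set t | @mat3 k N s1 s2 s3 (r t) != 0] by rewrite -aP0; apply: aeW jU => t [].
have rec := frame_recover e1 e1' e2 e2' e3 e3'.
have /choice[g gP] : forall t, exists g : pt * pt, @mat3 k N s1 s2 s3 (r t) != 0 -> br g.1 g.2 = 1 /\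
  forall e P i v, frame_coef s1 s2 s3 i1 i2 i3 x y z e P i v (r t) = @mat3 k N s1 s2 s3 (r t) ^+ e * (frm (2 * e) (P v) g.1 g.2)`_i.
  move=> t; have [Z|/rec[g [g' H]]] := eqVneq (@mat3 k N s1 s2 s3 (r t)) 0; last by exists (g, g').
  by exists (0, 0).
(* Three entries of the frame determine the fourth through the determinant 1; which three to take
   depends on whether the first entry vanishes. *)
have [ga gaP] : exists ga : 'I_3 -> ('I_20 -> k) -> k, forall L0 : 'I_(d.+1 + 3) -> ('I_20 -> k) -> k,
    (forall i, acl U L0 (ga i)) -> [/\ acl U L0 (fun t => (g t).1.1), acl U L0 (fun t => (g t).1.2),
      acl U L0 (fun t => (g t).2.1) & acl U L0 (fun t => (g t).2.2)].
  have [Z|Z] := ae_eq0 P0 (fun t => (g t).1.1); rewrite aP0 in Z.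
    exists (fun i t => if i == 0%N :> nat then (g t).1.2 else if i == 1%N :> nat then (g t).2.1 else (g t).2.2) => L0 H.
    split; [by apply: (acl_ae UU) (acl_cst UU L0 0)|exact: (H (inord 0))|exact: (H (inord 1))|exact: (H (inord 2))] || split.
    - by apply: (acl_ae UU) (acl_cst UU L0 0).
    - by apply: (acl_ae UU) (H (inord 0)); apply: filterE => t /=; rewrite inordK.
    - by apply: (acl_ae UU) (H (inord 1)); apply: filterE => t /=; rewrite inordK.
    - by apply: (acl_ae UU) (H (inord 2)); apply: filterE => t /=; rewrite inordK.
  exists (fun i t => if i == 0%N :> nat then (g t).1.1 else if i == 1%N :> nat then (g t).1.2 else (g t).2.1) => L0 H.
  have h0 : acl U L0 (fun t => (g t).1.1) by apply: (acl_ae UU) (H (inord 0)); apply: filterE => t /=; rewrite inordK.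
  have h1 : acl U L0 (fun t => (g t).1.2) by apply: (acl_ae UU) (H (inord 1)); apply: filterE => t /=; rewrite inordK.
  have h2 : acl U L0 (fun t => (g t).2.1) by apply: (acl_ae UU) (H (inord 2)); apply: filterE => t /=; rewrite inordK.
  split=> //; have := aclM UU (aclD UU (acl_cst UU L0 1) (aclM UU h1 h2)) (aclV UU h0).
  apply: (acl_ae UU); apply: filterS (filterI mU Z) => t [/gP[E _] g0] /=.
  by move: E; rewrite /br => <-; field.
pose L0 (j : 'I_(d.+1 + 3)) t := match fintype.split j with inl i => f i (v t) | inr i => ga i t end.
have aS nn h : semi_inv nn h -> acl U L0 (fun t => h (v t)) by move=> sh; exact: (semi_inv_acl UU ga fv m0 bf sh).
have aphi D a phi : (0 < D)%N -> equivariant D a phi -> acl U L0 (fun t => phi (v t) (r t)).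
  move=> D0 ephi; pose M := #|{: {perm 'I_(n + n)}}|.
  have ae_ j : acl U L0 (fun t => esum phi j (v t) (r t)).
    have [F [sF FE]] := exists_esum N2 (ss a0) j D0 ephi.
    by apply: (acl_ae UU) (aS _ _ sF); apply: filterE => t /=; rewrite (FE _ _ (rE t)).
  refine (@acl_root k ('I_20 -> k) U UU (d.+1 + 3)%N L0 M (fun j t => (-1) ^+ (M - j) * esum phi (M - j)%N (v t) (r t)) (fun t => phi (v t) (r t)) _ _ _).
  - by move=> j; apply: (aclM UU) (acl_cst UU L0 _) (ae_ _).
  - by apply: filterE => t /=; rewrite subnn expr0 mul1r esum0 oner_neq0.
  apply: filterE => t /=; rewrite -[RHS](esum_root phi 1%g (v t) (r t)) (reindex_inj rev_ord_inj) /=.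
  apply: eq_bigr => j _; rewrite subSS subKn; last by rewrite -ltnS.
  by congr (_ * _ * phi _ _ ^+ _); apply/funext => u; rewrite perm1.
have am : acl U L0 (fun t => @mat3 k N s1 s2 s3 (r t)) := aphi 3%N 0%N _ isT (@equivariant_mat3 k N s1 s2 s3).
have [b1 b2 b3 b4] : [/\ acl U L0 (fun t => (g t).1.1), acl U L0 (fun t => (g t).1.2),
      acl U L0 (fun t => (g t).2.1) & acl U L0 (fun t => (g t).2.2)].
  apply: gaP => i; apply: (acl_ae UU) (acl_base U L0 (rshift d.+1 i)); apply: filterE => t /=.
  by rewrite /L0 (unsplitK (inr _)).
have coords e a (P : W -> {poly k}) : (0 < e)%N -> (forall i, polynomial_fun (fun v => (P v)`_i)) ->
    (forall gl v, P (weierstrass_act gl v) = val gl.2 ^+ a *: frm (2 * e) (P v) (mx_row (val gl.1) ord0) (mx_row (val gl.1) ord_max)) ->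
    (forall v, size (P v) <= (2 * e).+1)%N -> aclp U L0 (fun t => P (v t)).
  move=> e0 KP Pact sP.
  have ah : aclp U L0 (fun t => frm (2 * e) (P (v t)) (g t).1 (g t).2).
    move=> i; have [ie|ie] := leqP i (2 * e); last first.
      by apply: (acl_ae UU) (acl_cst UU L0 0); apply: filterE => t /=; rewrite nth_default ?(leq_trans (size_frm _ _ _ _)).
    have e30 : (0 < 3 * e)%N by rewrite muln_gt0.
    have aF := aphi _ _ _ e30 (equivariant_frame_coef N2 e1 e1' e2 e2' e3 e3' KP Pact ie).
    apply: (acl_ae UU) (aclM UU aF (aclV UU (aclX UU e am))); apply: filterS mU => t mt /=.
    by rewrite (gP t mt).2 mulrAC mulfV ?mul1r// expf_neq0.
  have neg h : acl U L0 h -> acl U L0 (fun t => - h t).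
    by move=> ah'; apply: (acl_ae UU) (aclM UU (acl_cst UU L0 (-1)) ah'); apply: filterE => t /=; rewrite mulN1r.
  move=> i; have := @aclp_frm _ _ _ UU _ L0 (2 * e) _ (fun t => ((g t).2.2, - (g t).1.2)) (fun t => (- (g t).2.1, (g t).1.1)) ah b4 (neg _ b2) (neg _ b3) b1 i.
  by apply: (acl_ae UU); apply: filterS mU => t mt /=; rewrite frm_inv ?sP ?(gP t mt).1.
have E4 : (4 * N = 2 * (2 * N))%N by lia.
have E6 : (6 * N = 2 * (3 * N))%N by lia.
have aA : aclp U L0 (fun t => pA (v t)).
  apply: (coords (2 * N)%N 4%N).
  - by lia.
  - exact: polynomial_pA.
  - by move=> gl u; rewrite -E4 pA_act.
  - by move=> u; rewrite -E4 size_pA.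
have aB : aclp U L0 (fun t => pB (v t)).
  apply: (coords (3 * N)%N 6%N).
  - by lia.
  - exact: polynomial_pB.
  - by move=> gl u; rewrite -E6 pB_act.
  - by move=> u; rewrite -E6 size_pB.
apply: (acl_dependent UU (L0 := L0) (Y := fun (j : 'I_20) (t : 'I_20 -> k) => t j)) ind => [|j]; first by lia.
have : acl U L0 (fun t => slot j (v t)).
  rewrite /slot; case: (j < 4)%N; first exact: aA.
  case: (j < 8)%N; first exact: aA.
  by case: (j < 14)%N; exact: aB.
by apply: (acl_ae UU); apply: filterS slotU => t /= ->.
Qed.

End Generic.

(** * Affine charts *)

Section FunctionRings.
Context (k : closedFieldType) (Y : Type).

Definition ppoly m (b : 'I_m -> Y -> k) (g : Y -> k) := exists p : {mpoly k[m]}, forall y, g y = p.@[fun j => b j y].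

Lemma ppoly_meval m (b : 'I_m -> Y -> k) n (F : 'I_n -> Y -> k) (p : {mpoly k[n]}) :
  (forall l, ppoly b (F l)) -> ppoly b (fun y => p.@[fun l => F l y]).
Proof.
move=> /choice[q qE]; exists (p \mPo [tuple q l | l < n]) => y; rewrite comp_mpoly_meval.
by congr (_.@[_]); apply/funext => l; rewrite tnth_mktuple.
Qed.

Lemma ppoly_cst m (b : 'I_m -> Y -> k) c : ppoly b (fun=> c).
Proof. by exists c%:MP => y; rewrite mevalC. Qed.

Lemma ppoly_var m (b : 'I_m -> Y -> k) j : ppoly b (b j).
Proof. by exists 'X_j => y; rewrite mevalXU. Qed.

Lemma ppolyD m (b : 'I_m -> Y -> k) f g : ppoly b f -> ppoly b g -> ppoly b (fun y => f y + g y).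
Proof. by move=> [p pE] [q qE]; exists (p + q) => y; rewrite mevalD pE qE. Qed.

Lemma ppolyM m (b : 'I_m -> Y -> k) f g : ppoly b f -> ppoly b g -> ppoly b (fun y => f y * g y).
Proof. by move=> [p pE] [q qE]; exists (p * q) => y; rewrite mevalM pE qE. Qed.

Lemma ppolyX m (b : 'I_m -> Y -> k) f e : ppoly b f -> ppoly b (fun y => f y ^+ e).
Proof. by move=> [p pE]; exists (p ^+ e) => y; rewrite rmorphXn /= pE. Qed.

Context (R : (Y -> k) -> Prop) (m m0 M : nat) (b : 'I_m -> Y -> k) (D0 : (0 < m0 * M)%N).
Local Notation D := (m0 * M)%N.
Hypothesis R_sub : forall g, R g -> ppoly b g.
Context (c : 'I_m -> 'I_M -> Y -> k).
Hypothesis R_c : forall j i, R (c j i).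
Hypothesis cE : forall j y, b j y ^+ D = \sum_(i < M) c j i y * b j y ^+ (m0 * i).

Local Notation vars := (('I_m * 'I_M) + {ffun 'I_m -> 'I_D})%type.
Local Notation n := #|{: vars}|.
Let var (z : vars) : {mpoly k[n]} := 'X_(enum_rank z).
Let point (x : 'I_m * 'I_M -> k) (eta : {ffun 'I_m -> 'I_D} -> k) (l : 'I_n) :=
  match enum_val l with inl ji => x ji | inr mu => eta mu end.
Let ev (P : {mpoly k[n]}) x eta := P.@[point x eta].
Let lin (P : {mpoly k[n]}) := forall x a eta eta', ev P x (fun mu => a * eta mu + eta' mu) = a * ev P x eta + ev P x eta'.
Let cy y (ji : 'I_m * 'I_M) := c ji.1 ji.2 y.
Let mon y (mu : {ffun 'I_m -> 'I_D}) := \prod_j b j y ^+ mu j.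
(** The module over [k[c]] spanned by the monomials in [b] with exponents below [D]. An element is
    represented by a polynomial that is linear in the variables standing for these monomials. *)
Let module g := exists P, lin P /\ forall y, g y = ev P (cy y) (mon y).

Let ev_inl ji x eta : ev (var (inl ji)) x eta = x ji.
Proof. by rewrite /ev mevalXU /point enum_rankK. Qed.
Let ev_inr mu x eta : ev (var (inr mu)) x eta = eta mu.
Proof. by rewrite /ev mevalXU /point enum_rankK. Qed.

Let lin0 P x : lin P -> ev P x (fun=> 0) = 0.
Proof.
move=> lP; apply: (addrI (ev P x (fun=> 0))); rewrite addr0 -{1}[ev P x (fun=> 0)]mul1r -lP; congr ev.
by apply/funext => mu; rewrite mulr0 addr0.
Qed.

Let linZ P x a eta : lin P -> ev P x (fun mu => a * eta mu) = a * ev P x eta.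
Proof.
move=> lP; rewrite -[RHS]addr0 -(lin0 x lP) -lP; congr ev; apply/funext => mu.
by rewrite addr0.
Qed.

Let upd (mu : {ffun 'I_m -> 'I_D}) j d : {ffun 'I_m -> 'I_D} := [ffun l => if l == j then d else mu l].
Lemma low_subproof (i : 'I_M) : (m0 * i < D)%N.
Proof. by move: D0; rewrite muln_gt0 => /andP[m00 _]; rewrite ltn_pmul2l. Qed.
Let low (i : 'I_M) : 'I_D := Ordinal (low_subproof i).

(** Multiplication of a monomial by [b j]: the exponent grows by one, or, on reaching [D], the power
    is replaced by means of the integral equation. *)
Let shift j (mu : {ffun 'I_m -> 'I_D}) : {mpoly k[n]} := if insub (mu j).+1 is Some d then var (inr (upd mu j d))
  else \sum_i var (inl (j, i)) * var (inr (upd mu j (low i))).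

Let shift_lin j (mu : {ffun 'I_m -> 'I_D}) : lin (shift j mu).
Proof.
move=> x a eta eta'; rewrite /shift; case: insub => [d|]; first by rewrite !ev_inr.
have E e : ev (\sum_i var (inl (j, i)) * var (inr (upd mu j (low i)))) x e = \sum_i x (j, i) * e (upd mu j (low i)).
  by rewrite /ev raddf_sum /=; apply: eq_bigr => i _; rewrite mevalM -!/(ev _ _ _) ev_inl ev_inr.
by rewrite !E mulr_sumr -big_split; apply: eq_bigr => i _ /=; ring.
Qed.

Let shiftE j (mu : {ffun 'I_m -> 'I_D}) y : ev (shift j mu) (cy y) (mon y) = b j y * mon y mu.
Proof.
have updE d : mon y (upd mu j d) = b j y ^+ d * \prod_(l | l != j) b l y ^+ mu l.
  rewrite /mon (bigD1 j)//= ffunE eqxx; congr (_ * _); apply: eq_bigr => l /negPf lj.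
  by rewrite ffunE lj.
have -> : mon y mu = b j y ^+ mu j * \prod_(l | l != j) b l y ^+ mu l by rewrite /mon (bigD1 j).
rewrite /shift; case: insubP => [d _ dE|]; first by rewrite ev_inr updE dE exprS mulrA.
rewrite -leqNgt => le; have E1 : (mu j).+1 = D by apply/eqP; rewrite eqn_leq le ltn_ord.
rewrite mulrA -exprS E1 cE mulr_suml /ev raddf_sum /=; apply: eq_bigr => i _.
by rewrite mevalM -!/(ev _ _ _) ev_inl ev_inr updE mulrA.
Qed.

Let module_mul j g : module g -> module (fun y => b j y * g y).
Proof.
move=> [P [lP gE]].
pose P' := P \mPo [tuple if enum_val l is inr mu then shift j mu else 'X_l | l < n].
have P'E x eta : ev P' x eta = ev P x (fun mu => ev (shift j mu) x eta).
  rewrite /ev /P' comp_mpoly_meval; congr (_.@[_]); apply/funext => l; rewrite tnth_mktuple.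
  by rewrite [in RHS]/point; case E: (enum_val l) => [ji|mu] //; rewrite mevalXU /point E.
exists P'; split=> [x a eta eta'|y].
  by rewrite !P'E -lP; congr ev; apply/funext => mu; apply: shift_lin.
rewrite P'E gE -(linZ _ _ _ lP); congr ev; apply/funext => mu; exact/esym/shiftE.
Qed.

Let module_add f g : module f -> module g -> module (fun y => f y + g y).
Proof.
move=> [P [lP fE]] [Q [lQ gE]]; exists (P + Q); split=> [x a eta eta'|y]; last by rewrite /ev mevalD fE gE.
have E z e : ev (P + Q) z e = ev P z e + ev Q z e by rewrite /ev mevalD.
by rewrite !E lP lQ; ring.
Qed.

Let module_scale a g : module g -> module (fun y => a * g y).
Proof.
move=> [P [lP gE]]; have E z e : ev (a *: P) z e = a * ev P z e by rewrite /ev mevalZ.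
by exists (a *: P); split=> [x a' eta eta'|y]; rewrite !E ?lP ?gE//; ring.
Qed.

Let module1 : module (fun=> 1).
Proof.
exists (var (inr [ffun=> Ordinal D0])); split=> [x a eta eta'|y]; first by rewrite !ev_inr.
by rewrite ev_inr /mon big1// => j _; rewrite ffunE expr0.
Qed.

Let module_ppoly g : ppoly b g -> module g.
Proof.
move=> [p pE]; rewrite (_ : g = fun y => \sum_(mm <- msupp p) p@_mm * \prod_i b i y ^+ mm i); last first.
  by apply/funext => y; rewrite pE mevalE.
have mpow j e h : module h -> module (fun y => b j y ^+ e * h y).
  move=> mh; elim: e => [|e IH]; first by rewrite (_ : (fun y => _) = h)//; apply/funext => y; rewrite mul1r.
  rewrite (_ : (fun y => _) = fun y => b j y * (b j y ^+ e * h y)); first exact: module_mul.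
  by apply/funext => y; rewrite exprS mulrA.
have mprod (s : seq 'I_m) (e : 'I_m -> nat) : module (fun y => \prod_(i <- s) b i y ^+ e i).
  elim: s => [|j s IH]; first by rewrite (_ : (fun y => _) = fun=> 1)//; apply/funext => y; rewrite big_nil.
  rewrite (_ : (fun y => _) = fun y => b j y ^+ e j * \prod_(i <- s) b i y ^+ e i); first exact: mpow.
  by apply/funext => y; rewrite big_cons.
elim: (msupp p) => [|mm s IH].
  rewrite (_ : (fun y => _) = fun y => 0 * 1); first exact: module_scale.
  by apply/funext => y; rewrite big_nil mul0r.
rewrite (_ : (fun y => _) = fun y => p@_mm * (\prod_i b i y ^+ mm i) + \sum_(mm <- s) p@_mm * \prod_i b i y ^+ mm i).
  by apply: module_add => //; apply: module_scale.
by apply/funext => y; rewrite big_cons.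
Qed.

(* Artin-Tate: R is a k[c]-submodule of the finite k[c]-module spanned by the *)
(* monomials in b; a finite generating set is read off a finite basis of the *)
(* ideal of the forms linear in the module variables whose value lies in R.  *)
Theorem finite_generation : exists s (u : 'I_s -> Y -> k), (forall i, R (u i)) /\ forall g, R g -> ppoly u g.
Proof.
have [s sJ sP] := hilbert_basis (fun P => lin P /\ R (fun y => ev P (cy y) (mon y))).
pose gens := (('I_m * 'I_M) + 'I_(size s))%type.
pose u (l : 'I_#|{: gens}|) y := match enum_val l with inl ji => c ji.1 ji.2 y | inr i => ev s`_i (cy y) (mon y) end.
exists #|{: gens}|, u; split=> [l|g Rg].
  rewrite /u; case: (enum_val l) => [ji|i]; first exact: R_c.
  by have [|_] := sJ s`_i; first exact: mem_nth.
have uc j i : ppoly u (fun y => c j i y).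
  have := ppoly_var u (enum_rank (inl (j, i) : gens)); congr ppoly; apply/funext => y.
  by rewrite /u enum_rankK.
have us q : q \in s -> ppoly u (fun y => ev q (cy y) (mon y)).
  move=> qs; have iq : (index q s < size s)%N by rewrite index_mem.
  have := ppoly_var u (enum_rank (inr (Ordinal iq) : gens)); congr ppoly; apply/funext => y.
  by rewrite /u enum_rankK /= nth_index.
have [P [lP gE]] := module_ppoly (R_sub Rg).
have [|l lJ PE] := sP P; first by split=> //; rewrite (_ : (fun y => _) = g)//; apply/funext => y; rewrite gE.
have ls h q : (h, q) \in l -> lin q by move=> /lJ/sJ[].
(* Linearity in [eta] is extracted from a combination with arbitrary coefficients: substitute
   [t * eta], divide by [t], and set [t = 0], which leaves coefficients in [x] alone. *)
have key x eta : ev P x eta = \sum_(z <- l) ev z.1 x (fun=> 0) * ev z.2 x eta.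
  pose K (f : k -> k) := exists p : {poly k}, forall t, f t = p.[t].
  have Kc z : K (fun=> z) by exists z%:P => t; rewrite hornerC.
  have Ka f f' : K f -> K f' -> K (fun t => f t + f' t) by move=> [p E] [p' E']; exists (p + p') => t; rewrite hornerD E E'.
  have Km f f' : K f -> K f' -> K (fun t => f t * f' t) by move=> [p E] [p' E']; exists (p * p') => t; rewrite hornerM E E'.
  have Kx (f : k -> k) e : K f -> K (fun t => f t ^+ e) by move=> [p E]; exists (p ^+ e) => t; rewrite horner_exp E.
  have Kt : K id by exists 'X => t; rewrite hornerX.
  have Kev h : K (fun t => ev h x (fun mu => t * eta mu)).
    rewrite /ev; under [fun t => _]funext do rewrite mevalE.
    apply: (K_sum Kc Ka) => mm; apply: (Km) => //; apply: (K_prod Kc Km) => i; apply: (Kx).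
    by rewrite /point; case: (enum_val i) => [ji|mu] //; apply: (Km).
  have [p pE] : K (fun t => \sum_(z <- l) ev z.1 x (fun mu => t * eta mu) * ev z.2 x eta).
    by apply: (K_sum Kc Ka) => z; apply: (Km).
  have p0 : 'X * (p - (ev P x eta)%:P) = 0.
    apply: poly_eq0_forall => t; rewrite hornerM hornerX hornerD hornerN hornerC -pE.
    have evS e : ev P x e = \sum_(z <- l) ev z.1 x e * ev z.2 x e.
      by rewrite /ev PE raddf_sum /=; apply: eq_bigr => z _; rewrite mevalM.
    apply/eqP; rewrite mulrBr subr_eq0 -(linZ x t eta lP) evS mulr_sumr; apply/eqP.
    rewrite !big_seq; apply: eq_bigr => -[h q] hq; rewrite /= (linZ x t eta (ls _ _ hq)).
    by rewrite mulrCA.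
  move/eqP: p0; rewrite mulf_eq0 polyX_eq0 /= subr_eq0 => /eqP p0.
  have := pE 0; rewrite p0 hornerC => <-; apply: eq_bigr => z _; congr (ev _ _ _ * _); apply/funext => mu.
  by rewrite mul0r.
rewrite (_ : g = fun y => \sum_(z <- l) ev z.1 (cy y) (fun=> 0) * ev z.2 (cy y) (mon y)); last first.
  by apply/funext => y; rewrite gE key.
elim: l lJ {PE ls key} => [|z l IH] lJ.
  rewrite (_ : (fun y => _) = fun=> 0); first exact: ppoly_cst.
  by apply/funext => y; rewrite big_nil.
rewrite (_ : (fun y => _) = fun y => ev z.1 (cy y) (fun=> 0) * ev z.2 (cy y) (mon y) + \sum_(z <- l) ev z.1 (cy y) (fun=> 0) * ev z.2 (cy y) (mon y)).
  apply: ppolyD; last by apply: IH => z' z'l; apply: lJ; rewrite inE z'l orbT.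
  apply: ppolyM; last by apply: us; apply: lJ; rewrite mem_head.
  rewrite /ev; apply: (ppoly_meval (F := fun l y => point (cy y) (fun=> 0) l)) => i.
  by rewrite /point; case: (enum_val i) => [ji|mu]; [exact: uc|exact: ppoly_cst].
by apply/funext => y; rewrite big_cons.
Qed.

End FunctionRings.

(** * Finite generation of the rings of the charts *)

Section ChartRing.
Context (k : closedFieldType) (N : nat) (N2 : (2 <= N)%N).
Local Notation pt := (k * k)%type.
Local Notation W := (weierstrass_data k N).
Local Notation h := (12 * N + 2)%N.
Local Notation p := (6 * N * h)%N.
Local Notation n := (p + p)%N.
Local Notation "''Sn'" := {perm 'I_(p + p)}.
Local Notation semi_inv := (semi_invariant (@weierstrass_act k N) (@weierstrass_char k)).
Context (ss : 'I_h -> k) (s1 s2 s3 : 'Sn) (i1 i2 i3 : 'I_p) (x y z : 'I_n).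
Hypotheses (s1x : s1 (lshift p i1) = x) (s1y : s1 (rshift p i1) = y).
Hypotheses (s2y : s2 (lshift p i2) = y) (s2z : s2 (rshift p i2) = z).
Hypotheses (s3x : s3 (lshift p i3) = x) (s3z : s3 (rshift p i3) = z).
Local Notation mm := (fun _ r => @mat3 k N s1 s2 s3 r).
Context (j0 : nat) (j00 : (0 < j0)%N) (f : W -> k).
Local Notation m0 := (j0 * (12 * h * 3 + 0))%N.
Hypotheses (sf : semi_inv m0 f) (fE : forall v r, prodlin r = pencil_form ss v -> f v = esum mm j0 v r).
Local Notation M := #|{: 'Sn}|.

(** The cover of the locus f = 1 by labelled roots. Functions of labels are functions on it, and [R]
    is the subring of invariants whose weight is a multiple of that of [f]. *)
Let Y := {u : W * ('I_n -> pt) | prodlin u.2 = pencil_form ss u.1 /\ f u.1 = 1}.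
Let yv (u : Y) : W := (sval u).1.
Let yr (u : Y) := (sval u).2.
Let R (g : Y -> k) := exists l Phi, semi_inv (m0 * l) Phi /\ forall u, g u = Phi (yv u).

Local Notation kinds := (option ('I_(4 * N).+1 + 'I_(6 * N).+1)).
Let phi (ka : kinds) : W -> ('I_n -> pt) -> k := match ka with
  | None => mm
  | Some (inl i) => frame_coef s1 s2 s3 i1 i2 i3 x y z (2 * N) (@pA k N) i
  | Some (inr i) => frame_coef s1 s2 s3 i1 i2 i3 x y z (3 * N) (@pB k N) i end.

Let E4 : (2 * (2 * N) = 4 * N)%N. Proof. by rewrite mulnA. Qed.
Let E6 : (2 * (3 * N) = 6 * N)%N. Proof. by rewrite mulnA. Qed.
Let fy1 u : f (yv u) = 1. Proof. by case: (svalP u). Qed.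

Let phi_equiv ka : exists D a, (0 < D)%N /\ equivariant D a (phi ka).
Proof.
case: ka => [[i|i]|]; last by exists 3%N, 0%N; split=> //; exact: equivariant_mat3.
  exists (3 * (2 * N))%N, 4%N; split; first by rewrite !muln_gt0 (ltnW N2).
  apply: (equivariant_frame_coef N2 s1x s1y s2y s2z s3x s3z); last by rewrite E4 -ltnS.
    exact: polynomial_pA.
  by move=> gl v; rewrite E4 pA_act.
exists (3 * (3 * N))%N, 6%N; split; first by rewrite !muln_gt0 (ltnW N2).
apply: (equivariant_frame_coef N2 s1x s1y s2y s2z s3x s3z); last by rewrite E6 -ltnS.
  exact: polynomial_pB.
by move=> gl v; rewrite E6 pB_act.
Qed.

Local Notation gens := ('Sn * kinds)%type.
Let b (j : 'I_#|{: gens}|) (u : Y) := phi (enum_val j).2 (yv u) (fun l => yr u ((enum_val j).1 l)).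
Let bgen (t : 'Sn) ka : ppoly b (fun u => phi ka (yv u) (fun l => yr u (t l))).
Proof.
have := ppoly_var b (enum_rank ((t, ka) : gens)); congr ppoly; apply/funext => u.
by rewrite /b enum_rankK.
Qed.

Let m00 : (0 < m0)%N. Proof. by rewrite !muln_gt0 j00 !addn_gt0 !muln_gt0 /= addn2. Qed.

(** The [m0]-th powers of the generators are used so that the coefficients of their equations have
    weights divisible by [m0] and belong to [R]. *)
Let integral : exists c : 'I_#|{: gens}| -> 'I_M -> Y -> k, (forall j i, R (c j i)) /\
  forall j u, b j u ^+ (m0 * M) = \sum_(i < M) c j i u * b j u ^+ (m0 * i).
Proof.
have H (j : 'I_#|{: gens}|) : exists c : 'I_M -> Y -> k, (forall i, R (c i)) /\
    forall u, b j u ^+ (m0 * M) = \sum_(i < M) c i u * b j u ^+ (m0 * i).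
  have [D [a [D0 ephi]]] := phi_equiv (enum_val j).2; set ph := phi (enum_val j).2 in ephi *.
  have eq_pow := equivariantX m0 ephi; have D0' : (0 < m0 * D)%N by rewrite muln_gt0 m00.
  have /choice[Ps PsP] := fun i => exists_esum N2 ss i D0' eq_pow.
  exists (fun i u => - (-1) ^+ (M - i) * Ps (M - i)%N (yv u)); split=> [i|u].
    exists ((M - i) * (12 * h * D + a))%N, (fun v => - (-1) ^+ (M - i) * Ps (M - i)%N v); split=> //.
    apply: semi_inv_cst_mul; apply: semi_inv_weight (PsP (M - i)%N).1; lia.
  have := esum_root (fun v r => ph v r ^+ m0) (enum_val j).1 (yv u) (yr u).
  rewrite (reindex_inj rev_ord_inj) big_ord_recr /= subSS subnn expr0 mul1r esum0 mul1r subn0 -exprM => /eqP.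
  rewrite addrC addr_eq0 -sumrN => /eqP E; rewrite -[LHS]/(ph _ _ ^+ _) E; apply: eq_bigr => i _.
  have iM : (i <= M)%N := ltnW (ltn_ord i).
  have PE := proj2 (PsP (M - i)%N) (yv u) (yr u); rewrite subSS subKn// PE; last by case: (svalP u).
  by rewrite -exprM mulNr mulNr.
by have /choice[c cP] := H; exists c; split=> [j i|j u]; [case: (cP j)|case: (cP j)].
Qed.

(* Multiplied by a power of mat3, an invariant is a polynomial in the frame  *)
(* coefficients; these powers generate the unit ideal where f = 1.           *)
Let R_sub g : R g -> ppoly b g.
Proof.
move=> [l [Phi [[pPhi aPhi] gE]]].
pose mt (t : 'Sn) u := @mat3 k N s1 s2 s3 (fun l' => yr u (t l')).
have mtP (t : 'Sn) : ppoly b (mt t) by apply: (bgen t None).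
have local (t : 'Sn) : exists E, ppoly b (fun u => mt t u ^+ E * g u).
  have /choice[w wE] (u : Y) : exists w : W, mt t u != 0 -> Phi w = g u /\ forall i : 'I_(4 * N).+1 + 'I_(6 * N).+1,
      phi (Some i) (yv u) (fun l' => yr u (t l')) =
        match i with inl i => mt t u ^+ (2 * N) * (pA w)`_i | inr i => mt t u ^+ (3 * N) * (pB w)`_i end.
    have [m00'|m00'] := eqVneq (mt t u) 0; first by exists 0.
    have [g1 [g2 [g12 gC]]] := frame_recover s1x s1y s2y s2z s3x s3z m00'.
    have [gl [gl1 gl2 gl3]] := exists_gl g12 (oner_neq0 k).
    exists (weierstrass_act gl (yv u)) => _; split.
      by rewrite aPhi /weierstrass_char gl3 expr1n mul1r gE.
    by case=> i; rewrite ?pA_act ?pB_act gl1 gl2 gl3 expr1n scale1r /= gC ?E4 ?E6.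
  pose Q (h : Y -> k) := exists E q, ppoly b q /\ forall u, mt t u != 0 -> mt t u ^+ E * h u = q u.
  have [E [q [bq qE]]] : Q (fun u => Phi (w u)).
    apply: (polynomial_fun_coef (Q := Q)) pPhi.
    - by move=> c; exists 0%N, (fun=> c); split=> [|u _]; [exact: ppoly_cst|rewrite mul1r].
    - move=> h h' [E [q [bq qE]]] [E' [q' [bq' qE']]]; exists (E + E')%N, (fun u => mt t u ^+ E' * q u + mt t u ^+ E * q' u).
      split=> [|u mu]; first by apply: ppolyD; apply: ppolyM => //; apply: ppolyX.
      by rewrite -qE// -qE'// exprD; ring.
    - move=> h h' [E [q [bq qE]]] [E' [q' [bq' qE']]]; exists (E + E')%N, (fun u => q u * q' u).
      by split=> [|u mu]; [exact: ppolyM|rewrite -qE// -qE'// exprD; ring].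
    - move=> i; have [ii|ii] := ltnP i (4 * N).+1.
        exists (2 * N)%N, (fun u => phi (Some (inl (Ordinal ii))) (yv u) (fun l' => yr u (t l'))); split=> [|u mu].
          exact: bgen.
        by rewrite (proj2 (wE u mu)).
      exists 0%N, (fun=> 0); split=> [|u _]; first exact: ppoly_cst.
      by rewrite nth_default ?mulr0// (leq_trans (size_pA _) ii).
    - move=> i; have [ii|ii] := ltnP i (6 * N).+1.
        exists (3 * N)%N, (fun u => phi (Some (inr (Ordinal ii))) (yv u) (fun l' => yr u (t l'))); split=> [|u mu].
          exact: bgen.
        by rewrite (proj2 (wE u mu)).
      exists 0%N, (fun=> 0); split=> [|u _]; first exact: ppoly_cst.
      by rewrite nth_default ?mulr0// (leq_trans (size_pB _) ii).
  exists E.+1; suff -> : (fun u => mt t u ^+ E.+1 * g u) = (fun u => mt t u * q u) by apply: ppolyM.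
  apply/funext => u; rewrite exprS -mulrA; have [->|mu] := eqVneq (mt t u) 0; first by rewrite !mul0r.
  by rewrite -qE// (proj1 (wE u mu)).
(* The functions with a power that carries [g] into the polynomials in [b]. They are closed under
   sums and multiples and contain every [mt t]; as the function 1 is a sum of products of the [mt t]
   on f = 1, they contain 1. *)
pose rad a := ppoly b a /\ exists E, ppoly b (fun u => a u ^+ E * g u).
have radM a a' : rad a -> ppoly b a' -> rad (fun u => a u * a' u).
  move=> [ba [E bE]] ba'; split; first exact: ppolyM.
  exists E; suff -> : (fun u => (a u * a' u) ^+ E * g u) = (fun u => (a u ^+ E * g u) * a' u ^+ E).
    exact: ppolyM bE (ppolyX E ba').
  by apply/funext => u; rewrite exprMn; ring.
have bsum (J : Type) (s : seq J) (F : J -> Y -> k) : (forall j, ppoly b (F j)) -> ppoly b (fun u => \sum_(j <- s) F j u).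
  move=> bF; elim: s => [|j s IH]; first by under [fun u => _]funext do rewrite big_nil; exact: ppoly_cst.
  by under [fun u => _]funext do rewrite big_cons; exact: ppolyD.
have radD a a' : rad a -> rad a' -> rad (fun u => a u + a' u).
  move=> [ba [E bE]] [ba' [E' bE']]; split; first exact: ppolyD.
  exists (E + E')%N; under [fun u => _]funext do rewrite exprDn mulr_suml.
  apply: (bsum) => -[i iE] /=; have [Ei|Ei] := leqP E' i.
    rewrite (_ : (fun u => _) = fun u => a u ^+ (E + E' - i) * a' u ^+ (i - E') * 'C(E + E', i)%:R * (a' u ^+ E' * g u)).
      by apply: ppolyM bE'; apply: ppolyM (ppoly_cst _ _); apply: ppolyM; apply: ppolyX.
    by apply/funext => u; have -> : a' u ^+ i = a' u ^+ (i - E') * a' u ^+ E' by [rewrite -exprD subnK]; rewrite -mulr_natr; ring.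
  have Ei' : (E + E' - i = E' - i + E)%N by rewrite addnC addnBAC// ltnW.
  rewrite (_ : (fun u => _) = fun u => a u ^+ (E' - i) * a' u ^+ i * 'C(E + E', i)%:R * (a u ^+ E * g u)).
    by apply: ppolyM bE; apply: ppolyM (ppoly_cst _ _); apply: ppolyM; apply: ppolyX.
  by apply/funext => u; rewrite -mulr_natr Ei' exprD; ring.
have [_ [E]] : rad (fun=> 1).
  have -> : (fun=> 1) = (fun u : Y => \sum_(J <- index_enum {set 'Sn}) (if #|J| == j0 then \prod_(t in J) mt t u else 0)).
    apply/funext => u; transitivity (f (yv u)); first by rewrite fy1.
    rewrite (fE (r := yr u)); last by case: (svalP u).
    by rewrite /esum big_mkcond.
  elim: (index_enum _) => [|J s IH].
    under [fun u => _]funext do rewrite big_nil.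
    split; first exact: ppoly_cst.
    by exists 1%N; under [fun u => _]funext do rewrite expr1 mul0r; exact: ppoly_cst.
  under [fun u => _]funext do rewrite big_cons.
  apply: (radD) IH; have [Jj|_] := boolP (#|J| == j0); last first.
    split; first exact: ppoly_cst.
    by exists 1%N; under [fun u => _]funext do rewrite expr1 mul0r; exact: ppoly_cst.
  have /card_gt0P[t tJ] : (0 < #|J|)%N by rewrite (eqP Jj).
  under [fun u => _]funext do rewrite (bigD1 t)//=.
  apply: (radM); first by split=> //; exact: local.
  elim: (index_enum _) => [|t' s' IH'].
    by under [fun u => _]funext do rewrite big_nil; exact: ppoly_cst.
  under [fun u => _]funext do rewrite big_cons.
  by case: (_ && _) => //; exact: ppolyM.
by under [fun u => _]funext do rewrite expr1n mul1r.
Qed.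

Theorem chart_generators : exists s (Ps : 'I_s -> W -> k) (ls : 'I_s -> nat), (forall i, semi_inv (m0 * ls i) (Ps i)) /\
  forall l Phi, semi_inv (m0 * l) Phi -> exists q : {mpoly k[s]}, forall v, f v = 1 -> Phi v = q.@[fun i => Ps i v].
Proof.
have [c [cR cE]] := integral; have D0 : (0 < m0 * M)%N.
  by rewrite muln_gt0 m00; apply/card_gt0P; exists 1%g.
have [s [u [uR gen]]] := finite_generation D0 R_sub cR cE.
have /choice[Pl PlP] : forall i, exists Pl : nat * (W -> k), semi_inv (m0 * Pl.1) Pl.2 /\ forall w, u i w = Pl.2 (yv w).
  by move=> i; have [l [Phi H]] := uR i; exists (l, Phi).
exists s, (fun i => (Pl i).2), (fun i => (Pl i).1); split=> [i|l Phi sP]; first by case: (PlP i).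
have [|q qE] := gen (fun w => Phi (yv w)); first by exists l, Phi.
exists q => v fv; have [r rE] := exists_labels N2 ss v.
have := qE (exist _ (v, r) (conj rE fv)); rewrite /yv /= => ->; congr (_.@[_]); apply/funext => i.
by rewrite (PlP i).2.
Qed.

End ChartRing.

Lemma continuous_of_closed (S T : topologicalType) (phi : S -> T) :
  (forall (C : set T) s, closed C -> ~ C (phi s) -> \forall s' \near s, ~ C (phi s')) -> continuous phi.
Proof.
move=> H s O; rewrite nbhsE => -[O' [oO' O's] O'O].
have := H (~` O') s (open_closedC oO') (fun nO => nO O's); apply: filterS => s' nn.
by apply: O'O; apply: contrapT.
Qed.

Section RegularPolynomials.
Context (k : closedFieldType) (X : funSpaceType k).

Lemma regular_meval n (F : 'I_n -> X -> k) (x : X) (q : {mpoly k[n]}) : (forall i, regular_at x (F i)) ->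
  regular_at x (fun y => q.@[fun i => F i y]).
Proof.
move=> rF; have E : (fun y => \sum_(m <- msupp q) q@_m * \prod_i F i y ^+ m i) = (fun y => q.@[fun i => F i y]).
  by apply/funext => y; rewrite mevalE.
rewrite -E; apply: (K_sum (K := regular_at x)) => [c|f g|m]; [exact: regular_at_cst|exact: regular_at_add|].
apply: regular_at_mul; first exact: regular_at_cst.
apply: (K_prod (K := regular_at x)) => [c|f g|i]; [exact: regular_at_cst|exact: regular_at_mul|].
elim: (m i) => [|e IH].
  by rewrite (_ : (fun y => _) = fun=> 1); [exact: regular_at_cst|apply/funext => y; rewrite expr0].
rewrite (_ : (fun y => _) = fun y => F i y * F i y ^+ e); first exact: regular_at_mul.
by apply/funext => y; rewrite exprS.
Qed.

End RegularPolynomials.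

(** * Affine charts and separatedness of the image *)

Section Charts.
Context (k : closedFieldType) (N : nat) (N2 : (2 <= N)%N).
Local Notation W := (weierstrass_data k N).
Local Notation E := (E_ k N).
Local Notation gequiv := (git_equiv (@weierstrass_act k N) (@weierstrass_char k)).
Local Notation semi_inv := (semi_invariant (@weierstrass_act k N) (@weierstrass_char k)).
Context (fam : W -> Prop).
Hypothesis fam_T : forall v, fam v -> T_ v.
Hypothesis fam_lim : forall (I : Type) (P : place k I) (v : I -> W), (forall t, fam (v t)) ->
  exists (th : I -> k) w, [/\ forall t, th t != 0, fam w &
    forall n f, semi_inv n f -> tends P (fun t => th t ^+ n * f (v t)) (f w)].
Context (A : W -> Prop) (iA : irr_family fam A).
Local Notation Z := (classes A).
Local Notation X := (set_type Z : funSpaceType k).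

Section Chart.
Context (m0 : nat) (m00 : (0 < m0)%N) (f : W -> k) (sf : semi_inv m0 f) (s : nat) (Ps : 'I_s -> W -> k) (ls : 'I_s -> nat).
Hypothesis sPs : forall i, semi_inv (m0 * ls i) (Ps i).
Hypothesis gen : forall l Phi, semi_inv (m0 * l) Phi -> exists q : {mpoly k[s]}, forall v, f v = 1 -> Phi v = q.@[fun i => Ps i v].

Definition chart : set X := [set x : X | f (zrep x) != 0].
Local Notation U := (set_type chart : funSpaceType k).
Local Notation V := 'rV[k]_s.
Let urep (x : U) : W := zrep (set_val x).
Let rho (i : 'I_s) (x : U) : k := Ps i (urep x) / f (urep x) ^+ ls i.

Let fU (x : U) : f (urep x) != 0.
Proof. exact: (set_valP x). Qed.

Lemma chart_open : open chart.
Proof. by rewrite openE => x fx; apply: filterS (zrep_near sf fx) => y. Qed.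

Let sf_exp l : semi_inv (m0 * l) (fun v => f v ^+ l) := semi_inv_exp l sf.

(* Invariants of weight divisible by that of f are polynomials in the        *)
(* coordinates on the chart.                                                 *)
Let chart_poly l Phi : semi_inv (m0 * l) Phi -> exists q : {mpoly k[s]}, forall x, Phi (urep x) / f (urep x) ^+ l = q.@[fun i => rho i x].
Proof.
move=> sP; have [q qE] := gen sP; exists q => x.
(* Scaling by an [m0]-th root moves the representative to f = 1, where the generators apply. *)
have [la laE] : exists la, la ^+ m0 = (f (urep x))^-1.
  have [la] := solve_monicpoly (fun i => if i == 0%N then (f (urep x))^-1 else 0) m00.
  move: m00; case: (m0) => // m' _; rewrite big_ord_recl big1 => [|i _]; last by rewrite mul0r.
  by rewrite /= expr0 mulr1 addr0 => lE; exists la.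
have la0 : la != 0 by apply: contraTneq (fU x) => la0; rewrite -invr_eq0 -laE la0 expr0n (gtn_eqF m00) eqxx.
have [gl [_ _ gl3]] := @exists_gl k (1, 0) (0, 1) la (etrans (congr2 (fun a b => a - b) (mul1r 1) (mulr0 0)) (subr0 1)) la0.
have scale l' Phi' : semi_inv (m0 * l') Phi' -> Phi' (weierstrass_act gl (urep x)) = Phi' (urep x) / f (urep x) ^+ l'.
  by move=> [_ ->]; rewrite /weierstrass_char gl3 exprM laE exprVn mulrC.
have f1 : f (weierstrass_act gl (urep x)) = 1.
  by rewrite sf.2 /weierstrass_char gl3 laE mulVf.
rewrite -scale// qE//; congr (_.@[_]); apply/funext => i; exact: scale.
Qed.

Definition chart_image : set (affine_space V) := [set u | forall q : {mpoly k[s]}, (forall x : U, q.@[fun i => rho i x] = 0) -> q.@[fun i => (u : V) 0 i] = 0].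

Lemma chart_image_closed : closed chart_image.
Proof.
rewrite -openC; change (zariski_open (~` chart_image)) => u /existsNP[q /not_implyP[qU /eqP qu]].
by exists (fun v : V => q.@[fun i => v 0 i]); split=> // [|v qv]; [exact: polynomial_meval|move=> /(_ q qU)/eqP; rewrite (negPf qv)].
Qed.

Let coords (x : U) : V := \row_i rho i x.
Let coordsE (x : U) (q : {mpoly k[s]}) : q.@[fun i => coords x 0 i] = q.@[fun i => rho i x].
Proof. by congr (_.@[_]); apply/funext => i; rewrite mxE. Qed.

Let coords_image x : chart_image (coords x).
Proof. by move=> q qU; rewrite coordsE. Qed.

(** A point of the closure is a specialization of the coordinates, so the representatives have a
    limit [w] along a suitable place. If [f] vanished at [w], so would every invariant of positive
    weight, against semistability; hence [w] defines a point of the chart above [u]. *)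
Let image_coords u : chart_image u -> exists x, coords x = u.
Proof.
move=> Cu; have [|||Uf [UU UB]] := @ultra_of_fip U [set B | exists2 q : {mpoly k[s]}, q.@[fun i => (u : V) 0 i] != 0 & B = [set x | q.@[fun i => rho i x] != 0]].
- move=> _ _ [q q0 ->] [q' q'0 ->]; exists [set x | (q * q').@[fun i => rho i x] != 0].
    by exists (q * q') => //; rewrite mevalM mulf_neq0.
  by move=> x /=; rewrite mevalM mulf_eq0 negb_or => /andP[].
- by exists [set x | (1 : {mpoly k[s]}).@[fun i => rho i x] != 0], 1 => //; rewrite meval1 oner_neq0.
- move=> _ [q q0 ->]; apply: contrapT => /forallNP H; case/eqP: q0; apply: Cu => x.
  by apply/eqP/negPn/negP/H.
have [q qU|P [aP tP]] := exists_place_vals UU (x := rho) (c := fun i => (u : V) 0 i).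
  apply/eqP/negPn/negP => q0.
  by have [x [/negP H /eqP E0]] := filter_ex (filterI (UB _ (ex_intro2 _ _ q q0 erefl)) qU).
have /choice[v vP] : forall x : U, exists v, A v /\ gequiv v (urep x).
  by move=> x; have /(classesP N2 fam_T fam_lim _ iA)[w Aw we] := set_valP (set_val x); exists w.
have [th [w [th0 Aw tw]]] := irr_family_lim fam_lim P iA (fun x => (vP x).1).
have Tw := fam_T (irr_family_fam iA Aw).
have ratio l Phi x : semi_inv (m0 * l) Phi -> Phi (urep x) / f (urep x) ^+ l = Phi (v x) / f (v x) ^+ l /\ f (v x) != 0.
  move=> sP; have fv : f (v x) != 0 by rewrite ((vP x).2 _ _ sf).
  by have [_ ->] := git_equiv_ratio (vP x).2 sP (sf_exp l) (expf_neq0 l fv).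
have trat l Phi q : semi_inv (m0 * l) Phi -> (forall x, Phi (urep x) / f (urep x) ^+ l = q.@[fun i => rho i x]) ->
    Phi w = q.@[fun i => (u : V) 0 i] * f w ^+ l.
  move=> sP qE; apply: tends_uniq (tw _ _ sP) _.
  apply: tends_ext (tendsM (tends_meval q tP) (tw _ _ (sf_exp l))) => x.
  have [E0 fv] := ratio l Phi x sP; rewrite -qE E0 mulrCA divfK// expf_neq0//.
have fw : f w != 0.
  have [n [Phi [n0 sP Pw]]] := T_semistable N2 Tw.
  have sPm : semi_inv (m0 * n) (fun v => Phi v ^+ m0) by apply: semi_inv_weight (semi_inv_exp m0 sP); rewrite mulnC.
  have [q qE] := chart_poly sPm; have := trat _ _ _ sPm qE.
  by move=> E0; apply: contraNneq Pw => fw0; move: E0; rewrite fw0 expr0n (gtn_eqF n0) mulr0 => /eqP; rewrite expf_eq0 m00.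
have [e we] := exists_class N2 Tw; have ce : classes A e by apply/(classesP N2 fam_T fam_lim _ iA); exists w.
pose z : X := exist _ e (mem_set ce); have ze : zrep z = erep e by rewrite /zrep set_valE.
have Uz : chart z by rewrite /chart /= ze -(we _ _ sf).
exists (exist _ z (mem_set Uz)); apply/rowP => i; rewrite mxE /rho.
have -> : urep (exist _ z (mem_set Uz)) = erep e by rewrite /urep set_valE.
have [_ ->] := git_equiv_ratio we (sPs i) (sf_exp (ls i)) (expf_neq0 _ fw).
by rewrite (trat _ _ 'X_i (sPs i)) ?mevalXU ?mulfK ?expf_neq0// => x; rewrite mevalXU.
Qed.

Let coords_inj x x' : coords x = coords x' -> x = x'.
Proof.
move=> cE; apply: val_inj; apply: val_inj; have H : set_val (set_val x) = set_val (set_val x'); last by move: H; rewrite !set_valE.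
apply: erep_inj => n Phi sP; have sPm : semi_inv (m0 * n) (fun v => Phi v ^+ m0).
  by apply: semi_inv_weight (semi_inv_exp m0 sP); rewrite mulnC.
have [q qE] := chart_poly sPm; have := qE x; have := qE x'; rewrite -!coordsE cE => <- /eqP E0.
have zero y : (Phi (urep y) == 0) = (Phi (urep y) ^+ m0 / f (urep y) ^+ n == 0).
  by rewrite mulf_eq0 invr_eq0 !expf_eq0 m00 (negPf (fU y)) andbF orbF.
by rewrite -[erep _]/(urep x) -[erep (set_val (set_val x'))]/(urep x') !zero (eqP E0).
Qed.

Local Notation C := (set_type chart_image : funSpaceType k).

Lemma chart_affine : affine_algebraic U.
Proof.
exists s, chart_image; split; first exact: chart_image_closed.
pose phi (x : U) : C := exist _ (coords x : affine_space V) (mem_set (coords_image x)).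
have phiE x : set_val (phi x) = coords x by rewrite set_valE.
have /choice[psi psiE] : forall c : C, exists x, coords x = set_val c.
  by move=> c; apply: image_coords; exact: (set_valP c).
have psiK : cancel psi phi by move=> c; apply: val_inj; have := phiE (psi c); rewrite psiE; by rewrite !set_valE.
have phiK : cancel phi psi by move=> x; apply: coords_inj; rewrite psiE phiE.
have reg_ratio n F G (x : U) : semi_inv n F -> semi_inv n G -> G (urep x) != 0 -> regular_at x (fun y : U => F (urep y) / G (urep y)).
  move=> sF sG Gx; have := zrep_ratio_regular sF sG Gx; exact: sub_regular.
have rho_reg i (x : U) : regular_at x (rho i) by apply: reg_ratio (sPs i) (sf_exp _) (expf_neq0 _ (fU x)).
have qreg (q : {mpoly k[s]}) (x : U) : regular_at x (fun y : U => q.@[fun i => rho i y]) := regular_meval q (fun i => rho_reg i x).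
have qC (q : {mpoly k[s]}) (c : C) : q.@[fun i => (set_val c : V) 0 i] = q.@[fun i => rho i (psi c)] by rewrite -psiE coordsE.
have cphi : continuous phi.
  apply: continuous_of_closed => D x cD /(affine_closed_sep cD)[q []]; rewrite phiE coordsE => qx qD.
  have [near_q _] := regular_at_inv _ _ (qreg q x) qx; apply: filterS near_q => y qy Dy.
  by case/negP: qy; rewrite -coordsE -phiE qD.
have cpsi : continuous psi.
  apply: continuous_of_closed => D c cD nD; have [B [oB Bx BD]] := sub_closed_sep cD nD.
  have [|n [Phi [n0 sP Px PB]]] := zrep_closed_sep (open_closedC oB) (x := set_val (psi c)); first by apply.
  have sPm : semi_inv (m0 * n) (fun v => Phi v ^+ m0) by apply: semi_inv_weight (semi_inv_exp m0 sP); rewrite mulnC.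
  have [q qE] := chart_poly sPm.
  have qc : q.@[fun i => (set_val c : V) 0 i] != 0.
    by rewrite qC -qE mulf_neq0 ?invr_neq0 ?expf_neq0 ?fU.
  have [near_q _] := regular_at_inv _ _ (polynomial_regular q c) qc; apply: filterS near_q => c' qc' Dc'.
  case/negP: qc'; rewrite qC -qE; have -> : Phi (urep (psi c')) = 0 by apply: PB => /=; apply: (fun H => BD _ H Dc').
  by rewrite expr0n (gtn_eqF m00) mul0r.
exists phi, psi; split=> //; split=> //.
- move=> x g [g' [p [q [[p' [p'p]] [q' q'q] qx gE]]] gg'] || move=> x g rg.
  case: rg => g1 [P1 [Q1 [/meval_polynomial[p pE] /meval_polynomial[q qE] Q1x g1E]]] gE.
  have qx : q.@[fun i => rho i x] != 0 by rewrite -coordsE -qE -phiE.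
  have [_ rV] := regular_at_inv _ _ (qreg q x) qx; have := regular_at_mul _ _ _ (qreg p x) rV; apply: regular_at_ext.
  have near_x : \forall y \near x, g (phi y) = g1 (set_val (phi y)) /\ g1 (set_val (phi y)) = P1 (set_val (phi y)) / Q1 (set_val (phi y)).
    exact: (cphi x _ (filterI gE (set_val_near g1E))).
  apply: filterS near_x => y [E1 E2] /=; rewrite E1 E2.
  by rewrite phiE pE qE !coordsE.
move=> c g [g1 /regular_ratio[n [F [G [sF sG Gx g1E]]]] gE].
(* The fraction is extended by a power of [G] so that numerator and denominator have weights
   divisible by [m0] and become polynomials in the coordinates. *)
have sFG : semi_inv (m0 * n) (fun v => F v * G v ^+ m0.-1).
  by apply: semi_inv_weight (semi_invariant_mul sF (semi_inv_exp m0.-1 sG)); rewrite -mulnS prednK// mulnC.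
have sGm : semi_inv (m0 * n) (fun v => G v ^+ m0) by apply: semi_inv_weight (semi_inv_exp m0 sG); rewrite mulnC.
have [p pE] := chart_poly sFG; have [q qE] := chart_poly sGm.
have qc : q.@[fun i => (set_val c : V) 0 i] != 0 by rewrite qC -qE mulf_neq0 ?invr_neq0 ?expf_neq0 ?fU.
have [near_q rV] := regular_at_inv _ _ (polynomial_regular q c) qc.
have := regular_at_mul _ _ _ (polynomial_regular p c) rV; apply: regular_at_ext.
have near_c : \forall c' \near c, g (psi c') = g1 (set_val (psi c')) /\ g1 (set_val (psi c')) = F (zrep (set_val (psi c'))) / G (zrep (set_val (psi c'))).
  exact: (cpsi c _ (filterI gE (set_val_near g1E))).
apply: filterS2 near_q near_c => c' qc' [E1 E2] /=; rewrite E1 E2.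
rewrite !qC -pE -qE -/(urep _); rewrite qC -qE in qc'.
have Gy : G (urep (psi c')) != 0.
  by apply: contraNneq qc' => ->; rewrite expr0n (gtn_eqF m00) mul0r.
have fy := expf_neq0 n (fU (psi c')).
rewrite -{2}(prednK m00) exprS; have Gm := expf_neq0 m0.-1 Gy.
by field; rewrite Gm Gy fy.
Qed.

End Chart.

(** With [Phi] nonzero at [x] and zero at [y], and [Th] nonzero at [y], the fractions
    [Th ^+ n / Phi ^+ m] at the first point and [Phi ^+ m / Th ^+ n] at the second have product 1 on
    the diagonal and 0 at [(x, y)]. *)
Lemma classes_separated : separated X.
Proof.
have sep (x y : X) n Phi : semi_inv n Phi -> Phi (zrep x) != 0 -> Phi (zrep y) = 0 ->
    exists (F G : X -> k), [/\ regular_at x F, regular_at y G, F x * G y = 0 & \forall x' \near x & y' \near y, x' = y' -> F x' * G y' = 1].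
  move=> sP Px Py; have [m [Th [m0 sT Ty]]] := T_semistable N2 (erep_T (set_val y)).
  have sP' : semi_inv (n * m) (fun v => Phi v ^+ m) := semi_inv_exp m sP.
  have sT' : semi_inv (n * m) (fun v => Th v ^+ n) by apply: semi_inv_weight (semi_inv_exp n sT); rewrite mulnC.
  exists (fun x' => Th (zrep x') ^+ n / Phi (zrep x') ^+ m), (fun y' => Phi (zrep y') ^+ m / Th (zrep y') ^+ n); split.
  - by apply: zrep_ratio_regular sT' sP' _; rewrite expf_neq0.
  - by apply: zrep_ratio_regular sP' sT' _; rewrite expf_neq0.
  - by rewrite Py expr0n (gtn_eqF m0) mul0r mulr0.
  exists (([set x' | Phi (zrep x') != 0], [set y' | Th (zrep y') != 0]) : set X * set X).
    by split; [exact: zrep_near sP Px|exact: zrep_near sT Ty].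
  move=> [x' y'] /= [Px' Ty'] E0; rewrite -E0 in Ty' *; field.
  by rewrite !expf_neq0.
rewrite /separated -openC; change (prod_open (~` [set p : variety_prod X X | p.1 = p.2])) => -[x y] /= xy.
have [n [Phi [sP ne]]] : exists n Phi, semi_inv n Phi /\ (Phi (zrep x) == 0) != (Phi (zrep y) == 0).
  apply: contrapT => H; apply: xy; apply: val_inj; have : set_val x = set_val y; last by rewrite !set_valE.
  apply: erep_inj => n Phi sP; apply: contrapT => ne; apply: H; exists n, Phi; split=> //.
  by apply/eqP.
have [F [G [rF rG FG0 FG1]]] : exists F G : X -> k, [/\ regular_at x F, regular_at y G, F x * G y = 0 & \forall x' \near x & y' \near y, x' = y' -> F x' * G y' = 1].
  have [Px|Px] := eqVneq (Phi (zrep x)) 0; last first.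
    by apply: (sep x y n Phi sP Px); apply/eqP; move: ne; rewrite (negPf Px); case: (_ == 0).
  have Py : Phi (zrep y) != 0 by move: ne; rewrite Px eqxx; case: (_ == 0).
  have [F [G [rF rG FG0 FG1]]] := sep y x n Phi sP Py Px; exists G, F; split=> //; first by rewrite mulrC.
  case: FG1 => -[O O'] /= [nO nO'] H; exists (O', O) => // -[x' y'] /= [Ox Oy] E0.
  by rewrite mulrC; apply: (H (y', x')).
exists bool, (fun b => if b then F else fun=> 1), (fun b => if b then (fun y => - G y) else fun=> 1); split.
- case; split=> //=; try exact: regular_at_cst.
  rewrite (_ : (fun y => - G y) = fun y => -1 * G y); first exact: regular_at_mul (regular_at_cst _ _) rG.
  by apply/funext => y'; rewrite mulN1r.
- by rewrite big_bool /= mulrN FG0 oppr0 add0r mulr1 oner_neq0.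
apply: filterS FG1 => -[x' y'] /= H; rewrite big_bool /= mulrN mulr1 => nz E0.
by move: nz; rewrite H// addNr eqxx.
Qed.

Lemma exists_chart (x : X) : exists (m0 s : nat) (f : W -> k) (Ps : 'I_s -> W -> k) (ls : 'I_s -> nat),
  [/\ (0 < m0)%N, semi_inv m0 f, forall i, semi_inv (m0 * ls i) (Ps i),
    forall l Phi, semi_inv (m0 * l) Phi -> exists q : {mpoly k[s]}, forall v, f v = 1 -> Phi v = q.@[fun i => Ps i v]
    & f (zrep x) != 0].
Proof.
have /(T_P _ (ltnW N2))[mv _] := erep_T (set_val x); rewrite -/(zrep x) in mv.
have [ss [ss_inj ss1]] := exists_pencils k N2.
have [a va] : exists a, pencil_form (ss a) (zrep x) != 0.
  have [E0|H] := eqVneq (pencil_form (ss ord0) (zrep x)) 0; last by exists ord0.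
  by exists ord_max; apply/eqP => E'; have := ss1 _ mv _ _ E0 E'.
have [r rE] := exists_labels N2 (ss a) (zrep x).
have [s1 [s2 [s3 [i1 [i2 [i3 [x0 [y [z [[e1 e1' e2 e2'] [e3 e3'] mr]]]]]]]]]] := exists_mat3 N2 (ss_inj a) mv va rE.
pose mm (_ : W) r := @mat3 k N s1 s2 s3 r.
have [j [j0 ej]] : exists j, (0 < j)%N /\ esum mm j (zrep x) r != 0.
  apply: contrapT => H; have := esum_root mm 1%g (zrep x) r.
  rewrite big_ord_recl esum0 subn0 expr0 !mul1r big1 => [|i _].
    rewrite addr0 => /eqP; rewrite expf_eq0 => /andP[_]; apply/negP.
    by rewrite (_ : (fun l => _) = r)//; apply/funext => l; rewrite perm1.
  rewrite (_ : esum _ _ _ _ = 0) ?mulr0 ?mul0r//; apply/eqP/negPn/negP => ne; apply: H.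
  by exists (bump 0 i).
have [f [sf fE]] := exists_esum N2 (ss a) j (isT : (0 < 3)%N) (@equivariant_mat3 k N s1 s2 s3).
have [s [Ps [ls [sPs gen]]]] := chart_generators N2 e1 e1' e2 e2' e3 e3' j0 fE.
exists (j * (12 * (12 * N + 2) * 3 + 0))%N, s, f, Ps, ls; split=> //; last by rewrite (fE _ _ rE).
by rewrite !muln_gt0 j0 !addn_gt0 !muln_gt0 /= addn2.
Qed.

End Charts.

(** * Existence of the complete subvariety *)

Section Existence.
Context (k : closedFieldType) (N : nat) (N2 : (2 <= N)%N).
Local Notation W := (weierstrass_data k N).
Local Notation E := (E_ k N).
Local Notation semi_inv := (semi_invariant (@weierstrass_act k N) (@weierstrass_char k)).
Context (fam : W -> Prop).
Hypothesis fam_T : forall v, fam v -> T_ v.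
Hypothesis fam_lim : forall (I : Type) (P : place k I) (v : I -> W), (forall t, fam (v t)) ->
  exists (th : I -> k) w, [/\ forall t, th t != 0, fam w &
    forall n f, semi_inv n f -> tends P (fun t => th t ^+ n * f (v t)) (f w)].

Theorem classes_complete A : irr_family fam A -> complete_subvariety (classes A).
Proof.
move=> iA; split.
  exists setT, (classes A); split; [exact: openT|exact: classes_closed|by rewrite setTI].
split; last by move=> Y _ C; apply: (classes_proper N2 fam_T fam_lim iA).
split.
- have := zclasses_irreducible N2 fam_T fam_lim iA (Z := classes A) (fun e ce => ce).
  rewrite (_ : zclasses A = setT)//; apply/seteqP; split=> // x _; exact: (set_valP x).
- pose val (p : {mpoly k[\dim {:W}]}) (v : W) := p.@[fun i => coord (vbasis {:W}) i v].
  pose good (p : {mpoly k[\dim {:W}]}) := exists (m0 s : nat) (Ps : 'I_s -> W -> k) (ls : 'I_s -> nat),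
    [/\ (0 < m0)%N, semi_inv m0 (val p), forall i, semi_inv (m0 * ls i) (Ps i) &
      forall l Phi, semi_inv (m0 * l) Phi -> exists q : {mpoly k[s]}, forall v, val p v = 1 -> Phi v = q.@[fun i => Ps i v]].
  (* Quasi-compactness: finitely many chart functions generate the ideal of all of them, so the
     charts that they define already cover. *)
  have [l lJ lP] := hilbert_basis good.
  exists (size l), (fun i => @chart k N A (val l`_i)); split=> [i|].
    have [|m0 [s [Ps [ls [m00 sf sPs gen]]]]] := lJ l`_i; first exact: mem_nth.
    by split; [exact: chart_open sf|exact: (chart_affine N2 fam_T fam_lim iA m00 sf sPs gen)].
  apply/seteqP; split=> // x _; have [m0 [s [f [Ps [ls [m00 sf sPs gen fx]]]]]] := exists_chart N2 x.
  have [p pE] := sf.1; have fE : f = val p by apply/funext => v; rewrite pE.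
  rewrite fE in sf gen fx; apply: contrapT => none; case/eqP: fx.
  apply: (ideal_span_root (J := fun q => q \in l)); first by apply: lP; exists m0, s, Ps, ls.
  move=> q ql; have iq : (index q l < size l)%N by rewrite index_mem.
  apply/eqP/negPn/negP => qx; apply: none; exists (Ordinal iq) => //.
  by rewrite /chart /= nth_index.
- exact: (classes_separated N2 (A := A)).
Qed.

Lemma exists_bpf : exists d m f, (0 < m)%N /\ bpf fam d m f.
Proof.
have [ss [ss_inj ss1]] := exists_pencils k N2.
have /choice[f fP] := fun a => exists_invariants N2 (ss a).
pose J := ('I_3 * inv_index N)%type.
have [w [w0 sf]] : exists w, (0 < w)%N /\ forall al : J, semi_inv w (f al.1 al.2).
  eexists; split; last by move=> al; exact: (fP al.1).1 al.2.
  by rewrite !muln_gt0 !fact_gt0 addn2.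
pose j0 : J := (ord0, (finset.set0, ord0)).
exists #|{: J}|, w, (fun i v => let al := nth j0 (enum {: J}) i in f al.1 al.2 v); split=> //.
split=> [i|v fv]; first exact: sf.
have /(T_P _ (ltnW N2))[mv _] := fam_T fv.
have [a va] : exists a, pencil_form (ss a) v != 0.
  have [E0|H] := eqVneq (pencil_form (ss ord0) v) 0; last by exists ord0.
  by exists ord_max; apply/eqP => E'; have := ss1 _ mv _ _ E0 E'.
have [l fl] := exists_invariant_neq0 N2 (ss_inj a) (fP a).2 mv va.
exists (index ((a, l) : J) (enum {: J})); last by rewrite nth_index ?mem_enum.
by apply: leq_trans (index_size _ _) _; rewrite -cardE.
Qed.

(** The complete subvariety is the image of the top member of a flag over projective space, and the
    images of the lower members form the chain. The chain of length [r] exists because every system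
    without base points maps to a space of dimension at least [r]. *)
Theorem exists_complete r : (exists w, fam w) -> (forall d m f, (0 < m)%N -> bpf fam d m f -> (r <= d)%N) ->
  exists2 Z : set E, complete_subvariety Z & has_chain (set_type Z) r.
Proof.
move=> ne dim; have [d0 [m [f0 [m0 b0]]]] := exists_bpf.
have [d [f [bf of_]]] := exists_onto N2 ne b0; have rd := dim _ _ _ m0 bf.
have [A [A1 A2 A3 A4]] := exists_flag fam_lim bf rd (onto_le rd of_) (fun w fw => fw).
exists (classes (A r)); first exact: classes_complete (A1 r (leqnn r)).
have sub i j : (i <= j)%N -> (j <= r)%N -> forall n g, semi_inv n g -> (forall w, A j w -> g w = 0) -> forall w, A i w -> g w = 0.
  elim: j => [|j IH]; first by rewrite leqn0 => /eqP-> _ n g _; apply.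
  rewrite leq_eqVlt => /orP[/eqP-> _ n g _|ij jr n g sg H]; first by apply.
  by apply: (IH ij (ltnW jr) n g sg); apply: (A2 j jr n g sg).
have csub i j : (i <= j)%N -> (j <= r)%N -> forall e, classes (A i) e -> classes (A j) e.
  by move=> ij jr e ce n g sg H; apply: (ce n g sg); apply: (sub i j ij jr n g sg).
exists (fun i => @zclasses k N (classes (A r)) (A i)); split=> i ir.
  split; last exact: zclasses_closed.
  by apply: (zclasses_irreducible N2 fam_T fam_lim (A1 i ir)) => e; apply: csub.
split; first by move=> x; apply: csub.
have [w Aw fw] := A3 i ir; have Tw := fam_T (irr_family_fam (A1 i.+1 ir) Aw).
have [e we] := exists_class N2 Tw.
have ce : classes (A i.+1) e by apply/(classesP N2 fam_T fam_lim _ (A1 i.+1 ir)); exists w.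
have ce' : classes (A r) e by apply: csub ce.
pose x : set_type (classes (A r)) := exist _ e (mem_set ce').
have xe : set_val x = e by rewrite set_valE.
move=> /(_ x); rewrite /zclasses /= xe => /(_ ce) /(_ m (f i.+1) (bf.1 i.+1) (fun w Aw => A4 i w ir Aw)) /eqP.
by rewrite -(we m _ (bf.1 i.+1)) (negPf fw).
Qed.

End Existence.

Theorem corollary1p3 (k : closedFieldType)
    (char_neq2 : 2%N \notin [pchar k]%R) (char_neq3 : 3%N \notin [pchar k]%R)
    (N : nat) (N_ge2 : (2 <= N)%N) :
  (exists2 Z : set (E_ k N),
     complete_subvariety Z & has_dimension (set_type Z) 16) /\
  (forall Z : set (E_ k N), complete_subvariety Z ->
     exists2 d : nat, (d <= 16)%N & has_dimension (set_type Z) d).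
Proof.
split; last by move=> Z; apply: complete_subvariety_dimension.
have [c1 [c2 [g1 g2 c12]]] := exists_covariants k (4 * N - 8) (6 * N - 12).
have fT v : in_family c1 c2 v -> T_ v by case.
have fL := family_limit_invariants N_ge2 char_neq2 char_neq3 g1 g2 c12.
have [||Z cZ chZ] := exists_complete N_ge2 fT (fun I P v => fL I P v) (r := 16).
- have [U [v [_ fv _ _]]] := exists_generic N_ge2 char_neq2 char_neq3 g1 g2 c12.
  by exists (v (fun=> 0)).
- by move=> d m f; apply: (bpf_dimension N_ge2 char_neq2 char_neq3 g1 g2 c12).
(* The upper bound, applied to the subvariety just found, turns its chain of length 16 into
   dimension exactly 16. *)
exists Z => //; split=> // n chn; have [d d16 [_ dmax]] := complete_subvariety_dimension N_ge2 cZ.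
exact: leq_trans (dmax n chn) d16.
Qed.
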